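(* Let $\mathfrak g=\mathfrak{osp}(1\vert2)$ and assume $r\in\mathbb C$, $r\notin\mathbb Z$. Then $L^{\mathfrak g}_{-3/2}(U_0(r))$ is an $L_{-3/2}(\mathfrak g)$-module and it is realized as $$L^{\mathfrak g}_{-3/2}(U_0(r))=L_{-3/2}(\mathfrak g).\,e^{\alpha/2-\mu-(r+1/4)c}.$$ The basis of the top component $U^{\mathfrak g}_0(r)$ is given by $$E_i=e^{\alpha/2-\mu-(r+i+5/4)c},\qquad E_{i-1/2}=e^{-\alpha/2-\mu-(r+i+3/4)c}\qquad(i\in\mathbb Z).$$ As an $L_{-3/2}(\mathfrak g)$-module we have $$F^{tw}\otimes\Pi^{1/2}_{(-1)}\big(-(r+\tfrac14)\big)\cong L^{\mathfrak g}_{-3/2}(U_0(r))\oplus L^{\mathfrak g}_{-3/2}(U_0(r+\tfrac12)).$$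
   Context: Everything is over $\mathbb C$; $k=-\tfrac32$. $\mathfrak{osp}(1\vert2)$ has even part $\mathrm{span}\{e,f,h\}\cong\mathfrak{sl}(2)$, odd part $\mathrm{span}\{x,y\}$, relations $[e,f]=h$, $[h,e]=2e$, $[h,f]=-2f$, $[h,x]=x$, $[e,x]=0$, $[f,x]=-y$, $[h,y]=-y$, $[e,y]=-x$, $[f,y]=0$, $\{x,x\}=2e$, $\{x,y\}=h$, $\{y,y\}=-2f$, and form $(e,f)=(f,e)=1$, $(h,h)=2$, $(x,y)=-(y,x)=2$. $L_k(\mathfrak g)$ is the unique simple (graded) quotient of the universal affine vertex superalgebra $V^k(\mathfrak g)$. $U_0^{\mathfrak g}(r)$ (also written $U_0(r)$) is the $\mathfrak g$-module with basis $E_i,E_{i-1/2}$, $i\in\mathbb Z$, and action $eE_i=E_{i-1}$, $hE_i=-(2i+2r+1)E_i$, $fE_i=-(r+i+1)^2E_{i+1}$, $eE_{i-1/2}=E_{i-3/2}$, $hE_{i-1/2}=-(2i+2r)E_{i-1/2}$, $fE_{i-1/2}=-(r+i+1)(r+i)E_{i+1/2}$, $xE_i=E_{i-1/2}$, $yE_i=-(r+i+1)E_{i+1/2}$, $xE_{i-1/2}=E_{i-1}$, $yE_{i-1/2}=-(r+i)E_i$. $L^{\mathfrak g}_{-3/2}(U_0(r))$ is the irreducible $V^{-3/2}(\mathfrak g)$-module whose top component is $U_0^{\mathfrak g}(r)$; more generally, for a module $U$ over the Zhu algebra of $L_{-3/2}(\mathfrak g)$, $L^{\mathfrak g}_{-3/2}(U)$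 denotes the corresponding $\frac12\mathbb Z_{\ge0}$-graded module obtained by Zhu's theory. Realization. $F\cong V_{\mathbb Z\alpha}$, $\langle\alpha,\alpha\rangle=1$, is the Clifford vertex superalgebra generated by $\Psi^\pm=e^{\pm\alpha}$; $F^{tw}=V_{\mathbb Z\alpha+\alpha/2}$ is its twisted module. $\Pi(0)^{1/2}=M(1)\otimes\mathbb C[\mathbb Z\frac c2]$, where $M(1)$ is the Heisenberg vertex algebra generated by $c,d$ with $\langle c,c\rangle=\langle d,d\rangle=0$, $\langle c,d\rangle=2$; $\mu=\frac d2+\frac k4c$, $\nu=\frac d2-\frac k4c$; $\Pi^{1/2}_{(m)}(\lambda)=\Pi(0)^{1/2}e^{m\mu+\lambda c}$ for $m\in\mathbb Z$, $\lambda\in\mathbb C$. With $\omega=\frac12\alpha(-1)^2+\frac12\alpha(-2)+e^{2\alpha}$ (a Virasoro vector of central charge $-2$), $L_{-3/2}(\mathfrak g)$ is realized as the vertex subalgebra of $F\otimes\Pi(0)^{1/2}$ generated by $e=e^c$, $h=2\mu(-1)$, $f=[(k+2)\omega-\nu(-1)^2-(k+1)\nu(-2)]e^{-c}$, $x=e^{\alpha+c/2}+e^{-\alpha+c/2}$, $y=[\nu(-1)+\frac12\alpha(-1)]e^{-\alpha-c/2}+[\nu(-1)-\frac32\alpha(-1)]e^{\alpha-c/2}$. It acts through lattice vertex operators on $F^{tw}\otimes\Pi^{1/2}_{(-1)}(\lambda)$, which is thereby an untwisted $L_{-3/2}(\mathfrak g)$-module; $L_{-3/2}(\mathfrak g).v$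 denotes the submodule generated by $v$. *)

(* Defs.v *)
From HB Require Import structures.
From mathcomp Require Import all_boot all_order all_algebra.
From mathcomp Require Import finmap multiset monalg.
From mathcomp Require Import boolp classical_sets functions cardinality fsbigop.
From mathcomp Require Import reals complex.

Set Implicit Arguments.
Unset Strict Implicit.
Unset Printing Implicit Defensive.

Import GRing.Theory Num.Theory.

Local Open Scope classical_set_scope.
Local Open Scope ring_scope.

(* Every sum [\sum_(j \in A) F j] over an infinite index set below has only   *)
(* finitely many nonzero terms: this follows from the truncation axioms for   *)
(* superalgebras and modules, and from local nilpotency of the annihilation   *)
(* operators on Fock spaces.                                                  *)

(******************************************************************************)
(* Graded vector spaces                                                       *)
(******************************************************************************)

Section LinearAlgebra.
Variable K : fieldType.

Definition subspace (V : lmodType K) (S : set V) : Prop :=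
  S 0 /\ forall (c : K) (u v : V), S u -> S v -> S (c *: u + v).

(* every vector of S is a finite sum of vectors of S lying in the pieces G i *)
Definition homogeneous (I : eqType) (V : lmodType K) (G : I -> set V)
    (S : set V) : Prop :=
  forall u, S u -> exists (s : seq I) (v : I -> V),
    (forall i, G i (v i) /\ S (v i)) /\ u = \sum_(i <- s) v i.

Definition grading (I : eqType) (V : lmodType K) (G : I -> set V) : Prop :=
  [/\ forall i, subspace (G i),
      homogeneous G setT
    & forall (s : seq I) (v : I -> V), uniq s -> (forall i, G i (v i)) ->
        \sum_(i <- s) v i = 0 -> forall i, i \in s -> v i = 0].

Definition linext (I : choiceType) (M : lmodType K) (f : I -> M)
    (u : {malg K[I]}) : M :=
  \sum_(i <- msupp u) mcoeff i u *: f i.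

End LinearAlgebra.

(******************************************************************************)
(* Vertex superalgebras and their (untwisted) modules                         *)
(******************************************************************************)

Section VertexSuperalgebra.
Variable K : fieldType.

Definition binz (m : int) (j : nat) : K :=
  \prod_(i < j) ((m - i%:Z)%:~R / i.+1%:R).

(* [act a n u] is the n-th product a_(n) u, where Y(a,z) = \sum_n a_(n)       *)
(* z^(-n-1); in [borcherds] a product [vp] on V acts on a V-module M.         *)
Definition borcherds (V M : lmodType K) (vpar : bool -> set V)
    (vp : V -> int -> V -> V) (act : V -> int -> M -> M) : Prop :=
  forall (p q : bool) (a b : V) (c : M) (m n l : int), vpar p a -> vpar q b ->
    \sum_(j \in [set: nat])
       binz m j *: act (vp a (n + j%:Z) b) (m + l - j%:Z) c =
    \sum_(j \in [set: nat])
       ((-1) ^+ j * binz n j) *: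
         (act a (m + n - j%:Z) (act b (l + j%:Z) c)
          - ((-1) ^ n * (-1) ^+ (p && q)) *:
              act b (l + n - j%:Z) (act a (m + j%:Z) c)).

Record vertex_action (V M : lmodType K) (vpar : bool -> set V)
    (mpar : bool -> set M) (vac : V) (vp : V -> int -> V -> V)
    (act : V -> int -> M -> M) : Prop := VertexAction {
  va_linl : forall (c : K) (a b : V) n u,
    act (c *: a + b) n u = c *: act a n u + act b n u;
  va_linr : forall (c : K) (a : V) n (u w : M),
    act a n (c *: u + w) = c *: act a n u + act a n w;
  va_par : forall p q a n u, vpar p a -> mpar q u ->
    mpar (p (+) q) (act a n u);
  va_trunc : forall a u, exists N : int, forall n, N <= n -> act a n u = 0;
  va_vac : forall n u, act vac n u = if n == -1 then u else 0;
  va_borcherds : borcherds vpar vp act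
}.

Record vsa := Vsa {
  vsort :> lmodType K;
  vpar : bool -> set vsort;
  vac : vsort;
  vprod : vsort -> int -> vsort -> vsort;
  _ : grading vpar;
  _ : vpar false vac;
  _ : vertex_action vpar vpar vac vprod vprod;
  _ : forall a, vprod a (-1) vac = a;
  _ : forall a (n : int), 0 <= n -> vprod a n vac = 0
}.

Record vmod (V : vsa) (M : lmodType K) := Vmod {
  mpar : bool -> set M;
  mact : V -> int -> M -> M;
  _ : grading mpar;
  _ : vertex_action (@vpar V) mpar (vac V) (@vprod V) mact
}.

Definition vsa_hom (V W : vsa) (phi : V -> W) : Prop :=
  [/\ forall (c : K) a b, phi (c *: a + b) = c *: phi a + phi b,
      forall p a, vpar p a -> vpar p (phi a),
      phi (vac V) = vac W
    & forall a n b, phi (vprod a n b) = vprod (phi a) n (phi b)].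

Definition ideal (V : vsa) (S : set V) : Prop :=
  [/\ subspace S, homogeneous (@vpar V) S
    & forall a n u, S u -> S (vprod a n u) /\ S (vprod u n a)].

Definition simple_vsa (V : vsa) : Prop :=
  vac V <> 0 /\
  forall S : set V, ideal S -> (forall u, S u -> u = 0) \/ (forall u, S u).

(* conformal-weight grading; all weights occurring here are nonnegative       *)
(* integers, and [G d = 0] for d < 0                                          *)
Definition vgrading (V : vsa) (G : int -> set V) : Prop :=
  [/\ grading G,
      forall d, homogeneous (@vpar V) (G d),
      forall d u, d < 0 -> G d u -> u = 0,
      G 0 (vac V)
    & forall d d' n a b, G d a -> G d' b -> G (d + d' - n - 1) (vprod a n b)].

Section Modules.
Variables (V : vsa).

Definition vmod_hom (M N : lmodType K) (YM : vmod V M) (YN : vmod V N)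
    (phi : M -> N) : Prop :=
  [/\ forall (c : K) u w, phi (c *: u + w) = c *: phi u + phi w,
      forall p u, mpar YM p u -> mpar YN p (phi u)
    & forall a n u, phi (mact YM a n u) = mact YN a n (phi u)].

Variables (M : lmodType K) (YM : vmod V M).

Definition submodule (S : set M) : Prop :=
  [/\ subspace S, homogeneous (mpar YM) S
    & forall a n u, S u -> S (mact YM a n u)].

Definition generated_submodule (X : set M) : set M :=
  [set u | forall S, submodule S -> X `<=` S -> S u].

Definition irreducible : Prop :=
  (exists u : M, u <> 0) /\
  forall S, submodule S -> (forall u, S u -> u = 0) \/ (forall u, S u).

(* (1/2)Z_{>=0}-grading: [GM t] is the piece of degree t/2 *)
Definition mgrading (GV : int -> set V) (GM : int -> set M) : Prop :=
  [/\ grading GM,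
      forall t, homogeneous (mpar YM) (GM t),
      forall t u, t < 0 -> GM t u -> u = 0
    & forall d t n a u, GV d a -> GM t u ->
        GM (t + 2 * (d - n - 1)) (mact YM a n u)].

End Modules.

End VertexSuperalgebra.

(******************************************************************************)
(* osp(1|2), its affine vertex superalgebras, and the modules U_0(r)          *)
(******************************************************************************)

Inductive osp := ge | gf | gh | gx | gy.

Definition osp_odd (a : osp) : bool :=
  match a with gx | gy => true | _ => false end.

(* a bracket is given by the list of its (coefficient, basis vector) pairs *)
Definition osp_br (a b : osp) : seq (int * osp) :=
  match a, b with
  | ge, ge => [::]          | ge, gf => [:: (1, gh)]  | ge, gh => [:: (- 2, ge)]
  | ge, gx => [::]          | ge, gy => [:: (- 1, gx)]
  | gf, ge => [:: (- 1, gh)] | gf, gf => [::]         | gf, gh => [:: (2, gf)]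
  | gf, gx => [:: (- 1, gy)] | gf, gy => [::]
  | gh, ge => [:: (2, ge)]  | gh, gf => [:: (- 2, gf)] | gh, gh => [::]
  | gh, gx => [:: (1, gx)]  | gh, gy => [:: (- 1, gy)]
  | gx, ge => [::]          | gx, gf => [:: (1, gy)]  | gx, gh => [:: (- 1, gx)]
  | gx, gx => [:: (2, ge)]  | gx, gy => [:: (1, gh)]
  | gy, ge => [:: (1, gx)]  | gy, gf => [::]          | gy, gh => [:: (1, gy)]
  | gy, gx => [:: (1, gh)]  | gy, gy => [:: (- 2, gf)]
  end.

Definition osp_form (a b : osp) : int :=
  match a, b with
  | ge, gf | gf, ge => 1
  | gh, gh => 2
  | gx, gy => 2
  | gy, gx => - 2
  | _, _ => 0
  end.

Section Affine.
Variable K : fieldType.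

(* the operator product expansions of the affine currents at level k *)
Record affine_map (k : K) (V : vsa K) (j : osp -> V) : Prop := AffineMap {
  am_par : forall a, vpar (osp_odd a) (j a);
  am_ope0 : forall a b,
    vprod (j a) 0 (j b) = \sum_(t <- osp_br a b) t.1%:~R *: j t.2;
  am_ope1 : forall a b,
    vprod (j a) 1 (j b) = (k * (osp_form a b)%:~R) *: vac V;
  am_ope2 : forall a b (n : int), 2 <= n -> vprod (j a) n (j b) = 0
}.

(* V^k(osp(1|2)) is the initial vertex superalgebra with affine currents *)
Definition universal_affine (k : K) (V : vsa K) (j : osp -> V) : Prop :=
  affine_map k j /\
  forall (W : vsa K) (i : osp -> W), affine_map k i ->
    exists! phi : V -> W, vsa_hom phi /\ forall a, phi (j a) = i a.

Definition affine_grading (V : vsa K) (j : osp -> V) (G : int -> set V) : Prop :=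
  vgrading G /\ forall a, G 1 (j a).

(* At the critical level k = -3/2 gradedness has to be required: V^k then has *)
(* simple quotients by non-graded ideals as well.                             *)
Definition simple_graded_quotient (V : vsa K) (j : osp -> V) (L : vsa K)
    (pr : V -> L) : Prop :=
  [/\ vsa_hom pr, forall l, exists v, l = pr v, simple_vsa L
    & exists G, affine_grading (fun a => pr (j a)) G].

(* U_0(r): the basis vector (i, false) is E_i and (i, true) is E_{i-1/2} *)
Definition U0 : lmodType K := {malg K[(int * bool)%type]}.
Definition U0E (i : int) : U0 := << (i, false) >>.
Definition U0Eh (i : int) : U0 := << (i, true) >>.

Definition U0basis_act (r : K) (a : osp) (b : int * bool) : U0 :=
  let i := b.1 in
  let s : K := r + i%:~R in
  match a, b.2 with
  | ge, false => U0E (i - 1)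
  | gh, false => - (2 * s + 1) *: U0E i
  | gf, false => - (s + 1) ^+ 2 *: U0E (i + 1)
  | ge, true => U0Eh (i - 1)
  | gh, true => - (2 * s) *: U0Eh i
  | gf, true => - ((s + 1) * s) *: U0Eh (i + 1)
  | gx, false => U0Eh i
  | gy, false => - (s + 1) *: U0Eh (i + 1)
  | gx, true => U0E (i - 1)
  | gy, true => - s *: U0E i
  end.

Definition U0act (r : K) (a : osp) : U0 -> U0 := linext (U0basis_act r a).

Section TopComponent.
Variables (V : vsa K) (j : osp -> V) (N : lmodType K) (YN : vmod V N).

(* theta identifies U_0(r) with the degree-0 piece of N as modules over       *)
(* osp(1|2), which acts on that piece by the zero modes                       *)
Definition top_iso (GN : int -> set N) (r : K) (theta : U0 -> N) : Prop :=
  [/\ forall (c : K) u w, theta (c *: u + w) = c *: theta u + theta w,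
      injective theta,
      forall u, GN 0 u <-> exists w, u = theta w,
      forall i, mpar YN false (theta (U0E i)) /\ mpar YN true (theta (U0Eh i))
    & forall a w, theta (U0act r a w) = mact YN (j a) 0 (theta w)].

Definition irreducible_with_top (r : K) (theta : U0 -> N) : Prop :=
  irreducible YN /\
  exists GV GN, [/\ affine_grading j GV, mgrading YN GV GN
                  & top_iso GN r theta].

(* The module L(U), U = U_0(r), of Zhu's theory: it is generated by its top   *)
(* component U and has no nonzero graded submodule that meets U trivially.    *)
(* U need not be irreducible.                                                 *)
Definition zhu_module (r : K) (theta : U0 -> N) : Prop :=
  exists GV GN,
    [/\ affine_grading j GV, mgrading YN GV GN, top_iso GN r theta,
        forall u, generated_submodule YN (GN 0) u
      & forall S, submodule YN S -> homogeneous GN S ->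
          (forall u, S u -> GN 0 u -> u = 0) -> forall u, S u -> u = 0].

End TopComponent.

End Affine.

(******************************************************************************)
(* Lattice vertex operators for h = span(alpha, c, d)                         *)
(******************************************************************************)

Section Lattice.
Variable K : fieldType.

(* coordinates with respect to alpha, c, d *)
Definition wt : choiceType := 'rV[K]_3.
Definition bas (i : 'I_3) : 'rV[K]_3 := delta_mx 0 i.
Definition wal : 'rV[K]_3 := bas (inord 0).
Definition wc : 'rV[K]_3 := bas (inord 1).
Definition wd : 'rV[K]_3 := bas (inord 2).

Definition pairing (u v : 'rV[K]_3) : K :=
  let co (w : 'rV[K]_3) (i : nat) : K := w 0 (inord i) in
  co u 0 * co v 0 + 2 * (co u 1 * co v 2 + co u 2 * co v 1).

(* An element (i, n) of a multiset stands for the factor h_i(-n-1), where     *)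
(* h_0, h_1, h_2 = alpha, c, d; a basis vector (A, beta) is the monomial A    *)
(* times e^beta. All e^beta, beta in h, are put in one space; the spaces      *)
(* F \otimes Pi(0)^{1/2} and F^tw \otimes Pi^{1/2}_{(-1)}(lambda) sit inside. *)
Definition modes : choiceType := {mset ('I_3 * nat)%type}%mset.
Definition fock : lmodType K := {malg K[(modes * wt)%type]}.
Definition ket (A : modes) (beta : 'rV[K]_3) : fock := << (A, beta) >>.
Definition expv (beta : 'rV[K]_3) : fock := ket mset0 beta.

(* the operator h(n) of the Heisenberg algebra *)
Definition heis (h : 'rV[K]_3) (n : int) : fock -> fock :=
  linext (fun b : modes * wt =>
    let: (A, beta) := b in
    match n with
    | Negz k => \sum_(i < 3) h 0 i *: ket (A `+` [mset (i, k)])%mset beta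
    | Posz 0 => pairing h beta *: ket A beta
    | Posz k.+1 => \sum_(i < 3)
        (k.+1%:R * (A (i, k))%:R * pairing h (bas i)) *:
          ket (A `\ (i, k))%mset beta
    end).

(* the coefficient of z^n in exp(\sum_{i>0} T i z^i), for commuting T i *)
Definition exp_coef (T : nat -> fock -> fock) (n : nat) (u : fock) : fock :=
  \sum_(l < n.+1) (l`!)%:R^-1 *:
    \sum_(t : l.-tuple 'I_n.+1 |
           all (fun i : 'I_n.+1 => 0 < i)%N t &&
           (\sum_(i <- t) (i : nat) == n)%N)
      foldr (fun (i : 'I_n.+1) w => T i w) u t.

Definition shift (gam : 'rV[K]_3) : fock -> fock :=
  linext (fun b : modes * wt => ket b.1 (b.2 + gam)).

(* The coefficient of z^(-s-1) in Y(e^gam, z) =                               *)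
(*   exp(\sum_{i>0} gam(-i) z^i / i) exp(- \sum_{i>0} gam(i) z^-i / i)        *)
(*     e^gam z^gam(0).                                                        *)
(* No cocycle is needed: Z alpha has rank one and is generated by an odd      *)
(* vector, and Z c/2 is isotropic and orthogonal to alpha.                    *)
Definition exp_mode (gam : 'rV[K]_3) (s : K) : fock -> fock :=
  linext (fun b : modes * wt =>
    \sum_(pq \in [set pq : nat * nat |
                   pairing gam b.2 + pq.1%:R - pq.2%:R = - s - 1])
      exp_coef (fun i w => i%:R^-1 *: heis gam (- i%:Z) w) pq.1
        (shift gam
          (exp_coef (fun i w => - i%:R^-1 *: heis gam i%:Z w) pq.2
            (ket b.1 b.2)))).

(* The coefficient of z^(-s-1) in Y(h_{i1}(-k1-1) ... e^gam, z), by           *)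
(* Y(h(-k-1) v, z) = :(d/dz)^k h(z) / k! Y(v, z):                             *)
(* where h(z) = \sum_m h(m) z^(-m-1) and m < 0 is written -m-1.               *)
Fixpoint monomial_mode (A : seq ('I_3 * nat)) (gam : 'rV[K]_3) (s : K)
    (u : fock) : fock :=
  match A with
  | [::] => exp_mode gam s u
  | (i, k) :: A' =>
      \sum_(m \in [set: nat])
        'C(m, k)%:R *:
          heis (bas i) (Negz m) (monomial_mode A' gam (s + m%:R - k%:R) u)
      + \sum_(m \in [set: nat])
        ((-1) ^+ k * 'C((m + k)%N, k)%:R) *:
          monomial_mode A' gam (s - m%:R - k%:R - 1) (heis (bas i) m%:Z u)
  end.

(* the coefficient of z^(-s-1) in Y(v, z) u *)
Definition Ymode (v : fock) (s : K) (u : fock) : fock :=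
  linext (fun b : modes * wt => monomial_mode (enum_mset b.1) b.2 s u) v.

Section Realization.
Variable k : K.

Definition wmu : 'rV[K]_3 := 2^-1 *: wd + (k / 4) *: wc.
Definition wnu : 'rV[K]_3 := 2^-1 *: wd - (k / 4) *: wc.

(* omega (x) e^gam, for gam in the span of c and d *)
Definition omega_exp (gam : 'rV[K]_3) : fock :=
  2^-1 *: heis wal (- 1) (heis wal (- 1) (expv gam))
  + 2^-1 *: heis wal (- 2) (expv gam) + expv (2 *: wal + gam).

Definition realization (a : osp) : fock :=
  match a with
  | ge => expv wc
  | gh => 2 *: heis wmu (- 1) (expv 0)
  | gf => (k + 2) *: omega_exp (- wc)
          - heis wnu (- 1) (heis wnu (- 1) (expv (- wc)))
          - (k + 1) *: heis wnu (- 2) (expv (- wc))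
  | gx => expv (wal + 2^-1 *: wc) + expv (- wal + 2^-1 *: wc)
  | gy => heis (wnu + 2^-1 *: wal) (- 1) (expv (- wal - 2^-1 *: wc))
          + heis (wnu - (3 / 2) *: wal) (- 1) (expv (wal - 2^-1 *: wc))
  end.

(* F^tw (x) Pi^{1/2}_{(-1)}(lambda): the basis vector (A, (n, m)) is the      *)
(* monomial A times e^((n + 1/2) alpha - mu + (lambda + m/2) c). The space    *)
(* does not depend on lambda, its inclusion [FtwPi_incl lambda] in [fock]     *)
(* does.                                                                      *)
Definition FtwPi : lmodType K := {malg K[(modes * (int * int))%type]}.

Definition FtwPi_incl (lambda : K) : FtwPi -> fock :=
  linext (fun b : modes * (int * int) =>
    let: (A, (n, m)) := b in
    ket A ((n%:~R + 2^-1) *: wal - wmu + (lambda + m%:~R / 2) *: wc)).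

End Realization.

End Lattice.

(* Main.v *)
(* A single Fock space has three sectors: the vertex superalgebra
   P = F (x) Pi(0)^{1/2} and the two halves of F^tw (x) Pi^{1/2}_{(-1)}, of
   index r and r + 1/2. Twist operators map the first sector to the others and
   commute with all vertex operators. Hence a field that is local with the
   generators and with the twist operators is determined by its value on the
   vacuum (Goddard), P acts on every sector, and the operator products of x, y,
   f need only be checked on the vacuum sector; they give V^k -> P.

   Let S be a subspace of a sector stable under the modes of e, h, x, y. A
   vector v of S of minimal degree is killed by their positive modes. Those of
   e^c make v free of c, those of h make it free of d, and then those of x and
   y give e^{-alpha-c/2}_(k) v = e^{alpha-c/2}_(k) v = 0 for k >= 0, so that v
   is a combination of top vectors. In the vacuum sector e_(-1) and y_(1) y_(0)
   move a top vector to the vacuum; hence the graded kernel of V^k -> L, whose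
   degree 0 part vanishes, maps to 0 in P, and L acts on all sectors. In the
   twisted sectors the zero modes act transitively on the top when r is not an
   integer. Conversely the same identities, read on c-free vectors, produce
   from the top all of e^{+-alpha-c/2}_(k), then alpha(-i) by bosonization and
   d(-i) from h(-i), so that the top generates the sector.

   V^k is graded by the monomials in the currents; they span it and degrees are
   separated because V^k is initial. *)
Require Import Defs.
From HB Require Import structures.
From mathcomp Require Import all_boot all_order all_algebra.
From mathcomp Require Import finmap multiset monalg.
From mathcomp Require Import boolp classical_sets functions cardinality fsbigop.
From mathcomp Require Import reals complex.
From mathcomp Require Import zify ring.

Set Implicit Arguments.
Unset Strict Implicit.
Unset Printing Implicit Defensive.

Import Order.TTheory GRing.Theory Num.Theory.

Local Open Scope classical_set_scope.
Local Open Scope ring_scope.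

(** * Expansions of (z - w)^n and Borcherds' identity *)

(** The exponents of the currents lie in the lattice spanned by $\alpha+c/2$ and $c$, of index two
    in $\mathbb Z\alpha+\mathbb Z\frac c2$. Its two cosets split
    $F^{tw}\otimes\Pi^{1/2}_{(-1)}(\lambda)$ and account for the shift of $r$ by $\frac12$. It pairs
    integrally with $\alpha/2-\mu$ and pairs trivially with $c$, which makes the twisted space an
    untwisted module. The obstacle is that $x$ and $y$ are sums of two vertex operators, and a
    stable subspace need not be stable under each summand. On $c$-free vectors, multiplying $x$ by
    $e^{-c}$ gives $B=e^{-\alpha-c/2}+e^{\alpha-c/2}$, and $y$ is a combination of $hB$,
    $c\,e^{-\alpha-c/2}$ and derivatives in which $e^{-\alpha-c/2}_{(k-1)}$ is left over with
    coefficient $-(k+\frac t2)$, where $t=0$ in the vacuum sector and $t=1$ in the twisted ones. A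
    descending induction on modes isolates it. The coefficient is nonzero for $k\ge1$, which
    suffices for vectors of minimal degree, and for $t=1$ it is nonzero for every $k$, which is what
    generation by the top needs. *)

Section LinearMaps.
Variables (K : numFieldType).

Definition islin (M M' : lmodType K) (f : M -> M') :=
  forall c u v, f (c *: u + v) = c *: f u + f v.

Variables (M M' : lmodType K) (f : M -> M').
Hypothesis fl : islin f.

Lemma islin0 : f 0 = 0.
Proof.
have := fl 1 0 0; rewrite !scale1r addr0 => /esym/eqP.
by rewrite -subr_eq0 addrK => /eqP.
Qed.

Lemma islinZ c u : f (c *: u) = c *: f u.
Proof. by rewrite -[X in f X]addr0 fl islin0 addr0. Qed.

Lemma islinD u v : f (u + v) = f u + f v.
Proof. by rewrite -[u]scale1r fl !scale1r. Qed.

Lemma islinN u : f (- u) = - f u.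
Proof. by rewrite -scaleN1r islinZ scaleN1r. Qed.

Lemma islinB u v : f (u - v) = f u - f v.
Proof. by rewrite islinD islinN. Qed.

Lemma islin_sum I (r : seq I) (P : pred I) (F : I -> M) :
  f (\sum_(i <- r | P i) F i) = \sum_(i <- r | P i) f (F i).
Proof.
by elim/big_ind2: _ => [|? ? ? ? <- <-|]; rewrite ?islin0 ?islinD.
Qed.

End LinearMaps.

Section Sums.
Variables (M : zmodType).
Implicit Types F : nat -> M.

Lemma fsumE F J : (forall j, (J <= j)%N -> F j = 0) ->
  \sum_(j \in [set: nat]) F j = \sum_(j < J) F j.
Proof.
move=> F0; rewrite (fsbig_ord _ J F); symmetry; apply: fsbig_widen => //.
move=> j [_ /= /negP]; rewrite -leqNgt => /F0 //.
Qed.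

Lemma sum_ord_trunc F J J' : (forall j, (J <= j)%N -> F j = 0) -> (J <= J')%N ->
  \sum_(j < J') F j = \sum_(j < J) F j.
Proof. by move=> F0 le; rewrite -!fsumE // => j /(leq_trans le)/F0. Qed.

End Sums.

Section Binomials.
Variable K : numFieldType.

Lemma binz0 m : binz K m 0 = 1.
Proof. by rewrite /binz big_ord0. Qed.

Lemma binzSr m j : binz K m j.+1 = binz K m j * ((m - j%:Z)%:~R / j.+1%:R).
Proof. by rewrite /binz big_ord_recr. Qed.

Lemma binz_absorb m j :
  binz K (m + 1) j.+1 = binz K m j * ((m + 1)%:~R / j.+1%:R).
Proof.
elim: j => [|j IH]; first by rewrite binzSr !binz0 subr0.
rewrite binzSr IH (binzSr m j) -!mulrA; congr (_ * _).
have -> : m + 1 - j.+1%:Z = m - j%:Z by lia.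
by ring.
Qed.

Lemma binzS m j : binz K (m + 1) j.+1 = binz K m j.+1 + binz K m j.
Proof.
have j0 : j.+1%:R != 0 :> K by rewrite pnatr_eq0.
rewrite binz_absorb binzSr rmorphD rmorphB /=.
have -> : (Posz j)%:~R = j.+1%:R - 1 :> K by rewrite -natr1 addrK.
rewrite rmorph1; move: (binz K m j) (m%:~R) j.+1%:R j0 => b x y y0.
by field.
Qed.

Lemma binz_nat0 (n j : nat) : (n < j)%N -> binz K n j = 0.
Proof.
move=> nj; rewrite /binz (bigD1 (Ordinal nj)) //=.
by rewrite subrr mul0r mul0r.
Qed.

(** The coefficient of $x^j$ in $F=(1-x)^n$. The recursions below come from multiplication by $1-x$
    and from the differential equation $(1-x)F'=-nF$. *)
Definition cf (n : int) (j : nat) : K := (-1) ^+ j * binz K n j.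

Lemma cf0 n : cf n 0 = 1.
Proof. by rewrite /cf binz0 mulr1. Qed.

Lemma cfS n j : cf (n + 1) j.+1 = cf n j.+1 - cf n j.
Proof. by rewrite /cf binzS exprS; ring. Qed.

Lemma cfSr n j : j.+1%:R * cf n j.+1 = - (n - j%:Z)%:~R * cf n j.
Proof.
have j0 : j.+1%:R != 0 :> K by rewrite pnatr_eq0.
rewrite /cf binzSr exprS; move: (binz K n j) (_ ^+ j) (_%:~R) j.+1%:R j0 => b s x y y0.
by field.
Qed.

Lemma cf_nat0 (n j : nat) : (n < j)%N -> cf n j = 0.
Proof. by move=> nj; rewrite /cf binz_nat0 // mulr0. Qed.

End Binomials.

(* [ex G n p q] is the coefficient of [(z - w)^n G(z, w)], where [(z - w)^n]  *)
(* is expanded in nonnegative powers of [w].                                  *)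
Section Expansion.
Variables (K : numFieldType) (M : lmodType K).
Implicit Types G : int -> int -> M.

(** Truncation in the second index makes the expansion [ex] a finite sum for every integer exponent
    and excludes nonzero solutions of $(z-w)G=0$. *)
Definition rt G := exists Q : int, forall p q, Q <= q -> G p q = 0.

Definition ex G n p q : M :=
  \sum_(j \in [set: nat]) cf K n j *: G (p + n - j%:Z) (q + j%:Z).

(** Multiplication by $z-w$: the coefficient of $z^{-p-1}$ in $zG$ is the one of $z^{-(p+1)-1}$ in
    $G$. *)
Definition dz G : int -> int -> M := fun p q => G (p + 1) q - G p (q + 1).

Lemma exE G n p q J :
    (forall j, (J <= j)%N -> G (p + n - j%:Z) (q + j%:Z) = 0) ->
  ex G n p q = \sum_(j < J) cf K n j *: G (p + n - j%:Z) (q + j%:Z).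
Proof. by move=> G0; apply: fsumE => j /G0 ->; rewrite scaler0. Qed.

Lemma rt_bound G : rt G -> forall q, exists J : nat, forall j p,
  (J <= j)%N -> G p (q + j%:Z) = 0.
Proof.
by case=> Q G0 q; exists `|Q - q|%N => j p le; apply: G0; lia.
Qed.

Lemma ex0 G p q : ex G 0 p q = G p q.
Proof.
rewrite /ex (@fsumE _ _ 1) => [|[//|j] _]; last first.
  by rewrite (@cf_nat0 _ 0 j.+1) // scale0r.
by rewrite big_ord1 cf0 scale1r subr0 !addr0.
Qed.

Lemma exS G n p q : rt G ->
  ex G (n + 1) p q = ex G n (p + 1) q - ex G n p (q + 1).
Proof.
move=> rG; have [J G0] := rt_bound rG q.
rewrite (@exE _ _ _ _ J.+1) => [|j le]; last by rewrite G0 //; lia.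
rewrite (@exE _ _ (p + 1) _ J.+1) => [|j le]; last by rewrite G0 //; lia.
rewrite (@exE _ _ _ _ J) => [|j le]; last first.
  by rewrite (_ : q + 1 + j%:Z = q + j.+1%:Z) ?G0 //; lia.
rewrite !big_ord_recl /= !cf0 !scale1r.
have -> : p + (n + 1) = p + 1 + n by lia.
rewrite -[RHS]addrA; congr (_ + _).
rewrite -sumrB; apply: eq_bigr => i _; rewrite /bump /= add1n cfS scalerBl.
congr (_ - _ *: G _ _); lia.
Qed.

Lemma rt_ex G n : rt G -> rt (ex G n).
Proof.
case=> Q G0; exists Q => p q le; rewrite (@exE _ _ _ _ 0) ?big_ord0 // => j _.
by apply: G0; lia.
Qed.

Lemma exN G (n : nat) p q : rt G -> ex G n p q = iter n dz G p q.
Proof.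
move=> rG; elim: n p q => [|n IH] p q; first by rewrite ex0.
by rewrite -addn1 PoszD exS // !IH addn1.
Qed.

Lemma ex_comp G s (n : nat) p q : rt G -> ex (ex G s) n p q = ex G (s + n%:Z) p q.
Proof.
move=> rG; elim: n p q => [|n IH] p q; first by rewrite ex0 addr0.
rewrite -addn1 PoszD exS; last exact: rt_ex.
by rewrite !IH addrA exS.
Qed.

Lemma exP G G' c n p q : rt G -> rt G' ->
  ex (fun p q => c *: G p q + G' p q) n p q = c *: ex G n p q + ex G' n p q.
Proof.
move=> rG rG'; have [J G0] := rt_bound rG q; have [J' G0'] := rt_bound rG' q.
pose L := maxn J J'.
have H0 j p' : (L <= j)%N -> G p' (q + j%:Z) = 0.
  by rewrite geq_max => /andP[/G0].
have H0' j p' : (L <= j)%N -> G' p' (q + j%:Z) = 0.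
  by rewrite geq_max => /andP[_ /G0'].
rewrite !(@exE _ _ _ _ L) => [|j le|j le|j le]; rewrite ?H0 ?H0' ?scaler0 ?addr0 //.
rewrite scaler_sumr -big_split; apply: eq_bigr => j _ /=.
by rewrite scalerDr !scalerA mulrC.
Qed.

Lemma ex_ext G G' n p q : (forall p q, G p q = G' p q) -> ex G n p q = ex G' n p q.
Proof. by move=> E; congr (ex _ n p q); apply/funext => i; apply/funext => k. Qed.

Lemma ex_eq0 G n p q : (forall p q, G p q = 0) -> ex G n p q = 0.
Proof. by move=> E; rewrite (@exE _ _ _ _ 0) ?big_ord0. Qed.

(* The Euler operator [- p - q] on modes is a derivation killing [(z - w)^n]. *)
Lemma ex_deriv G n p q : rt G ->
  ex (fun p q => p%:~R *: G (p - 1) q + q%:~R *: G p (q - 1)) n p q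
    = p%:~R *: ex G n (p - 1) q + q%:~R *: ex G n p (q - 1).
Proof.
move=> [Q G0]; pose J := `|Q - q|%N.+2.
have G1 p' q' : q' >= q + J%:Z - 1 -> G p' q' = 0 by move=> H; apply: G0; lia.
rewrite !(@exE _ _ _ _ J) => [|j le|j le|j le];
  rewrite ?G1 ?scaler0 ?addr0 //; try lia.
pose A j := cf K n j *: G (p + n - j%:Z - 1) (q + j%:Z).
pose B j := cf K n j *: G (p + n - j%:Z) (q + j%:Z - 1).
transitivity (\sum_(j < J) (p + n - j%:Z)%:~R *: A j +
              \sum_(j < J) (q + j%:Z)%:~R *: B j).
  rewrite -big_split; apply: eq_bigr => j _ /=.
  by rewrite /A /B scalerDr !scalerA ![cf _ _ _ * _]mulrC.
transitivity (\sum_(j < J) p%:~R *: A j + \sum_(j < J) q%:~R *: B j); last first.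
  rewrite !scaler_sumr; congr (_ + _); apply: eq_bigr => j _.
    by rewrite /A; congr (_ *: (_ *: G _ _)); lia.
  by rewrite /B; congr (_ *: (_ *: G _ _)); lia.
(* The coefficients $n-j$ and $j$ remain in the two sums. Shifting the second sum by one pairs them
   through [cfSr]; the boundary terms vanish by truncation and because $j=0$ has coefficient
   zero. *)
apply/eqP; rewrite -subr_eq0 opprD addrACA -!sumrB.
under eq_bigr => j _ do rewrite -scalerBl -rmorphB /=.
under [X in _ + X]eq_bigr => j _ do rewrite -scalerBl -rmorphB /=.
rewrite [X in X + _]big_ord_recr [X in _ + X]big_ord_recl /=.
have -> : A J.-1 = 0 by rewrite /A G1 ?scaler0 //; lia.
have -> : q + 0 - q = 0 by lia.
rewrite scale0r add0r scaler0 addr0 -big_split big1 // => j _ /=.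
rewrite /A /B /bump /= add1n.
have -> : p + n - j.+1%:Z = p + n - j%:Z - 1 by lia.
have -> : q + j.+1%:Z - 1 = q + j%:Z by lia.
rewrite !scalerA -scalerDl.
have -> : q + j.+1%:Z - q = j.+1%:Z by lia.
rewrite [_%:~R * cf K n j.+1]cfSr -mulrDl -rmorphN -rmorphD /=.
have -> : p + n - j%:Z - p + - (n - j%:Z) = 0 by lia.
by rewrite mul0r scale0r.
Qed.

(** Annihilation by $z-w$ makes $G$ constant along each line where $p+q$ is constant, and far along
    such a line truncation gives zero. *)
Lemma dz_cancel G : rt G -> (forall p q, dz G p q = 0) -> forall p q, G p q = 0.
Proof.
case=> Q G0 E p q.
have S (i : nat) : G p q = G (p - i%:Z) (q + i%:Z).
  elim: i => [|i ->]; first by rewrite subr0 addr0.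
  have /eqP := E (p - i.+1%:Z) (q + i%:Z); rewrite /dz subr_eq0 => /eqP.
  have -> : p - i.+1%:Z + 1 = p - i%:Z by lia.
  by move=> ->; congr (G _ _); lia.
by rewrite (S `|Q - q|%N) G0 //; lia.
Qed.

Lemma rt_dz G : rt G -> rt (dz G).
Proof. by case=> Q G0; exists Q => p q le; rewrite /dz !G0 ?subr0 //; lia. Qed.

Lemma ex_cancel G (n : nat) : rt G -> (forall p q, ex G n p q = 0) ->
  forall p q, G p q = 0.
Proof.
move=> rG E; have {}E p q : iter n dz G p q = 0 by rewrite -exN.
elim: n E => // n IH E; apply: IH; apply: dz_cancel => //.
by elim: n {E} => //= n IH; apply: rt_dz.
Qed.

End Expansion.

Lemma ex_lin (K : numFieldType) (M M' : lmodType K) (f : M -> M')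
    (G : int -> int -> M) n p q : islin f -> rt G ->
  f (ex G n p q) = ex (fun p q => f (G p q)) n p q.
Proof.
move=> fl rG; have [J G0] := rt_bound rG q.
rewrite (@exE _ _ G n p q J) => [|j le]; last by rewrite G0.
rewrite (@exE _ _ _ n p q J) => [|j le]; last by rewrite G0 // (islin0 fl).
by rewrite (islin_sum fl); apply: eq_bigr => j _; rewrite islinZ.
Qed.

(** Every term of $(f-g)^{a+b}u$ contains $f^a$ or $g^b$. It is applied to $w-x=(z-x)-(z-w)$ in
    Dong's lemma. *)
Lemma nilpotent_sub (G : zmodType) (f g h : G -> G) :
    (forall u, h u = f u - g u) -> (forall u, f (g u) = g (f u)) ->
    (forall u v, h (u - v) = h u - h v) -> f 0 = 0 -> g 0 = 0 ->
  forall a b u, iter a f u = 0 -> iter b g u = 0 -> iter (a + b) h u = 0.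
Proof.
move=> hE fg hB f0 g0.
have it0 (k : G -> G) n : k 0 = 0 -> iter n k 0 = 0.
  by move=> k0; elim: n => //= n ->.
have h0 : h 0 = 0 by rewrite hE f0 g0 subr0.
have hB' n u v : iter n h (u - v) = iter n h u - iter n h v.
  by elim: n => //= n ->; rewrite hB.
have fgn n u : iter n f (g u) = g (iter n f u).
  by elim: n => //= n ->; rewrite fg.
have gfn n u : iter n g (f u) = f (iter n g u).
  by elim: n => //= n ->; rewrite -fg.
move=> a b; move: {2}(a + b)%N (erefl (a + b)%N) => N.
elim: N a b => [|N IH] [|a] [|b] //= E u fu gu.
- by rewrite fu it0 ?add0n // hE f0 g0 subr0.
- by rewrite gu it0 ?addn0 // hE f0 g0 subr0.
have {}E : (a + b.+1)%N = N by lia.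
rewrite -[LHS]/(iter (a + b.+1).+1 h u) iterSr hE hB'.
rewrite [X in X - _]IH //; first last.
- by rewrite gfn /= gu f0.
- by rewrite -iterSr.
rewrite -addSnnS IH ?subr0 //; first by lia.
- by rewrite fgn /= fu g0.
- by rewrite -iterSr.
Qed.

(** * Fields, their $n$-th products and locality *)

Section Fields.
Variables (K : numFieldType) (M : lmodType K).

Definition fld := int -> M -> M.

Definition lfield (a : fld) := (forall n, islin (a n)) /\
  (forall u, exists N : int, forall n, N <= n -> a n u = 0).

Definition prodf (a b : fld) u p q := a p (b q u).

(** The modes of $(z-w)^na(z)b(w)-s(z-w)^nb(w)a(z)$, the power being expanded for $|z|>|w|$ in the
    first term and for $|w|>|z|$ in the second, where $(-1)^n$ accounts for $(w-z)^n$. The mode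
    $p=0$ is the residue in $z$, hence [nprod]. *)
Definition D (s : K) (a b : fld) (n p q : int) u : M :=
  ex (prodf a b u) n p q - ((-1) ^ n * s) *: ex (prodf b a u) n q p.

Definition nprod s a b n : fld := fun m u => D s a b n 0 m u.

Definition local s a b := exists N : nat, forall p q u, D s a b N p q u = 0.

Implicit Types a b c : fld.

Lemma nprod_idx s a b n n' m m' u : n = n' -> m = m' ->
  nprod s a b n m u = nprod s a b n' m' u.
Proof. by move=> -> ->. Qed.

Lemma rt_prodf a b u : lfield a -> lfield b -> rt (prodf a b u).
Proof.
move=> [la _] [_ tb]; have [N b0] := tb u; exists N => p q le.
by rewrite /prodf b0 // (islin0 (la p)).
Qed.

Lemma D_comb s a b n p q u : lfield a -> lfield b ->
  \sum_(j \in [set: nat]) cf K n j *: (a (p + n - j%:Z) (b (q + j%:Z) u) -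
      ((-1) ^ n * s) *: b (q + n - j%:Z) (a (p + j%:Z) u)) = D s a b n p q u.
Proof.
move=> fa fb; have rab := rt_prodf u fa fb; have rba := rt_prodf u fb fa.
have [J G0] := rt_bound rab q; have [J' G0'] := rt_bound rba p.
pose L := maxn J J'.
have H0 j p' : (L <= j)%N -> a p' (b (q + j%:Z) u) = 0.
  by rewrite geq_max => /andP[le _]; exact: (G0 _ _ le).
have H0' j p' : (L <= j)%N -> b p' (a (p + j%:Z) u) = 0.
  by rewrite geq_max => /andP[_ le]; exact: (G0' _ _ le).
rewrite (@fsumE _ _ L) => [|j le]; last by rewrite H0 // H0' // scaler0 subr0 scaler0.
rewrite /D !(@exE _ _ _ _ _ _ L); try by move=> j le; rewrite /prodf ?H0 ?H0'.
rewrite scaler_sumr -sumrB; apply: eq_bigr => j _.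
by rewrite scalerBr !scalerA [_ * cf _ _ _]mulrC.
Qed.

Lemma DS s a b n p q u : lfield a -> lfield b ->
  D s a b (n + 1) p q u = D s a b n (p + 1) q u - D s a b n p (q + 1) u.
Proof.
move=> fa fb; rewrite /D !exS; try exact: rt_prodf.
have -> : (-1) ^ (n + 1) = - ((-1) ^ n) :> K.
  by rewrite expfzDr ?oppr_eq0 ?oner_eq0 // mulrN1.
rewrite mulNr scaleNr opprK scalerBr opprB addrACA [RHS]addrACA.
by congr (_ + _); rewrite addrC.
Qed.

Lemma D_lin s a b n p q : lfield a -> lfield b -> islin (D s a b n p q).
Proof.
move=> fa fb c u v; rewrite /D.
have E x y : lfield x -> lfield y -> forall p q, prodf x y (c *: u + v) p q
    = c *: prodf x y u p q + prodf x y v p q.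
  by move=> [lx _] [ly _] p' q'; rewrite /prodf ly lx.
rewrite (ex_ext _ _ _ (E a b fa fb)) (ex_ext _ _ _ (E b a fb fa)).
rewrite !exP; try exact: rt_prodf.
rewrite [X in _ - X]scalerDr opprD addrACA [in RHS]scalerBr !scalerA.
by rewrite [c * _]mulrC.
Qed.

Lemma lfield_prod s a b n : lfield a -> lfield b ->
  lfield (nprod s a b n).
Proof.
move=> fa fb; have [la ta] := fa; have [lb tb] := fb; split.
  by move=> m; apply: D_lin.
move=> u.
have [Qa Ha] := ta u; have [Qb Hb] := tb u.
pose A := `|Qa|%N.
(* Only the finitely many vectors [a j u] with [j < A] can be nonzero, so one bound serves for all
   of them. *)
have [B HB] : exists B : int, forall j m, (j < A)%N -> B <= m ->
    b m (a j%:Z u) = 0.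
  elim: A => [|A [B IH]]; first by exists 0.
  have [B' HB'] := tb (a A%:Z u); exists (Num.max B B') => j m.
  rewrite ltnS ge_max leq_eqVlt => /orP[/eqP ->|lt] /andP[le le'].
    exact: HB'.
  exact: IH.
exists (Num.max Qb (B - n + A%:Z)) => m; rewrite ge_max => /andP[m1 m2].
rewrite /nprod /D (@exE _ _ _ _ _ _ 0) => [|j _]; last first.
  by rewrite /prodf Hb ?(islin0 (la _)) //; lia.
rewrite (@exE _ _ _ _ _ _ A) => [|j le]; last first.
  by rewrite /prodf Ha ?(islin0 (lb _)) //; lia.
rewrite big_ord0 big1 ?scaler0 ?subr0 // => j _.
by rewrite /prodf add0r HB ?scaler0 //; have := ltn_ord j; lia.
Qed.

Lemma local_ge s a b (N : nat) : lfield a -> lfield b ->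
    (forall p q u, D s a b N p q u = 0) ->
  forall n p q u, N%:Z <= n -> D s a b n p q u = 0.
Proof.
move=> fa fb D0 n p q u le.
have -> : n = N%:Z + (`|n - N%:Z|%N)%:Z by lia.
elim: `|_|%N p q => [|i IH] p q; first by rewrite addr0 D0.
by rewrite -addn1 PoszD addrA DS // !IH subr0.
Qed.

Lemma local_sym s a b : s * s = 1 -> local s a b -> local s b a.
Proof.
move=> ss [N D0]; exists N => p q u; have := D0 q p u; rewrite /D => /eqP.
rewrite subr_eq0 => /eqP ->; rewrite scalerA.
have -> : (-1) ^ N%:Z * s * ((-1) ^ N%:Z * s) = 1.
  by rewrite mulrACA ss mulr1 -exprMn mulrNN mulr1 expr1n.
by rewrite scale1r subrr.
Qed.

Lemma D_nat s a b (n : nat) p q u : lfield a -> lfield b ->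
  D s a b n p q u = iter n (@dz _ _) (fun p q => a p (b q u) - s *: b q (a p u)) p q.
Proof.
move=> fa fb; elim: n p q => [|n IH] p q.
  by rewrite /D !ex0 expr0z mul1r.
by rewrite -addn1 PoszD DS // !IH addn1.
Qed.

(* A local pair of fields satisfies Borcherds' identity: both sides satisfy   *)
(* the same recursion, they agree at [m = 0], and vanish for large [n].       *)
Lemma borcherds_local s a b : lfield a -> lfield b -> local s a b ->
  forall m n l u, \sum_(j \in [set: nat])
     binz K m j *: nprod s a b (n + j%:Z) (m + l - j%:Z) u = D s a b n m l u.
Proof.
move=> fa fb [N D0].
have P0 n m u : N%:Z <= n -> nprod s a b n m u = 0.
  by move=> le; apply: local_ge fa fb D0 _ _ _ _ le.
move=> m n l u.
pose F m n l j := binz K m j *: nprod s a b (n + j%:Z) (m + l - j%:Z) u.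
pose L m n l := \sum_(j \in [set: nat]) F m n l j.
have LE m' n' l' J : N%:Z <= n' + J%:Z -> L m' n' l' = \sum_(j < J) F m' n' l' j.
  by move=> le; apply: fsumE => j lej; rewrite /F P0 ?scaler0 //; lia.
have LS m' n' l' : L (m' + 1) n' l' = L m' (n' + 1) l' + L m' n' (l' + 1).
  pose J := `|N%:Z - n'|%N.
  rewrite !(LE _ _ _ J.+1); try lia.
  rewrite big_ord_recl [X in _ = _ + X]big_ord_recl addrCA.
  have El : m' + 1 + l' = m' + (l' + 1) by lia.
  rewrite [X in X + _ = _]/F [X in _ = X + _]/F !binz0 El; congr (_ + _).
  rewrite [X in _ = X + _]big_ord_recr /= [X in _ = _ + X + _]/F P0; last by lia.
  rewrite scaler0 addr0 -big_split; apply: eq_bigr => j _.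
  rewrite /F /bump /= add1n binzS scalerDl addrC; congr (_ *: _ + _ *: _).
    by apply: nprod_idx; lia.
  by apply: nprod_idx; lia.
have DS' m' n' l' : D s a b n' (m' + 1) l' u =
    D s a b (n' + 1) m' l' u + D s a b n' m' (l' + 1) u by rewrite DS ?subrK.
rewrite -[LHS]/(L m n l).
have L0 n' l' : L 0 n' l' = D s a b n' 0 l' u.
  rewrite (LE _ _ _ (`|N%:Z - n'|%N).+1); last by lia.
  rewrite big_ord_recl big1 => [|j _]; last by rewrite /F binz_nat0 ?scale0r.
  by rewrite /F binz0 scale1r /= !addr0 ?subr0 add0r.
case: m => m.
  elim: m n l => [|m IH] n l //.
  by rewrite -addn1 PoszD LS DS' !IH.
(* For negative [m] the recursion is run backwards: both sides vanish once [n] is at least [N], and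
   descending in [n] from there determines them from the values at the next larger [m]. *)
have -> : Negz m = 0 - m.+1%:Z by lia.
elim: m.+1 n l => [|i IH] n l; first by rewrite subr0.
have big n' l' : N%:Z <= n' -> L (0 - i.+1%:Z) n' l' = D s a b n' (0 - i.+1%:Z) l' u.
  move=> le; rewrite (LE _ _ _ 0) ?big_ord0 ?addr0 //.
  by rewrite (local_ge fa fb D0).
have [le|lt] := leP N%:Z n; first exact: big.
have -> : n = N%:Z - (`|N%:Z - n|%N)%:Z by lia.
elim: `|_|%N l => [|k IHk] l; first by rewrite big // subr0.
have E : 0 - i.+1%:Z + 1 = 0 - i%:Z :> int by lia.
have := LS (0 - i.+1%:Z) (N%:Z - k.+1%:Z) (l - 1).
have := DS' (0 - i.+1%:Z) (N%:Z - k.+1%:Z) (l - 1).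
rewrite E IH => ->; rewrite subrK.
have -> : N%:Z - k.+1%:Z + 1 = N%:Z - k%:Z by lia.
by rewrite IHk => /addrI.
Qed.

(** Locality gives $(z-w)^Na(z)b(w)u=s(z-w)^Nb(w)a(z)u=0$, and the power can be cancelled because
    $b(w)u$ is truncated. *)
Lemma kill_prop s a b u : lfield a -> lfield b -> local s a b ->
  (forall n, a n u = 0) -> forall l n, a n (b l u) = 0.
Proof.
move=> fa fb [N D0] au l n.
apply: (@ex_cancel _ _ (prodf a b u) N); first exact: rt_prodf.
move=> p q; have := D0 p q u; rewrite /D [X in _ - _ *: X]ex_eq0 ?scaler0 ?subr0 //.
by move=> p' q'; rewrite /prodf au (islin0 (fb.1 _)).
Qed.

End Fields.

(** * Dong's lemma and Goddard's uniqueness theorem *)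

Section Dong.
Variables (K : numFieldType) (M : lmodType K).
Notation T3 := (int -> int -> int -> M).
Implicit Types F : T3.

Let zw F : T3 := fun p q s => F (p + 1) q s - F p (q + 1) s.
Let zx F : T3 := fun p q s => F (p + 1) q s - F p q (s + 1).
Let wx F : T3 := fun p q s => F p (q + 1) s - F p q (s + 1).

Let wx_sub F : wx F = zx F - zw F.
Proof.
by do 3 apply/funext => ?; rewrite !fctE /wx /zx /zw opprB addrC addrA subrK.
Qed.

Let sub3 (a b c d : M) : (a - b) - (c - d) = (a - c) - (b - d).
Proof. by rewrite !opprB addrACA [RHS]addrACA [- b + _]addrC. Qed.

Let zxzw F : zx (zw F) = zw (zx F).
Proof. by do 3 apply/funext => ?; rewrite /zx /zw sub3. Qed.

Let wxzw F : wx (zw F) = zw (wx F).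
Proof. by do 3 apply/funext => ?; rewrite /wx /zw sub3. Qed.

Let wxB F F' : wx (F - F') = wx F - wx F'.
Proof. by do 3 apply/funext => ?; rewrite /wx !fctE sub3. Qed.

Let zx0 : zx 0 = 0.
Proof. by do 3 apply/funext => ?; exact: subr0. Qed.

Let zw0 : zw 0 = 0.
Proof. by do 3 apply/funext => ?; exact: subr0. Qed.

Let wx0 : wx 0 = 0.
Proof. by do 3 apply/funext => ?; exact: subr0. Qed.

Let iter0 (f : T3 -> T3) n : f 0 = 0 -> iter n f 0 = 0.
Proof. by move=> f0; elim: n => //= n ->. Qed.

Let iter_wxzw m n F : iter m wx (iter n zw F) = iter n zw (iter m wx F).
Proof.
have E k G : iter k wx (zw G) = zw (iter k wx G).
  by elim: k => //= k ->; rewrite wxzw.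
by elim: n F => //= n IH F; rewrite E IH.
Qed.

Let rt3 F := forall s, rt (fun p q => F p q s).
Let E3 n F : T3 := fun p q s => ex (fun p q => F p q s) n p q.

Let exB G G' n p q : rt G -> rt G' ->
  ex (fun p q => G p q - G' p q) n p q = ex G n p q - ex G' n p q :> M.
Proof.
move=> rG rG'; rewrite [LHS](@ex_ext _ _ _ (fun p q => -1 *: G' p q + G p q)).
  by rewrite exP // scaleN1r addrC.
by move=> p' q'; rewrite scaleN1r addrC.
Qed.

Let exl (G : int -> int -> M) n p q :
  ex (fun p q => G (p + 1) q) n p q = ex G n (p + 1) q.
Proof.
rewrite /ex; apply: eq_fsbigr => j _.
by rewrite (_ : p + n - j%:Z + 1 = p + 1 + n - j%:Z) //; lia.
Qed.

Let exr (G : int -> int -> M) n p q :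
  ex (fun p q => G p (q + 1)) n p q = ex G n p (q + 1).
Proof.
rewrite /ex; apply: eq_fsbigr => j _.
by rewrite (_ : q + j%:Z + 1 = q + 1 + j%:Z) //; lia.
Qed.

Let rt3l F : rt3 F -> rt3 (fun p q s => F (p + 1) q s).
Proof. by move=> rF s; have [Q h] := rF s; exists Q => p q /h. Qed.

Let rt3r F : rt3 F -> rt3 (fun p q s => F p (q + 1) s).
Proof.
by move=> rF s; have [Q h] := rF s; exists Q => p q l; apply: h; lia.
Qed.

Let rt3s F : rt3 F -> rt3 (fun p q s => F p q (s + 1)).
Proof. by move=> rF s; apply: rF. Qed.

Let rt3B F F' : rt3 F -> rt3 F' -> rt3 (fun p q s => F p q s - F' p q s).
Proof.
move=> rF rF' s; have [Q h] := rF s; have [Q' h'] := rF' s.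
by exists (Num.max Q Q') => p q; rewrite ge_max => /andP[/h -> /h' ->]; rewrite subr0.
Qed.

Let zxE3 n F : rt3 F -> zx (E3 n F) = E3 n (zx F).
Proof.
move=> rF; apply/funext => p; apply/funext => q; apply/funext => s.
rewrite /zx /E3 exB ?(exl (fun p q => F p q s)) //; exact: (rt3l rF s).
Qed.

Let wxE3 n F : rt3 F -> wx (E3 n F) = E3 n (wx F).
Proof.
move=> rF; apply/funext => p; apply/funext => q; apply/funext => s.
rewrite /wx /E3 exB ?(exr (fun p q => F p q s)) //; exact: (rt3r rF s).
Qed.

Let rt3zx n F : rt3 F -> rt3 (iter n zx F).
Proof. by move=> rF; elim: n => //= n IH; apply: rt3B; [apply: rt3l|apply: rt3s]. Qed.

Let rt3wx n F : rt3 F -> rt3 (iter n wx F).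
Proof. by move=> rF; elim: n => //= n IH; apply: rt3B; [apply: rt3r|apply: rt3s]. Qed.

Let iterE3 m m' n F : rt3 F ->
  iter m zx (iter m' wx (E3 n F)) = E3 n (iter m zx (iter m' wx F)).
Proof.
move=> rF.
have -> : iter m' wx (E3 n F) = E3 n (iter m' wx F).
  by elim: m' => //= m' ->; rewrite wxE3 //; apply: rt3wx.
by elim: m => //= m ->; rewrite zxE3 //; apply/rt3zx/rt3wx.
Qed.

Let sw F : T3 := fun p q s => F q p s.

Let sw_zx m F : iter m zx (sw F) = sw (iter m wx F).
Proof. by elim: m => //= m ->. Qed.

Let sw_wx m F : iter m wx (sw F) = sw (iter m zx F).
Proof. by elim: m => //= m ->. Qed.

Let wxzx F : wx (zx F) = zx (wx F).
Proof. by do 3 apply/funext => ?; rewrite /wx /zx sub3. Qed.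

Let iter_wxzx m n F : iter m wx (iter n zx F) = iter n zx (iter m wx F).
Proof.
have E k G : iter k wx (zx G) = zx (iter k wx G).
  by elim: k => //= k ->; rewrite wxzx.
by elim: n F => //= n IH F; rewrite E IH.
Qed.

Let zxL (f : int -> M -> M) n (G : int -> int -> M) : (forall q, islin (f q)) ->
  iter n zx (fun p q s => f q (G p s)) = fun p q s => f q (iter n (@dz _ _) G p s).
Proof.
move=> fl; elim: n => //= n ->; do 3 apply/funext => ?.
by rewrite /zx /dz (islinB (fl _)).
Qed.

Let zxR n (G : int -> int -> int -> M) :
  iter n zx (fun p q s => G q p s) = fun p q s => iter n (@dz _ _) (G q) p s.
Proof. by elim: n => //= n ->. Qed.

Let itB (f : T3 -> T3) m F F' : (forall F F', f (F - F') = f F - f F') ->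
  iter m f (F - F') = iter m f F - iter m f F'.
Proof. by move=> fB; elim: m => //= m ->. Qed.

Let zxB F F' : zx (F - F') = zx F - zx F'.
Proof. by do 3 apply/funext => ?; rewrite /zx !fctE sub3. Qed.

Let zxZ k F : zx (fun p q s => k *: F p q s) = fun p q s => k *: zx F p q s.
Proof. by do 3 apply/funext => ?; rewrite /zx scalerBr. Qed.

Let wxZ k F : wx (fun p q s => k *: F p q s) = fun p q s => k *: wx F p q s.
Proof. by do 3 apply/funext => ?; rewrite /wx scalerBr. Qed.

Let iterZ (f : T3 -> T3) m k F :
  (forall k F, f (fun p q s => k *: F p q s) = fun p q s => k *: f F p q s) ->
  iter m f (fun p q s => k *: F p q s) = fun p q s => k *: iter m f F p q s.
Proof. by move=> fZ; elim: m => //= m ->; rewrite fZ. Qed.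

Variables (s1 s2 s3 : K) (a b c : fld M) (n : int).
Hypotheses (fa : lfield a) (fb : lfield b) (fc : lfield c).
Hypotheses (lab : local s1 a b) (lac : local s2 a c) (lbc : local s3 b c).

Let tri (a b : fld M) u : T3 :=
  fun p q s => a p (b q (c s u)) - (s2 * s3) *: c s (a p (b q u)).

Let triE a' b' u p q s : lfield a' -> lfield b' ->
  ex (fun p q => tri a' b' u p q s) n p q =
  ex (prodf a' b' (c s u)) n p q - (s2 * s3) *: c s (ex (prodf a' b' u) n p q).
Proof.
move=> fa' fb'; rewrite (ex_lin _ _ _ (fc.1 s)); last exact: rt_prodf.
rewrite [LHS](@ex_ext _ _ _ (fun p q => - (s2 * s3) *: c s (prodf a' b' u p q) +
  prodf a' b' (c s u) p q)) => [|p' q']; last by rewrite scaleNr addrC.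
rewrite exP ?scaleNr 1?addrC //; last exact: rt_prodf.
have [Q h] := rt_prodf u fa' fb'; exists Q => p' q' /h ->.
exact: (islin0 (fc.1 _)).
Qed.

Let rt3_tri a' b' u : lfield a' -> lfield b' -> rt3 (tri a' b' u).
Proof.
move=> [la _] [lb tb] s; have [Q h] := tb (c s u); have [Q' h'] := tb u.
exists (Num.max Q Q') => p q; rewrite ge_max => /andP[/h e /h' e'].
by rewrite /tri e e' !(islin0 (la _)) (islin0 (fc.1 _)) scaler0 subr0.
Qed.

(** Moving [c] past [b'] and then past [a'] splits [tri] into a part killed by a power of $w-x$ and
    a part killed by a power of $z-x$. The equation between the signs lets the same statement serve
    for both orders of [a] and [b]. *)
Let tri_kill (a' b' : fld M) s2' s3' (Na Nb : nat) u : lfield a' -> lfield b' ->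
    s2' * s3' = s2 * s3 ->
    (forall p q u, D s2' a' c Na p q u = 0) ->
    (forall p q u, D s3' b' c Nb p q u = 0) ->
  iter Na zx (iter Nb wx (tri a' b' u)) = 0.
Proof.
move=> fa' fb' E ha hb; have [la _] := fa'; have [lc _] := fc.
pose A : T3 := fun p q s => a' p (b' q (c s u) - s3' *: c s (b' q u)).
pose B : T3 := fun p q s => - s3' *: (a' p (c s (b' q u)) - s2' *: c s (a' p (b' q u))).
have -> : tri a' b' u = A - B.
  do 3 apply/funext => ?; rewrite /tri /A /B !fctE scaleNr opprK (islinB (la _)).
  by rewrite (islinZ (la _)) scalerBr addrA subrK scalerA -E (mulrC s3').
have A0 : iter Nb wx A = 0.
  have -> : A = sw (fun p q s => a' q (b' p (c s u) - s3' *: c s (b' p u))) by [].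
  rewrite sw_wx (zxL _ (fun p s => b' p (c s u) - s3' *: c s (b' p u))) //.
  apply/funext => p; apply/funext => q; apply/funext => s.
  by rewrite /sw -(D_nat s3' Nb q s u fb' fc) hb (islin0 (la _)).
have B0 : iter Na zx B = 0.
  rewrite -[B]/(fun p q s => (fun q p s => - s3' *: (a' p (c s (b' q u)) - s2' *: c s (a' p (b' q u)))) q p s).
  rewrite zxR; apply/funext => p; apply/funext => q; apply/funext => s.
  have Z m (G : int -> int -> M) x y : iter m (@dz _ _) (fun p s => - s3' *: G p s) x y
     = - s3' *: iter m (@dz _ _) G x y.
    by elim: m x y => //= m IH x y; rewrite /dz !IH scalerBr.
  by rewrite Z -(D_nat s2' Na p s (b' q u) fa' fc) ha scaler0.
rewrite (itB _ _ _ wxB) (itB _ _ _ zxB) A0 (iter0 _ zx0) -iter_wxzx B0.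
by rewrite (iter0 _ wx0) subr0.
Qed.

Lemma dong : local (s2 * s3) (nprod s1 a b n) c.
Proof.
have [Nab hab] := lab; have [Nac hac] := lac; have [Nbc hbc] := lbc.
(* [B] makes [n + B] at least [Nab], so $(z-w)^B$ kills the products of [a] and [b], while
   $(z-x)^{Nac}(w-x)^{Nbc}$ kills their commutator with [c]. Writing $w-x=(z-x)-(z-w)$ then gives a
   power of $w-x$ alone. *)
pose B := `|Nab%:Z - n|%N; exists (Nac + B + Nbc)%N => q s u.
pose X n : T3 := fun p q s =>
  D s1 a b n p q (c s u) - (s2 * s3) *: c s (D s1 a b n p q u).
have fp := lfield_prod s1 n fa fb.
rewrite D_nat //.
have S m (G : T3) : iter m (@dz _ _) (G 0) q s = iter m wx G 0 q s :> M.
  by elim: m q s => //= m IH q s; rewrite /dz !IH.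
rewrite (S _ (X n)) iterD.
have zwX m : iter m zw (X n) = X (n + m%:Z).
  elim: m => [|m IH]; first by rewrite addr0.
  rewrite /= IH -addn1 PoszD addrA /X /zw.
  apply/funext => p'; apply/funext => q'; apply/funext => s'.
  rewrite (DS _ _ p' q' (c s' u) fa fb) (DS _ _ p' q' u fa fb).
  rewrite (islinB (fc.1 s') (D s1 a b (n + m%:Z) (p' + 1) q' u)) scalerBr.
  exact: sub3.
have X0 : iter B zw (X n) = 0.
  rewrite zwX /X; do 3 apply/funext => ?.
  by rewrite !(local_ge fa fb hab) ?(islin0 (fc.1 _)) ?scaler0 ?subr0 //; lia.
suff -> : iter (Nac + B) wx (iter Nbc wx (X n)) = 0 by [].
apply: (@nilpotent_sub _ zx zw wx) => //; last first.
  by rewrite -iter_wxzw X0 (iter0 _ wx0).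
have -> : X n = E3 n (tri a b u) - (fun p q s => ((-1) ^ n * s1) *: sw (E3 n (tri b a u)) p q s).
  apply/funext => p'; apply/funext => q'; apply/funext => s'.
  rewrite /X /D !fctE /sw /E3 !triE //.
  rewrite (islinB (fc.1 _)) (islinZ (fc.1 _)) !scalerBr sub3 !scalerA.
  by rewrite [_ * _ * (s2 * s3)]mulrC.
rewrite (itB _ _ _ wxB) (itB _ _ _ zxB) iterE3; last exact: rt3_tri.
rewrite (tri_kill _ _ _ (erefl _) hac hbc) //.
rewrite (iterZ _ _ _ wxZ) (iterZ _ _ _ zxZ) sw_wx sw_zx iter_wxzx.
rewrite iterE3; last exact: rt3_tri.
rewrite (tri_kill _ _ _ (mulrC _ _) hbc hac) //.
have -> : E3 n 0 = 0 by do 3 apply/funext => ?; apply: ex_eq0.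
by do 3 apply/funext => ?; rewrite !fctE; apply/eqP; rewrite subr_eq0 eq_sym; apply/eqP; exact: scaler0.
Qed.

End Dong.

Section Goddard.
Variables (K : numFieldType) (M : lmodType K).
Notation fld := (fld M).

Definition sgn (p : bool) : K := (-1) ^+ p.

Lemma sgnM p q : sgn p * sgn q = sgn (p (+) q).
Proof. by case: p; case: q; rewrite /sgn /= ?expr0 ?expr1 ?mulrNN ?mulr1 ?mul1r. Qed.

Lemma sgn_sqr p : sgn p * sgn p = 1.
Proof. by rewrite sgnM addbb. Qed.

Definition lcomb (k : K) (a b : fld) : fld := fun n u => k *: a n u + b n u.
Definition zfld : fld := fun _ _ => 0.
Definition idf : fld := fun n u => if n == -1 then u else 0.

Lemma lfield0 : lfield zfld.
Proof. by split=> [n c u v|u]; [rewrite scaler0 addr0|exists 0]. Qed.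

Lemma lfield_id : lfield idf.
Proof.
split=> [n c u v|u]; first by rewrite /idf; case: ifP => //; rewrite scaler0 addr0.
by exists 0 => n n0; rewrite /idf; case: eqP => // E; lia.
Qed.

Lemma lfield_lin k a b : lfield a -> lfield b -> lfield (lcomb k a b).
Proof.
move=> [la ta] [lb tb]; split=> [n c u v|u].
  by rewrite /lcomb la lb !scalerDr addrACA !scalerA (mulrC k).
have [N h] := ta u; have [N' h'] := tb u; exists (Num.max N N') => n.
by rewrite ge_max /lcomb => /andP[/h -> /h' ->]; rewrite scaler0 addr0.
Qed.

Lemma local_lin s k a b c : lfield a -> lfield b -> lfield c ->
  local s a c -> local s b c -> local s (lcomb k a b) c.
Proof.
move=> fa fb fc [N h] [N' h']; exists (maxn N N') => p q u.
have E : D s (lcomb k a b) c (maxn N N') p q u =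
    k *: D s a c (maxn N N') p q u + D s b c (maxn N N') p q u.
  rewrite /D (@ex_ext _ _ _ (fun p q => k *: prodf a c u p q + prodf b c u p q)) //.
  rewrite (@ex_ext _ _ (prodf c _ u) (fun p q => k *: prodf c a u p q + prodf c b u p q)).
    rewrite !exP; try exact: rt_prodf.
    by rewrite scalerBr scalerDr !scalerA mulrC opprD addrACA.
  by move=> p' q'; rewrite /prodf /lcomb fc.1.
rewrite E (local_ge fa fc h) ?(local_ge fb fc h') ?scaler0 ?addr0 //.
- by rewrite lez_nat leq_maxr.
- by rewrite lez_nat leq_maxl.
Qed.

Lemma local0 s c : lfield c -> local s zfld c.
Proof.
move=> fc; exists 0 => p q u; rewrite D_nat /=; last exact: fc.
  by rewrite /zfld (islin0 (fc.1 _)) scaler0 subr0.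
exact: lfield0.
Qed.

Lemma local_id c : lfield c -> local 1 idf c.
Proof.
move=> fc; exists 0 => p q u; rewrite D_nat /=; last exact: fc.
  rewrite scale1r /idf; case: ifP; first by rewrite subrr.
  by rewrite (islin0 (fc.1 _)) subr0.
exact: lfield_id.
Qed.

Variables (T : M -> M) (vc : M).
Hypotheses (Tl : islin T) (Tvac : T vc = 0).

(** This is $[T,a(z)]=\partial a(z)$ in modes. *)
Definition tcov (a : fld) := forall n u, T (a n u) = a n (T u) - n%:~R *: a (n - 1) u.
Definition creative (a : fld) := forall n, 0 <= n -> a n vc = 0.

Lemma ex_tcov a b n p q u : lfield a -> lfield b -> tcov a -> tcov b ->
  T (ex (prodf a b u) n p q) = ex (prodf a b (T u)) n p q -
    (p%:~R *: ex (prodf a b u) n (p - 1) q + q%:~R *: ex (prodf a b u) n p (q - 1)).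
Proof.
move=> fa fb ta tb; have rab := rt_prodf u fa fb.
rewrite (ex_lin _ _ _ Tl rab) -ex_deriv //.
rewrite (@ex_ext _ _ _ (fun p q => -1 *: (p%:~R *: prodf a b u (p - 1) q +
  q%:~R *: prodf a b u p (q - 1)) + prodf a b (T u) p q)).
  rewrite exP; last exact: rt_prodf; first by rewrite scaleN1r addrC.
  have [Q h] := rab; exists (Q + 1) => p' q' le.
  by rewrite !h ?scaler0 ?addr0 //; lia.
move=> p' q'; rewrite /prodf ta tb (islinB (fa.1 _)) (islinZ (fa.1 _)).
by rewrite scaleN1r opprD addrC addrAC addrA.
Qed.

Lemma tcov_prod s a b n : lfield a -> lfield b -> tcov a -> tcov b ->
  tcov (nprod s a b n).
Proof.
move=> fa fb ta tb m u; rewrite /nprod /D (islinB Tl) (islinZ Tl) !ex_tcov //.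
rewrite !scale0r !add0r addr0 !scalerBr !scalerA opprB.
set A := ex _ _ _ _; set B := ex _ _ _ _; set C := ex _ _ _ _; set E := ex _ _ _ _.
rewrite [m%:~R * _]mulrC opprB addrACA [RHS]addrA -[LHS]addrA -[RHS]addrA.
by rewrite -[RHS]addrA; congr (A + _); rewrite addrA addrC.
Qed.

Lemma tcov_lin k a b : tcov a -> tcov b -> tcov (lcomb k a b).
Proof.
move=> ta tb n u; rewrite /lcomb Tl ta tb scalerBr addrACA [in RHS]scalerDr opprD !scalerA.
by rewrite (mulrC k).
Qed.

Lemma tcov0 : tcov zfld.
Proof. by move=> n u; rewrite /zfld (islin0 Tl) scaler0 subr0. Qed.

Lemma tcov_id : tcov idf.
Proof.
move=> n u; rewrite /idf; case: eqP => [->|ne].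
  by case: eqP => [//|_]; rewrite scaler0 subr0.
rewrite (islin0 Tl); case: eqP => [e|_]; last by rewrite scaler0 subr0.
have n0 : n = 0 by lia.
by rewrite n0 mulr0z scale0r subr0.
Qed.

Lemma creative_lin k a b : creative a -> creative b -> creative (lcomb k a b).
Proof. by move=> ca cb n n0; rewrite /lcomb ca // cb // scaler0 addr0. Qed.

Lemma creative_id : creative idf.
Proof. by move=> n n0; rewrite /idf; case: eqP => // E; lia. Qed.

Lemma creative_prod s a b n : lfield a -> lfield b -> creative a -> creative b ->
  creative (nprod s a b n).
Proof.
move=> fa fb ca cb m m0; rewrite /nprod /D !(@exE _ _ _ _ _ _ 0) ?big_ord0.
- by rewrite scaler0 subr0.
- by move=> j _; rewrite /prodf ca ?(islin0 (fb.1 _)) //; lia.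
- by move=> j _; rewrite /prodf cb ?(islin0 (fa.1 _)) //; lia.
Qed.

Lemma nprod_vac s a b n : lfield a -> lfield b -> creative a -> creative b ->
  nprod s a b n (-1) vc = a n (b (-1) vc).
Proof.
move=> fa fb ca cb; rewrite /nprod /D (@exE _ _ _ _ _ _ 1) => [|j le]; last first.
  by rewrite /prodf cb ?(islin0 (fa.1 _)) //; lia.
rewrite (@exE _ _ _ _ _ _ 0) => [|j _]; last first.
  by rewrite /prodf ca ?(islin0 (fb.1 _)) //; lia.
by rewrite big_ord1 big_ord0 scaler0 subr0 cf0 scale1r /prodf /= add0r subr0 addr0.
Qed.

(** On the vacuum covariance reads $Ta_n\mathbf 1=-n\,a_{n-1}\mathbf 1$, which in characteristic
    zero determines $a_{-2}\mathbf 1,a_{-3}\mathbf 1,\dots$ from $a_{-1}\mathbf 1$. *)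
Lemma tcov_vac0 a : lfield a -> tcov a -> creative a -> a (-1) vc = 0 ->
  forall n, a n vc = 0.
Proof.
move=> fa ta ca a0; case=> n; first exact: ca.
rewrite NegzE; elim: n => // n IH.
have := ta (- n.+1%:Z) vc; rewrite IH (islin0 Tl) Tvac (islin0 (fa.1 _)) sub0r.
move=> /esym/eqP; rewrite oppr_eq0 scaler_eq0 intr_eq0 => /orP[|/eqP].
  by rewrite oppr_eq0.
by have -> : - n.+1%:Z - 1 = - n.+2%:Z by lia.
Qed.

Variables (I J : Type) (bf : I -> fld) (bp : I -> bool) (ef : J -> fld).
Hypotheses (bfl : forall i, lfield (bf i)) (bft : forall i, tcov (bf i)).
Hypotheses (bfc : forall i, creative (bf i)) (efl : forall e, lfield (ef e)).
Hypothesis bfb : forall i i', local (sgn (bp i && bp i')) (bf i) (bf i').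
Hypothesis bfe : forall i e, local 1 (bf i) (ef e).
Hypothesis gen : forall S : set M, subspace S -> S vc ->
  (forall i n u, S u -> S (bf i n u)) -> (forall e n u, S u -> S (ef e n u)) ->
  forall u, S u.

(** Besides the generating fields [bf], a good field is local with the operators [ef], which carry
    information from the vacuum to vectors that no [bf] reaches. All conditions survive $n$-th
    products, by Dong's lemma. *)
Record good (p : bool) (a : fld) : Prop := Good {
  good_fld : lfield a;
  good_tcov : tcov a;
  good_vac : creative a;
  good_base : forall i, local (sgn (p && bp i)) a (bf i);
  good_ext : forall e, local 1 a (ef e)
}.

(** Goddard's argument: the vectors killed by all modes of [a] contain the vacuum by covariance and
    are stable under every [bf] and [ef] by locality, so they are everything. *)
Lemma good_eq0 p a : good p a -> a (-1) vc = 0 -> forall n u, a n u = 0.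
Proof.
case=> fa ta ca ba ea a0 n u.
suff: (forall n, a n u = 0) by [].
apply: (gen (S := [set u | forall n, a n u = 0])).
- split=> [|c v w hv hw] m /=; first by rewrite (islin0 (fa.1 _)).
  by rewrite fa.1 hv hw scaler0 addr0.
- exact: tcov_vac0.
- by move=> i m v hv k; apply: (kill_prop fa (bfl i) (ba i)).
- by move=> i m v hv k; apply: (kill_prop fa (efl i) (ea i)).
Qed.

Lemma good_lin k p a b : good p a -> good p b -> good p (lcomb k a b).
Proof.
case=> fa ta ca ba ea [fb tb cb bb eb]; split.
- exact: lfield_lin.
- exact: tcov_lin.
- exact: creative_lin.
- by move=> i; apply: local_lin.
- by move=> i; apply: local_lin.
Qed.

Lemma good_zero p : good p zfld.
Proof.
split.
- exact: lfield0.
- exact: tcov0.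
- by [].
- by move=> i; apply: local0.
- by move=> i; apply: local0.
Qed.

Lemma good_id : good false idf.
Proof.
split.
- exact: lfield_id.
- exact: tcov_id.
- exact: creative_id.
- by move=> i; apply: local_id.
- by move=> i; apply: local_id.
Qed.

Lemma good_bf i : good (bp i) (bf i).
Proof. by split. Qed.

Lemma good_prod p q a b n : good p a -> good q b -> local (sgn (p && q)) a b ->
  good (p (+) q) (nprod (sgn (p && q)) a b n).
Proof.
case=> fa ta ca ba ea [fb tb cb bb eb] lab; split.
- exact: lfield_prod.
- exact: tcov_prod.
- exact: creative_prod.
- move=> i; rewrite andb_addl -sgnM; exact: dong.
- by move=> i; rewrite -[1]mulr1; apply: dong.
Qed.

Lemma good_inj p a b : good p a -> good p b -> a (-1) vc = b (-1) vc ->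
  forall n u, a n u = b n u.
Proof.
move=> ga gb E n u; apply/eqP; rewrite -subr_eq0 addrC -scaleN1r.
by apply/eqP/(good_eq0 (good_lin (-1) gb ga)); rewrite /lcomb E scaleN1r addNr.
Qed.

End Goddard.

(** * Fock spaces *)

Section Malg.
Variables (K : numFieldType) (B : choiceType) (M : lmodType K).
Implicit Types (u v : {malg K[B]}) (f : B -> M).

Lemma linextEw f u (d : {fset B}) : (msupp u `<=` d)%fset ->
  linext f u = \sum_(b <- d) u@_b *: f b.
Proof.
move=> le; rewrite /linext; apply: big_fset_incl => // b bd bu.
by rewrite mcoeff_outdom // scale0r.
Qed.

Lemma linext_is f : islin (linext f).
Proof.
move=> c u v; set d := (msupp u `|` msupp v)%fset.
rewrite !(@linextEw _ _ d).
- rewrite scaler_sumr -big_split; apply: eq_bigr => b _ /=.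
  by rewrite mcoeffD mcoeffZ scalerDl scalerA.
- exact: fsubsetUr.
- exact: fsubsetUl.
- apply: fsubset_trans (msuppD_le _ _) _.
  by apply: fsetSU; apply: msuppZ_le.
Qed.

Lemma linextU f b : linext f << b >> = f b.
Proof.
rewrite (@linextEw _ _ [fset b]%fset) ?msuppU_le //.
by rewrite big_seq_fset1 mcoeffUU scale1r.
Qed.

Lemma malg_lind (P : {malg K[B]} -> Prop) : P 0 ->
  (forall c u v, P u -> P v -> P (c *: u + v)) -> (forall b, P << b >>) ->
  forall u, P u.
Proof.
move=> P0 PL PB u; rewrite [u]monalgE.
elim/big_rec: _ => // b v _ Pv.
have -> : << u@_b *g b >> = u@_b *: << b >> :> {malg K[B]}.
  by apply/malgP => k; rewrite mcoeffZ !mcoeffU mulrnAr mulr1.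
exact: PL.
Qed.

Lemma lin_eq (f g : {malg K[B]} -> M) : islin f -> islin g ->
  (forall b, f << b >> = g << b >>) -> forall u, f u = g u.
Proof.
move=> fl gl E; apply: malg_lind => //; first by rewrite !islin0.
by move=> c u v; rewrite fl gl => -> ->.
Qed.

End Malg.

Section LinOps.
Variables (K : numFieldType) (M M' M'' : lmodType K).

Lemma islin_comp (f : M' -> M'') (g : M -> M') :
  islin f -> islin g -> islin (fun u => f (g u)).
Proof. by move=> fl gl c u v; rewrite gl fl. Qed.

Lemma islin_id : islin (fun u : M => u).
Proof. by []. Qed.

Lemma islin_scale k (f : M -> M') : islin f -> islin (fun u => k *: f u).
Proof. by move=> fl c u v; rewrite fl scalerDr !scalerA mulrC. Qed.

Lemma islin_add (f g : M -> M') : islin f -> islin g -> islin (fun u => f u + g u).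
Proof. by move=> fl gl c u v; rewrite fl gl scalerDr addrACA. Qed.

Lemma islin_sub (f g : M -> M') : islin f -> islin g -> islin (fun u => f u - g u).
Proof. by move=> fl gl c u v; rewrite fl gl scalerBr opprD addrACA. Qed.

Lemma islin_bigsum (J : Type) (r : seq J) (P : pred J) (F : J -> M -> M') :
  (forall j, islin (F j)) -> islin (fun u => \sum_(j <- r | P j) F j u).
Proof.
move=> Fl c u v; rewrite scaler_sumr -big_split; apply: eq_bigr => j _.
exact: Fl.
Qed.

End LinOps.

Lemma enum_msetD1 (B : choiceType) (A : {mset B}%mset) x :
  perm_eq (enum_mset (A `+` [mset x])%mset) (x :: enum_mset A).
Proof.
suff -> : (A `+` [mset x])%mset = seq_mset (x :: enum_mset A).
  exact: perm_eq_seq_mset.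
by rewrite mset_cons seq_mset_id msetDC.
Qed.

Lemma mset_ind (B : choiceType) (P : {mset B}%mset -> Prop) : P mset0 ->
  (forall A x, P A -> P (A `+` [mset x])%mset) -> forall A, P A.
Proof.
move=> P0 PD A; rewrite -[A]seq_mset_id; elim: (enum_mset A) => [|x s IH].
  suff -> : seq_mset [::] = mset0 :> {mset B}%mset by [].
  by apply/msetP => y; rewrite mset_seqE mset0E.
by rewrite mset_cons msetDC; apply: PD.
Qed.

Section Pairing.
Variable K : numFieldType.
Implicit Types u v h g : 'rV[K]_3.

Lemma sum3 (M : zmodType) (F : 'I_3 -> M) :
  \sum_(i < 3) F i = F (inord 0) + F (inord 1) + F (inord 2).
Proof.
rewrite !big_ord_recl big_ord0 addr0 addrA.
by congr (F _ + F _ + F _); apply/val_inj; rewrite /= inordK.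
Qed.

Lemma pairingC u v : pairing u v = pairing v u.
Proof. by rewrite /pairing; ring. Qed.

Lemma pairingDl u u' v : pairing (u + u') v = pairing u v + pairing u' v.
Proof. by rewrite /pairing !mxE; ring. Qed.

Lemma pairingZl c u v : pairing (c *: u) v = c * pairing u v.
Proof. by rewrite /pairing !mxE; ring. Qed.

Lemma pairingDr u v v' : pairing u (v + v') = pairing u v + pairing u v'.
Proof. by rewrite !(pairingC u) pairingDl. Qed.

Lemma pairingZr c u v : pairing u (c *: v) = c * pairing u v.
Proof. by rewrite !(pairingC u) pairingZl. Qed.

Lemma pairingNl u v : pairing (- u) v = - pairing u v.
Proof. by rewrite -scaleN1r pairingZl mulN1r. Qed.

Lemma pairingNr u v : pairing u (- v) = - pairing u v.
Proof. by rewrite pairingC pairingNl pairingC. Qed.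

Lemma pairing0l v : pairing 0 v = 0 :> K.
Proof. by rewrite -(scale0r 0) pairingZl mul0r. Qed.

Lemma basE (i j : 'I_3) : bas K i 0 j = (j == i)%:R.
Proof. by rewrite /bas mxE eqxx. Qed.

Lemma inord3_eq (i j : nat) : (i < 3)%N -> (j < 3)%N ->
  (inord i == inord j :> 'I_3) = (i == j).
Proof. by move=> i3 j3; rewrite -val_eqE /= !inordK. Qed.

Lemma pairing_sum h g : \sum_(i < 3) g 0 i * pairing h (bas K i) = pairing h g.
Proof. by rewrite sum3 /pairing !basE !inord3_eq //=; ring. Qed.

End Pairing.

(* The coefficients [Ex g n] of [exp (\sum_(i > 0) g i z^i / i)].             *)
Section Exponential.
Variables (K : numFieldType) (M : lmodType K) (g : nat -> M -> M).
Hypothesis gl : forall i, islin (g i).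

(** Differentiating the exponential gives $nE_n=\sum_{i=1}^n g_iE_{n-i}$. Taking this as the
    definition makes all commutation rules inductions on [n]; agreement with the sum over tuples in
    the statement is proved separately. *)
Fixpoint Xf (fuel n : nat) (u : M) : M :=
  match fuel, n with
  | f.+1, m.+1 => m.+1%:R^-1 *: \sum_(i < m.+1) g i.+1 (Xf f (m - i) u)
  | _, _ => u
  end.

Definition Ex (n : int) (u : M) : M := if n is Posz n then Xf n n u else 0.

Lemma Xf_fuel f f' n u : (n <= f)%N -> (n <= f')%N -> Xf f n u = Xf f' n u.
Proof.
elim: f f' n => [|f IH] [|f'] [|n] //= le le'; congr (_ *: _).
by apply: eq_bigr => i _; congr (g _ _); apply: IH; have := ltn_ord i; lia.
Qed.

Lemma Ex0 u : Ex 0 u = u. Proof. by []. Qed.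

Lemma Ex_neg n u : n < 0 -> Ex n u = 0.
Proof. by case: n. Qed.

Lemma ExE n N u : n <= N%:Z ->
  n%:~R *: Ex n u = \sum_(i < N) g i.+1 (Ex (n - i.+1%:Z) u).
Proof.
case: n => n le; last first.
  by rewrite Ex_neg // scaler0 big1 // => i _; rewrite Ex_neg ?islin0 //; lia.
rewrite (@sum_ord_trunc _ (fun i => g i.+1 (Ex (n%:Z - i.+1%:Z) u)) n).
- case: n le => [|n] _; first by rewrite big_ord0 scale0r.
  rewrite /= scalerA divff ?intr_eq0 // scale1r; apply: eq_bigr => i _.
  have -> : n.+1%:Z - i.+1%:Z = (n - i)%N by have := ltn_ord i; lia.
  by congr (g _ _); apply: Xf_fuel; have := ltn_ord i; lia.
- by move=> i ni; rewrite Ex_neg ?islin0 //; lia.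
- by [].
Qed.

Lemma Ex_lin n : islin (Ex n).
Proof.
case: n => n; last by move=> c u v; rewrite /= scaler0 addr0.
move=> c u v /=; move: {1 3 5}n => f; elim: f n => [|f IH] [|n] //=.
rewrite scalerA mulrC -scalerA -scalerDr; congr (_ *: _).
rewrite scaler_sumr -big_split; apply: eq_bigr => i _.
by rewrite IH gl.
Qed.

Lemma Ex_ind (P : int -> Prop) : (forall n, n < 0 -> P n) -> P 0 ->
  (forall n : nat, (forall m, m <= n%:Z -> P m) -> P n.+1%:Z) -> forall n, P n.
Proof.
move=> Pneg P0 PS n; case: (ltP n 0) => [/Pneg //|n0].
suff H (k : nat) : forall m, m <= k%:Z -> P m by apply: (H `|n|%N); lia.
elim: k => [|k IH] m le.
  have [/Pneg //|m0] := ltP m 0; have -> // : m = 0 by lia.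
have [/IH //|m0] := leP m k%:Z; have -> : m = k.+1%:Z by lia.
exact: PS.
Qed.

Lemma scale_inj (n : nat) (x y : M) : n.+1%:Z%:~R *: x = n.+1%:Z%:~R *: y -> x = y.
Proof. by apply: scalerI; rewrite intr_eq0. Qed.

Lemma Ex_comm (L : M -> M) n u : islin L ->
  (forall i v, L (g i.+1 v) = g i.+1 (L v)) -> L (Ex n u) = Ex n (L u).
Proof.
move=> Ll Lg; elim/Ex_ind: n => [n n0|//|n IH].
  by rewrite !Ex_neg ?islin0.
apply: (@scale_inj n); rewrite -(islinZ Ll) !(@ExE _ n.+1) // (islin_sum Ll).
by apply: eq_bigr => i _; rewrite Lg IH //; lia.
Qed.

(* [L] acts on [g] as a derivation with values in scalars, supported at [m] *)
Lemma Ex_deriv (L : M -> M) (m : nat) (k : K) n u : islin L ->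
    (forall i v, L (g i.+1 v) = g i.+1 (L v) + (if i == m then m.+1%:R * k else 0) *: v) ->
  L (Ex n u) = Ex n (L u) + k *: Ex (n - m.+1%:Z) u.
Proof.
move=> Ll Lg; elim/Ex_ind: n => [n n0||n IH].
- have h : n - m.+1%:Z < 0 by lia.
  by rewrite !Ex_neg // (islin0 Ll) scaler0 addr0.
- have h : 0 - m.+1%:Z < 0 by lia.
  by rewrite (Ex_neg _ h) scaler0 addr0.
apply: (@scale_inj n); rewrite -(islinZ Ll) scalerDr !(@ExE _ n.+1) // (islin_sum Ll).
transitivity (\sum_(i < n.+1) (g i.+1 (Ex (n.+1%:Z - i.+1%:Z) (L u)) +
    k *: g i.+1 (Ex (n.+1%:Z - m.+1%:Z - i.+1%:Z) u)) +
    \sum_(i < n.+1) (if i == m :> nat then m.+1%:R * k else 0) *: Ex (n.+1%:Z - i.+1%:Z) u).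
  rewrite -big_split; apply: eq_bigr => i _; rewrite Lg IH; last by lia.
  rewrite (islinD (gl _)) (islinZ (gl _)).
  by have -> : n.+1%:Z - i.+1%:Z - m.+1%:Z = n.+1%:Z - m.+1%:Z - i.+1%:Z by lia.
rewrite big_split -addrA; congr (_ + _); rewrite -scaler_sumr -ExE; last by lia.
transitivity (k *: ((n.+1%:Z - m.+1%:Z)%:~R *: Ex (n.+1%:Z - m.+1%:Z) u) +
   (m.+1%:R * k) *: Ex (n.+1%:Z - m.+1%:Z) u); last first.
  rewrite !scalerA -scalerDl; congr (_ *: _).
  by rewrite rmorphB /=; ring.
congr (_ + _); have [lt|ge] := ltnP m n.+1.
  rewrite (bigD1 (Ordinal lt)) //= eqxx big1 ?addr0 // => i /eqP ne.
  rewrite ifF ?scale0r //; apply/negP => /eqP E; apply: ne.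
  by apply/val_inj.
rewrite Ex_neg ?scaler0; last by lia.
rewrite big1 // => i _; rewrite ifF ?scale0r //; apply/negP => /eqP E.
by have := ltn_ord i; lia.
Qed.

End Exponential.

Arguments Ex : simpl never.

(* A space with a basis indexed by [modes * I]; working with this interface   *)
(* instead of {malg K[modes * I]} keeps conversion from unfolding {malg}.     *)
Record fockmod (K : numFieldType) (I : choiceType) := FockMod {
  fsort :> lmodType K;
  kt : modes -> I -> fsort;
  fext : forall M : lmodType K, (modes -> I -> M) -> fsort -> M;
  fext_is : forall (M : lmodType K) (f : modes -> I -> M), islin (fext f);
  fext_kt : forall (M : lmodType K) (f : modes -> I -> M) A i, fext f (kt A i) = f A i;
  fx_lind : forall P : fsort -> Prop, P 0 ->
    (forall c u v, P u -> P v -> P (c *: u + v)) -> (forall A i, P (kt A i)) ->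
    forall u, P u
}.
Arguments kt {K I X} : rename.
Arguments fext {K I X M} : rename.
Arguments fext_is {K I X M} : rename.
Arguments fext_kt {K I X M} : rename.
Arguments fx_lind {K I X} P : rename.

Section MalgFock.
Variables (K : numFieldType) (I : choiceType).

Let mkt A i : {malg K[(modes * I)%type]} := << (A, i) >>.
Let mext (M : lmodType K) (f : modes -> I -> M) : {malg K[(modes * I)%type]} -> M :=
  linext (fun b => f b.1 b.2).

Lemma malg_fock_kt M f A i : mext (M := M) f (mkt A i) = f A i.
Proof. exact: linextU. Qed.

Lemma malg_fock_ind (P : {malg K[(modes * I)%type]} -> Prop) : P 0 ->
    (forall c u v, P u -> P v -> P (c *: u + v)) -> (forall A i, P (mkt A i)) ->
  forall u, P u.
Proof. by move=> P0 PL PB; apply: malg_lind => // -[A i]; apply: PB. Qed.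

Definition malg_fock : fockmod K I :=
  FockMod (fun M f => linext_is (fun b => f b.1 b.2)) malg_fock_kt malg_fock_ind.

End MalgFock.

Section Span.
Variables (K : numFieldType) (I : choiceType) (X : fockmod K I).
Implicit Types (S : set (modes * I)) (u v : X).

Lemma fx_eq (M : lmodType K) (f g : X -> M) : islin f -> islin g ->
  (forall A i, f (kt A i) = g (kt A i)) -> forall u, f u = g u.
Proof.
move=> fl gl E; apply: fx_lind => //; first by rewrite !islin0.
by move=> c u v; rewrite fl gl => -> ->.
Qed.

(* the span of the basis vectors indexed by [S] *)
Variant supp S u : Prop := Supp of forall P : X -> Prop, P 0 ->
  (forall c u v, P u -> P v -> P (c *: u + v)) ->
  (forall A i, S (A, i) -> P (kt A i)) -> P u.

Lemma suppE S u (P : X -> Prop) : supp S u -> P 0 ->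
  (forall c u v, P u -> P v -> P (c *: u + v)) ->
  (forall A i, S (A, i) -> P (kt A i)) -> P u.
Proof. by case=> h; apply: h. Qed.

Lemma supp_subspace S : subspace (supp S).
Proof.
split; first by split=> P P0 _ _.
move=> c u v [hu] [hv]; split=> P P0 PL PS.
by apply: (PL c); [exact: (hu P)|exact: (hv P)].
Qed.

Lemma supp0 S : supp S 0. Proof. by case: (supp_subspace S). Qed.

Lemma suppL S c u v : supp S u -> supp S v -> supp S (c *: u + v).
Proof. by have [_] := supp_subspace S; apply. Qed.

Lemma suppD S u v : supp S u -> supp S v -> supp S (u + v).
Proof.
by move=> hu hv; rewrite -[u]scale1r; apply: (supp_subspace S).2.
Qed.

Lemma suppZ S c u : supp S u -> supp S (c *: u).
Proof.
by move=> hu; rewrite -[_ *: u]addr0; apply: (supp_subspace S).2 => //; apply: supp0.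
Qed.

Lemma supp_sum S (J : Type) (r : seq J) (P : pred J) (F : J -> X) :
  (forall j, P j -> supp S (F j)) -> supp S (\sum_(j <- r | P j) F j).
Proof.
by move=> h; apply: (big_ind (supp S)); [exact: supp0|exact: suppD|].
Qed.

Lemma suppU S A i : S (A, i) -> supp S (kt A i).
Proof. by move=> Si; split=> P _ _ h; apply: h. Qed.

Lemma supp_sub S S' u : S `<=` S' -> supp S u -> supp S' u.
Proof. by move=> le [h]; split=> P P0 PL PS; apply: h => // A i /le; apply: PS. Qed.

Lemma suppT u : supp setT u.
Proof. by apply: fx_lind; [exact: supp0|exact: suppL|move=> A i; exact: suppU]. Qed.

Definition proj S : X -> X :=
  fext (fun A i => if (A, i) \in S then kt A i else 0).

Lemma proj_is S : islin (proj S). Proof. exact: fext_is. Qed.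

Lemma proj_id S u : supp S u -> proj S u = u.
Proof.
move=> h; apply: (suppE (P := fun u => proj S u = u) h); first exact: (islin0 (proj_is S)).
  by move=> c v v' hv hv'; rewrite proj_is hv hv'.
by move=> A i Si; rewrite /proj fext_kt mem_set.
Qed.

Lemma proj_eq0 S S' u : (forall b, S b -> S' b -> False) -> supp S' u -> proj S u = 0.
Proof.
move=> d h; apply: (suppE (P := fun u => proj S u = 0) h); first exact: (islin0 (proj_is S)).
  by move=> c v v' hv hv'; rewrite proj_is hv hv' scaler0 addr0.
by move=> A i Si; rewrite /proj fext_kt memNset // => /d; apply.
Qed.

Lemma supp_disj S S' u : (forall b, S b -> S' b -> False) -> supp S u -> supp S' u -> u = 0.
Proof. by move=> d /proj_id hS /(proj_eq0 d); rewrite hS. Qed.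

Lemma proj_supp S S' u : supp S' u -> supp [set b | S b /\ S' b] (proj S u).
Proof.
move=> h; apply: (suppE (P := fun u => supp _ (proj S u)) h);
  first by rewrite (islin0 (proj_is S)); apply: supp0.
  by move=> c v v' hv hv'; rewrite proj_is; exact: suppL.
move=> A i Si; rewrite /proj fext_kt; case: ifP => [/set_mem ?|_]; last exact: supp0.
exact: suppU.
Qed.

End Span.

Lemma supp_lin (K : numFieldType) (I I' : choiceType) (X : fockmod K I) (X' : fockmod K I')
    (S : set (modes * I)) (S' : set (modes * I')) (f : X -> X') u : islin f ->
  (forall A i, S (A, i) -> supp S' (f (kt A i))) -> supp S u -> supp S' (f u).
Proof.
move=> fl h hu; apply: (suppE (P := fun u => supp S' (f u)) hu) => //;
  first by rewrite (islin0 fl); apply: supp0.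
by move=> c v v' hv hv'; rewrite fl; exact: suppL.
Qed.

Section FockSpace.
Variables (K : numFieldType) (I : choiceType) (w : I -> 'rV[K]_3) (X : fockmod K I).
Implicit Types (u v : X) (x y : 'I_3 * nat).

(** Locking keeps unification from unfolding multisets and linear extensions in the computations
    below. *)
Fact fock_key : unit. Proof. by []. Qed.

Definition ins : 'I_3 * nat -> modes -> modes :=
  locked_with fock_key (fun x A => (A `+` [mset x])%mset).
Definition del : 'I_3 * nat -> modes -> modes :=
  locked_with fock_key (fun x A => (A `\ x)%mset).

Definition cr : 'I_3 * nat -> X -> X := locked_with fock_key
  (fun x => fext (fun A i => kt (ins x A) i)).
Definition an : 'I_3 * nat -> X -> X := locked_with fock_key
  (fun x => fext (fun A i => (A x)%:R *: kt (del x A) i)).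

Definition hs : 'rV[K]_3 -> int -> X -> X := locked_with fock_key (fun h n =>
  match n with
  | Negz k => fun u => \sum_(i < 3) h 0 i *: cr (i, k) u
  | Posz 0 => fext (fun A i => pairing h (w i) *: kt A i)
  | Posz k.+1 => fun u => \sum_(i < 3) (k.+1%:R * pairing h (bas K i)) *: an (i, k) u
  end).

Lemma ins_def x A : ins x A = (A `+` [mset x])%mset.
Proof. by rewrite /ins unlock. Qed.

Lemma del_def x A : del x A = (A `\ x)%mset.
Proof. by rewrite /del unlock. Qed.

Lemma insE x A y : ins x A y = (A y + (x == y))%N.
Proof. by rewrite ins_def msetDC mset1DE addnC eq_sym. Qed.

Lemma delE x A y : del x A y = (A y - (x == y))%N.
Proof. by rewrite del_def msetB1E eq_sym. Qed.

Lemma ins_perm x A : perm_eq (enum_mset (ins x A)) (x :: enum_mset A).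
Proof. by rewrite ins_def; apply: enum_msetD1. Qed.

Lemma modes_eq (A B : modes) : (forall y, A y = B y) -> A = B.
Proof. by move=> E; apply/msetP. Qed.

Lemma modes_ind (P : modes -> Prop) : P mset0 ->
  (forall A x, P A -> P (ins x A)) -> forall A, P A.
Proof.
by move=> P0 PD; apply: mset_ind => // A x; have := PD A x; rewrite ins_def.
Qed.

Definition e0 (i : I) : X := kt mset0 i.

Lemma cr_is x : islin (cr x). Proof. rewrite /cr unlock; exact: fext_is. Qed.
Lemma an_is x : islin (an x). Proof. rewrite /an unlock; exact: fext_is. Qed.

Lemma hsN h k u : hs h (Negz k) u = \sum_(i < 3) h 0 i *: cr (i, k) u.
Proof. by rewrite /hs unlock. Qed.

Lemma hsP h k u :
  hs h k.+1%:Z u = \sum_(i < 3) (k.+1%:R * pairing h (bas K i)) *: an (i, k) u.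
Proof. by rewrite /hs unlock. Qed.

Lemma crU x A i : cr x (kt A i) = kt (ins x A) i.
Proof. by rewrite /cr unlock fext_kt. Qed.

Lemma anU x A i : an x (kt A i) = (A x)%:R *: kt (del x A) i.
Proof. by rewrite /an unlock fext_kt. Qed.

Lemma hs0U h A i : hs h 0 (kt A i) = pairing h (w i) *: kt A i.
Proof. by rewrite /hs unlock [LHS]fext_kt. Qed.

Lemma hs_is h n : islin (hs h n).
Proof.
case: n => [[|k]|k] c u v.
- rewrite /hs unlock; exact: fext_is.
- rewrite !hsP scaler_sumr -big_split; apply: eq_bigr => i _ /=.
  by rewrite an_is scalerDr !scalerA mulrC.
- rewrite !hsN scaler_sumr -big_split; apply: eq_bigr => i _ /=.
  by rewrite cr_is scalerDr !scalerA mulrC.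
Qed.

Lemma insC x y A : ins x (ins y A) = ins y (ins x A).
Proof. by apply: modes_eq => z; rewrite !insE addnAC. Qed.

Lemma crC x y u : cr x (cr y u) = cr y (cr x u).
Proof.
apply: (@fx_eq _ _ _ _ (fun u => cr x (cr y u)) (fun u => cr y (cr x u)));
  try by apply: islin_comp; apply: cr_is.
by move=> A i; rewrite (crU y A i) (crU x A i) (crU x) (crU y) insC.
Qed.

Lemma anC x y u : an x (an y u) = an y (an x u).
Proof.
apply: (@fx_eq _ _ _ _ (fun u => an x (an y u)) (fun u => an y (an x u)));
  try by apply: islin_comp; apply: an_is.
move=> A i; rewrite (anU y A i) (anU x A i) !(islinZ (an_is _)) (anU x) (anU y).
rewrite !scalerA !delE.
have -> : del x (del y A) = del y (del x A).
  by apply: modes_eq => z; rewrite !delE; lia.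
rewrite -!natrM (_ : (A y * (A x - (y == x)) = A x * (A y - (x == y)))%N) //.
by have [<-//|ne] := eqVneq x y; rewrite !subn0 mulnC.
Qed.

Lemma an_cr x y u : an x (cr y u) = cr y (an x u) + (x == y)%:R *: u.
Proof.
apply: (@fx_eq _ _ _ _ (fun u => an x (cr y u))
  (fun u => cr y (an x u) + (x == y)%:R *: u)).
- by apply: islin_comp; [apply: an_is|apply: cr_is].
- apply: islin_add; last exact/islin_scale/islin_id.
  by apply: islin_comp; [apply: cr_is|apply: an_is].
move=> A i; rewrite (crU y A i) (anU x A i) (anU x) (islinZ (cr_is _)) crU insE.
have [->|ne] := eqVneq x y.
  have -> : del y (ins y A) = A.
    by apply: modes_eq => z; rewrite delE insE addnK.
  have [A0|A0] := posnP (A y).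
    by rewrite A0 scale0r add0r.
  have -> : ins y (del y A) = A.
    apply: modes_eq => z; rewrite insE delE subnK //.
    by have [<-|] := eqVneq y z.
  by rewrite natrD scalerDl.
rewrite addn0 scale0r addr0.
have [->|A0] := posnP (A x); first by rewrite !scale0r.
have -> // : del x (ins y A) = ins y (del x A).
apply: modes_eq => z; rewrite !(insE, delE) addnBAC //.
by have [<-|] := eqVneq x z.
Qed.

Lemma hsP_cr h k i l u : hs h k.+1%:Z (cr (i, l) u) = cr (i, l) (hs h k.+1%:Z u) +
  (if k == l then k.+1%:R * pairing h (bas K i) else 0) *: u.
Proof.
rewrite !hsP (islin_sum (cr_is _)).
under eq_bigr => i' _ do rewrite an_cr scalerDr.
rewrite big_split; congr (_ + _).
  by apply: eq_bigr => i' _; rewrite (islinZ (cr_is _)).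
rewrite (eq_bigr (fun i' => if i' == i then
    (if k == l then k.+1%:R * pairing h (bas K i) else 0) *: u else 0)).
  by rewrite -big_mkcond big_pred1_eq.
move=> i' _; rewrite xpair_eqE; have [->|ne] := eqVneq i' i.
  by case: eqP => _; rewrite ?scale1r // !scale0r scaler0.
by rewrite scale0r scaler0.
Qed.

(** Only a positive mode against a negative one contributes. [zz] collects the commuting cases;
    [caseP] is the contraction, where the sum over coordinates rebuilds the pairing. *)
Lemma hs_comm h g m n u : hs h m (hs g n u) =
  hs g n (hs h m u) + (if m + n == 0 then m%:~R * pairing h g else 0) *: u.
Proof.
have zz m' n' h' g' : hs h' m' (hs g' n' u) = hs g' n' (hs h' m' u) -> m' + n' != 0 \/ m' = 0 ->
    hs h' m' (hs g' n' u) = hs g' n' (hs h' m' u) + (if m' + n' == 0 then m'%:~R * pairing h' g' else 0) *: u.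
  move=> -> [/negPf -> | ->]; first by rewrite scale0r addr0.
  by rewrite mul0r if_same scale0r addr0.
have w0 x h' : (forall v, hs h' 0 (cr x v) = cr x (hs h' 0 v)) /\
    (forall v, hs h' 0 (an x v) = an x (hs h' 0 v)).
  split=> v.
    apply: (@fx_eq _ _ _ _ (fun v => hs h' 0 (cr x v)) (fun v => cr x (hs h' 0 v))).
    - by apply: islin_comp; [apply: hs_is|apply: cr_is].
    - by apply: islin_comp; [apply: cr_is|apply: hs_is].
    by move=> A i; rewrite (hs0U h' A i) (islinZ (cr_is _)) crU hs0U.
  apply: (@fx_eq _ _ _ _ (fun v => hs h' 0 (an x v)) (fun v => an x (hs h' 0 v))).
  - by apply: islin_comp; [apply: hs_is|apply: an_is].
  - by apply: islin_comp; [apply: an_is|apply: hs_is].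
  move=> A i; rewrite (hs0U h' A i) (islinZ (an_is _)) anU (islinZ (hs_is _ _)) hs0U.
  by rewrite !scalerA mulrC.
have w1 h' g' n' v : hs h' 0 (hs g' n' v) = hs g' n' (hs h' 0 v).
  case: n' => [[|k]|k].
  - apply: (@fx_eq _ _ _ _ (fun v => hs h' 0 (hs g' 0 v)) (fun v => hs g' 0 (hs h' 0 v)));
      try by apply: islin_comp; apply: hs_is.
    move=> A i; rewrite (hs0U h' A i) (hs0U g' A i) !(islinZ (hs_is _ _)).
    by rewrite (hs0U h') (hs0U g') !scalerA mulrC.
  - rewrite !hsP (islin_sum (hs_is _ _)); apply: eq_bigr => i _.
    by rewrite (islinZ (hs_is _ _)) (w0 _ _).2.
  - rewrite !hsN (islin_sum (hs_is _ _)); apply: eq_bigr => i _.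
    by rewrite (islinZ (hs_is _ _)) (w0 _ _).1.
have caseP k l h' g' : hs h' k.+1%:Z (hs g' (Negz l) u) = hs g' (Negz l) (hs h' k.+1%:Z u) +
    (if k == l then k.+1%:R * pairing h' g' else 0) *: u.
  rewrite (hsN g' l u) (islin_sum (hs_is _ _)) hsN.
  under eq_bigr => i _ do rewrite (islinZ (hs_is _ _)) hsP_cr scalerDr.
  rewrite big_split; congr (_ + _).
  case: (k == l); last by rewrite scale0r big1 // => i _; rewrite scaler0.
  rewrite -(pairing_sum h' g') mulr_sumr scaler_suml; apply: eq_bigr => i _.
  by rewrite scalerA mulrCA.
case: m => [[|k]|k]; first by apply: zz; [apply: w1|right].
- case: n => [[|l]|l]; first by apply: zz; [rewrite w1|left].
    apply: zz; last by left.
    rewrite (hsP g l u) (hsP h k u) !(islin_sum (hs_is _ _)).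
    under eq_bigr do rewrite (islinZ (hs_is _ _)) hsP scaler_sumr.
    under [RHS]eq_bigr do rewrite (islinZ (hs_is _ _)) hsP scaler_sumr.
    rewrite exchange_big; apply: eq_bigr => i _; apply: eq_bigr => i' _.
    by rewrite !scalerA mulrC anC.
  rewrite caseP; congr (_ + _ *: _).
  by rewrite NegzE subr_eq0 eqz_nat eqSS; case: ifP.
case: n => [[|l]|l]; first by apply: zz; [rewrite w1|left].
- rewrite (caseP l k g h) -addrA -scalerDl [X in _ = _ + X *: u](_ : _ = 0).
    by rewrite scale0r addr0.
  rewrite NegzE (addrC (- _)) subr_eq0 eqz_nat eqSS; case: eqP => [->|_].
    by rewrite (pairingC h) rmorphN mulNr addrN.
  by rewrite addr0.
apply: zz; last by left.
rewrite (hsN g l u) (hsN h k u) !(islin_sum (hs_is _ _)).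
under eq_bigr do rewrite (islinZ (hs_is _ _)) hsN scaler_sumr.
under [RHS]eq_bigr do rewrite (islinZ (hs_is _ _)) hsN scaler_sumr.
rewrite exchange_big; apply: eq_bigr => i _; apply: eq_bigr => i' _.
by rewrite !scalerA mulrC crC.
Qed.

End FockSpace.

(** An element [(i, n)] stands for $h_i(-n-1)$, of weight $n+1$. *)
Definition mdeg (A : modes) : nat := \sum_(x <- enum_mset A) x.2.+1.

Lemma mdeg0 : mdeg mset0 = 0.
Proof. by rewrite /mdeg enum_mset0 big_nil. Qed.

Lemma mdeg_ins x A : mdeg (ins x A) = (mdeg A + x.2.+1)%N.
Proof. by rewrite /mdeg (perm_big _ (ins_perm x A)) big_cons addnC. Qed.

Lemma del_ins x (A : modes) : (0 < A x)%N -> ins x (del x A) = A.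
Proof.
move=> A0; apply: modes_eq => y; rewrite insE delE subnK //.
by have [<-|] := eqVneq x y.
Qed.

Lemma mdeg_del x (A : modes) : (0 < A x)%N -> mdeg A = (mdeg (del x A) + x.2.+1)%N.
Proof. by move=> /del_ins {1}<-; apply: mdeg_ins. Qed.

Definition imap (K : numFieldType) (I I' : choiceType) (X : fockmod K I)
    (X' : fockmod K I') (f : I -> I') : X -> X' :=
  fext (fun A i => kt A (f i)).

Section Imap.
Variables (K : numFieldType) (I I' : choiceType).
Variables (X : fockmod K I) (X' : fockmod K I') (f : I -> I').
Local Notation im := (imap X' f : X -> X').

Lemma imap_is : islin im. Proof. exact: fext_is. Qed.

Lemma imap_kt A i : im (kt A i) = kt A (f i). Proof. exact: fext_kt. Qed.

Lemma imap_cr x u : im (cr x u) = cr x (im u).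
Proof.
apply: (@fx_eq _ _ _ _ (fun u => im (cr x u)) (fun u => cr x (im u))).
- by apply: islin_comp; [apply: imap_is|apply: cr_is].
- by apply: islin_comp; [apply: cr_is|apply: imap_is].
by move=> A i; rewrite crU !imap_kt crU.
Qed.

Lemma imap_an x u : im (an x u) = an x (im u).
Proof.
apply: (@fx_eq _ _ _ _ (fun u => im (an x u)) (fun u => an x (im u))).
- by apply: islin_comp; [apply: imap_is|apply: an_is].
- by apply: islin_comp; [apply: an_is|apply: imap_is].
by move=> A i; rewrite anU (islinZ imap_is) !imap_kt anU.
Qed.

Variables (w : I -> 'rV[K]_3) (w' : I' -> 'rV[K]_3).

Lemma imap_hs h n u : n != 0 -> im (hs w h n u) = hs w' h n (im u).
Proof.
case: n => [[|k]|k] // _; rewrite ?hsP ?hsN (islin_sum imap_is);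
  apply: eq_bigr => i _; rewrite (islinZ imap_is) ?imap_an ?imap_cr //.
Qed.

Lemma imap_hs0 h A i g : w' (f i) = w i + g ->
  hs w' h 0 (im (kt A i)) = im (hs w h 0 (kt A i)) + pairing h g *: im (kt A i).
Proof.
by move=> E; rewrite imap_kt !hs0U (islinZ imap_is) imap_kt E pairingDr scalerDl.
Qed.

End Imap.

Section FockDegree.
Variables (K : numFieldType) (I : choiceType) (w : I -> 'rV[K]_3) (X : fockmod K I).
Implicit Types (u v : X) (h g : 'rV[K]_3).
Local Notation hs := (hs w).

Lemma fock_ind (P : X -> Prop) : P 0 ->
  (forall c u v, P u -> P v -> P (c *: u + v)) -> (forall i, P (e0 X i)) ->
  (forall x u, P u -> P (cr x u)) -> forall u, P u.
Proof.
move=> P0 PL Pe Pc; apply: fx_lind => // A i.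
by elim/modes_ind: A => [|A x IH]; [exact: Pe|rewrite -crU; exact: Pc].
Qed.

Definition Sd i (D : int) : set (modes * I) := [set b | b.2 = i /\ (mdeg b.1)%:Z = D].

Lemma Sd_kt A i : supp (Sd i (mdeg A)%:Z) (kt A i : X).
Proof. exact: suppU. Qed.

Lemma Sd_e0 i : supp (Sd i 0) (e0 X i).
Proof. by apply: suppU; split=> //=; rewrite mdeg0. Qed.

Lemma Sd_neg i D u : D < 0 -> supp (Sd i D) u -> u = 0.
Proof.
by move=> D0 h; apply: (suppE (P := fun u => u = 0) h) => [|c v v' -> ->|A j [_ /= E]];
  rewrite ?scaler0 ?addr0 //; lia.
Qed.

Lemma cr_supp x i D u : supp (Sd i D) u -> supp (Sd i (D + x.2.+1%:Z)) (cr x u).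
Proof.
apply: supp_lin; first exact: cr_is.
by move=> A j [/= -> E]; rewrite crU; apply: suppU; split=> //=; rewrite mdeg_ins; lia.
Qed.

Lemma an_supp x i D u : supp (Sd i D) u -> supp (Sd i (D - x.2.+1%:Z)) (an x u).
Proof.
apply: supp_lin; first exact: an_is.
move=> A j [/= -> E]; rewrite anU; have [->|A0] := posnP (A x).
  by rewrite scale0r; apply: supp0.
apply: suppZ; apply: suppU; split=> //.
by rewrite -E (mdeg_del A0) PoszD addrK.
Qed.

Lemma hs_supp h n i D u : supp (Sd i D) u -> supp (Sd i (D - n)) (hs h n u).
Proof.
case: n => [[|k]|k].
- rewrite subr0; apply: supp_lin; first exact: hs_is.
  by move=> A j [/= -> E]; rewrite hs0U; apply: suppZ; apply: suppU.
- by move=> hu; rewrite hsP; apply: supp_sum => j _; apply: suppZ; exact: (@an_supp (j, k) i D u hu).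
- by move=> hu; rewrite hsN NegzE opprK; apply: supp_sum => j _; apply: suppZ; exact: (@cr_supp (j, k) i D u hu).
Qed.

Lemma Ex_supp (f : nat -> X -> X) (e : int) i D n u : (forall k, islin (f k)) ->
  (forall k D v, supp (Sd i D) v -> supp (Sd i (D + e * k.+1%:Z)) (f k.+1 v)) ->
  supp (Sd i D) u -> supp (Sd i (D + e * n)) (Ex f n u).
Proof.
move=> fl fs hu; elim/Ex_ind: n => [n n0||n IH].
- by rewrite Ex_neg //; apply: supp0.
- by rewrite mulr0 addr0.
have n0 : n.+1%:Z%:~R != 0 :> K by rewrite intr_eq0.
rewrite -[Ex f _ _]scale1r -(mulVf n0) -scalerA (@ExE _ _ _ _ _ n.+1) //.
apply: suppZ; apply: supp_sum => k _.
have -> : D + e * n.+1%:Z = D + e * (n.+1%:Z - k.+1%:Z) + e * k.+1%:Z by lia.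
by apply: fs; apply: IH; lia.
Qed.

(* the exponentials of creation and annihilation operators of a vertex operator *)
Definition gm g (i : nat) u : X := hs g (- i%:Z) u.
Definition gp g (i : nat) u : X := - hs g i%:Z u.

Lemma gm_is g i : islin (gm g i). Proof. exact: hs_is. Qed.

Lemma gp_is g i : islin (gp g i).
Proof. by move=> c u v; rewrite /gp hs_is opprD scalerN. Qed.

Definition Em g n : X -> X := Ex (gm g) n.
Definition Ep g n : X -> X := Ex (gp g) n.

Lemma Em_is g n : islin (Em g n). Proof. exact: (Ex_lin (gm_is g)). Qed.
Lemma Ep_is g n : islin (Ep g n). Proof. exact: (Ex_lin (gp_is g)). Qed.

Lemma Em_supp g n i D u : supp (Sd i D) u -> supp (Sd i (D + n)) (Em g n u).
Proof.
move=> hu; rewrite -[X in D + X]mul1r; apply: Ex_supp => //; first exact: gm_is.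
by move=> k D' v hv; rewrite mul1r -[k.+1%:Z]opprK; apply: hs_supp.
Qed.

Lemma Ep_supp g n i D u : supp (Sd i D) u -> supp (Sd i (D - n)) (Ep g n u).
Proof.
move=> hu; rewrite -[X in D + X]mulN1r; apply: Ex_supp => //; first exact: gp_is.
by move=> k D' v hv; rewrite mulN1r /gp -scaleN1r; apply: suppZ; apply: hs_supp.
Qed.

Lemma Ep_big g n i D u : D < n -> supp (Sd i D) u -> Ep g n u = 0.
Proof. by move=> le /(Ep_supp g n) /Sd_neg; apply; lia. Qed.

Lemma Em_hsP g h (k : nat) n u :
  hs h k.+1%:Z (Em g n u) = Em g n (hs h k.+1%:Z u) + pairing h g *: Em g (n - k.+1%:Z) u.
Proof.
apply: Ex_deriv; [exact: gm_is|exact: hs_is|move=> i v].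
rewrite /gm hs_comm subr_eq0 eqz_nat eqSS eq_sym; case: eqP => [->|//].
by rewrite pairingC.
Qed.

Lemma Em_hsN g h n m u : m <= 0 -> hs h m (Em g n u) = Em g n (hs h m u).
Proof.
move=> m0; apply: Ex_comm; [exact: gm_is|exact: hs_is|move=> i v].
by rewrite /gm hs_comm ifF ?scale0r ?addr0 //; apply/negP => /eqP; lia.
Qed.

Lemma Ep_hsN g h (k : nat) n u : hs h (- k.+1%:Z) (Ep g n u) =
  Ep g n (hs h (- k.+1%:Z) u) + pairing h g *: Ep g (n - k.+1%:Z) u.
Proof.
apply: Ex_deriv; [exact: gp_is|exact: hs_is|move=> i v].
rewrite /gp (islinN (hs_is _ _ _)) hs_comm opprD -scaleNr; congr (_ + _ *: _).
rewrite (_ : (- k.+1%:Z + i.+1%:Z == 0) = (i == k)); last by apply/eqP/eqP; lia.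
by case: eqP => _; rewrite ?oppr0 // -mulNr -rmorphN opprK.
Qed.

Lemma Ep_hsP g h n m u : 0 <= m -> hs h m (Ep g n u) = Ep g n (hs h m u).
Proof.
move=> m0; apply: Ex_comm; [exact: gp_is|exact: hs_is|move=> i v].
rewrite /gp (islinN (hs_is _ _ _)) hs_comm ifF ?scale0r ?addr0 //.
by apply/negP => /eqP; lia.
Qed.

Lemma Em_Em g h n m u : Em g n (Em h m u) = Em h m (Em g n u).
Proof.
apply: Ex_comm; [exact: gm_is|exact: Em_is|move=> i v].
by rewrite /gm Em_hsN.
Qed.

Lemma hsP_e0 h k i : hs h k.+1%:Z (e0 X i) = 0.
Proof.
apply: (@Sd_neg i (0 - k.+1%:Z)); first by lia.
exact/hs_supp/Sd_e0.
Qed.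

End FockDegree.

Arguments Em : simpl never.
Arguments Ep : simpl never.

(** * Vertex operators and locality *)

Section Exchange.
Variables (K : numFieldType) (M : lmodType K) (g : nat -> M -> M).
Variables (L : int -> M -> M) (s : int).
Hypotheses (gl : forall i, islin (g i)) (Ll : forall m, islin (L m)).
Hypothesis Lg : forall m i v,
  L m (g i.+1 v) = g i.+1 (L m v) - s%:~R *: L (m - i.+1%:Z) v.

(** With $F=(1-x)^s$ this is $xF'=-\frac{sx}{1-x}F$, coefficient by coefficient. *)
Lemma cf_sum j : s%:~R * \sum_(i < j) cf K s i = - (j%:R * cf K s j).
Proof.
elim: j => [|j IH]; first by rewrite big_ord0 mulr0 mul0r oppr0.
rewrite big_ord_recr /= mulrDr IH cfSr rmorphB /=; ring.
Qed.

Lemma sum_shift (A : nat -> M) (n N j : nat) :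
    (forall l, (n.+1 < l)%N -> A l = 0) -> (n.+1 <= N)%N ->
  \sum_(i < n.+1) A (i + j).+1 = \sum_(l < N.+1) (if (j < l)%N then A l else 0).
Proof.
move=> A0 nN; transitivity (\sum_(i < N.+1) A (i + j).+1).
  by symmetry; apply: (@sum_ord_trunc _ (fun i => A (i + j).+1)) => [i ni|];
    [apply: A0; lia|lia].
pose B (l : nat) : M := if (j < l)%N then A l else 0.
transitivity (\sum_(l < j.+1 + N.+1) B l).
  rewrite big_split_ord [X in _ = X + _]big1 => [|i _]; last first.
    by rewrite /B ifF //=; have := ltn_ord i; lia.
  by rewrite add0r; apply: eq_bigr => i _; rewrite /B ifT /= ?addSn 1?addnC //; lia.
apply: (@sum_ord_trunc _ B) => [l ln|]; last by lia.
by rewrite /B; case: ifP => // _; apply: A0; lia.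
Qed.

(** In generating series, moving $L(z)$ past $\exp(\sum g_iw^i/i)$ produces the factor
    $\exp(-s\sum_{i>0}(w/z)^i/i)=(1-w/z)^s$. The induction multiplies by [n] and closes with
    [cf_sum]. *)
Lemma Ex_exch m n u (N : nat) : n <= N%:Z ->
  L m (Ex g n u) = \sum_(j < N.+1) cf K s j *: Ex g (n - j%:Z) (L (m - j%:Z) u).
Proof.
elim/Ex_ind: n m N => [n n0||n IH] m N le.
- rewrite Ex_neg // (islin0 (Ll _)) big1 // => j _.
  by rewrite Ex_neg ?scaler0 //; lia.
- rewrite big_ord_recl big1 => [|j _]; last by rewrite Ex_neg ?scaler0 //= /bump; lia.
  by rewrite cf0 scale1r addr0 !subr0.
pose A (l : nat) : M := Ex g (n.+1%:Z - l%:Z) (L (m - l%:Z) u).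
have A0 l : (n.+1 < l)%N -> A l = 0 by move=> nl; rewrite /A Ex_neg //; lia.
apply: (@scale_inj _ _ n); rewrite -(islinZ (Ll _)) (@ExE _ _ _ gl _ n.+1) // (islin_sum (Ll _)).
under eq_bigr => i _ do rewrite Lg.
rewrite sumrB.
transitivity (\sum_(j < N.+1) cf K s j *: ((n.+1%:Z - j%:Z)%:~R *: A j) +
              \sum_(j < N.+1) (j%:R * cf K s j) *: A j); last first.
  rewrite scaler_sumr -big_split; apply: eq_bigr => j _ /=.
  by rewrite !scalerA -scalerDl; congr (_ *: _); rewrite rmorphB /=; ring.
congr (_ + _).
  under eq_bigr => i _.
    rewrite (IH _ _ m N) //; try by have := ltn_ord i; lia.
    rewrite (islin_sum (gl _)).
    over.
  rewrite exchange_big; apply: eq_bigr => j _.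
  rewrite (@ExE _ _ _ gl _ n.+1); last by lia.
  rewrite scaler_sumr; apply: eq_bigr => i _; rewrite (islinZ (gl _)).
  by have -> : n.+1%:Z - i.+1%:Z - j%:Z = n.+1%:Z - j%:Z - i.+1%:Z by lia.
under eq_bigr => i _.
  rewrite (IH _ _ _ N); try by have := ltn_ord i; lia.
  under eq_bigr => j _.
    rewrite (_ : n.+1%:Z - i.+1%:Z - j%:Z = n.+1%:Z - (i + j).+1%:Z); last by lia.
    rewrite (_ : m - i.+1%:Z - j%:Z = m - (i + j).+1%:Z); last by lia.
    rewrite -/(A (i + j).+1).
    over.
  over.
rewrite -scaler_sumr exchange_big /=.
under eq_bigr => j _ do rewrite -scaler_sumr (sum_shift j A0 le) scaler_sumr.
rewrite exchange_big scaler_sumr -sumrN; apply: eq_bigr => l _.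
rewrite -[RHS]opprK; congr (- _); rewrite -scaleNr -cf_sum -scalerA; congr (_ *: _).
rewrite scaler_suml (eq_bigr (fun j : 'I_N.+1 => if (j < l)%N then cf K s j *: A l else 0)).
  rewrite -big_mkcond (big_ord_widen_cond N.+1 xpredT (fun j => cf K s j *: A l)) //.
  by rewrite ltnW.
by move=> j _; case: ifP => // _; rewrite scaler0.
Qed.

End Exchange.

Section Vop.
Variables (K : numFieldType) (I : choiceType) (w : I -> 'rV[K]_3) (X : fockmod K I).
Implicit Types (u v : X).
Variables (g : 'rV[K]_3) (a : I -> int) (sg : I -> I) (ch : I -> K).
Local Notation im := (imap X sg : X -> X).
Local Notation hs := (hs w).
Local Notation Sd := (@Sd I).

(* [vop n] is the coefficient of [z^(-n-1)] in the vertex operator of [e^g],  *)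
(* followed by the scalars [ch]; [a i] is the power of [z] on the sector [i]. *)
Definition vop (n : int) : X -> X := fext (fun A i =>
  ch i *: \sum_(q < (mdeg A).+1) Em w g (q%:Z - n - 1 - a i) (im (Ep w g q%:Z (kt A i)))).

Lemma vop_is n : islin (vop n). Proof. exact: fext_is. Qed.

Lemma im_supp i D u : supp (Sd i D) u -> supp (Sd (sg i) D) (im u).
Proof.
apply: supp_lin; first exact: imap_is.
by move=> A j [/= -> E]; rewrite imap_kt; apply: suppU.
Qed.

Lemma vopE i D n u (N : nat) : supp (Sd i D) u -> D < N%:Z -> vop n u =
  ch i *: \sum_(q < N) Em w g (q%:Z - n - 1 - a i) (im (Ep w g q%:Z u)).
Proof.
move=> h DN; pose R v : X :=
  ch i *: \sum_(q < N) Em w g (q%:Z - n - 1 - a i) (im (Ep w g q%:Z v)).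
have Rl : islin R.
  apply: islin_scale; apply: islin_bigsum => q.
  apply: (islin_comp (Em_is w g _)); apply: islin_comp; first exact: imap_is.
  exact: Ep_is.
apply: (suppE (P := fun u => vop n u = R u) h).
- by rewrite (islin0 (vop_is n)) (islin0 Rl).
- by move=> c v v' hv hv'; rewrite vop_is Rl hv hv'.
move=> A j [/= -> E]; rewrite /vop fext_kt /R; congr (_ *: _).
symmetry; apply: (@sum_ord_trunc _ (fun q : nat => Em w g (q%:Z - n - 1 - a i) (im (Ep w g q (kt A i))))).
  move=> q lq; rewrite (@Ep_big _ _ _ _ _ _ i (mdeg A)); last exact: Sd_kt.
    by rewrite (islin0 (imap_is _ _)) (islin0 (Em_is w g _)).
  by lia.
by lia.
Qed.

Lemma vop_supp i D n u : supp (Sd i D) u -> supp (Sd (sg i) (D - n - 1 - a i)) (vop n u).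
Proof.
move=> h; rewrite (@vopE i D n u `|D|%N.+1) //; last by lia.
apply: suppZ; apply: supp_sum => q _.
have -> : D - n - 1 - a i = D - q%:Z + (q%:Z - n - 1 - a i) by lia.
by apply: Em_supp; apply: im_supp; apply: Ep_supp.
Qed.

Lemma trunc_supp (f : fld X) : (forall n, islin (f n)) ->
    (forall A i, exists N : int, forall n, N <= n -> f n (kt A i) = 0) -> lfield f.
Proof.
move=> fl h; split=> // u; move: u; apply: fx_lind => //.
- by exists 0 => n _; rewrite (islin0 (fl n)).
- move=> c u v [N hN] [N' hN']; exists (Num.max N N') => n.
  by rewrite ge_max => /andP[/hN e /hN' e']; rewrite fl e e' scaler0 addr0.
Qed.

Lemma lfield_vop : lfield vop.
Proof.
apply: trunc_supp => [n|A i]; first exact: vop_is.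
exists ((mdeg A)%:Z - a i) => n le; apply: (@Sd_neg _ _ X (sg i) ((mdeg A)%:Z - n - 1 - a i)); first by lia.
by apply: vop_supp; apply: Sd_kt.
Qed.

Lemma lfield_hs h : lfield (hs h : fld X).
Proof.
apply: trunc_supp => [n|A i]; first exact: hs_is.
exists (mdeg A).+1%:Z => n le; apply: (@Sd_neg _ _ X i ((mdeg A)%:Z - n)); first by lia.
by apply: hs_supp; apply: Sd_kt.
Qed.

Hypothesis hw : forall i, ch i != 0 -> w (sg i) = w i + g.

(** Positive modes of [h] meet the creating exponential, negative modes the annihilating one, and
    the zero mode sees the change of weight, each time with the factor [pairing h g]. *)
Lemma vop_hs h m n u :
  hs h m (vop n u) = vop n (hs h m u) + pairing h g *: vop (m + n) u.
Proof.
apply: (@fx_eq _ _ _ _ (fun u => hs h m (vop n u))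
  (fun u => vop n (hs h m u) + pairing h g *: vop (m + n) u)).
- by apply: islin_comp; [apply: hs_is|apply: vop_is].
- apply: islin_add; last by apply: islin_scale; apply: vop_is.
  by apply: islin_comp; [apply: vop_is|apply: hs_is].
move=> A i; have hu := @Sd_kt _ _ X A i; move: (kt A i) hu => v hv.
(* The cutoff leaves room for the degree added by a negative mode and for the index shift that it
   causes in the sum over [q]. *)
pose N := (mdeg A + `|m|).+1.
rewrite (@vopE _ _ n v N hv) ?(@vopE _ _ (m + n) v N hv); try by rewrite /N; lia.
rewrite (@vopE _ _ n (hs h m v) N (hs_supp _ _ _ hv)); last by rewrite /N; lia.
rewrite (islinZ (hs_is _ _ _)) scalerA mulrC -scalerA -scalerDr.
have [->|ci] := eqVneq (ch i) 0; first by rewrite !scale0r.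
congr (_ *: _); rewrite (islin_sum (hs_is _ _ _)).
have im0 x y : supp (Sd i y) x -> hs h 0 (im x) = im (hs h 0 x) + pairing h g *: im x.
  move=> hx; apply: (suppE (P := fun x => hs h 0 (im x) = im (hs h 0 x) + pairing h g *: im x) hx).
  - by rewrite !(islin0 (hs_is _ _ _)) (islin0 (imap_is _ _)) (islin0 (hs_is _ _ _)) scaler0 addr0.
  - move=> c x1 x2 e1 e2; rewrite !(hs_is, imap_is) e1 e2 scalerDr.
    by rewrite [in RHS]scalerDr addrACA !scalerA mulrC addrACA.
  - move=> B j [/= -> _]; by apply: imap_hs0; apply: hw.
have [m0|m0|m0] := ltgtP m 0; last first.
- rewrite m0 scaler_sumr -big_split; apply: eq_bigr => q _ /=.
  rewrite Em_hsN // (im0 _ _ (Ep_supp w g q hv)) Ep_hsP // (islinD (Em_is _ _ _)).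
  by rewrite (islinZ (Em_is _ _ _)) add0r.
- have [k ->] : exists k : nat, m = k.+1%:Z by case: (m) m0 => // -[] // k _; exists k.
  rewrite scaler_sumr -big_split; apply: eq_bigr => q _ /=.
  rewrite Em_hsP -(imap_hs _ _ w) // Ep_hsP //.
  by have -> : q%:Z - n - 1 - a i - k.+1%:Z = q%:Z - (k.+1%:Z + n) - 1 - a i by lia.
have [k Em'] : exists k : nat, m = - k.+1%:Z.
  by case: (m) m0 => // k _; exists k; rewrite NegzE.
rewrite /N Em'; have -> : (mdeg A + `|(- k.+1%:Z)%R|).+1 = (k.+1 + (mdeg A).+1)%N by lia.
rewrite scaler_sumr -big_split.
pose F (q : nat) : X := Em w g (q%:Z - n - 1 - a i) (im (Ep w g (q%:Z - k.+1%:Z) v)).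
transitivity (\sum_(q < k.+1 + (mdeg A).+1) (Em w g (q%:Z - n - 1 - a i)
    (im (Ep w g q%:Z (hs h (- k.+1%:Z) v))) + pairing h g *: F q)).
  apply: eq_bigr => q _; rewrite Em_hsN // -(imap_hs _ _ w) //.
  rewrite Ep_hsN (islinD (imap_is _ _)) (islinZ (imap_is _ _)) (islinD (Em_is _ _ _)).
  by rewrite (islinZ (Em_is _ _ _)).
rewrite !big_split; congr (_ + _); rewrite -!scaler_sumr; congr (_ *: _).
rewrite big_split_ord /= big1 ?add0r => [|q _]; last first.
  rewrite /F /Ep Ex_neg ?(islin0 (imap_is _ _)) ?(islin0 (Em_is _ _ _)) //.
  by have := ltn_ord q; lia.
symmetry; transitivity (\sum_(q < (mdeg A).+1) Em w g (q%:Z - (- k.+1%:Z + n) - 1 - a i)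
    (im (Ep w g q%:Z v))).
  apply: (@sum_ord_trunc _ (fun q : nat => Em w g (q%:Z - (- k.+1%:Z + n) - 1 - a i)
    (im (Ep w g q v)))) => [q lq|]; last by lia.
  have -> : Ep w g q v = 0 by apply: (@Ep_big _ _ w X g q i (mdeg A) v) => //; lia.
  by rewrite (islin0 (imap_is _ _)) (islin0 (Em_is _ _ _)).
apply: eq_bigr => q _; rewrite /F.
have -> : (k.+1 + q)%N%:Z - k.+1%:Z = q%:Z by lia.
by have -> : (k.+1 + q)%N%:Z - n = q%:Z - (- k.+1%:Z + n) by lia.
Qed.

End Vop.

Section ModuleExpressions.
Variables (K : numFieldType) (M : lmodType K).

(** Reflection for linear identities: both sides become expressions over a list of atoms, and
    equality of all coefficients implies equality of the values, whether or not the atoms are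
    independent. *)
Inductive mexp := MZero | MAtom of nat | MAdd of mexp & mexp | MOpp of mexp
  | MScale of K & mexp.

Fixpoint mval (env : seq M) e : M := match e with
  | MZero => 0
  | MAtom n => nth 0 env n
  | MAdd a b => mval env a + mval env b
  | MOpp a => - mval env a
  | MScale c a => c *: mval env a
  end.

Fixpoint mcoord e (i : nat) : K := match e with
  | MZero => 0
  | MAtom n => if Nat.eqb n i then 1 else 0
  | MAdd a b => mcoord a i + mcoord b i
  | MOpp a => - mcoord a i
  | MScale c a => c * mcoord a i
  end.

Fixpoint mcoords n e e' : Prop := match n with
  | 0 => True
  | n.+1 => mcoord e n = mcoord e' n /\ mcoords n e e'
  end.

Lemma mval_coord env e : mval env e = \sum_(i < size env) mcoord e i *: nth 0 env i.
Proof.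
elim: e => [|n|a Ea b Eb|a Ea|c a Ea] /=; rewrite ?Ea ?Eb.
- by rewrite big1 // => i _; rewrite scale0r.
- have [lt|le] := ltnP n (size env); last first.
    rewrite nth_default // big1 // => i _.
    case: PeanoNat.Nat.eqb_spec => E; last by rewrite scale0r.
    by have := ltn_ord i; rewrite -E ltnNge le.
  rewrite (bigD1 (Ordinal lt)) //= PeanoNat.Nat.eqb_refl scale1r big1 ?addr0 // => i ne.
  case: PeanoNat.Nat.eqb_spec => E; last by rewrite scale0r.
  by case/eqP: ne; apply: val_inj.
- by rewrite -big_split; apply: eq_bigr => i _; rewrite scalerDl.
- by rewrite -sumrN; apply: eq_bigr => i _; rewrite scaleNr.
- by rewrite scaler_sumr; apply: eq_bigr => i _; rewrite scalerA.
Qed.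

Lemma mval_eq env e e' : mcoords (size env) e e' -> mval env e = mval env e'.
Proof.
rewrite !mval_coord; elim: (size env) => [|n IH]; first by rewrite !big_ord0.
by move=> /= [E /IH h]; rewrite !big_ord_recr /= E h.
Qed.

End ModuleExpressions.

Ltac mod_mem x l := lazymatch l with
  | nil => constr:(false)
  | cons x _ => constr:(true)
  | cons _ ?l' => mod_mem x l'
  end.
Ltac mod_atoms t l := lazymatch t with
  | @GRing.add _ ?a ?b => let l := mod_atoms a l in mod_atoms b l
  | @GRing.opp _ ?a => mod_atoms a l
  | @GRing.scale _ _ _ ?a => mod_atoms a l
  | @GRing.zero _ => l
  | _ => lazymatch mod_mem t l with true => l | false => constr:(cons t l) end
  end.
Ltac mod_idx x l := lazymatch l with
  | cons x _ => constr:(O)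
  | cons _ ?l' => let n := mod_idx x l' in constr:(S n)
  end.
Ltac mod_reify K l t := lazymatch t with
  | @GRing.add _ ?a ?b =>
      let a := mod_reify K l a in let b := mod_reify K l b in constr:(@MAdd K a b)
  | @GRing.opp _ ?a => let a := mod_reify K l a in constr:(@MOpp K a)
  | @GRing.scale _ _ ?c ?a => let a := mod_reify K l a in constr:(@MScale K c a)
  | @GRing.zero _ => constr:(@MZero K)
  | _ => let n := mod_idx t l in constr:(@MAtom K n)
  end.
(* reduces an equation in an [lmodType] to equations between the coefficients *)
Ltac mod_coords K M := lazymatch goal with |- @eq _ ?a ?b =>
  let l := mod_atoms a (@nil (GRing.Lmodule.sort M)) in let l := mod_atoms b l in
  let ea := mod_reify K l a in let eb := mod_reify K l b in
  apply: (@mval_eq K M l ea eb); cbn [mcoords mcoord size Nat.eqb]; repeat split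
  end.
Ltac mod_ring K M := by mod_coords K M; ring.

(** If $[L,g_i]=i\,g_{i+1}$ then $[L,\sum_{i\ge1}g_iz^i/i]=\sum_{i\ge1}g_{i+1}z^i$, which is the
    $z$-derivative of the exponent minus $g_1$. Hence $[L,E]=E'-g_1E$. *)
Lemma Ex_derivation (K : numFieldType) (X : lmodType K) (g : nat -> X -> X) (L : X -> X) n u : (forall i, islin (g i)) -> islin L ->
    (forall i j v, g i (g j v) = g j (g i v)) ->
    (forall i v, L (g i.+1 v) = g i.+1 (L v) + i.+1%:R *: g i.+2 v) ->
  L (Ex g n u) = Ex g n (L u) + (n + 1)%:~R *: Ex g (n + 1) u - g 1%N (Ex g n u).
Proof.
move=> gl Ll gC Lg; elim/Ex_ind: n => [n n0||n IH].
- rewrite (Ex_neg _ _ n0) (islin0 Ll) (Ex_neg _ _ n0) (islin0 (gl 1%N)) add0r subr0.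
  have [->|ne] := eqVneq (n + 1) 0; first by rewrite scale0r.
  by rewrite Ex_neg ?scaler0 //; lia.
- rewrite !Ex0 (@ExE _ _ _ gl _ 1%N) // big_ord1 subrr Ex0.
  by rewrite addrK.
apply: (@scale_inj _ _ n); rewrite -(islinZ Ll) (@ExE _ _ _ gl _ n.+1) // (islin_sum Ll).
pose A (l : nat) : X := Ex g (n.+2%:Z - l%:Z) u.
transitivity (\sum_(i < n.+1) (g i.+1 (Ex g (n.+1%:Z - i.+1%:Z) (L u)) +
    (n.+2%:Z - i.+1%:Z)%:~R *: g i.+1 (A i.+1) - g i.+1 (g 1%N (A i.+2)) + i.+1%:R *: g i.+2 (A i.+2))).
  apply: eq_bigr => i _; rewrite Lg IH; last by lia.
  rewrite (_ : n.+1%:Z - i.+1%:Z + 1 = n.+2%:Z - i.+1%:Z); last by lia.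
  rewrite (_ : n.+1%:Z - i.+1%:Z = n.+2%:Z - i.+2%:Z); last by lia.
  by rewrite (islinB (gl _)) (islinD (gl _)) (islinZ (gl _)).
pose F (l : nat) := (n.+2%:Z - l.+1%:Z)%:~R *: g l.+1 (A l.+1).
pose G (l : nat) := l%:R *: g l.+1 (A l.+1).
transitivity (n.+1%:Z%:~R *: Ex g n.+1 (L u) + \sum_(l < n.+2) (F l + G l) -
    n.+1%:Z%:~R *: g 1%N (Ex g n.+1 u)).
  have -> : \sum_(l < n.+2) (F l + G l) = \sum_(l < n.+1) (F l + G l.+1).
    rewrite !big_split big_ord_recr [\sum_(l < n.+2) G l]big_ord_recl /=.
    by rewrite /F subrr scale0r addr0 /G scale0r add0r.
  rewrite -(islinZ (gl 1%N)) !(@ExE _ _ _ gl _ n.+1) // (islin_sum (gl _)).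
  rewrite -big_split -sumrB; apply: eq_bigr => i _ /=.
  rewrite /F /G gC (_ : n.+1%:Z - i.+1%:Z = n.+2%:Z - i.+2%:Z); last by lia.
  rewrite -/(A i.+2).
  mod_ring K X.
have -> : \sum_(l < n.+2) (F l + G l) = n.+1%:Z%:~R *: (n.+2%:Z%:~R *: Ex g n.+2 u).
  rewrite (@ExE _ _ _ gl _ n.+2) // scaler_sumr; apply: eq_bigr => i _.
  by rewrite /F /G -scalerDl -[i%:R]/((i : nat)%:Z%:~R) -rmorphD; congr (_%:~R *: _); lia.
rewrite (_ : n.+1%:Z + 1 = n.+2%:Z); last by lia.
by rewrite scalerBr scalerDr.
Qed.

(** * The translation operator *)

Section Translation.
Variables (K : numFieldType) (I : choiceType) (w : I -> 'rV[K]_3) (X : fockmod K I).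
Implicit Types (u v : X).
Local Notation hs := (hs w).

Lemma cr_hs i k u : cr (i, k) u = hs (bas K i) (Negz k) u.
Proof.
rewrite hsN (eq_bigr (fun j => if j == i then cr (j, k) u else 0)).
  by rewrite -big_mkcond big_pred1_eq.
by move=> j _; rewrite basE; case: eqP => _; rewrite ?scale1r ?scale0r.
Qed.

Lemma hs_cr h n i k u : hs h n (cr (i, k) u) = cr (i, k) (hs h n u) +
  (if n == k.+1%:Z then n%:~R * pairing h (bas K i) else 0) *: u.
Proof. by rewrite !cr_hs hs_comm NegzE subr_eq0. Qed.

(** The derivation with $h(-n-1)\mapsto(n+1)h(-n-2)$, together with
    $e^\beta\mapsto\beta(-1)e^\beta$. *)
Definition T : X -> X := fext (fun A i =>
  \sum_(x <- enum_mset A) x.2.+1%:R *: kt (ins (x.1, x.2.+1) (del x A)) i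
    + hs (w i) (Negz 0) (kt A i)).

Lemma T_is : islin T. Proof. exact: fext_is. Qed.

Lemma T_cr i k u : T (cr (i, k) u) = cr (i, k) (T u) + k.+1%:R *: cr (i, k.+1) u.
Proof.
apply: (@fx_eq _ _ _ _ (fun u => T (cr (i, k) u))
  (fun u => cr (i, k) (T u) + k.+1%:R *: cr (i, k.+1) u)).
- by apply: islin_comp; [exact: T_is|exact: cr_is].
- apply: islin_add; last by apply: islin_scale; exact: cr_is.
  by apply: islin_comp; [exact: cr_is|exact: T_is].
move=> A j; rewrite !crU /T !fext_kt (perm_big _ (ins_perm _ _)) big_cons /=.
have -> : del (i, k) (ins (i, k) A) = A by apply: modes_eq => y; rewrite delE insE addnK.
rewrite (islinD (cr_is _)) (islin_sum (cr_is _)).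
have -> : hs (w j) (Negz 0) (kt (ins (i, k) A) j : X) = cr (i, k) (hs (w j) (Negz 0) (kt A j)).
  by rewrite -crU hs_cr scale0r addr0.
rewrite [RHS]addrC -!addrA; congr (_ + (_ + _)).
apply: eq_big_seq => x xA; rewrite (islinZ (cr_is _)) crU insC; congr (_ *: kt (ins _ _) j).
have x0 : (0 < A x)%N by rewrite -in_mset.
by apply: modes_eq => y; rewrite !(insE, delE) addnBAC //; case: eqP => // <-.
Qed.

Lemma T_e0 i : T (e0 X i) = hs (w i) (Negz 0) (e0 X i).
Proof. by rewrite /T fext_kt enum_mset0 big_nil add0r. Qed.

Lemma tcov_hs h : tcov T (hs h : fld X).
Proof.
case=> n u; last first.
  rewrite (_ : Negz n - 1 = Negz n.+1); last by lia.
  rewrite !hsN (islin_sum T_is) NegzE.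
  rewrite rmorphN scaleNr opprK scaler_sumr -big_split; apply: eq_bigr => i _ /=.
  by rewrite (islinZ T_is) T_cr scalerDr !scalerA mulrC.
move: n u => n; pose R u := T (hs h n%:Z u) - (hs h n%:Z (T u) - n%:~R *: hs h (n%:Z - 1) u).
suff R0 u : R u = 0 by move=> u; apply/eqP; rewrite -subr_eq0; apply/eqP/R0.
have Rl : islin R.
  apply: islin_sub; first by apply: islin_comp; [exact: T_is|exact: hs_is].
  apply: islin_sub; last by apply: islin_scale; exact: hs_is.
  by apply: islin_comp; [exact: hs_is|exact: T_is].
move: u; apply: fock_ind.
- exact: islin0.
- by move=> c u v; rewrite Rl => -> ->; rewrite scaler0 addr0.
- move=> i; rewrite /R T_e0 hs_comm NegzE subr_eq0.
  case: n {R Rl} => [|[|n]].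
  + rewrite /e0 hs0U (islinZ T_is) -/(e0 X i) T_e0 (islinZ (hs_is _ _ _)).
    by rewrite !scale0r addr0 subr0 subrr.
  + rewrite !hsP_e0 (islin0 T_is) (islin0 (hs_is _ _ _)) eqxx /e0 hs0U; mod_ring K X.
  + rewrite (_ : n.+2%:Z - 1 = n.+1%:Z); last by lia.
    by rewrite !hsP_e0 (islin0 T_is) (islin0 (hs_is _ _ _)) /= scale0r scaler0 addr0 !subr0.
move=> [i k] u R0; suff -> : R (cr (i, k) u) = cr (i, k) (R u) by rewrite R0 (islin0 (cr_is _)).
rewrite /R T_cr (islinD (hs_is _ _ _)) (islinZ (hs_is _ _ _)) !hs_cr (islinD T_is) T_cr.
rewrite (islinZ T_is) !(islinB (cr_is _)) (islinZ (cr_is _)).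
set p := pairing h _.
case: ifP => [/eqP ->|ne].
  rewrite ifF; last by apply/negP => /eqP; lia.
  rewrite (_ : (k.+1%:Z - 1 == k.+1%:Z) = false); last by apply/negP => /eqP; lia.
  mod_ring K X.
rewrite (_ : (n%:Z - 1 == k.+1%:Z) = (n%:Z == k.+2%:Z)); last by apply/eqP/eqP; lia.
case: ifP => [/eqP ->|_]; last by mod_ring K X.
rewrite (_ : k.+2%:Z - 1 = k.+1%:Z); last by lia.
mod_ring K X.
Qed.

End Translation.

Section VertexOperators.
Variables (K : numFieldType) (I : choiceType) (w : I -> 'rV[K]_3) (X : fockmod K I).
Implicit Types (u v : X).
Local Notation hs := (hs w).
Local Notation T := (@T K I w X).

Lemma T_Em g (p q : int) i : q = p + 1 -> T (Em w g p (e0 X i)) = Em w g p (hs (w i) (Negz 0) (e0 X i)) +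
  q%:~R *: Em w g q (e0 X i) - hs g (Negz 0) (Em w g p (e0 X i)).
Proof.
move=> ->; rewrite /Em Ex_derivation; first by rewrite T_e0.
- exact: gm_is.
- exact: T_is.
- by move=> n m v; rewrite /gm hs_comm; case: eqP => E; rewrite ?scale0r ?addr0 //;
  rewrite (_ : (- n%:Z)%:~R = 0 :> K) ?mul0r ?scale0r ?addr0 //; rewrite (_ : n = 0)%N //; lia.
move=> n v; rewrite /gm tcov_hs rmorphN scaleNr opprK.
by rewrite (_ : - n.+1%:Z - 1 = - n.+2%:Z); last by lia.
Qed.

Section One.
Variables (g : 'rV[K]_3) (a : I -> int) (sg : I -> I) (ch : I -> K).
Hypothesis hw : forall i, ch i != 0 -> w (sg i) = w i + g.
Local Notation vop := (vop w g a sg ch : int -> X -> X).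

Lemma vop_cr n i k u : vop n (cr (i, k) u) =
  cr (i, k) (vop n u) - pairing (bas K i) g *: vop (n - k.+1%:Z) u.
Proof.
rewrite !(cr_hs w) (vop_hs _ hw) (_ : Negz k + n = n - k.+1%:Z) ?addrK //.
by rewrite NegzE addrC.
Qed.

Lemma vop_e0 n i : vop n (e0 X i) = ch i *: Em w g (- n - 1 - a i) (e0 X (sg i)).
Proof.
rewrite (@vopE _ _ _ _ _ _ _ _ i 0 n _ 1) //; last exact: Sd_e0.
by rewrite big_ord1 /Ep Ex0 add0r /e0 imap_kt.
Qed.

Hypothesis ha : forall i, ch i != 0 -> pairing g (w i) = (a i)%:~R.

(** On a top vector [T_Em] yields the factor $-n-a_i$, and $a_i$ has to cancel against the pairing
    of [g] with the weight: this is where [ha] enters. Creation operators propagate the identity. *)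
Lemma tcov_vop : tcov T (vop : fld X).
Proof.
move=> n u; pose R n u := T (vop n u) - (vop n (T u) - n%:~R *: vop (n - 1) u).
suff R0 m v : R m v = 0 by apply/eqP; rewrite -subr_eq0; apply/eqP/R0.
have Rl m0 : islin (R m0).
  apply: islin_sub; first by apply: islin_comp; [exact: T_is|exact: vop_is].
  apply: islin_sub; last by apply: islin_scale; exact: vop_is.
  by apply: islin_comp; [exact: vop_is|exact: T_is].
move: v m; apply: fock_ind.
- by move=> m; apply: islin0.
- by move=> c u1 u2 h1 h2 m; rewrite Rl h1 h2 scaler0 addr0.
- move=> i m; rewrite /R T_e0 -[vop m (hs _ _ _)](addrK (pairing (w i) g *: vop (Negz 0 + m) (e0 X i))).
  rewrite -(vop_hs _ hw) !vop_e0 (islinZ (@T_is K I w X)).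
  rewrite (@T_Em _ _ (- m - a i)) ?(islinZ (hs_is _ _ _)); last by lia.
  have [->|ci] := eqVneq (ch i) 0; first by mod_ring K X.
  rewrite (hw ci) Em_hsN //.
  rewrite (_ : - (Negz 0 + m) - 1 - a i = - m - a i); last by lia.
  rewrite (_ : - (m - 1) - 1 - a i = - m - a i); last by lia.
  rewrite pairingC (ha ci).
  rewrite (_ : hs (w i + g) (Negz 0) (e0 X (sg i)) = hs (w i) (Negz 0) (e0 X (sg i)) + hs g (Negz 0) (e0 X (sg i))).
    rewrite (islinD (Em_is _ _ _)) !Em_hsN //.
    by mod_coords K X; rewrite ?rmorphD ?rmorphN /=; ring.
  by rewrite !hsN -big_split; apply: eq_bigr => l _ /=; rewrite mxE scalerDl.
move=> [i k] v IH m.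
suff -> : R m (cr (i, k) v) = cr (i, k) (R m v) - pairing (bas K i) g *: R (m - k.+1%:Z) v.
  by rewrite !IH (islin0 (cr_is _)) scaler0 subr0.
rewrite /R T_cr (islinD (vop_is _ _ _ _ _ _)) (islinZ (vop_is _ _ _ _ _ _)) !vop_cr.
rewrite (islinB (@T_is K I w X)) (islinZ (@T_is K I w X)) T_cr !(islinB (cr_is _)) (islinZ (cr_is _)).
rewrite (_ : m - k.+2%:Z = m - k.+1%:Z - 1); last by lia.
rewrite (_ : m - 1 - k.+1%:Z = m - k.+1%:Z - 1); last by lia.
mod_coords K X; rewrite ?rmorphB /=; ring.
Qed.

Lemma local_hs_vop h : local 1 (hs h : fld X) vop.
Proof.
exists 1%N => p q u; rewrite D_nat /=; [|exact: lfield_hs|exact: lfield_vop].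
rewrite /dz !(vop_hs _ hw) !scale1r (_ : p + (q + 1) = p + 1 + q); last by lia.
mod_ring K X.
Qed.

End One.

Lemma local_hs h g : local 1 (hs h : fld X) (hs g).
Proof.
exists 2%N => p q u; rewrite D_nat /=; [|exact: lfield_hs|exact: lfield_hs].
have C m n v : hs h m (hs g n v) - 1 *: hs g n (hs h m v) =
    (if m + n == 0 then m%:~R * pairing h g else 0) *: v.
  by rewrite hs_comm scale1r addrAC subrr add0r.
rewrite /dz !C (_ : p + 1 + (q + 1) = p + 1 + 1 + q); last by lia.
rewrite (_ : p + (q + 1 + 1) = p + 1 + 1 + q); last by lia.
case: ifP => _; mod_coords K X; rewrite ?rmorphD /=; ring.
Qed.

Lemma iter_dz (f : X -> X) (k1 k2 : K) (c : int) (n : nat) (F G : int -> int -> X) : islin f ->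
    (forall p q, F p q = f (G p q) - k1 *: G (p - c) q - k2 *: G p (q - c)) ->
  forall p q, iter n (@dz _ _) F p q = f (iter n (@dz _ _) G p q)
    - k1 *: iter n (@dz _ _) G (p - c) q - k2 *: iter n (@dz _ _) G p (q - c).
Proof.
move=> fl; elim: n F G => [|n IH] F G h p q; first exact: h.
rewrite !iterSr; apply: IH => {}p {}q; rewrite /dz !h (islinB fl).
rewrite (_ : p + 1 - c = p - c + 1); last by lia.
rewrite (_ : q + 1 - c = q - c + 1); last by lia.
mod_ring K X.
Qed.

Section Two.
Variables (g1 g2 : 'rV[K]_3) (a1 a2 : I -> int) (s1 s2 : I -> I) (c1 c2 : I -> K).
Variables (s : int) (e : K).
Hypothesis hw1 : forall i, c1 i != 0 -> w (s1 i) = w i + g1.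
Hypothesis hw2 : forall i, c2 i != 0 -> w (s2 i) = w i + g2.
Hypothesis gs : pairing g1 g2 = s%:~R.
Hypothesis cc : forall i, c2 i * c1 (s2 i) = e * (-1) ^ s * (c1 i * c2 (s1 i)).
Hypothesis cs : forall i, c2 i * c1 (s2 i) != 0 ->
  [/\ s1 (s2 i) = s2 (s1 i), a1 (s2 i) = a1 i + s & a2 (s1 i) = a2 i + s].
Hypothesis e2 : e * e = 1.
Local Notation v1 := (vop w g1 a1 s1 c1 : int -> X -> X).
Local Notation v2 := (vop w g2 a2 s2 c2 : int -> X -> X).

Let N' (h1 h2 : 'rV[K]_3) (b1 b2 : int) t (m n : int) : X :=
  Em w h2 (- n - 1 - b2) (Em w h1 (- m - 1 - b1) (e0 X t)).

Let rN h1 h2 b1 b2 t : rt (N' h1 h2 b1 b2 t).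
Proof. by exists (- b2) => m n le; rewrite /N' /Em Ex_neg //; lia. Qed.

(** On a top vector both annihilating halves are trivial; exchanging the first operator with the
    creating half of the second gives $(z-w)^s$ times the normally ordered [N']. *)
Let vv (h1 h2 : 'rV[K]_3) b1 b2 r1 r2 d1 d2 p q i : pairing h1 h2 = s%:~R ->
    (forall i, d1 i != 0 -> w (r1 i) = w i + h1) ->
    (d2 i * d1 (r2 i) != 0 -> b1 (r2 i) = b1 i + s) ->
  vop w h1 b1 r1 d1 p (vop w h2 b2 r2 d2 q (e0 X i)) =
  (d2 i * d1 (r2 i)) *: ex (N' h1 h2 (b1 i) (b2 i) (r1 (r2 i))) s p q.
Proof.
move=> hs12 hh hb; rewrite vop_e0 (islinZ (vop_is _ _ _ _ _ _)).
pose L := vop w h1 b1 r1 d1 : int -> X -> X.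
rewrite -[vop w h1 _ _ _ _ _]/(L p _) /Em.
have Lg m k v : L m (gm w h2 k.+1 v) = gm w h2 k.+1 (L m v) - s%:~R *: L (m - k.+1%:Z) v.
  by rewrite /gm /L (vop_hs _ hh) pairingC hs12 (addrC (- _) m) addrK.
rewrite /L (@Ex_exch _ _ _ _ _ (gm_is w h2) (vop_is w h1 b1 r1 d1) Lg _ _ _ (absz (- q - 1 - b2 i)%R)); last by lia.
rewrite (@exE _ _ _ _ _ _ (absz (- q - 1 - b2 i)%R).+1); last first.
  by move=> j le; rewrite /N' /Em Ex_neg //; lia.
rewrite !scaler_sumr; apply: eq_bigr => j _.
rewrite /L vop_e0 (islinZ (Ex_lin (gm_is _ _) _)) !scalerA.
have [E|ne] := eqVneq (d2 i * d1 (r2 i)) 0.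
  by rewrite mulrAC E !mul0r !scale0r.
rewrite hb // /N' /Em.
rewrite (_ : - (q + j%:Z) - 1 - b2 i = - q - 1 - b2 i - j%:Z); last by lia.
rewrite (_ : - (p + s - j%:Z) - 1 - b1 i = - (p - j%:Z) - 1 - (b1 i + s)); last by lia.
by rewrite mulrAC.
Qed.

Lemma local_vop : local e (v1 : fld X) v2.
Proof.
exists `|s|%N => p q u.
have l1 := lfield_vop w X g1 a1 s1 c1; have l2 := lfield_vop w X g2 a2 s2 c2.
move: u p q; apply: fock_ind.
- by move=> p q; rewrite (islin0 (D_lin _ _ _ _ l1 l2)).
- by move=> c u v hu hv p q; rewrite (D_lin _ _ _ _ l1 l2) hu hv scaler0 addr0.
- move=> i p q; rewrite /D.
  rewrite (@ex_ext _ _ (prodf v1 v2 _) (fun m n => (c2 i * c1 (s2 i)) *: ex (N' g1 g2 (a1 i) (a2 i) (s1 (s2 i))) s m n)); last first.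
    by move=> m n; apply: vv => // /cs[].
  rewrite (@ex_ext _ _ (prodf v2 v1 _) (fun m n => (c1 i * c2 (s1 i)) *: ex (N' g2 g1 (a2 i) (a1 i) (s2 (s1 i))) s m n)); last first.
    move=> m n; apply: vv => //; first by rewrite pairingC.
    move=> ne; case: (@cs i); last by [].
    rewrite cc mulf_neq0 // mulf_neq0 ?expfz_neq0 ?oppr_eq0 ?oner_eq0 //.
    by apply/eqP => ez; move: e2; rewrite ez mul0r => /eqP; rewrite eq_sym oner_eq0.
  have exZ c G n m k : rt G -> ex (fun p q => c *: G p q) n m k = c *: ex G n m k :> X.
    move=> rG; rewrite (@ex_ext _ _ _ (fun p q => c *: G p q + (fun _ _ => 0) p q)).
      rewrite exP //; last by exists 0.
      by rewrite [X in _ + X]ex_eq0 // addr0.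
    by move=> m' k'; rewrite addr0.
  rewrite !exZ; try exact/rt_ex/rN.
  rewrite !ex_comp; try exact: rN.
  (* The two orders are $(z-w)^s$ and $(w-z)^s$ times the same series. After a further factor
     $(z-w)^{|s|}$ the exponent is a natural number, the two expansions agree, and only the sign
     condition [cc] is left to compare. *)
  have [M EM] : exists M : nat, s + `|s|%N%:Z = M%:Z by exists (absz (s + `|s|%N%:Z)%R); lia.
  rewrite EM !exN; try exact: rN.
  have [E|ne] := eqVneq (c2 i * c1 (s2 i)) 0.
    move: (cc i); rewrite E => /esym/eqP; rewrite mulf_eq0 => /orP[|/eqP ->]; last first.
      by rewrite !scale0r scaler0 subr0.
    rewrite mulf_eq0 => /orP[/eqP -> |]; first by rewrite mulr0 !scale0r subr0.
    by rewrite (negPf (expfz_neq0 _ _)) // oppr_eq0 oner_eq0.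
  have [Es _ _] := cs ne; rewrite -Es.
  have sw M' m n t : iter M' (@dz _ _) (N' g2 g1 (a2 i) (a1 i) t) m n =
      (-1) ^+ M' *: iter M' (@dz _ _) (N' g1 g2 (a1 i) (a2 i) t) n m.
    elim: M' m n => [|M' IH] m n; first by rewrite scale1r /= /N' Em_Em.
    by rewrite /= /dz !IH exprS -scalerA scaleN1r -scalerBr -scalerN opprB.
  rewrite sw !scalerA cc -scalerBl (_ : _ - _ = 0) ?scale0r //.
  have -> : (-1) ^+ M = (-1) ^ s * (-1) ^ `|s|%N%:Z :> K.
    by rewrite -[(-1) ^+ M]/((-1) ^ M%:Z) -EM expfzDr ?oppr_eq0 ?oner_eq0.
  move: e ((-1) ^ s) (c1 i * c2 (s1 i)) => e' x y.
  have : (-1) ^ `|s|%N%:Z * (-1) ^ `|s|%N%:Z = 1 :> K.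
    by rewrite -[_ ^ _]/((-1) ^+ `|s|%N) -exprMn mulrNN mulr1 expr1n.
  move: (_ ^ `|s|%N%:Z) => z zz.
  rewrite (_ : z * e' * y * (x * z) = z * z * (e' * x * y)); last by ring.
  by rewrite zz mul1r subrr.
(* A creation operator changes both orders of the product by the same index shifts, so the
   difference inherits the vanishing. *)
move=> [i k] u IH p q.
have ID m n : iter `|s| (@dz _ _) (fun p q => v1 p (v2 q u) - e *: v2 q (v1 p u)) m n = 0 :> X.
  by rewrite -D_nat.
rewrite D_nat // (@iter_dz (cr (i, k)) (pairing (bas K i) g1)
    (pairing (bas K i) g2) k.+1%:Z _ _ (fun p q => v1 p (v2 q u) - e *: v2 q (v1 p u))).
- by rewrite !ID (islin0 (cr_is _)) !scaler0 !subr0.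
- exact: cr_is.
move=> m n; rewrite !vop_cr // !(islinB (vop_is _ _ _ _ _ _)) !(islinZ (vop_is _ _ _ _ _ _)).
rewrite !vop_cr // (islinB (cr_is _)) (islinZ (cr_is _)).
mod_ring K X.
Qed.

End Two.
End VertexOperators.

(** * The sectors and their vertex superalgebra *)

Section Labels.
Variables (K : numFieldType) (I : choiceType) (X : fockmod K I).
Variables (J : eqType) (lab : modes * I -> J).

Definition lgr (j : J) : set X := supp [set b | lab b = j].
Definition lproj (j : J) : X -> X := proj [set b | lab b = j].

Lemma lproj_lgr j u : lgr j (lproj j u).
Proof. by apply: supp_sub (proj_supp _ (suppT u)) => b []. Qed.

Lemma lproj_id j u : lgr j u -> lproj j u = u.
Proof. exact: proj_id. Qed.

Lemma lproj_ne j j' u : j != j' -> lgr j' u -> lproj j u = 0.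
Proof. by move=> ne; apply: proj_eq0 => b /= -> E; move: ne; rewrite E eqxx. Qed.

Lemma lproj_sum u : exists s, uniq s /\ u = \sum_(j <- s) lproj j u.
Proof.
suff [s h] : exists s : seq J, forall s', uniq s' -> {subset s <= s'} -> u = \sum_(j <- s') lproj j u.
  exists (undup s); split; first exact: undup_uniq.
  by apply: h; [exact: undup_uniq|move=> x; rewrite mem_undup].
move: u; apply: fx_lind.
- by exists [::] => s' _ _; rewrite big1 // => j _; rewrite /lproj (islin0 (proj_is _)).
- move=> c u v [s hs] [s' hs']; exists (s ++ s') => t ut st.
  rewrite {1}[u](hs t) // => [|x xs]; last by apply: st; rewrite mem_cat xs.
  rewrite {1}[v](hs' t) // => [|x xs]; last by apply: st; rewrite mem_cat xs orbT.
  rewrite scaler_sumr -big_split; apply: eq_bigr => j _.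
  by rewrite /lproj proj_is.
move=> A i; exists [:: lab (A, i)] => s us ss.
have li : lab (A, i) \in s by apply: ss; rewrite inE.
have hk : lgr (lab (A, i)) (kt A i) by apply: suppU.
rewrite (bigD1_seq _ li us) /= lproj_id // big1 ?addr0 // => j ne.
exact: lproj_ne hk.
Qed.

Lemma lgr_hom (S : set X) : (forall j u, S u -> S (lproj j u)) -> homogeneous lgr S.
Proof.
move=> h u Su; have [s [_ E]] := lproj_sum u; exists s, (fun j => lproj j u).
by split=> // j; split; [exact: lproj_lgr|exact: h].
Qed.

Lemma lgr_grading : grading lgr.
Proof.
split=> [j||s v us hv s0 i si]; first exact: supp_subspace.
  exact: lgr_hom.
have := congr1 (lproj i) s0; rewrite {1}/lproj (islin_sum (proj_is _)) (bigD1_seq i) //=.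
rewrite [X in X + _](lproj_id (hv i)) big1 ?addr0 => [->|j ne]; first exact: islin0 (proj_is _).
by apply: (lproj_ne _ (hv j)); rewrite eq_sym.
Qed.

End Labels.

(** [None] is the vacuum sector and [Some b] the two twisted ones; [(n, m)] stands for
    $n(\alpha+\frac c2)+mc$. For instance $-\alpha+\frac c2$ is [(-1, 1)] and $2\alpha-c$ is
    [(2, -2)]. *)
Definition sector : choiceType := (option bool * (int * int))%type.

Definition iodd (n : int) : bool := odd `|n|%N.

Lemma ioddD m n : iodd (m + n) = iodd m (+) iodd n.
Proof. rewrite /iodd; lia. Qed.

Lemma sgn_iodd (K : numFieldType) m n :
  sgn K (iodd m && iodd n) * (-1) ^ (m * n) = 1.
Proof.
have E (z : int) : (-1) ^ z = (-1) ^+ odd `|z|%N :> K.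
  rewrite (signr_odd K `|z|%N); case: z => n' //.
  by rewrite NegzE -exprz_inv invrN1.
by rewrite E abszM oddM /sgn -/(iodd m) -/(iodd n) -expr2 -exprM mulnC exprM sqrrN expr1n expr1n.
Qed.

Section Sectors.
Variables (K : numFieldType) (r : K).
Local Notation al := (wal K).
Local Notation cc := (wc K).
Local Notation dd := (wd K).

Definition lev : K := - (3 / 2).
Definition lat (x : int * int) : 'rV[K]_3 :=
  x.1%:~R *: al + (x.1%:~R / 2 + x.2%:~R) *: cc.
Definition sbase (s : option bool) : 'rV[K]_3 := match s with
  | None => 0
  | Some b => 2^-1 *: al - wmu lev - ((if b then r + 1 / 2 else r) + 1 / 4) *: cc
  end.
Definition swt (i : sector) : 'rV[K]_3 := sbase i.1 + lat i.2.

Lemma pairing_alal : pairing al al = 1.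
Proof. by rewrite /pairing /wal !basE !inord3_eq //=; ring. Qed.
Lemma pairing_alc : pairing al cc = 0.
Proof. by rewrite /pairing /wal /wc !basE !inord3_eq //=; ring. Qed.
Lemma pairing_ald : pairing al dd = 0.
Proof. by rewrite /pairing /wal /wd !basE !inord3_eq //=; ring. Qed.
Lemma pairing_cc : pairing cc cc = 0.
Proof. by rewrite /pairing /wc !basE !inord3_eq //=; ring. Qed.
Lemma pairing_cd : pairing cc dd = 2.
Proof. by rewrite /pairing /wc /wd !basE !inord3_eq //=; ring. Qed.
Lemma pairing_dd : pairing dd dd = 0.
Proof. by rewrite /pairing /wd !basE !inord3_eq //=; ring. Qed.

Lemma pairing0r (u : 'rV[K]_3) : pairing u 0 = 0.
Proof. by rewrite pairingC pairing0l. Qed.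

Definition pairE := (@pairingDl K, @pairingDr K, @pairingZl K, @pairingZr K, @pairingNl K, @pairingNr K,
  pairing_alal, pairing_alc, pairing_ald, pairing_cc, pairing_cd, pairing_dd,
  (pairingC cc al), (pairingC dd al), (pairingC dd cc), @pairing0l K, pairing0r).

Lemma lat_lat x y : pairing (lat x) (lat y) = (x.1 * y.1)%:~R.
Proof. by rewrite /lat !pairE rmorphM /=; ring. Qed.

(** Integrality is what makes the twisted sectors untwisted modules: $\alpha/2$ contributes $x_1/2$
    and $-d/2$ contributes $-(x_1/2+x_2)$. *)
Lemma lat_sbase x s : pairing (lat x) (sbase s) = - (if s is None then 0 else x.2)%:~R.
Proof.
case: s => [b|]; last by rewrite pairingC pairing0l oppr0.
by rewrite /lat /sbase /wmu !pairE; field.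
Qed.

Lemma latD x y : lat (x.1 + y.1, x.2 + y.2) = lat x + lat y.
Proof. by apply/rowP => i; rewrite /lat !mxE /= !rmorphD /=; field. Qed.

Variable X : fockmod K sector.
Local Notation hs := (@hs K sector swt X).

Definition gexp (x : int * int) (i : sector) : int :=
  x.1 * i.2.1 - (if i.1 is None then 0 else x.2).
Definition gsh (x : int * int) (i : sector) : sector :=
  (i.1, (i.2.1 + x.1, i.2.2 + x.2)).

Definition Gam x : fld X := vop swt (lat x) (gexp x) (gsh x) (fun _ => 1).

Lemma Gam_hw x i : (1 : K) != 0 -> swt (gsh x i) = swt i + lat x.
Proof. by move=> _; rewrite /swt /= latD addrA. Qed.

Lemma Gam_ha x i : (1 : K) != 0 -> pairing (lat x) (swt i) = (gexp x i)%:~R.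
Proof.
move=> _; rewrite /swt pairingDr lat_lat lat_sbase /gexp addrC.
by rewrite rmorphB.
Qed.

(* the twist operators intertwine the vacuum sector with the other sectors *)
Definition Tw (b : bool) : fld X := vop swt (sbase (Some b)) (fun i => - i.2.2)
  (fun i => (Some b, i.2)) (fun i => if i.1 is None then (-1) ^ i.2.2 else 0).

Lemma Tw_hw b (i : sector) : (if i.1 is None then (-1) ^ i.2.2 else 0 : K) != 0 ->
  swt (Some b, i.2) = swt i + sbase (Some b).
Proof. by case: i => -[?|] x /=; rewrite ?eqxx // => _; rewrite /swt add0r addrC. Qed.

Definition sbf (b : 'I_3 + int * int) : fld X := match b with
  | inl i => hs (bas K i)
  | inr x => Gam x
  end.
Definition sbp (b : 'I_3 + int * int) : bool := if b is inr x then iodd x.1 else false.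
Definition svac : X := e0 X (None, (0, 0)).
Local Notation T := (@T K sector swt X).

Lemma Gam_fld x : lfield (Gam x). Proof. exact: lfield_vop. Qed.
Lemma sbf_fld b : lfield (sbf b).
Proof. case: b => [i|x]; [exact: lfield_hs|exact: Gam_fld]. Qed.

Lemma sbf_tcov b : tcov T (sbf b).
Proof.
case: b => [i|x]; first exact: tcov_hs.
by apply: tcov_vop => i; [exact: Gam_hw|exact: Gam_ha].
Qed.

Lemma Gam_e0 x n i : Gam x n (e0 X i) = Em swt (lat x) (- n - 1 - gexp x i) (e0 X (gsh x i)).
Proof. by rewrite /Gam vop_e0 scale1r. Qed.

Lemma sbf_vac b : creative svac (sbf b).
Proof.
case: b => [i|x] n n0 /=; last first.
  by rewrite /svac Gam_e0 /Em Ex_neg // /gexp /=; lia.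
case: n n0 => [[|n]|] // _; last exact: hsP_e0.
by rewrite /svac /e0 hs0U /swt /lat /= !scale0r mul0r !add0r scale0r pairingC pairing0l scale0r.
Qed.

Lemma local_Gam x y : local (sgn K (iodd x.1 && iodd y.1)) (Gam x) (Gam y).
Proof.
apply: (@local_vop _ _ _ _ _ _ _ _ _ _ _ _ (x.1 * y.1)).
- by move=> i; apply: Gam_hw.
- by move=> i; apply: Gam_hw.
- exact: lat_lat.
- by move=> _; rewrite sgn_iodd !mul1r.
- move=> i _; rewrite /gsh /gexp /=; split; last first.
  + lia.
  + lia.
  by congr (_, (_, _)); lia.
- exact: sgn_sqr.
Qed.

Lemma sbf_local b b' : local (sgn K (sbp b && sbp b')) (sbf b) (sbf b').
Proof.
case: b b' => [i|x] [i'|x'] /=; [exact: local_hs| | |exact: local_Gam].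
  by apply: local_hs_vop => j; exact: Gam_hw.
rewrite andbF; apply: local_sym; first by rewrite /sgn mulr1.
by apply: local_hs_vop => j; exact: Gam_hw.
Qed.

Lemma Tw_fld b : lfield (Tw b). Proof. exact: lfield_vop. Qed.

(** The scalar $(-1)^m$ in [Tw] compensates the sign $(-1)^{x_2}$ that the pairing $-x_2$ produces
    when the two vertex operators are exchanged, so that odd fields commute with the twists as
    well. *)
Lemma sbf_Tw b b' : local 1 (sbf b) (Tw b').
Proof.
case: b => [i|x] /=.
  by apply: local_hs_vop => j; exact: Tw_hw.
apply: (@local_vop _ _ _ _ _ _ _ _ _ _ _ _ (- x.2)).
- by move=> i; apply: Gam_hw.
- by move=> i; apply: Tw_hw.
- by rewrite lat_sbase rmorphN.
- case=> -[?|] [n m] /=; first by rewrite mul0r !mulr0.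
  by rewrite mulr1 mul1r mul1r -expfzDr ?oppr_eq0 ?oner_eq0 // addrC addrK.
- case=> -[?|] [n m] /=; first by rewrite mul0r eqxx.
  by move=> _; rewrite /gsh /gexp /=; split=> //; lia.
- by rewrite mulr1.
Qed.

Lemma Gam_top x i : Gam x (- gexp x i - 1) (e0 X i) = e0 X (gsh x i).
Proof.
rewrite Gam_e0 (_ : _ - _ = 0) ?/Em ?Ex0 //; lia.
Qed.

(** Twist operators reach the other sectors from the vacuum, the [Gam] move between all lattice
    points of a sector, and Heisenberg modes create the rest. *)
Lemma sector_gen (S : set X) : subspace S -> S svac ->
  (forall b n u, S u -> S (sbf b n u)) -> (forall b n u, S u -> S (Tw b n u)) ->
  forall u, S u.
Proof.
move=> [S0 SL] Sv Sb St; apply: fock_ind => //; last first.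
  by move=> [i k] u Su; rewrite (cr_hs swt); apply: (Sb (inl i)).
have G s x y : S (e0 X (s, x)) -> S (e0 X (s, y)).
  move=> /(Sb (inr (y.1 - x.1, y.2 - x.2)) (- gexp (y.1 - x.1, y.2 - x.2) (s, x) - 1)) /=.
  rewrite Gam_top /gsh /=; case: y => a b /=.
  by rewrite (addrC x.1) (addrC x.2) !subrK.
case=> -[b|] x; last by apply: G Sv.
apply: (G _ (0, 0)); have := St b (-1) _ Sv.
by rewrite /Tw vop_e0 /= scale1r oppr0 subr0 addNr /Em Ex0.
Qed.

End Sectors.

Section FsumLin.
Variables (K : numFieldType) (M M' : lmodType K).

Lemma fsum_lin (f : M -> M') (F : nat -> M) (J : nat) : islin f ->
    (forall j, (J <= j)%N -> F j = 0) ->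
  f (\sum_(j \in [set: nat]) F j) = \sum_(j \in [set: nat]) f (F j).
Proof.
move=> fl F0; rewrite (fsumE F0) (islin_sum fl); symmetry; apply: fsumE => j /F0 ->.
exact: islin0.
Qed.

Lemma subspaceD (S : set M) u v : subspace S -> S u -> S v -> S (u + v).
Proof. by move=> [_ h] su sv; rewrite -[u]scale1r; apply: h. Qed.

Lemma subspaceZ (S : set M) c u : subspace S -> S u -> S (c *: u).
Proof. by move=> [h0 h] su; rewrite -[_ *: _]addr0; apply: h. Qed.

Lemma subspaceB (S : set M) u v : subspace S -> S u -> S v -> S (u - v).
Proof. by move=> [_ h] su sv; rewrite addrC -scaleN1r; apply: h. Qed.

Lemma subspace_sum (S : set M) I (s : seq I) (Q : pred I) (F : I -> M) : subspace S ->
  (forall i, Q i -> S (F i)) -> S (\sum_(i <- s | Q i) F i).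
Proof.
move=> Ss h; apply: (big_ind S) => //; first by case: Ss.
by move=> u v; apply: subspaceD.
Qed.

Lemma ex_closed (S : set M) G n p q : subspace S -> rt G ->
  (forall p' q', p' + q' = n + p + q -> S (G p' q')) -> S (ex G n p q).
Proof.
move=> Ss rG h; have [J G0] := rt_bound rG q.
rewrite (@exE _ _ _ _ _ _ J) => [|j le]; last exact: G0.
by apply: subspace_sum => // j _; apply: subspaceZ => //; apply: h; lia.
Qed.

Lemma D_closed (S : set M) s a b n p q u : subspace S -> lfield a -> lfield b ->
    (forall p' q', p' + q' = n + p + q -> S (a p' (b q' u))) ->
    (forall p' q', p' + q' = n + p + q -> S (b q' (a p' u))) -> S (D s a b n p q u).
Proof.
move=> Ss fa fb hab hba; apply: subspaceB => //.
  by apply: ex_closed => //; apply: rt_prodf.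
apply: subspaceZ => //; apply: ex_closed => //; first exact: rt_prodf.
by move=> p' q' E; apply: hba; lia.
Qed.

End FsumLin.

(** * The state-field correspondence on all sectors *)

Section StateField.
Variables (K : numFieldType) (r : K) (X : fockmod K sector).
Local Notation hs := (@hs K sector (swt r) X).
Local Notation T := (@T K sector (swt r) X).
Local Notation vac := (svac X).
Local Notation Gam := (@Gam K r X).
Local Notation sbf := (@sbf K r X).
Local Notation Tw := (@Tw K r X).
Local Notation gd := (good T vac sbf sbp Tw).
Implicit Types (p q : bool).

Lemma svac_T : T vac = 0.
Proof.
rewrite /svac T_e0 hsN big1 // => i _.
by rewrite /swt /lat /= !mul0r addr0 !scale0r !addr0 mxE scale0r.
Qed.

Lemma gd_inj p (a b : fld X) : gd p a -> gd p b -> a (-1) vac = b (-1) vac -> a = b.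
Proof.
move=> ga gb E; apply: functional_extensionality_dep => n.
apply: functional_extensionality_dep => u; move: n u.
apply: (good_inj (T_is (swt r) (X := X)) svac_T (@sbf_fld K r X) (@Tw_fld K r X) _ ga gb E).
exact: sector_gen.
Qed.

Lemma gd_lin k p a b : gd p a -> gd p b -> gd p (lcomb k a b).
Proof. apply: good_lin; by [exact: T_is|exact: svac_T|exact: sbf_fld|exact: Tw_fld]. Qed.

Lemma gd_zero p : gd p (@zfld _ X).
Proof. apply: good_zero; by [exact: T_is|exact: svac_T|exact: sbf_fld|exact: Tw_fld]. Qed.

Lemma gd_id : gd false (@idf _ X).
Proof. apply: good_id; by [exact: T_is|exact: svac_T|exact: sbf_fld|exact: Tw_fld]. Qed.

Lemma gd_prod p q a b n : gd p a -> gd q b -> local (sgn K (p && q)) a b ->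
  gd (p (+) q) (nprod (sgn K (p && q)) a b n).
Proof. apply: good_prod; by [exact: T_is|exact: svac_T|exact: sbf_fld|exact: Tw_fld]. Qed.

Lemma gd_bf b : gd (sbp b) (sbf b).
Proof.
apply: good_bf; [exact: sbf_fld|exact: sbf_tcov|exact: sbf_vac|exact: sbf_local|exact: sbf_Tw].
Qed.

Lemma gd_hs h : gd false (hs h).
Proof.
have -> : hs h = foldr (fun i b => lcomb (h 0 i) (hs (bas K i)) b) (@zfld _ X) (enum 'I_3).
  apply: functional_extensionality_dep => n; apply: functional_extensionality_dep => u.
  have E : hs h n u = \sum_(i <- enum 'I_3) h 0 i *: hs (bas K i) n u.
    rewrite big_enum /=; case: n => [[|n]|n].
    - apply: (@fx_eq _ _ _ _ (hs h 0) (fun u => \sum_i h 0 i *: hs (bas K i) 0 u)); first exact: hs_is.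
        by apply: islin_bigsum => i; apply/islin_scale/hs_is.
      move=> A i; rewrite hs0U.
      under eq_bigr => j _ do rewrite hs0U scalerA.
      rewrite -scaler_suml; congr (_ *: _); rewrite pairingC -(pairing_sum _ h).
      by apply: eq_bigr => j _; rewrite pairingC.
    - rewrite hsP; under [RHS]eq_bigr => j _ do rewrite hsP scaler_sumr.
      rewrite exchange_big; apply: eq_bigr => i _ /=.
      under eq_bigr => j _ do rewrite scalerA.
      rewrite -scaler_suml; congr (_ *: _); rewrite pairingC -(pairing_sum _ h) mulr_sumr.
      by apply: eq_bigr => j _; rewrite mulrCA pairingC.
    - by rewrite hsN; apply: eq_bigr => i _; rewrite (cr_hs (swt r)).
  rewrite E; elim: (enum 'I_3) => [|i s IH]; first by rewrite big_nil.
  by rewrite big_cons IH.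
elim: (enum 'I_3) => [|i s IH] /=; first exact: gd_zero.
by apply: gd_lin IH; apply: (gd_bf (inl i)).
Qed.

Lemma gd_Gam x : gd (iodd x.1) (Gam x). Proof. exact: (gd_bf (inr x)). Qed.

Lemma gd_local_bf p a b : gd p a -> local (sgn K (p && sbp b)) a (sbf b).
Proof. by case=> _ _ _ h _; apply: h. Qed.

Lemma gd_fld p a : gd p a -> lfield a. Proof. by case. Qed.

Fixpoint word (A : seq ('I_3 * nat)) (x : int * int) : fld X := match A with
  | [::] => Gam x
  | ik :: A => nprod 1 (hs (bas K ik.1)) (word A x) (Negz ik.2)
  end.

Lemma gd_local_hs p b i : gd p b -> local 1 (hs (bas K i)) b.
Proof.
move=> /(gd_local_bf (inl i)); rewrite andbF => h; apply: local_sym h.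
by rewrite /sgn mulr1.
Qed.

Lemma gd_word A x : gd (iodd x.1) (word A x).
Proof.
elim: A => [|ik A IH]; first exact: gd_Gam.
by apply: (@gd_prod false _ (hs _) _ _ (gd_bf (inl ik.1)) IH); apply: gd_local_hs IH.
Qed.

Lemma word_local p a A x : gd p a -> local (sgn K (p && iodd x.1)) a (word A x).
Proof.
move=> ga; elim: A => [|[i k] A IH]; first exact: (gd_local_bf (inr x) ga).
apply: local_sym; first exact: sgn_sqr.
rewrite -[sgn K _]mul1r; apply: dong.
- exact: lfield_hs.
- exact/gd_fld/gd_word.
- exact: gd_fld ga.
- exact: gd_local_hs (gd_word A x).
- exact: gd_local_hs ga.
- by apply: local_sym IH; apply: sgn_sqr.
Qed.

Lemma word_vac A x : word A x (-1) vac = foldr (@cr K sector X) (e0 X (None, x)) A.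
Proof.
elim: A => [|[i k] A IH] /=.
  rewrite Gam_e0 (_ : _ - _ = 0) ?/Em ?Ex0 /gsh /gexp /=; last by rewrite mulr0 !subr0.
  by rewrite !add0r; case: x.
rewrite (@nprod_vac _ _ vac); [|exact: lfield_hs|exact/gd_fld/gd_word| |].
- by rewrite IH /= -(cr_hs (swt r)).
- exact: (@sbf_vac K r X (inl i)).
- by case: (gd_word A x).
Qed.

Lemma foldr_ins (A : modes) : foldr ins mset0 (enum_mset A) = A.
Proof.
apply: modes_eq => y; rewrite -(count_mem_mset y A).
elim: (enum_mset A : seq _) => [|x s IH] /=; first by rewrite mset0E.
by rewrite insE IH addnC.
Qed.

Lemma foldr_cr (A : modes) i : foldr (@cr K sector X) (e0 X i) (enum_mset A) = kt A i.
Proof.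
rewrite -{2}(foldr_ins A); elim: (enum_mset A : seq _) => [|x s IH] //=.
by rewrite IH crU.
Qed.

Variable P : fockmod K (int * int)%type.
Implicit Types (u v : P).

(** A state of [P] acts on all sectors at once; the product of the algebra and the actions on its
    modules are restrictions of this one map. *)
Definition Y u : fld X := fun n (z : X) => fext (fun A x => word (enum_mset A) x n z) u.
Definition ppar p : set P := lgr (fun b => iodd b.2.1) p.
Definition iota u : X := imap X (fun x => (None, x)) u.

Lemma Y_kt A x : Y (kt A x) = word (enum_mset A) x.
Proof.
apply: functional_extensionality_dep => n; apply: functional_extensionality_dep => u.
exact: fext_kt.
Qed.

Lemma Y_lin c u v : Y (c *: u + v) = lcomb c (Y u) (Y v).
Proof.
apply: functional_extensionality_dep => n; apply: functional_extensionality_dep => w.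
exact: fext_is.
Qed.

Lemma Y0 : Y 0 = @zfld _ X.
Proof.
apply: functional_extensionality_dep => n; apply: functional_extensionality_dep => w.
exact: (islin0 (fext_is _)).
Qed.

Lemma ppar_ind p (Q : fld X -> Prop) u : ppar p u -> Q (@zfld _ X) ->
    (forall c a b, Q a -> Q b -> Q (lcomb c a b)) ->
    (forall A x, iodd x.1 = p -> Q (word A x)) -> Q (Y u).
Proof.
move=> hu Q0 QL Qw; apply: (suppE (P := fun u => Q (Y u)) hu).
- by rewrite Y0.
- by move=> c v v' hv hv'; rewrite Y_lin; apply: QL.
- by move=> A x E; rewrite Y_kt; apply: Qw.
Qed.

Lemma Y_good p u : ppar p u -> gd p (Y u).
Proof.
move=> hu; apply: (ppar_ind hu); first exact: gd_zero.
  by move=> *; apply: gd_lin.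
by move=> A x <-; apply: gd_word.
Qed.

Lemma Y_fld u : lfield (Y u).
Proof.
move: u; apply: fx_lind.
- by rewrite Y0; apply: lfield0.
- by move=> c u v hu hv; rewrite Y_lin; apply: lfield_lin.
- by move=> A x; rewrite Y_kt; apply: gd_fld (gd_word _ _).
Qed.

Lemma Y_local p q a u : gd p a -> ppar q u -> local (sgn K (p && q)) a (Y u).
Proof.
move=> ga hu; suff [] : lfield (Y u) /\ local (sgn K (p && q)) a (Y u) by [].
apply: (ppar_ind (Q := fun b => lfield b /\ local (sgn K (p && q)) a b) hu).
- by split; [exact: lfield0|apply: local_sym; [exact: sgn_sqr|exact: local0 (gd_fld ga)]].
- move=> c b b' [fb lb] [fb' lb']; split; first exact: lfield_lin.
  apply: local_sym; first exact: sgn_sqr.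
  by apply: local_lin => //; [exact: gd_fld ga| |]; apply: local_sym => //; apply: sgn_sqr.
- by move=> A x <-; split; [exact: gd_fld (gd_word _ _)|exact: word_local].
Qed.

Lemma Y_vac u : Y u (-1) vac = iota u.
Proof.
move: u; apply: fx_eq => [||A x].
- by move=> c u v; rewrite Y_lin.
- exact: imap_is.
- by rewrite Y_kt word_vac foldr_cr /iota imap_kt.
Qed.

Definition xsec (C : set (option bool)) : set X := supp [set b | C b.2.1].
Definition xpar (p : bool) : set X := lgr (fun b => iodd b.2.2.1) p.

Lemma hs_label (S : set sector) h n (v : X) : supp [set b | S b.2] v -> supp [set b | S b.2] (hs h n v).
Proof.
apply: supp_lin; first exact: hs_is.
move=> A i Si; have := @hs_supp _ _ (swt r) X h n i _ _ (Sd_kt X A i).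
by apply: supp_sub => b [/= ->].
Qed.

Lemma Gam_label (S S' : set sector) x n (v : X) : (forall i, S i -> S' (gsh x i)) ->
  supp [set b | S b.2] v -> supp [set b | S' b.2] (Gam x n v).
Proof.
move=> SS; apply: supp_lin; first exact: vop_is.
move=> A i Si; have := @vop_supp _ _ (swt r) X (lat K x) (gexp x) (gsh x) (fun _ => 1) i _ n _ (Sd_kt X A i).
by apply: supp_sub => b [/= -> _]; apply: SS.
Qed.

Lemma word_label (S : int -> set sector) A x n (v : X) : (forall i, S 0 i -> S x.1 (gsh x i)) ->
  supp [set b | S 0 b.2] v -> supp [set b | S x.1 b.2] (word A x n v).
Proof.
move=> SS; elim: A n v => [|[i k] A IH] n v hv; first exact: Gam_label hv.
apply: D_closed; first exact: supp_subspace.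
- exact: lfield_hs.
- exact/gd_fld/gd_word.
- by move=> p q _; apply: (@hs_label (S x.1)); apply: IH.
- by move=> p q _; apply: IH; apply: (@hs_label (S 0)).
Qed.

Lemma Y_sec (C : set (option bool)) u n (v : X) : xsec C v -> xsec C (Y u n v).
Proof.
move=> hv; move: u; apply: fx_lind.
- by rewrite Y0; apply: supp0.
- by move=> c u u' hu hu'; rewrite Y_lin; apply: suppL.
- by move=> A x; rewrite Y_kt; apply: (@word_label (fun _ => [set i | C i.1])).
Qed.

Lemma Y_par p q u n (v : X) : ppar p u -> xpar q v -> xpar (p (+) q) (Y u n v).
Proof.
move=> hu hv; apply: (ppar_ind (Q := fun a => xpar (p (+) q) (a n v)) hu).
- exact: supp0.
- by move=> c a b ha hb; apply: suppL.
move=> A x E.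
rewrite -E; apply: (@word_label (fun z => [set i | iodd i.2.1 = iodd z (+) q])) => // i /= e.
by rewrite ioddD e addbC.
Qed.

End StateField.

Section SectorModule.
Variables (K : numFieldType) (r : K) (X : fockmod K sector) (P : fockmod K (int * int)%type).
Local Notation T := (@T K sector (swt r) X).
Local Notation vac := (svac X).
Local Notation sbf := (@sbf K r X).
Local Notation Tw := (@Tw K r X).
Local Notation Y := (@Y K r X P).
Local Notation ppar := (@ppar K P).

Definition pvac : P := e0 P (0, 0).
Definition pprod (u : P) n (v : P) : P := imap P snd (Y u n (iota X v)).

Lemma pprod_iota u n v : iota X (pprod u n v) = Y u n (iota X v).
Proof.
rewrite /pprod; have h : xsec [set None] (Y u n (iota X v)).
  apply: Y_sec; apply: (@supp_lin _ _ _ _ _ setT _ _ _ (imap_is _ _)); last exact: suppT.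
  by move=> A x _; rewrite imap_kt; apply: suppU.
move: (Y u n _) h => z h.
apply: (suppE (P := fun z => iota X (imap P snd z) = z) h).
- by rewrite /iota !(islin0 (imap_is _ _)).
- by move=> c z1 z2 h1 h2; rewrite /iota !imap_is -/(iota X _) h1 -/(iota X _) h2.
- by move=> A [s x] /= ->; rewrite /iota !imap_kt.
Qed.

Lemma iota_inj : injective (@iota K X P).
Proof.
apply: (can_inj (g := imap P snd)); apply: fx_eq => [||A x].
- by apply: islin_comp; exact: imap_is.
- exact: islin_id.
- by rewrite /iota !imap_kt.
Qed.

(** Both sides are good fields with the same value on the vacuum. This associativity turns
    Borcherds' identity on every sector into [borcherds_local]. *)
Lemma Y_pprod p q u v n : ppar p u -> ppar q v ->
  Y (pprod u n v) = nprod (sgn K (p && q)) (Y u) (Y v) n.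
Proof.
move=> hu hv; have gu := Y_good r X hu; have gv := Y_good r X hv.
have gp := gd_prod n gu gv (Y_local gu hv).
apply: (gd_inj (p := p (+) q) _ gp).
  apply: Y_good; apply: (@supp_lin _ _ _ _ _ [set b | iodd b.2.2.1 = p (+) q] _ _ _ (imap_is _ _)).
    by move=> A i E; rewrite imap_kt; apply: suppU.
  apply: Y_par => //; apply: supp_lin hv; first exact: imap_is.
  by move=> A i E; rewrite /iota imap_kt; apply: suppU.
rewrite Y_vac pprod_iota (@nprod_vac _ _ vac).
- by rewrite Y_vac.
- exact: Y_fld.
- exact: Y_fld.
- by case: gu.
- by case: gv.
Qed.

Lemma Y_pvac : Y pvac = @idf _ X.
Proof.
apply: (gd_inj (p := false)); [by apply: Y_good; apply: suppU|exact: gd_id|].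
by rewrite Y_vac /idf eqxx /iota imap_kt.
Qed.

Section Restriction.
Variables (I' : choiceType) (f : I' -> sector) (g : sector -> I').
Variables (C : set (option bool)) (M' : fockmod K I').
Hypothesis fC : forall x, C (f x).1.
Hypothesis fg : forall i, C i.1 -> f (g i) = i.
Hypothesis gf : forall x, g (f x) = x.

(** [f] and [g] identify [M'] with the sectors in [C]. The cases used are the vacuum sector, a
    single twisted sector, and both twisted sectors together. *)
Definition smod (u : P) n (z : M') : M' := imap M' g (Y u n (imap X f z)).
Definition smpar p : set M' := lgr (fun b => iodd (f b.2).2.1) p.

Lemma imap_f_sec (z : M') : xsec C (imap X f z).
Proof.
apply: (@supp_lin _ _ _ _ _ setT _ _ _ (imap_is _ _)); last exact: suppT.
by move=> A x _; rewrite imap_kt; apply: suppU; exact: fC.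
Qed.

Lemma imap_fg (z : X) : xsec C z -> imap X f (imap M' g z) = z.
Proof.
move=> h; apply: (suppE (P := fun z => imap X f (imap M' g z) = z) h).
- by rewrite !(islin0 (imap_is _ _)).
- by move=> c z1 z2 h1 h2; rewrite !imap_is h1 h2.
- by move=> A i Ci; rewrite !imap_kt fg.
Qed.

Lemma imap_gf (z : M') : imap M' g (imap X f z) = z.
Proof.
move: z; apply: fx_eq => [||A x].
- by apply: islin_comp; exact: imap_is.
- exact: islin_id.
- by rewrite !imap_kt gf.
Qed.

Lemma smodE u n z : imap X f (smod u n z) = Y u n (imap X f z).
Proof. by rewrite imap_fg //; apply: Y_sec; apply: imap_f_sec. Qed.

Lemma imap_f_inj : injective (imap X f : M' -> X).
Proof. exact: can_inj imap_gf. Qed.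

Lemma smod_fsum (F : nat -> M') (G : nat -> X) J : (forall j, imap X f (F j) = G j) ->
    (forall j, (J <= j)%N -> G j = 0) ->
  imap X f (\sum_(j \in [set: nat]) F j) = \sum_(j \in [set: nat]) G j.
Proof.
move=> E G0; rewrite (@fsum_lin _ _ _ (imap X f) F J (imap_is _ _)).
  by apply: eq_fsbigr => j _.
by move=> j /G0; rewrite -E => e; apply: imap_f_inj; rewrite e (islin0 (imap_is _ _)).
Qed.

Lemma Dsummand_bound a b n p q (u : X) s : lfield a -> lfield b -> exists J, forall j, (J <= j)%N ->
  cf K n j *: (a (p + n - j%:Z) (b (q + j%:Z) u) -
      ((-1) ^ n * s) *: b (q + n - j%:Z) (a (p + j%:Z) u)) = 0.
Proof.
move=> fa fb; have [J G0] := rt_bound (rt_prodf u fa fb) q.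
have [J' G0'] := rt_bound (rt_prodf u fb fa) p.
exists (maxn J J') => j; rewrite geq_max => /andP[le le'].
have := G0 j (p + n - j%:Z) le; have := G0' j (q + n - j%:Z) le'.
by rewrite /prodf => -> ->; rewrite scaler0 subr0 scaler0.
Qed.

Lemma smod_action : vertex_action ppar smpar pvac pprod smod.
Proof.
split.
- by move=> c a b n u; rewrite /smod Y_lin; apply: imap_is.
- by move=> c a n u v; rewrite /smod imap_is (Y_fld r X a).1 imap_is.
- move=> p q a n u ha hu.
  have h : xpar (p (+) q) (Y a n (imap X f u)).
    apply: Y_par ha _; apply: supp_lin hu; first exact: imap_is.
    by move=> A i E; rewrite imap_kt; apply: suppU.
  have {}h : supp [set b | iodd b.2.2.1 = p (+) q /\ C b.2.1] (Y a n (imap X f u)).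
    have hs := Y_sec r a n (imap_f_sec u); have := proj_supp [set b | C b.2.1] h.
    rewrite (proj_id hs); by apply: supp_sub => b [? ?].
  apply: supp_lin h; first exact: imap_is.
  by move=> A i [/= E Ci]; rewrite imap_kt; apply: suppU; rewrite /= fg.
- move=> a u; have [N h] := (Y_fld r X a).2 (imap X f u); exists N => n /h e.
  by rewrite /smod e (islin0 (imap_is _ _)).
- move=> n u; rewrite /smod Y_pvac /idf; case: eqP => _; first exact: imap_gf.
  exact: islin0 (imap_is _ _).
move=> p q a b c m n l pa qb; apply: imap_f_inj.
have [fa fb] := (Y_fld r X a, Y_fld r X b).
have lab := Y_local (Y_good r X pa) qb.
have [N HN] := lab.
rewrite (@smod_fsum _ (fun j => binz K m j *: nprod (sgn K (p && q)) (Y a) (Y b) (n + j%:Z) (m + l - j%:Z) (imap X f c)) `|N%:Z - n|%N).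
- rewrite borcherds_local // -D_comb //.
  have [J HJ] := @Dsummand_bound (Y a) (Y b) n m l (imap X f c) (sgn K (p && q)) fa fb.
  symmetry; apply: (smod_fsum _ HJ) => j.
  by rewrite !(islinZ (imap_is _ _)) (islinB (imap_is _ _)) (islinZ (imap_is _ _)) !smodE.
- by move=> j; rewrite (islinZ (imap_is _ _)) smodE (Y_pprod _ pa qb).
- by move=> j le; rewrite /nprod (local_ge fa fb HN) ?scaler0 //; lia.
Qed.

Lemma smpar_grading : grading smpar. Proof. exact: lgr_grading. Qed.

End Restriction.

Lemma pprod_action : vertex_action ppar ppar pvac pprod pprod.
Proof.
apply: (@smod_action _ (fun x => (None, x)) snd [set None]) => //.
by case=> s x /= ->.
Qed.

Lemma pprod_vac a : pprod a (-1) pvac = a.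
Proof.
by apply: iota_inj; rewrite pprod_iota -(@Y_vac K r X P a) /iota imap_kt.
Qed.

Lemma pprod_vac0 a (n : int) : 0 <= n -> pprod a n pvac = 0.
Proof.
move=> n0; apply: iota_inj; rewrite pprod_iota /iota imap_kt (islin0 (imap_is _ _)).
move: a; apply: fx_lind.
- by rewrite Y0.
- by move=> c u v hu hv; rewrite Y_lin /lcomb hu hv scaler0 addr0.
- by move=> A x; rewrite Y_kt; case: (gd_word r X (enum_mset A) x) => _ _ /(_ n n0).
Qed.

Lemma ppar_vac : ppar false pvac. Proof. exact: suppU. Qed.

Definition Pvsa : vsa K := Vsa (@lgr_grading K _ P _ (fun b => iodd b.2.1))
  ppar_vac pprod_action pprod_vac pprod_vac0.

End SectorModule.

(** * Affine currents *)

Section VsaTheory.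
Variables (K : numFieldType) (V : vsa K).
Implicit Types (a b c u : V) (p q : bool).
Local Notation vac := (vac V).
Local Notation vp := (@vprod K V).

Lemma vsa_action : vertex_action (@vpar K V) (@vpar K V) vac vp vp.
Proof. by case: V. Qed.
Lemma vsa_grading : grading (@vpar K V). Proof. by case: V. Qed.
Lemma vpar_vac : vpar false vac. Proof. by case: V. Qed.
Lemma vprod_vacr a : vp a (-1) vac = a. Proof. by case: V a. Qed.
Lemma vprod_vac0 a (n : int) : 0 <= n -> vp a n vac = 0.
Proof. by case: V a => ? ? ? ? ? ? ? ? h a /h. Qed.

Lemma vprod_lin a n : islin (vp a n).
Proof. by move=> c u v; apply: (va_linr vsa_action). Qed.

Lemma vprod_linl n u : islin (fun a => vp a n u).
Proof. by move=> c a b; apply: (va_linl vsa_action). Qed.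

Section Modes.
Variables (M : lmodType K) (mp : bool -> set M) (act : V -> int -> M -> M).
Hypothesis H : vertex_action (@vpar K V) mp vac vp act.

Lemma act_lin a n : islin (act a n).
Proof. by move=> c u v; apply: (va_linr H). Qed.
Lemma act_linl n (u : M) : islin (fun a => act a n u).
Proof. by move=> c a b; apply: (va_linl H). Qed.

Definition ope a b u (k : K) := forall n : int, 0 <= n ->
  vp a n b = (if n == 0 then u else 0) + (if n == 1 then k else 0) *: vac.

Lemma act_comm p q a b m l (c : M) : vpar p a -> vpar q b ->
  (exists N : nat, forall n : int, N%:Z <= n -> vp a n b = 0) ->
  act a m (act b l c) = sgn K (p && q) *: act b l (act a m c) +
    \sum_(j \in [set: nat]) binz K m j *: act (vp a j%:Z b) (m + l - j%:Z) c.
Proof.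
move=> pa qb [N hN]; have := va_borcherds H c m 0 l pa qb.
under eq_fsbigr => j _ do rewrite add0r.
move=> ->; rewrite (@fsumE _ _ 1) => [|[|j] //]; last first.
  by rewrite binz_nat0 // mulr0 scale0r.
rewrite big_ord1 /= !(addr0, subr0) binz0 expr0 mul1r scale1r expr0z mul1r.
by rewrite addrC subrK.
Qed.

Lemma ope_comm p q a b u k m l (c : M) : vpar p a -> vpar q b -> ope a b u k ->
  act a m (act b l c) = sgn K (p && q) *: act b l (act a m c) + act u (m + l) c
    + (if m + l == 0 then m%:~R * k else 0) *: c.
Proof.
move=> pa qb hab; have h0 : forall n : int, 2 <= n -> vp a n b = 0.
  by move=> n le; rewrite hab; [rewrite !ifF ?scale0r ?addr0 //|]; try (apply/negP => /eqP); lia.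
rewrite (act_comm _ _ _ pa qb); last by exists 2%N.
rewrite -addrA; congr (_ + _); rewrite (@fsumE _ _ 2) => [|j le]; last first.
  by rewrite h0 ?(islin0 (act_linl _ _)) ?scaler0.
rewrite big_ord_recl big_ord1 !hab //= binz0 scale1r scale0r addr0 subr0; congr (_ + _).
rewrite add0r (islinZ (act_linl _ _)) (va_vac H) binzSr binz0 mul1r subr0 divr1.
rewrite scalerA; have -> : (m + l - (bump 0 0)%:Z == -1) = (m + l == 0).
  by apply/eqP/eqP; rewrite /bump /=; lia.
by case: ifP => _; rewrite ?scaler0 ?scale0r.
Qed.

End Modes.

Lemma ope_comm0 (M : lmodType K) (mp : bool -> set M) (act : V -> int -> M -> M) p q a b u m (c : M) :
    vertex_action (@vpar K V) mp vac vp act -> vpar p a -> vpar q b -> ope a b u 0 ->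
  act a m (act b 0 c) = sgn K (p && q) *: act b 0 (act a m c) + act u m c.
Proof.
move=> H pa qb /(ope_comm H m 0 c pa qb) ->.
by rewrite mulr0 if_same scale0r !addr0.
Qed.

(** Borcherds' identity on the vacuum at [m = -1]. The vectors $v_{(-1-j)}\mathbf 1$ stand for
    $T^jv/j!$, so translation is expressed through the products themselves. *)
Lemma skew p q a b (n : int) (N : nat) : vpar p a -> vpar q b ->
  (forall j, (N <= j)%N -> vp a (n + j%:Z) b = 0) ->
  vp b n a = - ((-1) ^ n * sgn K (p && q)) *:
     \sum_(j < N) (-1) ^+ j *: vp (vp a (n + j%:Z) b) (-1 - j%:Z) vac.
Proof.
move=> pa qb h; have := va_borcherds vsa_action vac (-1) n 0 pa qb.
rewrite (@fsumE _ _ N) => [|j le]; last by rewrite h // (islin0 (vprod_linl _ _)) scaler0.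
rewrite (@fsumE _ _ 1) => [|[|j] // _]; last first.
  rewrite (_ : -1 + j.+1%:Z = j%:Z); last by lia.
  by rewrite !vprod_vac0 ?(islin0 (vprod_lin _ _)) // scaler0 subrr scaler0.
rewrite big_ord1 /= vprod_vac0 // (islin0 (vprod_lin _ _)) sub0r addr0 vprod_vacr !addr0.
rewrite add0r expr0 mul1r binz0 scale1r => E.
have S2 : sgn K (p && q) * sgn K (p && q) = 1 by exact: sgn_sqr.
have N2 : (-1) ^ n * (-1) ^ n = 1 :> K.
  by rewrite -exprzMl ?oppr_eq0 ?oner_eq0 ?unitrN1 // mulrNN mulr1 exp1rz.
have -> : \sum_(j < N) (-1) ^+ j *: vp (vp a (n + j%:Z) b) (-1 - j%:Z) vac =
    - (((-1) ^ n * sgn K (p && q)) *: vp b n a).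
  rewrite -E; apply: eq_bigr => j _; congr (_ *: _).
  elim: (j : nat) => [|i IH]; first by rewrite binz0.
  rewrite binzSr exprS -IH (_ : -1 - i%:Z = - i.+1%:Z); last by lia.
  by rewrite mulrC; congr (_ * _); rewrite rmorphN /= -pmulrn mulNr divff ?pnatr_eq0.
rewrite scaleNr scalerN opprK scalerA.
by rewrite mulrACA N2 S2 mulr1 scale1r.
Qed.

Lemma ope_skew p q a b u k : vpar p a -> vpar q b -> ope a b u k ->
  ope b a (- sgn K (p && q) *: u) (sgn K (p && q) * k).
Proof.
move=> pa qb hab n n0; rewrite (@skew p q a b n 2) // => [|j le]; last first.
  rewrite hab; last by lia.
  by rewrite !ifF ?scale0r ?addr0 //; apply/negP => /eqP; lia.
rewrite big_ord_recl big_ord1 (_ : lift _ _ = 1%N :> nat) //= addr0 expr0 scale1r expr1 !hab; try by lia.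
have [->|n1] := eqVneq n 0.
  rewrite /= scale0r addr0 add0r vprod_vacr (islinZ (vprod_linl _ _)).
  by rewrite (va_vac vsa_action) /= !scaler0 !addr0 expr0z mul1r.
have [->|n2] := eqVneq n 1.
  rewrite (_ : (1 + 1%Z == 0) = false) // (_ : (1 + 1%Z == 1) = false) // scale0r !addr0 add0r vprod_vacr.
  rewrite (islin0 (vprod_linl _ _)) scaler0 addr0.
  by rewrite expr1z scalerA mulN1r opprK add0r.
rewrite !ifF; try by apply/negP => /eqP; lia.
by rewrite !scale0r !addr0 !(islin0 (vprod_linl _ _)) scaler0 addr0 scaler0.
Qed.

End VsaTheory.

(** * Operator products of the currents deduced from those of $x$ and $y$ *)

Section OspRelations.
Variables (K : numFieldType) (V : vsa K) (x y e f h : V) (k : K).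
Local Notation vac := (vac V).
Local Notation vp := (@vprod K V).
Hypotheses (px : vpar true x) (py : vpar true y).
Hypotheses (pe : vpar false e) (pf : vpar false f) (ph : vpar false h).
Hypotheses (xx : ope x x (2 *: e) 0) (xy : ope x y h (2 * k)) (yy : ope y y (- 2 *: f) 0).
Hypotheses (hx : ope h x x 0) (hy : ope h y (- y) 0) (ee : ope e e 0 0) (ex : ope e x 0 0).
Hypotheses (yf1 : vp y 1 f = 0) (yf3 : forall n : int, 3 <= n -> vp y n f = 0).

Let H := vsa_action V.
Let half (z z' : V) : 2 *: z = z' -> z = 2^-1 *: z'.
Proof. by move=> <-; rewrite scalerA mulVf ?scale1r // pnatr_eq0. Qed.

Let s1 : sgn K (true && true) = -1. Proof. by []. Qed.
Let s0 : sgn K (false) = 1. Proof. by []. Qed.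

Let opN (a b u u' : V) k1 k2 : ope a b u k1 -> u = u' -> k1 = k2 -> ope a b u' k2.
Proof. by move=> h1 <- <-. Qed.

Let yx : ope y x h (- (2 * k)).
Proof. by apply: (opN (ope_skew px py xy)); rewrite s1 ?opprK ?scale1r // mulN1r. Qed.
Let xh : ope x h (- x) 0.
Proof. by apply: (opN (ope_skew ph px hx)); rewrite /= s0 ?scaleN1r // mulr0. Qed.
Let yh : ope y h y 0.
Proof. by apply: (opN (ope_skew ph py hy)); rewrite /= s0 ?scaleN1r ?opprK // mulr0. Qed.

Let n01 (n : int) (A B : V) (c : K) : 0 <= n ->
  (n = 0 -> A = B) -> (n = 1 -> A = c *: vac) -> (2 <= n -> A = 0) ->
  A = (if n == 0 then B else 0) + (if n == 1 then c else 0) *: vac.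
Proof.
move=> n0 h0 h1 h2; have [E|n1] := eqVneq n 0; first by rewrite E /= scale0r addr0 h0.
have [E|n2] := eqVneq n 1; first by rewrite add0r h1.
by rewrite scale0r addr0 h2 //; lia.
Qed.

Let op0 a b u c : ope a b u c -> vp a 0 b = u.
Proof. by move=> ->//; rewrite /= scale0r addr0. Qed.
Let op1 a b u c : ope a b u c -> vp a 1 b = c *: vac.
Proof. by move=> ->//; rewrite /= add0r. Qed.
Let op2 a b u c n : ope a b u c -> 2 <= n -> vp a n b = 0.
Proof.
move=> h0 le; rewrite h0; last by lia.
by rewrite !ifF ?scale0r ?addr0 //; apply/negP => /eqP; lia.
Qed.
Let opz a b u n : ope a b u 0 -> 1 <= n -> vp a n b = 0.
Proof.
move=> h0 le; rewrite h0; last by lia.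
by rewrite ifF ?if_same ?scale0r ?addr0 //; apply/negP => /eqP; lia.
Qed.

Let eE : e = 2^-1 *: vp x 0 x. Proof. by apply: half; rewrite (op0 xx). Qed.
Let fE : f = - 2^-1 *: vp y 0 y.
Proof. by rewrite (op0 yy) scaleNr scaleNr scalerN opprK scalerA mulVf ?scale1r // pnatr_eq0. Qed.
Let hE : h = vp x 0 y. Proof. by rewrite (op0 xy). Qed.

Lemma ope_hh : ope h h 0 (k * 2).
Proof.
move=> n n0; rewrite {2}hE (ope_comm0 _ _ H ph px hx) /= s0 scale1r.
apply: n01 => // [->|->|le].
- by rewrite (op0 hy) (islinN (vprod_lin _ _)) -hE addNr.
- by rewrite (opz hy) // (islin0 (vprod_lin _ _)) add0r (op1 xy) mulrC.
- by rewrite (op2 hy le) (op2 xy le) (islin0 (vprod_lin _ _)) addr0.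
Qed.

Lemma ope_he : ope h e (2 *: e) 0.
Proof.
move=> n n0; rewrite {1}eE (islinZ (vprod_lin _ _)).
rewrite (ope_comm0 _ _ H ph px hx) /= s0 scale1r.
apply: n01 => // [->|->|le].
- by rewrite (op0 hx) (op0 xx) -scalerDl scalerA; congr (_ *: _); field.
- by rewrite !(opz hx, opz xx) // (islin0 (vprod_lin _ _)) scale0r addr0 scaler0.
- by rewrite (op2 hx le) (op2 xx le) (islin0 (vprod_lin _ _)) addr0 scaler0.
Qed.

Lemma ope_hf : ope h f (- 2 *: f) 0.
Proof.
move=> n n0; rewrite {1}fE (islinZ (vprod_lin _ _)).
rewrite (ope_comm0 _ _ H ph py hy) /= s0 scale1r.
rewrite (islinN (vprod_linl _ _)).
apply: n01 => // [->|->|le].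
- by rewrite (op0 hy) (islinN (vprod_lin _ _)) (op0 yy); mod_coords K V; field.
- by rewrite !(opz hy, opz yy) // (islin0 (vprod_lin _ _)) scale0r oppr0 addr0 scaler0.
- by rewrite (op2 hy le) (op2 yy le) (islin0 (vprod_lin _ _)) oppr0 addr0 scaler0.
Qed.

Lemma ope_ey : ope e y (- x) 0.
Proof.
move=> n n0; have := ope_comm0 n y H px px xx; rewrite s1 (islinZ (vprod_linl _ _)).
move=> E; have {E} -> : vp e n y = 2^-1 *: (vp x n (vp x 0 y) + vp x 0 (vp x n y)).
  by rewrite E; mod_coords K V; field.
rewrite -hE; apply: n01 => // [->|->|le].
- by rewrite -hE (op0 xh); mod_coords K V; field.
- by rewrite (opz xh) // (op1 xy) (islinZ (vprod_lin _ _)) vprod_vac0 // !scaler0 addr0 scaler0 scale0r.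
- by rewrite (op2 xh le) (op2 xy le) (islin0 (vprod_lin _ _)) addr0 scaler0.
Qed.

Lemma ope_ef : ope e f h k.
Proof.
move=> n n0; rewrite {1}fE (islinZ (vprod_lin _ _)).
rewrite (ope_comm0 _ _ H pe py ope_ey) /= s0 scale1r.
rewrite (islinN (vprod_linl _ _)).
apply: n01 => // [->|->|le].
- by rewrite (op0 ope_ey) (islinN (vprod_lin _ _)) (op0 yx) (op0 xy); mod_coords K V; field.
- by rewrite (opz ope_ey) // (op1 xy) (islin0 (vprod_lin _ _)); mod_coords K V; field.
- by rewrite (op2 ope_ey le) (op2 xy le) (islin0 (vprod_lin _ _)) oppr0 addr0 scaler0.
Qed.

Lemma ope_xf : ope x f y 0.
Proof.
move=> n n0; rewrite {1}fE (islinZ (vprod_lin _ _)).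
rewrite (ope_comm H _ _ _ px py xy) s1 addr0.
apply: n01 => // [->|->|le].
- by rewrite /= mul0r -hE (op0 yh) (op0 hy); mod_coords K V; field.
- rewrite (op1 xy) (opz hy) // (islinZ (vprod_lin _ _)) vprod_vac0 //.
  by rewrite /= !scaler0 !scale0r !addr0 scaler0.
- rewrite (op2 xy le) (op2 hy le) (islin0 (vprod_lin _ _)) ifF; last by apply/negP => /eqP; lia.
  by rewrite scale0r !scaler0 !addr0 scaler0.
Qed.

Let f_modes (n : int) : 0 <= n -> vp f n y = - 2^-1 *: (vp y n (vp y 0 y) + vp y 0 (vp y n y)).
Proof.
move=> n0; have := ope_comm0 n y H py py yy; rewrite s1 (islinZ (vprod_linl _ _)).
by move=> ->; mod_coords K V; field.
Qed.

(** The relation $\{y,y\}=-2f$ gives $f_{(n)}y=y_{(n)}f$ for $n\ge1$ and $f_{(0)}y=2y_{(0)}f$,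
    whereas skew-symmetry gives $f_{(2)}y=-y_{(2)}f$ and, once the higher products vanish,
    $f_{(0)}y=-y_{(0)}f$. So the products at 2 and 0 vanish; at 1 the two relations agree, and the
    value comes from [yf1]. *)
Lemma ope_yf : ope y f 0 0.
Proof.
have fy n : 1 <= n -> vp f n y = vp y n f.
  move=> le; rewrite f_modes; last by lia.
  rewrite (opz yy le) (islin0 (vprod_lin _ _)) addr0 (op0 yy) (islinZ (vprod_lin _ _)).
  by rewrite scalerA (_ : _ * _ = 1) ?scale1r //; field.
have sk n N : 0 <= n -> (forall j, (N <= j)%N -> vp y (n + j%:Z) f = 0) -> vp f n y =
    - ((-1) ^ n) *: \sum_(j < N) (-1) ^+ j *: vp (vp y (n + j%:Z) f) (-1 - j%:Z) vac.
  by move=> n0 /(skew py pf) ->; rewrite /= s0 mulr1.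
have y2 : vp y 2 f = 0.
  have := sk 2 1%N; rewrite big_ord1 fy // addr0 subr0 vprod_vacr => /(_ isT) E.
  suff : vp y 2 f = - 1 *: vp y 2 f.
    move=> {}E; have : 2 *: vp y 2 f = 0 by rewrite {1}scaler_nat mulr2n {1}E scaleN1r addNr.
    by move/eqP; rewrite scaler_eq0 pnatr_eq0 => /eqP.
  rewrite {1}E => [|j le]; last by apply: yf3; lia.
  by rewrite -exprnP sqrrN expr1n scale1r.
have y0 : vp y 0 f = 0.
  have E1 : vp f 0 y = - 1 *: vp y 0 f.
    rewrite (@sk 0 1%N) // => [|j le]; first by rewrite big_ord1 addr0 subr0 vprod_vacr expr0z scale1r.
    have [->|ne] := eqVneq j 1%N; first by rewrite add0r.
    have [->|ne'] := eqVneq j 2%N; first by rewrite add0r.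
    by apply: yf3; lia.
  have := f_modes (lexx 0); rewrite E1 (op0 yy) (islinZ (vprod_lin _ _)) => E.
  set v := vp y 0 f in E *; have : 3 *: v = 0.
    have -> : 3 *: v = 2 *: v - (-1 *: v) by mod_ring K V.
    by rewrite E; mod_coords K V; field.
  by move/eqP; rewrite scaler_eq0 pnatr_eq0 => /eqP.
move=> n n0; rewrite !if_same scale0r addr0.
have [->|ne] := eqVneq n 0; first by [].
have [->|ne1] := eqVneq n 1; first by [].
have [->|ne2] := eqVneq n 2; first by [].
by apply: yf3; lia.
Qed.

Lemma ope_fy : ope f y 0 0.
Proof. by apply: (opN (ope_skew py pf ope_yf)); rewrite ?scaler0 ?mulr0. Qed.

Lemma ope_ff : ope f f 0 0.
Proof.
move=> n n0; rewrite {2}fE (islinZ (vprod_lin _ _)).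
rewrite (ope_comm0 _ _ H pf py ope_fy) /= s0 scale1r ope_fy // !if_same scale0r addr0.
by rewrite (islin0 (vprod_lin _ _)) (islin0 (vprod_linl _ _)) addr0 scaler0.
Qed.

Definition osp_state (a : osp) : V := match a with
  | ge => e | gf => f | gh => h | gx => x | gy => y end.

Lemma ope_osp a b : ope (osp_state a) (osp_state b)
  (\sum_(t <- osp_br a b) t.1%:~R *: osp_state t.2) (k * (osp_form a b)%:~R).
Proof.
have ye := ope_skew pe py ope_ey; have he := ope_he.
case: a; case: b; [apply: (opN ee)|apply: (opN ope_ef)|apply: (opN (ope_skew ph pe he))|
  apply: (opN ex)|apply: (opN ope_ey)|apply: (opN (ope_skew pe pf ope_ef))|apply: (opN ope_ff)|
  apply: (opN (ope_skew ph pf ope_hf))|apply: (opN (ope_skew px pf ope_xf))|apply: (opN ope_fy)|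
  apply: (opN he)|apply: (opN ope_hf)|apply: (opN ope_hh)|apply: (opN hx)|apply: (opN hy)|
  apply: (opN (ope_skew pe px ex))|apply: (opN ope_xf)|apply: (opN xh)|apply: (opN xx)|apply: (opN xy)|
  apply: (opN ye)|apply: (opN ope_yf)|apply: (opN yh)|apply: (opN yx)|apply: (opN yy)];
  rewrite /= ?big_cons ?big_nil /sgn /= ?expr0 ?expr1 ?mulr0z; first [by mod_coords K V; ring|by ring].
Qed.

End OspRelations.

Definition hP (K : numFieldType) (P : fockmod K (int * int)%type) (h : 'rV[K]_3) (n : nat) : P -> P :=
  hs (fun x => swt 0 (None, x)) h (Negz n).

Section OspStates.
Variables (K : numFieldType) (r : K) (X : fockmod K sector) (P : fockmod K (int * int)%type).
Local Notation hs := (@hs K sector (swt r) X).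
Local Notation vac := (svac X).
Local Notation Gam := (@Gam K r X).
Local Notation Y := (@Y K r X P).
Local Notation ppar := (@ppar K P).
Local Notation io := (@iota K X P).
Local Notation al := (wal K).
Local Notation mu := (wmu (lev K)).
Local Notation nu := (wnu (lev K)).

Definition st_e : P := e0 P (0, 1).
Definition st_h : P := hP (2 *: mu) 0 (e0 P (0, 0)).
Definition st_x : P := e0 P (1, 0) + e0 P (-1, 1).
Definition st_y : P := hP (nu + 2^-1 *: al) 0 (e0 P (-1, 0))
  + hP (nu - (3 / 2) *: al) 0 (e0 P (1, -1)).
Definition st_om : P := 2^-1 *: hP al 0 (hP al 0 (e0 P (0, -1)))
  + 2^-1 *: hP al 1 (e0 P (0, -1)) + e0 P (2, -2).
Definition st_f : P := (lev K + 2) *: st_om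
  - hP nu 0 (hP nu 0 (e0 P (0, -1))) - (lev K + 1) *: hP nu 1 (e0 P (0, -1)).

Lemma iota_lin : islin io. Proof. exact: imap_is. Qed.

Lemma iota_hP h n u : io (hP h n u) = hs h (Negz n) (io u).
Proof. exact: imap_hs. Qed.

Lemma iota_e0 x : io (e0 P x) = e0 X (None, x).
Proof. by rewrite /iota imap_kt. Qed.

Lemma hP_par p h n u : ppar p u -> ppar p (hP h n u).
Proof.
apply: supp_lin; first exact: hs_is.
move=> A i Si; have := @hs_supp _ _ (fun x => swt 0 (None, x)) P h (Negz n) i _ _ (Sd_kt P A i).
by apply: supp_sub => b [/= ->].
Qed.

Lemma e0_par x : ppar (iodd x.1) (e0 P x). Proof. exact: suppU. Qed.

Lemma Y_e0 x : Y (e0 P x) = Gam x.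
Proof. by rewrite Y_kt enum_mset0. Qed.

Lemma Y_hP p h n u : ppar p u -> Y (hP h n u) = nprod 1 (hs h) (Y u) (Negz n).
Proof.
move=> hu; have gu := Y_good r X hu; have gh := gd_hs r X h.
have lh : local (sgn K (false && p)) (hs h) (Y u) by apply: Y_local gh hu.
have gp := gd_prod (Negz n) gh gu lh.
apply: (gd_inj _ gp); first by apply/Y_good/hP_par.
rewrite Y_vac iota_hP (@nprod_vac _ _ vac); first by rewrite Y_vac.
- exact: lfield_hs.
- exact: Y_fld.
- by case: gh.
- by case: gu.
Qed.

Definition gop (g : 'rV[K]_3) (x : int * int) : fld X := nprod 1 (hs g) (Gam x) (-1).

(* the normally ordered product [g(z) Gam_x(z)] *)
Lemma gopE g x n u N : (forall i, (N <= i)%N -> Gam x (n + i%:Z) u = 0) ->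
    (forall i, (N <= i)%N -> hs g i%:Z u = 0) ->
  gop g x n u = \sum_(i < N) hs g (-1 - i%:Z) (Gam x (n + i%:Z) u)
    + \sum_(i < N) Gam x (n - 1 - i%:Z) (hs g i%:Z u).
Proof.
move=> h1 h2; rewrite /gop /nprod /D.
have cf1 j : cf K (-1) j = 1.
  elim: j => [|j IH]; first exact: cf0.
  apply: (mulfI (_ : j.+1%:R != 0)); first by rewrite pnatr_eq0.
  rewrite cfSr IH !mulr1 (_ : -1 - j%:Z = - j.+1%:Z); last by lia.
  by rewrite rmorphN opprK.
rewrite (@exE _ _ _ _ _ _ N) => [|j le]; last by rewrite /prodf h1 ?(islin0 (hs_is _ _ _)).
rewrite (@exE _ _ _ _ _ _ N) => [|j le]; last first.
  rewrite /prodf add0r h2 //; exact: islin0 (vop_is _ _ _ _ _ _).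
rewrite mulr1 exprN1 invrN1 scaleN1r opprK; congr (_ + _); apply: eq_bigr => j _.
  by rewrite cf1 scale1r /prodf add0r.
by rewrite cf1 scale1r /prodf add0r.
Qed.

Lemma Y_x n u : Y st_x n u = Gam (1, 0) n u + Gam (-1, 1) n u.
Proof.
have -> : st_x = 1 *: e0 P (1, 0) + e0 P (-1, 1) by rewrite scale1r.
by rewrite Y_lin !Y_e0 /lcomb scale1r.
Qed.

Lemma Y_y n u : Y st_y n u = gop (nu + 2^-1 *: al) (-1, 0) n u + gop (nu - (3 / 2) *: al) (1, -1) n u.
Proof.
have -> : st_y = 1 *: hP (nu + 2^-1 *: al) 0 (e0 P (-1, 0)) + hP (nu - (3 / 2) *: al) 0 (e0 P (1, -1)).
  by rewrite scale1r.
rewrite Y_lin !(Y_hP _ _ (e0_par _)) !Y_e0 /lcomb scale1r.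
by [].
Qed.

Lemma Y_h n u : Y st_h n u = hs (2 *: mu) n u.
Proof.
have [ga gb] := (Y_good r X (hP_par (2 *: mu) 0 (e0_par (0, 0))), gd_hs r X (2 *: mu)).
rewrite (gd_inj ga gb) // Y_vac iota_hP iota_e0; by [].
Qed.

Lemma Gam_hs x n g m u : Gam x n (hs g m u) =
  hs g m (Gam x n u) - pairing g (lat K x) *: Gam x (m + n) u.
Proof.
by rewrite (@vop_hs K sector (swt r) X (lat K x) (gexp x) (gsh x) (fun _ => 1) (Gam_hw r x)) addrK.
Qed.

Lemma Gam_pos x n i : - gexp x i - 1 < n -> Gam x n (e0 X i) = 0.
Proof. by move=> le; rewrite Gam_e0 /Em Ex_neg //; lia. Qed.

Lemma Gam_hs_pos x n g m i : - gexp x i - 1 < n -> - gexp x i - 1 < m + n ->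
  Gam x n (hs g m (e0 X i)) = 0.
Proof. by move=> l1 l2; rewrite Gam_hs !Gam_pos // (islin0 (hs_is _ _ _)) scaler0 subr0. Qed.

End OspStates.

Section HeisenbergLinear.
Variables (K : numFieldType) (I : choiceType) (w : I -> 'rV[K]_3) (X : fockmod K I).
Local Notation hs := (@hs K I w X).

Lemma hs_linl n u : islin (fun h : 'rV[K]_3 => hs h n u).
Proof.
move=> c g h; case: n => [[|n]|n].
- apply: (@fx_eq _ _ _ _ (hs (c *: g + h) 0) (fun u => c *: hs g 0 u + hs h 0 u)); first exact: hs_is.
    by apply: islin_add; [apply: islin_scale|]; exact: hs_is.
  by move=> A i; rewrite !hs0U pairingDl pairingZl scalerDl scalerA.
- rewrite !hsP scaler_sumr -big_split; apply: eq_bigr => i _ /=.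
  by rewrite pairingDl pairingZl; mod_ring K X.
- rewrite !hsN scaler_sumr -big_split; apply: eq_bigr => i _ /=.
  by rewrite !mxE; mod_ring K X.
Qed.

Lemma hsDl g h n u : hs (g + h) n u = hs g n u + hs h n u.
Proof. exact: (islinD (hs_linl n u)). Qed.
Lemma hsZl c g n u : hs (c *: g) n u = c *: hs g n u.
Proof. exact: (islinZ (hs_linl n u)). Qed.
Lemma hsNl g n u : hs (- g) n u = - hs g n u.
Proof. exact: (islinN (hs_linl n u)). Qed.

Lemma Em0 g u : Em w g 0 u = u :> X. Proof. by []. Qed.
Lemma Em1 g u : Em w g 1%:Z u = hs g (-1) u.
Proof.
by rewrite -[LHS]scale1r /Em (@ExE _ _ _ (gm_is w g) 1%:Z 1%N) // big_ord1 subrr Ex0.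
Qed.
Lemma Em2 g u : Em w g 2%:Z u = 2^-1 *: (hs g (-1) (hs g (-1) u) + hs g (-2) u).
Proof.
have h : 2%:Z%:~R *: Em w g 2%:Z u = hs g (-1) (hs g (-1) u) + hs g (-2) u.
  rewrite /Em (@ExE _ _ _ (gm_is w g) 2%:Z 2%N) // big_ord_recl big_ord1.
  rewrite (_ : 2%:Z - (lift ord0 ord0 : nat).+1%:Z = 0) // Ex0.
  rewrite (_ : 2%:Z - (ord0 : nat).+1%:Z = 1%:Z) //.
  by rewrite -/(Em w g 1%:Z u) Em1.
by rewrite -h scalerA -[2%:Z%:~R]/(2 : K) mulVf ?scale1r // pnatr_eq0.
Qed.

Lemma hs_e0 h i : hs h 0 (e0 X i) = pairing h (w i) *: e0 X i.
Proof. exact: hs0U. Qed.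

End HeisenbergLinear.

(** * Normally ordered products on vectors of low degree *)

Section NormalOrder.
Variables (K : numFieldType) (r : K) (X : fockmod K sector).
Local Notation hs := (@hs K sector (swt r) X).
Local Notation Gam := (@Gam K r X).
Local Notation gop := (gop r (X := X)).
Variables (g : 'rV[K]_3) (x : int * int) (i : sector).
Local Notation ga := (lat K x).
Local Notation ga' := (swt r i).
Local Notation E := (e0 X i).
Local Notation G := (e0 X (gsh x i)).

Lemma Gam_deg D n u : supp (Sd i D) u -> D - n - 1 - gexp x i < 0 -> Gam x n u = 0.
Proof.
move=> hu lt; have := @vop_supp _ _ (swt r) X ga (gexp x) (gsh x) (fun _ => 1) i D n u hu.
exact: Sd_neg.
Qed.

Lemma hs_deg D n u h : supp (Sd i D) u -> D < n -> hs h n u = 0.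
Proof.
by move=> hu lt; have := @hs_supp _ _ (swt r) X h n i D u hu; apply: Sd_neg; lia.
Qed.

Lemma gop_sum D n u (N : nat) : supp (Sd i D) u -> D < n + N%:Z + 1 + gexp x i -> D < N%:Z ->
  gop g x n u = \sum_(l < N) hs g (-1 - l%:Z) (Gam x (n + l%:Z) u)
    + \sum_(l < N) Gam x (n - 1 - l%:Z) (hs g l%:Z u).
Proof.
move=> hu l1 l2; apply: gopE => l le; first by apply: (Gam_deg hu); lia.
by apply: (hs_deg _ hu); lia.
Qed.

Lemma gop_deg D n u : supp (Sd i D) u -> D - n - gexp x i < 0 -> gop g x n u = 0.
Proof.
move=> hu lt; rewrite (@gop_sum D n u (`|D| + `|n| + `|gexp x i|).+1 hu); try by lia.
rewrite !big1 ?addr0 // => l _; last by rewrite (Gam_deg hu) ?(islin0 (hs_is _ _ _)) //; lia.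
have := @hs_supp _ _ (swt r) X g l%:Z i D u hu => h.
have := @vop_supp _ _ (swt r) X ga (gexp x) (gsh x) (fun _ => 1) i _ (n - 1 - l%:Z) _ h.
by apply: Sd_neg; lia.
Qed.

Lemma hs1_Sd a m D : D = - m -> supp (Sd i D) (hs a m E).
Proof. by move=> ->; have := @hs_supp _ _ (swt r) X a m i 0 E (Sd_e0 X i); rewrite sub0r. Qed.
Lemma hs1S a : supp (Sd i 1) (hs a (-1) E). Proof. by apply: hs1_Sd; lia. Qed.
Lemma hsm2S a : supp (Sd i 2) (hs a (-2) E). Proof. by apply: hs1_Sd; lia. Qed.
Lemma hs2_Sd a b : supp (Sd i 2) (hs a (-1) (hs b (-1) E)).
Proof. by rewrite (_ : 2 = 1 - -1) //; apply: hs_supp; exact: hs1S. Qed.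

Lemma hs_pos a (m : int) : 0 < m -> hs a m E = 0.
Proof. by move=> m0; apply: hs_deg m0; exact: Sd_e0. Qed.

Lemma hsH a (m n : int) u : hs g m (hs a n u) =
  hs a n (hs g m u) + (if m + n == 0 then m%:~R * pairing g a else 0) *: u.
Proof. exact: hs_comm. Qed.

Lemma hs0_1 a u : hs g 0 (hs a (-1) u) = hs a (-1) (hs g 0 u).
Proof. by rewrite hsH scale0r addr0. Qed.
Lemma hs0_2 a u : hs g 0 (hs a (-2) u) = hs a (-2) (hs g 0 u).
Proof. by rewrite hsH scale0r addr0. Qed.
Lemma hs1_1 a u : hs g 1 (hs a (-1) u) = hs a (-1) (hs g 1 u) + pairing g a *: u.
Proof. by rewrite hsH mul1r. Qed.
Lemma hs1_2 a u : hs g 1 (hs a (-2) u) = hs a (-2) (hs g 1 u).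
Proof. by rewrite hsH scale0r addr0. Qed.
Lemma hs2_1 a u : hs g 2 (hs a (-1) u) = hs a (-1) (hs g 2 u).
Proof. by rewrite hsH scale0r addr0. Qed.
Lemma hs2_2 a u : hs g 2 (hs a (-2) u) = hs a (-2) (hs g 2 u) + (2 * pairing g a) *: u.
Proof. by rewrite hsH. Qed.

Lemma GamH (n m n' : int) a u : m + n = n' -> Gam x n (hs a m u) =
  hs a m (Gam x n u) - pairing a ga *: Gam x n' u.
Proof. by move=> <-; exact: Gam_hs. Qed.

(** The vectors met in the operator products have degree at most two, so three terms of each half
    suffice. The index equations are premises so that rewriting leaves plain numerals. *)
Lemma gop3 D (n n1 n2 m1 m2 m3 : int) u : supp (Sd i D) u ->
    D < n + 3%:Z + 1 + gexp x i -> D < 3%:Z -> n + 1 = n1 -> n + 2 = n2 ->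
    n - 1 = m1 -> n - 2 = m2 -> n - 3 = m3 ->
  gop g x n u = hs g (-1) (Gam x n u) + hs g (-2) (Gam x n1 u) + hs g (-3) (Gam x n2 u)
    + (Gam x m1 (hs g 0 u) + Gam x m2 (hs g 1 u) + Gam x m3 (hs g 2 u)).
Proof.
move=> hu l1 l2 <- <- <- <- <-; rewrite (gop_sum (N := 3) hu l1 l2).
have hI (m m' p p' : int) : m = m' -> p = p' -> hs g m (Gam x p u) = hs g m' (Gam x p' u).
  by move=> -> ->.
have gI (m m' p p' : int) : m = m' -> p = p' -> Gam x p (hs g m u) = Gam x p' (hs g m' u).
  by move=> -> ->.
rewrite !big_ord_recr /= !big_ord0 /= !add0r.
by apply: (congr2 +%R); apply: (congr2 +%R); try apply: (congr2 +%R); try (by apply: hI; lia); apply: gI; lia.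
Qed.

Definition GamR a u := ((GamH (n := 2) (n' := 1) (m := -1) a u erefl),
  (GamH (n := 1) (n' := 0) (m := -1) a u erefl),
  (GamH (n := 0) (n' := -1) (m := -1) a u erefl),
  (GamH (n := -1) (n' := -2) (m := -1) a u erefl),
  (GamH (n := 1) (n' := -1) (m := -2) a u erefl),
  (GamH (n := 0) (n' := -2) (m := -2) a u erefl)).

Definition opR a u := ((GamR a u), (hs0_1 a u), (hs0_2 a u), (hs1_1 a u), (hs1_2 a u), (hs2_1 a u), (hs2_2 a u)).

Lemma hsp1 a : hs a 1 E = 0. Proof. exact: hs_pos. Qed.
Lemma hsp2 a : hs a 2 E = 0. Proof. exact: hs_pos. Qed.

Let GE n : Gam x n E = Em (swt r) ga (- n - 1 - gexp x i) G. Proof. exact: Gam_e0. Qed.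
Let Gl c n u : Gam x n (c *: u) = c *: Gam x n u. Proof. exact: (islinZ (vop_is _ _ _ _ _ _)). Qed.
Let Gd n u v : Gam x n (u + v) = Gam x n u + Gam x n v. Proof. exact: (islinD (vop_is _ _ _ _ _ _)). Qed.
Let Gz n : Gam x n 0 = 0. Proof. exact: (islin0 (vop_is _ _ _ _ _ _)). Qed.
Let Hl a c n u : hs a n (c *: u) = c *: hs a n u. Proof. exact: (islinZ (hs_is _ _ _)). Qed.
Let Hd a n u v : hs a n (u + v) = hs a n u + hs a n v. Proof. exact: (islinD (hs_is _ _ _)). Qed.
Let Hb a n u v : hs a n (u - v) = hs a n u - hs a n v. Proof. exact: (islinB (hs_is _ _ _)). Qed.
Let Hz a n : hs a n 0 = 0. Proof. exact: (islin0 (hs_is _ _ _)). Qed.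
Let Gn n u : Gam x n (- u) = - Gam x n u. Proof. exact: (islinN (vop_is _ _ _ _ _ _)). Qed.
Let Hn a n u : hs a n (- u) = - hs a n u. Proof. exact: (islinN (hs_is _ _ _)). Qed.
Let lins := (Gl, Gd, Gz, Gn, Hl, Hd, Hb, Hz, Hn).

Section Exponent0.
Hypothesis x0 : gexp x i = 0.
Let G1 : Gam x 1 E = 0. Proof. by rewrite GE x0. Qed.
Let G0 : Gam x 0 E = 0. Proof. by rewrite GE x0. Qed.
Let Gm1 : Gam x (-1) E = G. Proof. by rewrite GE x0. Qed.
Let Gm2 : Gam x (-2) E = hs ga (-1) G. Proof. by rewrite GE x0 -Em1. Qed.

Lemma gop1_hs1hs1 a b : gop g x 1 (hs a (-1) (hs b (-1) E)) =
  (pairing a ga * pairing b ga) *: hs g (-1) G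
  + pairing g ga' *: ((pairing a ga * pairing b ga) *: hs ga (-1) G
      - pairing b ga *: hs a (-1) G - pairing a ga *: hs b (-1) G)
  + pairing g a *: (hs b (-1) G - pairing b ga *: hs ga (-1) G)
  + pairing g b *: (hs a (-1) G - pairing a ga *: hs ga (-1) G).
Proof.
rewrite (gop3 (hs2_Sd a b) _ _ (n1 := 2) (n2 := 3) (m1 := 0) (m2 := -1) (m3 := -2)) ?x0 //.
rewrite (@Gam_deg 2 3) ?(@Gam_deg 2 2) ?x0 //; try exact: hs2_Sd.
rewrite !(opR, lins) hs_e0 hsp1 hsp2 !(opR, lins) G1 G0 Gm1 Gm2 !lins.
mod_ring K X.
Qed.

Lemma gop1_hs2 a : gop g x 1 (hs a (-2) E) =
  - pairing a ga *: hs g (-1) G + (2 * pairing g a - pairing g ga' * pairing a ga) *: hs ga (-1) G.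
Proof.
rewrite (gop3 (hsm2S a) _ _ (n1 := 2) (n2 := 3) (m1 := 0) (m2 := -1) (m3 := -2)) ?x0 //.
rewrite (@Gam_deg 2 3) ?(@Gam_deg 2 2) ?x0 //; try by [exact: hs1S|exact: hsm2S].
rewrite !(opR, lins) hs_e0 hsp1 hsp2 !(opR, lins) G1 G0 Gm1 Gm2 !lins.
mod_ring K X.
Qed.
End Exponent0.

Section ExponentN1.
Hypothesis x0 : gexp x i = -1.
Let G1 : Gam x 1 E = 0. Proof. by rewrite GE x0. Qed.
Let G0 : Gam x 0 E = G. Proof. by rewrite GE x0. Qed.
Let Gm1 : Gam x (-1) E = hs ga (-1) G. Proof. by rewrite GE x0 -Em1. Qed.
Let Gm2 : Gam x (-2) E = 2^-1 *: (hs ga (-1) (hs ga (-1) G) + hs ga (-2) G).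
Proof. by rewrite GE x0 -Em2. Qed.

Lemma gop0_hs1 a : gop g x 0 (hs a (-1) E) = hs g (-1) (hs a (-1) G)
  - pairing a ga *: (hs g (-1) (hs ga (-1) G) + hs g (-2) G)
  + pairing g ga' *: (hs a (-1) (hs ga (-1) G)) + ((pairing g a - pairing g ga' * pairing a ga) / 2)
     *: (hs ga (-1) (hs ga (-1) G) + hs ga (-2) G).
Proof.
rewrite (gop3 (hs1S a) _ _ (n1 := 1) (n2 := 2) (m1 := -1) (m2 := -2) (m3 := -3)) ?x0 //.
rewrite (@Gam_deg 1 2) ?x0 //; last by [exact: hs1S|exact: hsm2S].
rewrite !(opR, lins) hs_e0 hsp1 hsp2 !(opR, lins) G1 G0 Gm1 Gm2 !lins.
by mod_coords K X; field.
Qed.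

Lemma gop1_hs1 a : gop g x 1 (hs a (-1) E) = - pairing a ga *: hs g (-1) G
  + pairing g ga' *: hs a (-1) G + (pairing g a - pairing g ga' * pairing a ga) *: hs ga (-1) G.
Proof.
rewrite (gop3 (hs1S a) _ _ (n1 := 2) (n2 := 3) (m1 := 0) (m2 := -1) (m3 := -2)) ?x0 //.
rewrite (@Gam_deg 1 2) ?(@Gam_deg 1 3) ?x0 //; try by [exact: hs1S|exact: hsm2S].
rewrite !(opR, lins) hs_e0 hsp1 hsp2 !(opR, lins) G1 G0 Gm1 !lins.
mod_ring K X.
Qed.

Lemma gop2_hs1 a : gop g x 2 (hs a (-1) E) = (pairing g a - pairing g ga' * pairing a ga) *: G.
Proof.
rewrite (gop3 (hs1S a) _ _ (n1 := 3) (n2 := 4) (m1 := 1) (m2 := 0) (m3 := -1)) ?x0 //.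
rewrite (@Gam_deg 1 2) ?(@Gam_deg 1 3) ?(@Gam_deg 1 4) ?x0 //; try by [exact: hs1S|exact: hsm2S].
rewrite !(opR, lins) hs_e0 hsp1 hsp2 !(opR, lins) G1 G0 !lins.
mod_ring K X.
Qed.

Lemma Gam0_hs1 a : Gam x 0 (hs a (-1) E) = hs a (-1) G - pairing a ga *: hs ga (-1) G.
Proof. by rewrite !opR G0 Gm1. Qed.
Lemma Gam1_hs1 a : Gam x 1 (hs a (-1) E) = - pairing a ga *: G.
Proof. by rewrite !opR G0 G1 !lins add0r scaleNr. Qed.
Lemma Gam0_e0N : Gam x 0 E = G. Proof. exact: G0. Qed.
End ExponentN1.

Section Exponent1.
Hypothesis x0 : gexp x i = 1.
Let Gm1 : Gam x (-1) E = 0. Proof. by rewrite GE x0. Qed.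
Let Gm2 : Gam x (-2) E = G. Proof. by rewrite GE x0. Qed.

Lemma gop0_hs1_pos a : gop g x 0 (hs a (-1) E) = (pairing g a - pairing g ga' * pairing a ga) *: G.
Proof.
rewrite (gop3 (hs1S a) _ _ (n1 := 1) (n2 := 2) (m1 := -1) (m2 := -2) (m3 := -3)) ?x0 //.
rewrite (@Gam_deg 1 2) ?(@Gam_deg 1 1) ?(@Gam_deg 1 0) ?x0 //; try by [exact: hs1S|exact: hsm2S].
rewrite !(opR, lins) hs_e0 hsp1 hsp2 !(opR, lins) Gm1 Gm2 !lins.
mod_ring K X.
Qed.
End Exponent1.

Lemma gop1_e0 : gexp x i = -2 -> gop g x 1 E = hs g (-1) G + pairing g ga' *: hs ga (-1) G.
Proof.
move=> x0; rewrite (gop3 (Sd_e0 X i) _ _ (n1 := 2) (n2 := 3) (m1 := 0) (m2 := -1) (m3 := -2)) ?x0 //.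
rewrite hs_e0 hsp1 hsp2 !lins !GE x0 (_ : - (1 : int) - 1 - -2 = 0) //.
have En m : m < 0 -> Em (swt r) ga m G = 0 by exact: Ex_neg.
rewrite (_ : - (0 : int) - 1 - -2 = 1%:Z) // Em1 (En (-2 - 1 - -2)) // (En (-3 - 1 - -2)) //.
by rewrite Em0 !lins !addr0.
Qed.

End NormalOrder.

Section OspRealization.
Variables (K : numFieldType) (r : K) (X : fockmod K sector) (P : fockmod K (int * int)%type).
Local Notation hs := (@hs K sector (swt r) X).
Local Notation vac := (svac X).
Local Notation Gam := (@Gam K r X).
Local Notation Y := (@Y K r X P).
Local Notation io := (@iota K X P).
Local Notation al := (wal K).
Local Notation cc := (wc K).
Local Notation mu := (wmu (lev K)).
Local Notation nu := (wnu (lev K)).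
Local Notation PV := (Pvsa r X P).
Local Notation gop := (@gop K r X).
Local Notation g1 := (nu + 2^-1 *: al).
Local Notation g2 := (nu - (3 / 2) *: al).
Local Notation ee n m := (e0 X (None, (n, m))).

Lemma mu_nu : mu = nu - (3 / 4) *: cc.
Proof. by apply/rowP => i; rewrite /wmu /wnu /lev !mxE; field. Qed.
Lemma lat10 : lat K (1, 0) = al + 2^-1 *: cc.
Proof. by apply/rowP => i; rewrite /lat !mxE /=; field. Qed.
Lemma latN1 : lat K (-1, 1) = - al + 2^-1 *: cc.
Proof. by apply/rowP => i; rewrite /lat !mxE /=; field. Qed.
Lemma latN0 : lat K (-1, 0) = - al - 2^-1 *: cc.
Proof. by apply/rowP => i; rewrite /lat !mxE /=; field. Qed.
Lemma lat1N : lat K (1, -1) = al - 2^-1 *: cc.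
Proof. by apply/rowP => i; rewrite /lat !mxE /=; field. Qed.
Lemma lat0N : lat K (0, -1) = - cc.
Proof. by apply/rowP => i; rewrite /lat !mxE /=; field. Qed.
Lemma lat2N : lat K (2, -2) = 2 *: al - cc.
Proof. by apply/rowP => i; rewrite /lat !mxE /=; field. Qed.
Lemma pair_nunu : pairing nu nu = 3 / 4.
Proof. by rewrite /wnu /lev !pairE; field. Qed.
Lemma pair_nual : pairing nu al = 0.
Proof. by rewrite /wnu /lev !pairE; field. Qed.
Lemma pair_nuc : pairing nu cc = 1.
Proof. by rewrite /wnu /lev !pairE; field. Qed.
Lemma swtN x : swt r (None, x) = lat K x. Proof. exact: add0r. Qed.
Definition latE := (lat10, latN1, latN0, lat1N, lat0N, lat2N).

Let HD g n u v : hs g n (u + v) = hs g n u + hs g n v. Proof. exact: (islinD (hs_is _ _ _)). Qed.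
Let HZ g c n u : hs g n (c *: u) = c *: hs g n u. Proof. exact: (islinZ (hs_is _ _ _)). Qed.
Let HN g n u : hs g n (- u) = - hs g n u. Proof. exact: (islinN (hs_is _ _ _)). Qed.
Let hcom g h u : hs g (-1) (hs h (-1) u) = hs h (-1) (hs g (-1) u).
Proof. by rewrite hs_comm scale0r addr0. Qed.

Lemma opeP (a b u : P) c : (forall n : int, 0 <= n ->
    Y a n (io b) = (if n == 0 then io u else 0) + (if n == 1 then c else 0) *: vac) ->
  @ope K PV a b u c.
Proof.
move=> h n n0; rewrite -[vprod _ _ _]/(pprod r X a n b).
apply: (@iota_inj K X P); rewrite pprod_iota h // (islinD (@iota_lin K X P)).
rewrite (islinZ (@iota_lin K X P)) iota_e0; congr (_ + _).
by case: ifP => // _; rewrite (islin0 (@iota_lin K X P)).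
Qed.

Let Gd x n u v : Gam x n (u + v) = Gam x n u + Gam x n v. Proof. exact: (islinD (vop_is _ _ _ _ _ _)). Qed.
Let Gl x c n u : Gam x n (c *: u) = c *: Gam x n u. Proof. exact: (islinZ (vop_is _ _ _ _ _ _)). Qed.
Let gopl g x n : islin (gop g x n). Proof. exact: (lfield_prod 1 _ (lfield_hs _ _ _) (@Gam_fld K r X x)).1. Qed.
Let god g x n u v : gop g x n (u + v) = gop g x n u + gop g x n v. Proof. exact: (islinD (gopl g x n)). Qed.
Let gol g x c n u : gop g x n (c *: u) = c *: gop g x n u. Proof. exact: (islinZ (gopl g x n)). Qed.
Let gob g x n u v : gop g x n (u - v) = gop g x n u - gop g x n v. Proof. exact: (islinB (gopl g x n)). Qed.

Let iox : io (st_x P) = ee 1 0 + ee (-1) 1.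
Proof. by rewrite (islinD (@iota_lin K X P)) !iota_e0. Qed.
Let ioy : io (st_y P) = hs g1 (-1) (ee (-1) 0) + hs g2 (-1) (ee 1 (-1)).
Proof. by rewrite (islinD (@iota_lin K X P)) !(iota_hP r) !iota_e0. Qed.
Let ioh : io (st_h P) = hs (2 *: mu) (-1) vac.
Proof. by rewrite (iota_hP r) iota_e0. Qed.
Let iof : io (st_f P) = (lev K + 2) *: (2^-1 *: hs al (-1) (hs al (-1) (ee 0 (-1)))
    + 2^-1 *: hs al (-2) (ee 0 (-1)) + ee 2 (-2))
  - hs nu (-1) (hs nu (-1) (ee 0 (-1))) - (lev K + 1) *: hs nu (-2) (ee 0 (-1)).
Proof.
rewrite /st_f /st_om !(islinB (@iota_lin K X P)) !(islinZ (@iota_lin K X P)).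
rewrite !(islinD (@iota_lin K X P)) !(islinZ (@iota_lin K X P)) !(iota_hP r) !iota_e0.
by [].
Qed.

Lemma st_ee : @ope K PV (st_e P) (st_e P) 0 0.
Proof.
apply: opeP => n n0; rewrite Y_e0 iota_e0 Gam_pos /gexp /=; last by lia.
by rewrite (islin0 (@iota_lin K X P)) !if_same scale0r addr0.
Qed.

Lemma st_ex : @ope K PV (st_e P) (st_x P) 0 0.
Proof.
apply: opeP => n n0; rewrite Y_e0 iox Gd !Gam_pos /gexp /=; try by lia.
by rewrite (islin0 (@iota_lin K X P)) !if_same scale0r !addr0.
Qed.

Lemma st_xx : @ope K PV (st_x P) (st_x P) (2 *: st_e P) 0.
Proof.
apply: opeP => n n0; rewrite Y_x iox !Gd (@Gam_pos _ _ _ (1, 0) n (None, (1, 0))) /gexp /=; last by lia.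
rewrite (@Gam_pos _ _ _ (-1, 1) n (None, (-1, 1))) /gexp /=; last by lia.
rewrite if_same scale0r !addr0 add0r.
have [->|ne] := eqVneq n 0; last by rewrite !Gam_pos ?addr0 // /gexp /=; lia.
by rewrite !Gam0_e0N // (islinZ (@iota_lin K X P)) iota_e0 scaler_nat mulr2n.
Qed.

Lemma st_hx : @ope K PV (st_h P) (st_x P) (st_x P) 0.
Proof.
apply: opeP => n n0; rewrite Y_h iox (islinD (hs_is _ _ _)) if_same scale0r addr0.
have [->|ne] := eqVneq n 0; last by rewrite !hs_pos ?addr0 //; lia.
rewrite !hs_e0; congr (_ + _); rewrite -[RHS]scale1r; congr (_ *: _);
  by rewrite /swt /lat /wmu /lev /= !pairE; field.
Qed.

Lemma st_hy : @ope K PV (st_h P) (st_y P) (- st_y P) 0.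
Proof.
apply: opeP => n n0; rewrite Y_h ioy (islinD (hs_is _ _ _)) if_same scale0r addr0.
rewrite [hs _ n (hs g1 _ _)]hs_comm [hs _ n (hs g2 _ _)]hs_comm.
have [->|ne] := eqVneq n 0.
  rewrite !hs_e0 (islinN (@iota_lin K X P)) ioy !(islinZ (hs_is _ _ _)) !scale0r !addr0 opprD.
  have -> : pairing (2 *: mu) (swt r (None, (-1, 0))) = -1.
    by rewrite swtN latE /wmu /lev !pairE; field.
  have -> : pairing (2 *: mu) (swt r (None, (1, -1))) = -1.
    by rewrite swtN latE /wmu /lev !pairE; field.
  by rewrite !scaleN1r.
rewrite !hs_pos; try lia.
rewrite !(islin0 (hs_is _ _ _)) !add0r.
have -> : pairing (2 *: mu) g1 = 0 by rewrite /wmu /wnu /lev !pairE; field.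
have -> : pairing (2 *: mu) g2 = 0 by rewrite /wmu /wnu /lev !pairE; field.
by rewrite mulr0 !if_same !scale0r addr0.
Qed.

Let k1 : pairing g1 (lat K (1, 0)) = 1. Proof. by rewrite /lat /wnu /lev /= !pairE; field. Qed.
Let k2 : pairing g2 (lat K (-1, 1)) = 2. Proof. by rewrite /lat /wnu /lev /= !pairE; field. Qed.

Lemma st_xy : @ope K PV (st_x P) (st_y P) (st_h P) (2 * lev K).
Proof.
apply: opeP => n n0; rewrite Y_x ioy !Gd.
rewrite (@Gam_hs_pos _ _ _ (-1, 1) n _ _ (None, (-1, 0))) /gexp /=; try by lia.
rewrite (@Gam_hs_pos _ _ _ (1, 0) n _ _ (None, (1, -1))) /gexp /=; try by lia.
rewrite addr0 add0r.
have [->|ne] := eqVneq n 0.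
  rewrite !Gam0_hs1 // k1 k2 /= scale0r addr0 ioh.
  rewrite (_ : gsh (1, 0) (None, (-1, 0)) = (None, (0, 0))) //.
  rewrite (_ : gsh (-1, 1) (None, (1, -1)) = (None, (0, 0))) //.
  by rewrite -/vac mu_nu !latE; move: (wnu (lev K)) => v; rewrite !(hsDl, hsZl, hsNl); mod_coords K X; field.
have [->|ne1] := eqVneq n 1.
  rewrite !Gam1_hs1 // k1 k2 add0r.
  rewrite (_ : gsh (1, 0) (None, (-1, 0)) = (None, (0, 0))) //.
  rewrite (_ : gsh (-1, 1) (None, (1, -1)) = (None, (0, 0))) //.
  by rewrite -scalerDl; congr (_ *: _); rewrite /lev; field.
by rewrite !Gam_hs_pos ?add0r ?scale0r // /gexp /=; lia.
Qed.

(** Equal exponents pair to $+1$, which leaves at most a simple pole between equal summands of $y$;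
    only the mixed terms survive. *)
Lemma st_y_small (n : int) : 1 <= n ->
  Y (st_y P) n (io (st_y P)) = gop g1 (-1, 0) n (hs g2 (-1) (ee 1 (-1))) +
    gop g2 (1, -1) n (hs g1 (-1) (ee (-1) 0)).
Proof.
move=> n1; rewrite Y_y ioy !god.
rewrite (@gop_deg _ _ _ g1 (-1, 0) (None, (-1, 0)) 1 n) ?add0r; last 2 first.
- exact: hs1S.
- by rewrite /gexp /=; lia.
rewrite [X in _ + (_ + X)](@gop_deg _ _ _ g2 (1, -1) (None, (1, -1)) 1 n) ?addr0 //.
- exact: hs1S.
- by rewrite /gexp /=; lia.
Qed.

Let p12 : pairing g1 g2 = 0. Proof. by rewrite /wnu /lev !pairE; field. Qed.
Let p21 : pairing g2 g1 = 0. Proof. by rewrite pairingC p12. Qed.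
Let p11 : pairing g1 g1 = 1. Proof. by rewrite /wnu /lev !pairE; field. Qed.
Let p22 : pairing g2 g2 = 3. Proof. by rewrite /wnu /lev !pairE; field. Qed.
Let q1m : pairing g1 (lat K (-1, 0)) = -1. Proof. by rewrite /lat /wnu /lev /= !pairE; field. Qed.
Let q1p : pairing g1 (lat K (1, -1)) = 0. Proof. by rewrite /lat /wnu /lev /= !pairE; field. Qed.
Let q2m : pairing g2 (lat K (-1, 0)) = 1. Proof. by rewrite /lat /wnu /lev /= !pairE; field. Qed.
Let q2p : pairing g2 (lat K (1, -1)) = -2. Proof. by rewrite /lat /wnu /lev /= !pairE; field. Qed.

Lemma st_yy : @ope K PV (st_y P) (st_y P) (- 2 *: st_f P) 0.
Proof.
apply: opeP => n n0; rewrite if_same scale0r addr0.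
have [->|ne] := eqVneq n 0.
  rewrite Y_y ioy !god (@gop0_hs1 _ _ _ g1 (-1, 0) (None, (1, -1))) //.
  rewrite (@gop0_hs1 _ _ _ g2 (1, -1) (None, (-1, 0))) //.
  rewrite (@gop0_hs1_pos _ _ _ g1 (-1, 0) (None, (-1, 0))) //.
  rewrite (@gop0_hs1_pos _ _ _ g2 (1, -1) (None, (1, -1))) //.
  rewrite !swtN p12 p21 p11 p22 q1m q1p q2m q2p.
  rewrite (_ : gsh (-1, 0) (None, (1, -1)) = (None, (0, -1))) //.
  rewrite (_ : gsh (1, -1) (None, (-1, 0)) = (None, (0, -1))) //.
  rewrite (_ : gsh (1, -1) (None, (1, -1)) = (None, (2, -2))) //.
  rewrite (islinZ (@iota_lin K X P)) iof !latE.
  move: (wnu (lev K)) => v; rewrite !(hsDl, hsZl, hsNl, HD, HZ, HN).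
  rewrite !(hcom cc al, hcom v al, hcom v cc) /lev.
  by mod_coords K X; field.
rewrite st_y_small; last by lia.
have [->|ne1] := eqVneq n 1.
  rewrite !gop1_hs1 // !swtN p12 p21 q1p q2m.
  rewrite (_ : gsh (-1, 0) (None, (1, -1)) = (None, (0, -1))) //.
  rewrite (_ : gsh (1, -1) (None, (-1, 0)) = (None, (0, -1))) //.
  mod_ring K X.
have [->|ne2] := eqVneq n 2.
  rewrite !gop2_hs1 // !swtN p12 p21 q1p q2m.
  by mod_ring K X.
rewrite (@gop_deg _ _ _ _ _ (None, (1, -1)) 1 n) ?add0r; [|exact: hs1S|by rewrite /gexp /=; lia].
by apply: (@gop_deg _ _ _ _ _ (None, (-1, 0)) 1 n); [exact: hs1S|rewrite /gexp /=; lia].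
Qed.

Lemma st_yf (n : int) : 3 <= n -> Y (st_y P) n (io (st_f P)) = 0.
Proof.
move=> le; rewrite Y_y iof !(gob, gol, god).
have z g (x : int * int) (i : sector) D (u : X) : supp (Sd i D) u -> D - gexp x i <= 2 -> gop g x n u = 0.
  by move=> hu l; apply: (@gop_deg K r X g x i D n u hu); lia.
rewrite [gop _ (-1, 0) n (ee 2 _)](z _ (-1, 0) (None, (2, -2)) 0) //; last exact: Sd_e0.
rewrite [gop _ (1, -1) n (ee 2 _)](z _ (1, -1) (None, (2, -2)) 0) //; last exact: Sd_e0.
rewrite !(z _ (-1, 0) (None, (0, -1)) 2) ?(z _ (1, -1) (None, (0, -1)) 2) //;
  try (by apply: hs2_Sd); try (by apply: hsm2S).
by rewrite !scaler0 !addr0 !scaler0 !subr0 addr0.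
Qed.

(** The input [yf1] of [ope_yf], computed directly: the coefficients on the exponents [(-1, -1)] and
    [(1, -2)] cancel at level $-\frac32$. *)
Lemma st_y1f : Y (st_y P) 1 (io (st_f P)) = 0.
Proof.
rewrite Y_y iof !(gob, gol, god) !gop1_hs1hs1 // !gop1_hs2 //.
rewrite gop1_e0 // (@gop_deg _ _ _ _ (1, -1) (None, (2, -2)) 0 1) //; last exact: Sd_e0.
rewrite (_ : gsh (-1, 0) (None, (0, -1)) = (None, (-1, -1))) //.
rewrite (_ : gsh (1, -1) (None, (0, -1)) = (None, (1, -2))) //.
rewrite (_ : gsh (-1, 0) (None, (2, -2)) = (None, (1, -2))) //.
rewrite !swtN !latE; move: pair_nunu pair_nual pair_nuc; move: (wnu (lev K)) => v vv va vc.
rewrite !(vv, va, vc, (pairingC al v), (pairingC cc v), pairE) !(hsDl, hsZl, hsNl) /lev.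
by mod_coords K X; field.
Qed.

Theorem st_affine : @affine_map K (lev K) PV (osp_state (V := PV) (st_x P) (st_y P) (st_e P) (st_f P) (st_h P)).
Proof.
have px : vpar true (st_x P : PV) by apply: suppD; apply: suppU.
have py : vpar true (st_y P : PV) by apply: suppD; apply: hP_par; apply: suppU.
have pe : vpar false (st_e P : PV) by apply: suppU.
have pf : vpar false (st_f P : PV).
  rewrite /st_f /st_om -!scaleNr; do 2?apply: suppD; try apply: suppZ; do 2?apply: suppD; try apply: suppZ;
    try (by do ?apply: hP_par; apply: suppU).
  by rewrite -scaleN1r; apply: suppZ; do ?apply: hP_par; apply: suppU.
have ph : vpar false (st_h P : PV) by apply: hP_par; apply: suppU.
have O := ope_osp px py pe pf ph st_xx st_xy st_yy st_hx st_hy st_ee st_ex.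
have yf1 : vprod (st_y P : PV) 1 (st_f P : PV) = 0.
  by apply: (@iota_inj K X P); rewrite pprod_iota st_y1f (islin0 (@iota_lin K X P)).
have yf3 n : 3 <= n -> vprod (st_y P : PV) n (st_f P : PV) = 0.
  by move=> le; apply: (@iota_inj K X P); rewrite pprod_iota st_yf // (islin0 (@iota_lin K X P)).
split.
- by case.
- by move=> a b; rewrite O // /= scale0r addr0.
- by move=> a b; rewrite O // /= add0r.
- move=> a b n le; rewrite O //; last by lia.
  by rewrite !ifF ?scale0r ?addr0 //; apply/negP => /eqP; lia.
Qed.

End OspRealization.

(** * Singular vectors *)

Section FieldIdentities.
Variables (K : numFieldType) (r : K) (X : fockmod K sector).
Local Notation hs := (@hs K sector (swt r) X).
Local Notation vac := (svac X).
Local Notation Gam := (@Gam K r X).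
Local Notation gd := (good (@T K sector (swt r) X) vac (@sbf K r X) sbp (@Tw K r X)).
Local Notation gop := (@gop K r X).
Local Notation al := (wal K).
Local Notation cc := (wc K).
Local Notation mu := (wmu (lev K)).
Local Notation nu := (wnu (lev K)).
Local Notation g1 := (nu + 2^-1 *: al).
Local Notation g2 := (nu - (3 / 2) *: al).
Implicit Types (u v : X) (x y : int * int).

Lemma Gam_is x n : islin (Gam x n). Proof. exact: vop_is. Qed.

Lemma Gam_vac x : Gam x (-1) vac = e0 X (None, x).
Proof.
rewrite /svac Gam_e0 (_ : - -1 - 1 - _ = 0); last by rewrite /gexp /=; lia.
by rewrite Em0 /gsh /= !add0r; case: x.
Qed.

Lemma gd_vac (a : fld X) p : gd p a -> creative vac a. Proof. by case. Qed.

Lemma gd_GamGam x y n : gd (iodd x.1 (+) iodd y.1)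
  (nprod (sgn K (iodd x.1 && iodd y.1)) (Gam x) (Gam y) n).
Proof. by apply: gd_prod; [exact: gd_Gam|exact: gd_Gam|exact: local_Gam]. Qed.

Lemma nprod_Gam x y n : nprod (sgn K (iodd x.1 && iodd y.1)) (Gam x) (Gam y) n (-1) vac =
  Em (swt r) (lat K x) (- n - 1 - gexp x (None, y)) (e0 X (gsh x (None, y))).
Proof.
rewrite (@nprod_vac _ _ vac); [|exact: Gam_fld|exact: Gam_fld| |].
- by rewrite Gam_vac Gam_e0.
- exact: gd_vac (gd_Gam r X x).
- exact: gd_vac (gd_Gam r X y).
Qed.

(* [e^(x + l c)] is the normally ordered product of [e^(l c)] and [e^x] *)
Lemma Gam_shift x l : Gam (x.1, x.2 + l) = nprod 1 (Gam (0, l)) (Gam x) (-1).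
Proof.
have g := gd_GamGam (0, l) x (-1).
apply: (gd_inj (gd_Gam r X (x.1, x.2 + l)) g).
rewrite Gam_vac nprod_Gam (_ : - -1 - 1 - _ = 0); last by rewrite /gexp /=; lia.
by rewrite Em0 /gsh /= addr0.
Qed.

(** The $(-2)$-nd product with the identity field is the derivative $\partial a$. *)
Lemma nprod_idf (a : fld X) m u : lfield a -> nprod 1 a (@idf _ X) (-2) m u = - m%:~R *: a (m - 1) u.
Proof.
move=> fa; rewrite /nprod /D.
have cf2 j : cf K (-2) j = j.+1%:R.
  elim: j => [|j IH]; first exact: cf0.
  apply: (mulfI (_ : j.+1%:R != 0)); first by rewrite pnatr_eq0.
  rewrite cfSr IH (_ : -2 - j%:Z = - j.+2%:Z); last by lia.
  by rewrite rmorphN opprK mulrC.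
rewrite (@exE _ _ _ _ _ _ `|m|%N) => [|j le]; last first.
  rewrite /prodf /idf ifF ?(islin0 (fa.1 _)) //; apply/negP => /eqP; lia.
rewrite (@exE _ _ _ _ _ _ `|m|%N) => [|j le]; last first.
  by rewrite /prodf /idf ifF //; apply/negP => /eqP; lia.
rewrite (_ : (-1) ^ (-2) * 1 = 1) ?scale1r; last by rewrite mulr1 -exprz_inv invrN1 -exprnP sqrrN expr1n.
have [m0|m0|m0] := ltrgtP m 0; last first.
- by rewrite m0 !big_ord0 subr0 mulr0z oppr0 scale0r.
- rewrite big1 => [|j _]; last first.
    by rewrite /prodf /idf ifF ?(islin0 (fa.1 _)) ?scaler0 //; apply/negP => /eqP; lia.
  have lt : (`|m|.-1 < `|m|)%N by lia.
  rewrite (bigD1 (Ordinal lt)) //= big1 => [|j ne]; last first.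
    rewrite /prodf /idf ifF ?scaler0 //; apply/negP => /eqP E; case/negP: ne; apply/eqP.
    by apply: val_inj => /=; lia.
  rewrite addr0 sub0r /prodf /idf ifT; last by apply/eqP; lia.
  rewrite cf2 -scaleNr (_ : 0 + `|m|.-1%:Z = m - 1); last by lia.
  rewrite prednK; last by lia.
  by congr (- _ *: _); rewrite -{2}(gtz0_abs m0).
- rewrite [X in _ - X]big1 => [|j _]; last first.
    by rewrite /prodf /idf ifF ?scaler0 //; apply/negP => /eqP; lia.
  have lt : (`|m|.-1 < `|m|)%N by lia.
  rewrite (bigD1 (Ordinal lt)) //= big1 => [|j ne]; last first.
    rewrite /prodf /idf ifF ?(islin0 (fa.1 _)) ?scaler0 //; apply/negP => /eqP E; case/negP: ne; apply/eqP.
    by apply: val_inj => /=; lia.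
  rewrite addr0 subr0 /prodf /idf ifT; last by apply/eqP; lia.
  rewrite cf2 (_ : 0 - 2 - `|m|.-1%:Z = m - 1); last by lia.
  rewrite prednK; last by lia.
  by rewrite -rmorphN -(ltz0_abs m0).
Qed.

(** The normally ordered product of $\gamma(z)$ and $e^\gamma(z)$ is $\partial e^\gamma(z)$, since
    both fields create $\gamma(-1)e^\gamma$ from the vacuum. *)
Lemma gop_deriv x n u : gop (lat K x) x n u = - n%:~R *: Gam x (n - 1) u.
Proof.
have gx := gd_Gam r X x; have gh := gd_hs r X (lat K x).
have lh : local (sgn K (false && iodd x.1)) (hs (lat K x)) (Gam x).
  apply: local_hs_vop => i; exact: Gam_hw.
have ga : gd (iodd x.1) (gop (lat K x) x) by exact: (gd_prod (-1) gh gx lh).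
have li : local (sgn K (iodd x.1 && false)) (Gam x) (@idf _ X).
  by rewrite andbF; apply: local_sym; [rewrite /sgn mulr1|exact: local_id (Gam_fld _ _ _)].
have := gd_prod (-2) gx (gd_id r X) li; rewrite addbF andbF => gb.
rewrite (gd_inj ga gb); first exact: nprod_idf (Gam_fld _ _ _).
rewrite -[gop _ _]/(nprod 1 (hs (lat K x)) (Gam x) (-1)) !(@nprod_vac _ _ vac); try by [exact: lfield_hs|exact: Gam_fld|exact: lfield_id|exact: gd_vac gx|exact: gd_vac gh|exact: gd_vac (gd_id r X)].
rewrite Gam_vac /idf eqxx /svac Gam_e0 (_ : - -2 - 1 - _ = 1%:Z); last by rewrite /gexp /=; lia.
by rewrite Em1 /gsh /= !add0r; case: x {gx gh lh ga li gb}.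
Qed.

(** For $\gamma=\alpha+\frac c2$ of norm one, $e^\gamma_{(-1)}e^{-\gamma}=\gamma(-1)\mathbf 1$, and
    uniqueness of fields does the rest. This recovers $\alpha(n)$ from charged operators. *)
Lemma hs_bosonization : hs (lat K (1, 0)) = nprod (-1) (Gam (1, 0)) (Gam (-1, 0)) (-1).
Proof.
have g := gd_GamGam (1, 0) (-1, 0) (-1).
apply: (gd_inj (gd_hs r X _) g); rewrite nprod_Gam (_ : - -1 - 1 - _ = 1%:Z) // Em1.
by [].
Qed.

Lemma hs_bound u : exists N : nat, forall h (i : nat), (N <= i)%N -> hs h i%:Z u = 0.
Proof.
move: u; apply: fx_lind.
- by exists 0 => h i _; rewrite (islin0 (hs_is _ _ _)).
- move=> c u v [N hN] [N' hN']; exists (maxn N N') => h i; rewrite geq_max => /andP[l l'].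
  by rewrite hs_is hN // hN' // scaler0 addr0.
- move=> A i; exists (mdeg A).+1 => h n le; apply: (@hs_deg K r X i (mdeg A)); first exact: Sd_kt.
  by lia.
Qed.

Lemma Gam_bound x n u : exists N : nat, forall i : nat, (N <= i)%N -> Gam x (n + i%:Z) u = 0.
Proof.
have [N h] := (Gam_fld r X x).2 u; exists `|N - n|%N => i le; apply: h; lia.
Qed.

Lemma gop_bound x n u : exists N0 : nat, forall N g, (N0 <= N)%N ->
  gop g x n u = \sum_(i < N) hs g (-1 - i%:Z) (Gam x (n + i%:Z) u)
    + \sum_(i < N) Gam x (n - 1 - i%:Z) (hs g i%:Z u).
Proof.
have [N h] := hs_bound u; have [N' h'] := Gam_bound x n u.
exists (maxn N N') => M g; rewrite geq_max => /andP[l l'].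
by apply: gopE => i le; [apply: h'|apply: h]; lia.
Qed.

Lemma gop_linl x n u : islin (fun g => gop g x n u).
Proof.
have [N E] := gop_bound x n u => c g h; rewrite !(E N) //.
have l1 : islin (fun g => \sum_(i < N) hs g (-1 - i%:Z) (Gam x (n + i%:Z) u)).
  by apply: islin_bigsum => i; exact: hs_linl.
have l2 : islin (fun g => \sum_(i < N) Gam x (n - 1 - i%:Z) (hs g i%:Z u)).
  by apply: islin_bigsum => i; apply: islin_comp; [exact: Gam_is|exact: hs_linl].
exact: (islin_add l1 l2).
Qed.

Definition Bop k u : X := Gam (-1, 0) k u + Gam (1, -1) k u.
Definition xop k u : X := Gam (1, 0) k u + Gam (-1, 1) k u.
Definition yop k u : X := gop g1 (-1, 0) k u + gop g2 (1, -1) k u.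

(** Substitute $\nu+\frac12\alpha=\mu+\frac12c-\frac12(-\alpha-\frac c2)$ and
    $\nu-\frac32\alpha=\mu-\frac32(\alpha-\frac c2)$; the last parts become derivatives by
    [gop_deriv]. Completing these to the sum [Bop] leaves [Gam (-1, 0)] with coefficient $-k$. *)
Lemma yopE k u : yop k u = 2^-1 *: (gop (2 *: mu) (-1, 0) k u + gop (2 *: mu) (1, -1) k u)
  + 2^-1 *: gop cc (-1, 0) k u - k%:~R *: Gam (-1, 0) (k - 1) u + (3 / 2 * k%:~R) *: Bop (k - 1) u.
Proof.
rewrite /yop; have -> : gop g1 (-1, 0) k u = 2^-1 *: gop (2 *: mu) (-1, 0) k u + 2^-1 *: gop cc (-1, 0) k u
    - 2^-1 *: gop (lat K (-1, 0)) (-1, 0) k u.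
  rewrite -!(islinZ (gop_linl _ _ _)) -(islinD (gop_linl _ _ _)) -(islinB (gop_linl _ _ _)).
  rewrite (_ : _ + _ - _ = g1) //.
  by apply/rowP => i; rewrite /wmu /wnu /lev latN0 !mxE; field.
have -> : gop g2 (1, -1) k u = 2^-1 *: gop (2 *: mu) (1, -1) k u
    - (3 / 2) *: gop (lat K (1, -1)) (1, -1) k u.
  rewrite -!(islinZ (gop_linl _ _ _)) -(islinB (gop_linl _ _ _)).
  rewrite (_ : _ *: _ - _ = g2) //.
  by apply/rowP => i; rewrite /wmu /wnu /lev lat1N !mxE; field.
by rewrite !gop_deriv /Bop; mod_coords K X; field.
Qed.

(** On such vectors $e^{lc}(z)$ reduces to its creating half, so normally ordered products with it
    become one-sided sums. *)
Definition cfree u := forall i : nat, hs cc i.+1%:Z u = 0.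

Lemma Gam_swap h x i n u : pairing h (lat K x) = 0 -> hs h i (Gam x n u) = Gam x n (hs h i u).
Proof.
move=> h0; rewrite (@vop_hs K sector (swt r) X (lat K x) (gexp x) (gsh x) (fun _ => 1) (Gam_hw r x)).
by rewrite h0 scale0r addr0.
Qed.

Lemma Ep_free g u : (forall i : nat, hs g i.+1%:Z u = 0) -> forall q, q != 0 -> Ep (swt r) g q u = 0 :> X.
Proof.
move=> h q; elim/Ex_ind: q => [q q0 _|//|q IH _]; first exact: Ex_neg.
apply: (@scale_inj _ _ q); rewrite scaler0 /Ep (@ExE _ _ _ (gp_is (swt r) g) q.+1%:Z q.+1) //.
rewrite big1 // => i _; have [E|ne] := eqVneq (q.+1%:Z - i.+1%:Z) 0.
  by rewrite E Ex0 /gp h oppr0.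
by rewrite -/(Ep _ _ _ _) IH ?(islin0 (gp_is _ _ _)) //; lia.
Qed.

Lemma free_Ep g u : (forall q : int, 0 < q -> Ep (swt r) g q u = 0 :> X) ->
  forall i : nat, hs g i.+1%:Z u = 0.
Proof.
move=> h i; have : i.+1%:Z%:~R *: Ep (swt r) g i.+1%:Z u = 0 by rewrite h // scaler0.
rewrite /Ep (@ExE _ _ _ (gp_is (swt r) g) i.+1%:Z i.+1) // big_ord_recr /= big1 => [|j _].
  by rewrite add0r subrr Ex0 /gp => /eqP; rewrite oppr_eq0 => /eqP.
rewrite -/(Ep _ _ _ _) h ?(islin0 (gp_is _ _ _)) //; have := ltn_ord j; lia.
Qed.

Lemma Gam_unif x a u : supp [set b | gexp x b.2 = a] u -> exists N0 : nat, forall (N : nat) n, (N0 <= N)%N ->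
  Gam x n u = \sum_(q < N) Em (swt r) (lat K x) (q%:Z - n - 1 - a) (imap X (gsh x) (Ep (swt r) (lat K x) q%:Z u)).
Proof.
move=> hu; apply: (suppE (P := fun u => exists N0 : nat, forall (N : nat) n, (N0 <= N)%N ->
  Gam x n u = \sum_(q < N) Em (swt r) (lat K x) (q%:Z - n - 1 - a) (imap X (gsh x) (Ep (swt r) (lat K x) q%:Z u))) hu).
- exists 0 => N n _; rewrite (islin0 (Gam_is _ _)) big1 // => q _.
  by rewrite (islin0 (Ep_is _ _ _)) (islin0 (imap_is _ _)) (islin0 (Em_is _ _ _)).
- move=> c v v' [N h] [N' h']; exists (maxn N N') => M n; rewrite geq_max => /andP[l l'].
  rewrite (Gam_is _ _) (h M) // (h' M) // scaler_sumr -big_split; apply: eq_bigr => q _.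
  by rewrite Ep_is imap_is Em_is.
move=> A i /= <-; exists (mdeg A).+1 => N n le.
have lt : (mdeg A)%:Z < N%:Z by lia.
have := @vopE _ _ (swt r) X (lat K x) (gexp x) (gsh x) (fun _ => 1) i _ n _ N (Sd_kt X A i) lt.
by rewrite scale1r.
Qed.

Lemma gsh_imapK x u : imap X (gsh (- x.1, - x.2)) (imap X (gsh x) u) = u.
Proof.
move: u; apply: fx_eq => [||A [o [n m]]].
- by apply: islin_comp; exact: imap_is.
- exact: islin_id.
- by rewrite !imap_kt /gsh /= !addrK.
Qed.

(** In the mode $k=q-1-a$ the terms before $q$ vanish by their index and those after $q$ by
    descending induction. What is left is [Ep q u] with its labels shifted, and the shift is
    invertible. *)
Lemma Ep_lead x a (k0 : int) u : supp [set b | gexp x b.2 = a] u ->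
    (forall k, k0 <= k -> Gam x k u = 0) ->
  forall q : int, k0 + 1 + a <= q -> 0 <= q -> Ep (swt r) (lat K x) q u = 0 :> X.
Proof.
move=> hu hk; have [N hN] := Gam_unif hu.
have big : exists M : nat, forall q : nat, (M <= q)%N -> Ep (swt r) (lat K x) q%:Z u = 0 :> X.
  move: (u); apply: fx_lind.
  - by exists 0 => q _; apply: islin0 (Ep_is _ _ _).
  - move=> c v v' [M h] [M' h']; exists (maxn M M') => q; rewrite geq_max => /andP[l l'].
    by rewrite Ep_is h // h' // scaler0 addr0.
  - move=> A i; exists (mdeg A).+1 => q le; apply: (@Ep_big _ _ _ _ _ _ i (mdeg A)); first by lia.
    exact: Sd_kt.
have [M hM] := big => q lq q0.
suff H (j q' : nat) : (M <= q' + j)%N -> k0 + 1 + a <= q'%:Z -> Ep (swt r) (lat K x) q'%:Z u = 0 :> X.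
  have -> : q = `|q|%N%:Z by lia.
  by apply: (H M); lia.
elim: j q' => [|j IH] q' le lq'; first by apply: hM; lia.
have := hk (q'%:Z - 1 - a) ltac:(lia); rewrite (hN (maxn N q'.+1)) ?leq_maxl //.
have lt : (q' < maxn N q'.+1)%N by rewrite leq_max ltnSn orbT.
rewrite (bigD1 (Ordinal lt)) //= big1 => [|p ne]; last first.
  have [l|l] := ltnP p q'; first by rewrite /Em Ex_neg //; lia.
  rewrite IH ?(islin0 (imap_is _ _)) ?(islin0 (Em_is _ _ _)) //; try lia.
    have : (p : nat) != q' by apply: contra ne => /eqP E; apply/eqP/val_inj.
    lia.
rewrite addr0 (_ : q'%:Z - (q'%:Z - 1 - a) - 1 - a = 0); last by lia.
by rewrite Em0 => E; rewrite -(gsh_imapK x (Ep _ _ _ u)) E (islin0 (imap_is _ _)).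
Qed.

Section CFree.
Variable s : option bool.
Let t : int := if s is None then 0 else 1.
Local Notation inS := (xsec (X := X) [set s]).

Lemma xsec_gexp l u : inS u -> supp [set b | gexp (0, l) b.2 = - t * l] u.
Proof.
apply: supp_sub => -[A [o [n m]]] /= ->; rewrite /gexp /t /=; case: (s) => [b|]; lia.
Qed.

Lemma cfree_Gam l u (n : int) : inS u -> cfree u -> t * l <= n -> Gam (0, l) n u = 0.
Proof.
move=> hu fu le; have [N h] := Gam_unif (xsec_gexp l hu); rewrite (h N.+1) //.
have lE : lat K (0, l) = l%:~R *: cc by rewrite /lat /= mul0r add0r scale0r add0r.
rewrite big_ord_recl big1 => [|q _]; last first.
  rewrite (@Ep_free (lat K (0, l))) ?(islin0 (imap_is _ _)) ?(islin0 (Em_is _ _ _)) // => i.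
  by rewrite lE hsZl fu scaler0.
by rewrite /Em Ex_neg ?addr0 //=; lia.
Qed.

Lemma Gam_cfree l u n : inS u -> cfree u ->
  Gam (0, l) n u = Em (swt r) (lat K (0, l)) (- n - 1 + t * l) (imap X (gsh (0, l)) u).
Proof.
move=> hu fu; have [N h] := Gam_unif (xsec_gexp l hu); rewrite (h N.+1) //.
have lE : lat K (0, l) = l%:~R *: cc by rewrite /lat /= mul0r add0r scale0r add0r.
rewrite big_ord_recl big1 => [|q _]; last first.
  rewrite (@Ep_free (lat K (0, l))) ?(islin0 (imap_is _ _)) ?(islin0 (Em_is _ _ _)) // => i.
  by rewrite lE hsZl fu scaler0.
rewrite addr0 /Ep Ex0; congr (Em _ _ _ _); rewrite /=; lia.
Qed.

Lemma pairing_c_lat x : pairing cc (lat K x) = 0.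
Proof. by rewrite /lat !pairE; ring. Qed.

Lemma cfree_GamS x n u : cfree u -> cfree (Gam x n u).
Proof. by move=> fu i; rewrite Gam_swap ?pairing_c_lat // fu (islin0 (Gam_is _ _)). Qed.

Lemma Gam_inS x n u : inS u -> inS (Gam x n u).
Proof. by apply: (@Gam_label _ _ _ [set i | i.1 = s] [set i | i.1 = s]). Qed.

Lemma hs_inS h n u : inS u -> inS (hs h n u).
Proof. exact: (@hs_label _ _ _ [set i | i.1 = s]). Qed.

Lemma Gam_down x k u : inS u -> cfree u -> exists N0 : nat, forall N, (N0 <= N)%N ->
  Gam (x.1, x.2 - 1) k u = \sum_(i < N) Gam (0, -1) (-1 - i%:Z) (Gam x (k + i%:Z) u).
Proof.
move=> hu fu; have [N hN] := Gam_bound x k u; exists N => M le; rewrite Gam_shift /nprod /D.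
have cf1 j : cf K (-1) j = 1.
  elim: j => [|j IH]; first exact: cf0.
  apply: (mulfI (_ : j.+1%:R != 0)); first by rewrite pnatr_eq0.
  rewrite cfSr IH !mulr1 (_ : -1 - j%:Z = - j.+1%:Z); last by lia.
  by rewrite rmorphN opprK.
rewrite (@exE _ _ _ _ _ _ M) => [|j lj]; last first.
  by rewrite /prodf hN ?(islin0 (Gam_is _ _)) //; lia.
rewrite (@exE _ _ _ _ _ _ 0) => [|j _]; last first.
  rewrite /prodf cfree_Gam ?(islin0 (Gam_is _ _)) //; rewrite /t; case: (s) => [b|]; lia.
rewrite big_ord0 scaler0 subr0; apply: eq_bigr => j _.
by rewrite cf1 scale1r /prodf (_ : 0 - 1 - j%:Z = -1 - j%:Z).
Qed.

(** Multiplying $e^{\pm\alpha+c/2}$ by $e^{-c}$ gives $e^{\pm\alpha-c/2}$, so $x$ becomes [Bop]; on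
    a $c$-free vector only the creating half of $e^{-c}$ contributes. *)
Lemma Bop_xop k u : inS u -> cfree u -> exists N : nat,
  Bop k u = \sum_(i < N) Gam (0, -1) (-1 - i%:Z) (xop (k + i%:Z) u).
Proof.
move=> hu fu; have [N h] := Gam_down (-1, 1) k hu fu; have [N' h'] := Gam_down (1, 0) k hu fu.
have e : Gam (-1, 0) k u = _ := h _ (leq_maxl N N').
have e' : Gam (1, -1) k u = _ := h' _ (leq_maxr N N').
exists (maxn N N'); rewrite /Bop e e' -big_split; apply: eq_bigr => i _ /=.
by rewrite /xop (islinD (Gam_is _ _)) addrC.
Qed.

Lemma c_zero u : inS u -> hs cc 0 u = - t%:~R *: u.
Proof.
move=> hu; apply: (suppE (P := fun u => hs cc 0 u = - t%:~R *: u) hu).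
- by rewrite (islin0 (hs_is _ _ _)) scaler0.
- by move=> c v v' hv hv'; rewrite hs_is hv hv'; mod_ring K X.
move=> A [o x] /= ->; rewrite hs0U; congr (_ *: _).
rewrite /swt /= pairingDr pairing_c_lat addr0 /t; case: (s) => [b|]; last by rewrite pairing0r oppr0.
by rewrite /sbase /wmu !pairE; field.
Qed.

(** The normally ordered $c$-term of [yopE] keeps only the zero mode of $c$ on its right-hand half.
    This mode acts as $-t$ and turns the coefficient $-k$ into $-(k+\frac t2)$. *)
Lemma yop_cfree k u : inS u -> cfree u -> exists N : nat, yop k u =
  2^-1 *: (\sum_(i < N) hs (2 *: mu) (-1 - i%:Z) (Bop (k + i%:Z) u) + \sum_(i < N) Bop (k - 1 - i%:Z) (hs (2 *: mu) i%:Z u))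
  + 2^-1 *: (\sum_(i < N) hs cc (-1 - i%:Z) (Gam (-1, 0) (k + i%:Z) u))
  - (k%:~R + t%:~R / 2) *: Gam (-1, 0) (k - 1) u + (3 / 2 * k%:~R) *: Bop (k - 1) u.
Proof.
move=> hu fu; have [N h] := gop_bound (-1, 0) k u; have [N' h'] := gop_bound (1, -1) k u.
exists (maxn N N').+1; rewrite yopE !(h (maxn N N').+1) ?(h' (maxn N N').+1); try lia.
rewrite [X in _ + 2^-1 *: (_ + X) - _]big_ord_recl [X in _ + 2^-1 *: (_ + (_ + X)) - _]big1 => [|i _]; last first.
  by rewrite -[(lift ord0 i : nat)%:Z]/((i.+1)%:Z) fu (islin0 (Gam_is _ _)).
rewrite c_zero // (islinZ (Gam_is _ _)) !subr0 addr0.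
have -> : \sum_(i < (maxn N N').+1) hs (2 *: mu) (-1 - i%:Z) (Bop (k + i%:Z) u) =
    \sum_(i < (maxn N N').+1) hs (2 *: mu) (-1 - i%:Z) (Gam (-1, 0) (k + i%:Z) u)
    + \sum_(i < (maxn N N').+1) hs (2 *: mu) (-1 - i%:Z) (Gam (1, -1) (k + i%:Z) u).
  by rewrite -big_split; apply: eq_bigr => i _; rewrite /Bop (islinD (hs_is _ _ _)).
have -> : \sum_(i < (maxn N N').+1) Bop (k - 1 - i%:Z) (hs (2 *: mu) i%:Z u) =
    \sum_(i < (maxn N N').+1) Gam (-1, 0) (k - 1 - i%:Z) (hs (2 *: mu) i%:Z u)
    + \sum_(i < (maxn N N').+1) Gam (1, -1) (k - 1 - i%:Z) (hs (2 *: mu) i%:Z u).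
  by rewrite -big_split.
by rewrite /Bop; mod_coords K X; field.
Qed.

End CFree.
End FieldIdentities.

(** Applying [A] minus the eigenvalue of the first component removes that component and rescales the
    others by nonzero factors; induction treats the rest. *)
Lemma eigen_extract (K : numFieldType) (M : lmodType K) (J : eqType) (S : set M) (A : M -> M)
    (lam : J -> K) (s : seq J) (w : J -> M) : subspace S -> islin A -> injective lam ->
    (forall u, S u -> S (A u)) -> (forall j, A (w j) = lam j *: w j) -> uniq s ->
  S (\sum_(j <- s) w j) -> forall j, j \in s -> S (w j).
Proof.
move=> Ss Al li SA; elim: s w => [//|i s IH] w hw /= /andP[si us] Sw.
have rest j : j \in s -> S (w j).
  move=> js; have ne : lam j - lam i != 0.
    by rewrite subr_eq0; apply: contra si => /eqP /li <-.
  have := IH (fun j => (lam j - lam i) *: w j) _ us _ j js => h.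
  rewrite -[w j]scale1r -(mulVf ne) -scalerA; apply: subspaceZ => //; apply: h.
    by move=> j'; rewrite (islinZ Al) hw !scalerA mulrC.
  have := subspaceB Ss (SA _ Sw) (subspaceZ (lam i) Ss Sw).
  rewrite (islin_sum Al) scaler_sumr -sumrB big_cons hw subrr add0r.
  by under eq_bigr => j' _ do rewrite hw -scalerBl.
move=> j; rewrite inE => /orP[/eqP ->|]; last exact: rest.
have -> : w i = \sum_(j <- i :: s) w j - \sum_(j <- s) w j by rewrite big_cons addrK.
by apply: subspaceB => //; rewrite big_seq; apply: subspace_sum.
Qed.

Lemma lproj_is (K : numFieldType) (I : choiceType) (X : fockmod K I) (J : eqType)
  (lab : modes * I -> J) j : islin (lproj lab j : X -> X).
Proof. exact: proj_is. Qed.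

(** * Vectors of minimal degree in a stable subspace *)

Section Singular.
Variables (K : numFieldType) (r : K) (X : fockmod K sector).
Local Notation hs := (@hs K sector (swt r) X).
Local Notation Gam := (@Gam K r X).
Local Notation gop := (@gop K r X).
Local Notation al := (wal K).
Local Notation cc := (wc K).
Local Notation dd := (wd K).
Local Notation mu := (wmu (lev K)).
Local Notation nu := (wnu (lev K)).
Local Notation xop := (@xop K r X).
Local Notation yop := (@yop K r X).
Local Notation Bo := (@Bop K r X).
Implicit Types (u v : X).

Section OneBasisVector.
Variable i : sector.
Local Notation E := (e0 X i).

Lemma gop_lead g x k : k = - gexp x i -> gop g x k E = pairing g (swt r i) *: e0 X (gsh x i).
Proof.
move=> ->; have [N h] := gop_bound r x (- gexp x i) E; rewrite (h N.+1) //.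
rewrite big1 => [|j _]; last first.
  by rewrite Gam_pos ?(islin0 (hs_is _ _ _)) //; lia.
rewrite add0r big_ord_recl big1 => [|j _]; last by rewrite hs_pos ?(islin0 (Gam_is _ _ _)).
by rewrite hs_e0 (islinZ (Gam_is _ _ _)) subr0 addr0 Gam_top.
Qed.

Lemma gop_vanish g x k : - gexp x i < k -> gop g x k E = 0.
Proof. by move=> lt; apply: (@gop_deg K r X g x i 0); [exact: Sd_e0|lia]. Qed.
End OneBasisVector.

(** Creation after annihilation at [x] multiplies a monomial by its multiplicity of [x], so a
    component containing [x] cannot survive. *)
Lemma an_free_top u : (forall x, an x u = 0) -> supp [set b | b.1 = mset0] u.
Proof.
move=> h; pose lab (b : modes * sector) := b.1.
have [s [_ ->]] := lproj_sum lab u; apply: supp_sum => A _.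
have [->|ne] := eqVneq A mset0; first exact: lproj_lgr.
suff -> : lproj lab A u = 0 by exact: supp0.
have [x xA] : exists x, (0 < A x)%N.
  apply: contrapT => nx; case/eqP: ne; apply: modes_eq => y; rewrite mset0E.
  by apply/eqP; rewrite -leqn0 leqNgt; apply/negP => lt; apply: nx; exists y.
have E : (A x)%:R *: lproj lab A u = lproj lab A (cr x (an x u)).
  apply: (@fx_eq _ _ _ _ (fun u => (A x)%:R *: lproj lab A u) (fun u => lproj lab A (cr x (an x u)))).
  - by apply: islin_scale; exact: proj_is.
  - by apply: islin_comp; [exact: proj_is|apply: islin_comp; [exact: cr_is|exact: an_is]].
  move=> B i; rewrite anU (islinZ (cr_is _)) crU (islinZ (lproj_is _ _)).
  have [B0|Bp] := posnP (B x).
    rewrite B0 scale0r (@lproj_ne _ _ _ _ lab _ B) ?scaler0 //; last exact: suppU.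
    by apply: contraTneq xA => ->; rewrite B0.
  rewrite del_ins //; have [->//|nB] := eqVneq A B.
  by rewrite (@lproj_ne _ _ _ _ lab _ B) ?scaler0 //; exact: suppU.
move/eqP: E; rewrite h (islin0 (cr_is _)) (islin0 (lproj_is _ _)) scaler_eq0 pnatr_eq0.
by move=> /orP[/eqP A0|/eqP //]; rewrite A0 in xA.
Qed.

Lemma free_an u : (forall i : nat, hs al i.+1%:Z u = 0) -> (forall i : nat, hs cc i.+1%:Z u = 0) ->
  (forall i : nat, hs dd i.+1%:Z u = 0) -> forall x, an x u = 0.
Proof.
move=> ha hc hd [i k].
have k0 : k.+1%:R != 0 :> K by rewrite pnatr_eq0.
have := ha k; have := hc k; have := hd k; rewrite !hsP !sum3 !pairing_alal !pairing_alc !pairing_ald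
  !pairing_cc !pairing_cd !pairing_dd !(pairingC _ al) !pairing_alc !pairing_ald (pairingC dd) pairing_cd.
rewrite !mulr0 !scale0r ?addr0 ?add0r mulr1 => /eqP.
rewrite scaler_eq0 mulf_eq0 (negPf k0) pnatr_eq0 /= => /eqP h1 /eqP.
rewrite scaler_eq0 mulf_eq0 (negPf k0) pnatr_eq0 /= => /eqP h2 /eqP.
rewrite scaler_eq0 (negPf k0) /= => /eqP h0.
by case: i => -[|[|[|//]]] l3; [rewrite -h0|rewrite -h1|rewrite -h2];
  congr (an (_, k) u); apply/val_inj; rewrite /= inordK.
Qed.

Variable s : option bool.
Let t : int := if s is None then 0 else 1.
Let t01 : t = 0 \/ t = 1. Proof. by rewrite /t; case: (s) => [b|]; [right|left]. Qed.
Local Notation inS := (xsec (X := X) [set s]).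

(** Unlike the conformal weight, this ignores the multiple of $c$ in the exponent: in the vacuum
    sector $e^{mc}$ has weight $m$ of either sign, whereas a minimal degree has to exist. *)
Definition wdeg (b : modes * sector) : int :=
  2 * (mdeg b.1)%:Z + b.2.2.1 * b.2.2.1 + t * b.2.2.1.
Definition FS (N : int) : set X := supp [set b | b.2.1 = s /\ wdeg b <= N].

Lemma FS_le N N' u : N <= N' -> FS N u -> FS N' u.
Proof. by move=> le; apply: supp_sub => b [? ?]; split=> //; apply: le_trans le. Qed.

Lemma FS_neg N u : N < 0 -> FS N u -> u = 0.
Proof.
move=> N0 hu; apply: (supp_disj _ hu hu) => -[A [o [n m]]] [_ h] _; move: h.
by rewrite /wdeg /=; case: t01 => ->; nia.
Qed.

Lemma FS_ex u : inS u -> exists N : nat, FS N%:Z u.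
Proof.
move=> hu; apply: (suppE (P := fun u => exists N : nat, FS N%:Z u) hu).
- by exists 0%N; apply: supp0.
- move=> c v v' [N h] [N' h']; exists (maxn N N').
  by apply: suppL; [apply: FS_le h|apply: FS_le h']; lia.
- move=> A i /= E; exists `|wdeg (A, i)|%N; apply: suppU; split=> //=; lia.
Qed.

Lemma FS_Gam N x k u : FS N u ->
  FS (N - 2 * k - 2 + (x.1 * x.1 + t * (x.1 + 2 * x.2))) (Gam x k u).
Proof.
apply: supp_lin; first exact: Gam_is.
move=> A [o [n m]] [/= -> le].
have := @vop_supp _ _ (swt r) X (lat K x) (gexp x) (gsh x) (fun _ => 1) _ _ k _ (Sd_kt X A (s, (n, m))).
apply: supp_sub => -[B j] [/= -> D]; split=> //; move: D le.
have -> : gexp x (s, (n, m)) = x.1 * n - t * x.2 by rewrite /gexp /t /=; case: (s) => [b|]; lia.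
rewrite /wdeg /= => D le; case: x D => a b /= D.
have -> : (n + a) * (n + a) = n * n + 2 * (a * n) + a * a by ring.
rewrite (mulrDr t n a) (mulrDr t a (2 * b)); lia.
Qed.

Lemma FS_hs N h k u : FS N u -> FS (N - 2 * k) (hs h k u).
Proof.
apply: supp_lin; first exact: hs_is.
move=> A i /= [E le]; have := @hs_supp _ _ (swt r) X h k _ _ _ (Sd_kt X A i).
by apply: supp_sub => -[B j] [/= -> D]; split=> //; move: D le; rewrite /wdeg /=; lia.
Qed.

Lemma FS_gop N g x k u : FS N u ->
  FS (N - 2 * k + (x.1 * x.1 + t * (x.1 + 2 * x.2))) (gop g x k u).
Proof.
move=> hu; apply: D_closed; first exact: supp_subspace.
- exact: lfield_hs.
- exact: Gam_fld.
- move=> p q E; apply: FS_le (FS_hs g p (FS_Gam x q hu)); lia.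
- move=> p q E; apply: FS_le (FS_Gam x q (FS_hs g p hu)); lia.
Qed.

Variable S : set X.
Hypotheses (Ss : subspace S) (SI : forall u, S u -> inS u).
Hypotheses (Se : forall k u, S u -> S (Gam (0, 1) k u)) (Sh : forall k u, S u -> S (hs (2 *: mu) k u)).
Hypotheses (Sx : forall k u, S u -> S (xop k u)) (Sy : forall k u, S u -> S (yop k u)).

Section Minimal.
Variable N : int.
Hypothesis Smin : forall v, S v -> FS (N - 1) v -> v = 0.
Variable v : X.
Hypotheses (Sv : S v) (Fv : FS N v).

Lemma min_e k : t <= k -> Gam (0, 1) k v = 0.
Proof.
move=> le; apply: Smin; first exact: Se.
apply: FS_le (FS_Gam (0, 1) k Fv); rewrite /=; lia.
Qed.

Lemma min_h k : 1 <= k -> hs (2 *: mu) k v = 0.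
Proof. by move=> le; apply: Smin; [exact: Sh|apply: FS_le (FS_hs _ k Fv); lia]. Qed.

Lemma min_x k : t <= k -> xop k v = 0.
Proof.
move=> le; apply: Smin; first exact: Sx.
by apply: suppD; apply: FS_le (FS_Gam _ k Fv); rewrite /=; lia.
Qed.

Lemma min_y k : 1 <= k -> yop k v = 0.
Proof.
move=> le; apply: Smin; first exact: Sy.
by apply: suppD; apply: FS_le (FS_gop _ _ k Fv); rewrite /=; case: t01 => ->; lia.
Qed.

Let iv : inS v := SI Sv.

Lemma lat01 : lat K (0, 1) = cc.
Proof. by rewrite /lat /= mul0r add0r scale0r add0r scale1r. Qed.

Lemma min_cfree : cfree r v.
Proof.
move=> i; rewrite -lat01; move: i; apply: free_Ep => q q0.
by apply: (@Ep_lead K r X (0, 1) (- t * 1) t v (xsec_gexp 1 iv) min_e); lia.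
Qed.

Lemma min_dfree (i : nat) : hs dd i.+1%:Z v = 0.
Proof.
have -> : dd = 2 *: mu + (3 / 4) *: cc by apply/rowP => j; rewrite /wmu /lev !mxE; field.
have cf := min_cfree; rewrite hsDl [X in _ + X]hsZl cf scaler0 addr0 min_h //.
Qed.

(** In the sum of [Bop_xop] the terms with $k+i\ge t$ are killed by $x$. What remains is $t=1$,
    $k=i=0$, where $e^{-c}_{(-1)}$ kills the $c$-free vectors of a twisted sector. *)
Lemma min_B k : 0 <= k -> Bo k v = 0.
Proof.
move=> k0; have [M ->] := Bop_xop k iv min_cfree; rewrite big1 // => i _.
have [le|lt] := leP t (k + i%:Z); first by rewrite min_x // (islin0 (Gam_is _ _ _)).
have ix : inS (xop (k + i%:Z) v) by apply: SI; apply: Sx.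
apply: (cfree_Gam ix); last by rewrite -/t; lia.
by move=> j; rewrite /xop (islinD (hs_is _ _ _)) !(cfree_GamS _ _ min_cfree) addr0.
Qed.
End Minimal.

Section Minimal2.
Variable N : int.
Hypothesis Smin : forall v, S v -> FS (N - 1) v -> v = 0.
Variable v : X.
Hypotheses (Sv : S v) (Fv : FS N v).
Let iv : inS v := SI Sv.
Let Sh0 : S (hs (2 *: mu) 0 v). Proof. exact: Sh. Qed.
Let Fh0 : FS N (hs (2 *: mu) 0 v). Proof. by apply: FS_le (FS_hs _ 0 Fv); lia. Qed.

Lemma half_ne (k : int) : 0 <= k -> (k + 1)%:~R + t%:~R / 2 != 0 :> K.
Proof.
move=> k0; have -> : (k + 1)%:~R + t%:~R / 2 = (2 * (k + 1) + t)%:~R / 2 :> K.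
  by rewrite !(rmorphD, rmorphM) /=; field.
rewrite mulf_neq0 ?invr_eq0 ?pnatr_eq0 // intr_eq0; apply/eqP; case: t01 => ->; lia.
Qed.

(** Descending induction on [k], using [yop_cfree] at $k+1$: the [Bop] terms vanish by [min_B], also
    on $h_{(0)}v$, which is again of minimal degree; the $c$-term vanishes by induction and
    $y_{(k+1)}v$ by minimality. Only $k+1+\frac t2$ times the wanted mode is left. *)
Lemma min_minus k : 0 <= k -> Gam (-1, 0) k v = 0.
Proof.
have [M hM] := Gam_bound r (-1, 0) 0 v => k0.
suff H (j : nat) k' : 0 <= k' -> M%:Z <= k' + j%:Z -> Gam (-1, 0) k' v = 0 by apply: (H M); lia.
elim: j k' {k k0} => [|j IH] k k0 le.
  by rewrite (_ : k = 0 + `|k|%N%:Z); [apply: hM; lia|lia].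
have cf := min_cfree Smin Sv Fv; have := min_y Smin Sv Fv (k := k + 1) ltac:(lia).
have [L ->] := yop_cfree (k + 1) iv cf.
have B0 := min_B Smin Sv Fv; have B1 := min_B Smin Sh0 Fh0.
rewrite [\sum_(i < L) hs (2 *: mu) _ _]big1 => [|i _]; last first.
  by rewrite B0 ?(islin0 (hs_is _ _ _)) //; lia.
rewrite [\sum_(i < L) Bo _ _]big1 => [|[[|i] l] _]; last 2 first.
- by rewrite /= subr0 addrK B1.
- by rewrite (min_h Smin Sv Fv) // /Bop ?(islin0 (Gam_is _ _ _)) ?addr0.
rewrite [\sum_(i < L) hs cc _ _]big1 => [|i _]; last first.
  by rewrite IH ?(islin0 (hs_is _ _ _)) //; lia.
rewrite addrK B0 // !addr0 !scaler0 !addr0 sub0r -scaleNr => /eqP.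
by rewrite scaler_eq0 oppr_eq0 (negPf (half_ne k0)) => /eqP.
Qed.

Lemma min_plus k : 0 <= k -> Gam (1, -1) k v = 0.
Proof.
move=> k0; have := min_B Smin Sv Fv k0; rewrite /Bop min_minus // add0r.
by [].
Qed.

(** Charge components are taken because [Ep_lead] needs a constant exponent: at charge $n$ it is
    $-n$ for [(-1, 0)] and $n+t$ for [(1, -1)]. *)
Definition charge (b : modes * sector) : int := b.2.2.1.

Lemma charge_Gam x k n (u : X) : Gam x k (lproj charge n u) = lproj charge (n + x.1) (Gam x k u).
Proof.
move: u; apply: fx_eq => [||A i].
- by apply: islin_comp; [exact: Gam_is|exact: proj_is].
- by apply: islin_comp; [exact: proj_is|exact: Gam_is].
have hk : lgr charge (i.2.1 + x.1) (Gam x k (kt A i)).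
  by apply: (@Gam_label _ _ _ [set j | j.2.1 = i.2.1] [set j | j.2.1 = i.2.1 + x.1]) => [j /= ->|] //; exact: suppU.
have [E|ne] := eqVneq n i.2.1.
  by rewrite E lproj_id ?lproj_id //; exact: suppU.
rewrite (lproj_ne _ (suppU X (erefl : charge (A, i) = i.2.1))) // (islin0 (Gam_is _ _ _)).
by rewrite (lproj_ne _ hk) //; apply: contra ne => /eqP E; apply/eqP; lia.
Qed.

Lemma charge_hs h k n (u : X) : hs h k (lproj charge n u) = lproj charge n (hs h k u).
Proof.
move: u; apply: fx_eq => [||A i].
- by apply: islin_comp; [exact: hs_is|exact: proj_is].
- by apply: islin_comp; [exact: proj_is|exact: hs_is].
have hk : lgr charge i.2.1 (hs h k (kt A i)).
  by apply: (@hs_label _ _ _ [set j | j.2.1 = i.2.1]); exact: suppU.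
have [E|ne] := eqVneq n i.2.1.
  by rewrite E lproj_id ?lproj_id //; exact: suppU.
rewrite (lproj_ne _ (suppU X (erefl : charge (A, i) = i.2.1))) // (islin0 (hs_is _ _ _)).
by rewrite (lproj_ne _ hk).
Qed.

Definition topset : set (modes * sector) :=
  [set b | [/\ b.1 = mset0, b.2.1 = s, - t <= b.2.2.1 & b.2.2.1 <= 0]].

Lemma min_top : supp topset v.
Proof.
have [l [_ ->]] := lproj_sum charge v; apply: supp_sum => n _.
set w := lproj charge n v.
have [->|w0] := eqVneq w 0; first exact: supp0.
have wS : supp [set b | charge b = n /\ b.2.1 = s] w.
  by have := proj_supp [set b | charge b = n] iv.
have wc : cfree r w by move=> i; rewrite charge_hs (min_cfree Smin Sv Fv) (islin0 (lproj_is _ _)).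
have wd (i : nat) : hs dd i.+1%:Z w = 0 by rewrite charge_hs (min_dfree Smin Sv Fv) (islin0 (lproj_is _ _)).
have wm k : 0 <= k -> Gam (-1, 0) k w = 0 by move=> k0; rewrite charge_Gam min_minus // (islin0 (lproj_is _ _)).
have wp k : 0 <= k -> Gam (1, -1) k w = 0 by move=> k0; rewrite charge_Gam min_plus // (islin0 (lproj_is _ _)).
have Lm := @Ep_lead K r X (-1, 0) (- n) 0 w _ wm.
have Lp := @Ep_lead K r X (1, -1) (n + t) 0 w _ wp.
have {}Lm q : 1 - n <= q -> 0 <= q -> Ep (swt r) (lat K (-1, 0)) q w = 0.
  move=> l1 l2; apply: Lm; try lia.
  by apply: supp_sub wS => -[A [o [c m]]] [/= E _]; rewrite /gexp /=; move: E; rewrite /charge /=; case: o; lia.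
have {}Lp q : 1 + n + t <= q -> 0 <= q -> Ep (swt r) (lat K (1, -1)) q w = 0.
  move=> l1 l2; apply: Lp; try lia.
  by apply: supp_sub wS => -[A [o [c m]]] [/= E ->]; rewrite /gexp /=; move: E; rewrite /charge /t /=; case: (s) => [?|]; lia.
(* If the bound already covers [q = 0], then [w] itself vanishes; this and its companion confine the
   charge to $[-t,0]$. *)
have n0 : n <= 0.
  by rewrite leNgt; apply/negP => lt; case/eqP: w0; rewrite -(Lm 0) //; lia.
have nt : - t <= n.
  by rewrite leNgt; apply/negP => lt; case/eqP: w0; rewrite -(Lp 0) //; lia.
(* At charge 0 the bound for [(-1, 0)] starts at [q = 1]; at charge $-1$, possible only for $t=1$,
   the bound for [(1, -1)] does. As [w] is $c$-free, either one frees it of $\alpha$. *)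
have wa (i : nat) : hs al i.+1%:Z w = 0.
  have [E|ne] := eqVneq n 0.
    have h : hs (lat K (-1, 0)) i.+1%:Z w = 0.
      by apply: free_Ep => q q0; apply: Lm; lia.
    have -> : al = - lat K (-1, 0) - 2^-1 *: cc by rewrite latN0; apply/rowP => j; rewrite !mxE; ring.
    by rewrite hsDl !hsNl hsZl h wc scaler0 !oppr0 addr0.
  have h : hs (lat K (1, -1)) i.+1%:Z w = 0.
    by apply: free_Ep => q q0; apply: Lp; [case: t01 nt; lia|lia].
  have -> : al = lat K (1, -1) + 2^-1 *: cc by rewrite lat1N subrK.
  by rewrite hsDl hsZl h wc scaler0 addr0.
have := an_free_top (free_an wa wc wd) => h.
have := proj_supp [set b | b.1 = mset0] wS; rewrite (proj_id h).
by apply: supp_sub => b [b1 [E o]]; rewrite -E in n0 nt; split.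
Qed.
End Minimal2.

Lemma minimal_ex : (exists2 u, S u & u <> 0) ->
  exists N u, [/\ S u, u <> 0, FS N u & forall v, S v -> FS (N - 1) v -> v = 0].
Proof.
case=> u Su u0; have [M FM] := FS_ex (SI Su).
elim: M u Su u0 FM => [|M IH] u Su u0 FM.
  by exists 0, u; split=> // v _; apply: FS_neg.
have [[v [Sv v0 Fv]]|no] := pselect (exists v, [/\ S v, v <> 0 & FS M%:Z v]); first exact: IH Fv.
exists M.+1%:Z, u; split=> // v Sv; rewrite (_ : M.+1%:Z - 1 = M%:Z); last by lia.
by move=> Fv; apply: contrapT => v0; apply: no; exists v.
Qed.

Lemma supp1 b u : supp [set b' | b' = b] u -> exists c, u = c *: kt b.1 b.2.
Proof.
move=> h; apply: (suppE (P := fun u => exists c, u = c *: kt b.1 b.2) h).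
- by exists 0; rewrite scale0r.
- by move=> c v v' [a ->] [a' ->]; exists (c * a + a'); rewrite scalerDl scalerA.
- by move=> A i /= <-; exists 1; rewrite scale1r.
Qed.

Theorem singular_vector : (exists2 u, S u & u <> 0) ->
  exists n m, [/\ - t <= n, n <= 0 & S (e0 X (s, (n, m)))].
Proof.
move=> /minimal_ex[N [u [Su u0 Fu Smin]]]; have Tu := min_top Smin Su Fu.
(* Up to a constant, $n+2m$ is the eigenvalue of $h_{(0)}$. For $n\in\{-1,0\}$ it determines
   $(n,m)$, so an eigencomponent is a multiple of a single basis vector. *)
pose lab (b : modes * sector) : int := b.2.2.1 + 2 * b.2.2.2.
pose h0 := hs (2 *: mu) 0; pose lam (l : int) : K := l%:~R + pairing (2 *: mu) (sbase r s).
have [l [ul E]] := lproj_sum lab u.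
have hl (j : int) : supp [set b | lab b = j /\ topset b] (lproj lab j u) by apply: proj_supp.
have hw (j : int) : h0 (lproj lab j u) = lam j *: lproj lab j u.
  apply: (suppE (P := fun u => h0 u = lam j *: u) (hl j)).
  - by rewrite scaler0; apply: islin0 (hs_is _ _ _).
  - by move=> c v v' hv hv'; rewrite /h0 hs_is -/h0 hv hv'; mod_ring K X.
  move=> A [o [n m]] [<- [_ /= -> _ _]]; rewrite /h0 hs0U; congr (_ *: _).
  rewrite /lam /swt /= pairingDr addrC; congr (_ + _).
  by rewrite /lab /lat /wmu /lev /= !pairE rmorphD rmorphM /=; field.
have [j jl j0] : exists2 j, j \in l & lproj lab j u <> 0.
  apply: contrapT => no; apply: u0; rewrite E big_seq big1 // => j jl.
  by apply: contrapT => ne; apply: no; exists j.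
have Sj : S (lproj lab j u).
  apply: (@eigen_extract _ _ _ S h0 lam l (fun j => lproj lab j u) Ss (hs_is _ _ _)) => //.
  - by move=> a b /addIr /(@intr_inj K).
  - by move=> w; apply: Sh.
  - by rewrite -E.
have [b [bt bj]] : exists b, topset b /\ forall b', lab b' = j /\ topset b' -> b' = b.
  have uq b b' : lab b = j /\ topset b -> lab b' = j /\ topset b' -> b' = b.
    case: b b' => [A [o [n m]]] [A' [o' [n' m']]] [/= l1 [/= -> -> a1 a2]] [/= l2 [/= -> -> a3 a4]].
    by congr (_, (_, (_, _))); move: l1 l2; rewrite /lab /=; case: t01 a1 a3; lia.
  have [[b hb]|no] := pselect (exists b, lab b = j /\ topset b).
    by exists b; split=> [|b' hb']; [case: hb|exact: uq hb'].
  case: j0; apply: (supp_disj (S := set0) _ _ (hl j)) => //.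
  by apply: supp_sub (hl j) => b' hb'; case: no; exists b'.
have [c Ec] : exists c, lproj lab j u = c *: kt b.1 b.2.
  by apply: supp1; apply: supp_sub (hl j) => b' /bj.
have c0 : c != 0 by apply/eqP => c0; apply: j0; rewrite Ec c0 scale0r.
case: b {bj} bt Ec => [A [o [n m]]] [/= -> -> n1 n2] Ec; exists n, m; split=> //.
by rewrite -[e0 _ _]scale1r -(mulVf c0) -scalerA -Ec; apply: subspaceZ.
Qed.

End Singular.

Section TopActions.
Variables (K : numFieldType) (r : K) (X : fockmod K sector).
Local Notation hs := (@hs K sector (swt r) X).
Local Notation Gam := (@Gam K r X).
Local Notation gop := (@gop K r X).
Local Notation al := (wal K).
Local Notation mu := (wmu (lev K)).
Local Notation nu := (wnu (lev K)).
Local Notation g1 := (nu + 2^-1 *: al).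
Local Notation g2 := (nu - (3 / 2) *: al).
Local Notation xop := (@xop K r X).
Local Notation yop := (@yop K r X).
Implicit Types (u v : X) (m : int).

Lemma gop_topE g x k i : k = - gexp x i ->
  gop g x k (e0 X i) = pairing g (swt r i) *: e0 X (gsh x i).
Proof. exact: gop_lead. Qed.

Lemma gop_is g x k : islin (gop g x k).
Proof. by have [h _] := lfield_prod 1 (-1) (lfield_hs (swt r) X g) (Gam_fld r X x); apply: h. Qed.

Lemma Gam_topk x k i : k = - gexp x i - 1 -> Gam x k (e0 X i) = e0 X (gsh x i).
Proof. by move=> ->; exact: Gam_top. Qed.

Lemma yop_vac0 m : yop 0 (e0 X (None, (0, m))) =
  m%:~R *: (e0 X (None, (-1, m)) + e0 X (None, (1, m - 1))).
Proof.
rewrite /yop !gop_topE // /gsh /swt /lat /wnu /lev /= !pairE !add0r addr0 scalerDr.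
by congr (_ *: _ + _ *: _); field.
Qed.

Lemma yop_vac1 m : yop 1 (yop 0 (e0 X (None, (0, m)))) =
  (m * (2 * m + 1))%:~R *: e0 X (None, (0, m - 1)).
Proof.
have yis k : islin (yop k) by apply: islin_add; [exact: gop_is|exact: gop_is].
rewrite yop_vac0 (islinZ (yis 1)) (islinD (yis 1)) /yop.
rewrite (@gop_vanish _ _ _ _ g1 (-1, 0)) // (@gop_topE g2 (1, -1)) //.
rewrite (@gop_topE g1 (-1, 0)) // (@gop_vanish _ _ _ _ g2 (1, -1)) //.
rewrite /gsh /swt /lat /wnu /lev /= !pairE add0r addr0 addNr subrr addr0.
rewrite -scalerDl scalerA; congr (_ *: _).
by rewrite !(rmorphD, rmorphM, rmorphN) /=; field.
Qed.

(** $e_{(-1)}$ raises the exponent of $e^{mc}$ and $y_{(1)}y_{(0)}$ lowers it with coefficient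
    $m(2m+1)$, nonzero for every positive $m$; so the vacuum is reached from either side. *)
Lemma vacuum_vector (S : set X) : subspace S ->
    (forall u, S u -> xsec [set None] u) ->
    (forall k u, S u -> S (Gam (0, 1) k u)) -> (forall k u, S u -> S (hs (2 *: mu) k u)) ->
    (forall k u, S u -> S (xop k u)) -> (forall k u, S u -> S (yop k u)) ->
  (exists2 u, S u & u <> 0) -> S (svac X).
Proof.
move=> Ss SI Se Sh Sx Sy /(singular_vector Ss SI Se Sh Sx Sy)[n [m [n1 n2]]].
have -> : n = 0 by lia.
have up k m' : S (e0 X (None, (0, m'))) -> S (e0 X (None, (0, m' + k%:Z))).
  elim: k => [|k IH] h; first by rewrite addr0.
  have := Se (-1) _ (IH h); have -> : -1 = - gexp (0, 1) (None, (0, m' + k%:Z)) - 1 by [].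
  rewrite Gam_top /gsh /= (_ : m' + k%:Z + 1 = m' + k.+1%:Z) //; lia.
have down k : S (e0 X (None, (0, k%:Z))) -> S (svac X).
  elim: k => [//|k IH] h; apply: IH; have := Sy 1 _ (Sy 0 _ h); rewrite yop_vac1.
  have c0 : (k.+1%:Z * (2 * k.+1%:Z + 1))%:~R != 0 :> K by rewrite intr_eq0; lia.
  move=> /(subspaceZ (k.+1%:Z * (2 * k.+1%:Z + 1))%:~R^-1 Ss); rewrite scalerA mulVf // scale1r.
  by rewrite (_ : k.+1%:Z - 1 = k%:Z) //; lia.
case: m => m h; first exact: down h.
by have := up m.+1 _ h; rewrite NegzE addNr.
Qed.

Section Sector.
Variable b : bool.
Local Notation s := (Some b).
Let rb := if b then r + 1 / 2 else r.
Local Notation E n m := (e0 X (s, (n, m))).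

Let pg1 n m : pairing g1 (swt r (s, (n, m))) = - rb + n%:~R + m%:~R.
Proof. by rewrite /swt /sbase /lat /wnu /wmu /lev /= -/rb !pairE; field. Qed.
Let pg2 n m : pairing g2 (swt r (s, (n, m))) = - rb - 1 - n%:~R + m%:~R.
Proof. by rewrite /swt /sbase /lat /wnu /wmu /lev /= -/rb !pairE; field. Qed.

Lemma xop_top0 m : xop 0 (E 0 m) = E (-1) (m + 1).
Proof.
rewrite /xop (@Gam_pos _ _ _ (1, 0)) // add0r.
by rewrite Gam_topk.
Qed.

Lemma xop_top1 m : xop 0 (E (-1) m) = E 0 m.
Proof.
rewrite /xop (@Gam_pos _ _ _ (-1, 1)) // addr0.
by rewrite Gam_topk // /gsh /= addr0.
Qed.

Lemma yop_top0 m : yop 0 (E 0 m) = (m%:~R - rb) *: E (-1) m.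
Proof.
rewrite /yop (@gop_vanish _ _ _ _ g2) // addr0 gop_topE // pg1 /gsh /= addr0 sub0r.
by rewrite addr0 addrC.
Qed.

Lemma yop_top1 m : yop 0 (E (-1) m) = (m%:~R - rb) *: E 0 (m - 1).
Proof.
rewrite /yop (@gop_vanish _ _ _ _ g1) // add0r gop_topE // pg2 /gsh /= addNr.
by rewrite -addrA -addrA addrC mulrN1z opprK addKr.
Qed.

Lemma Gam_topE l n m : Gam (0, l) (l - 1) (E n m) = E n (m + l).
Proof.
by rewrite Gam_topk /gsh /= ?addr0 // /gexp /=; lia.
Qed.

Lemma hs_top n m : hs (2 *: mu) 0 (E n m) = (- 2 * rb + (n + 2 * m)%:~R - 1 / 2 + 3 / 2) *: E n m.
Proof.
rewrite /e0 hs0U; congr (_ *: _); rewrite /swt /sbase /lat /wmu /lev /= -/rb !pairE.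
by rewrite rmorphD rmorphM /=; field.
Qed.

End Sector.
End TopActions.

(** * Generation by the top component *)

Section ImapExp.
Variables (K : numFieldType) (I I' : choiceType) (X : fockmod K I) (X' : fockmod K I') (f : I -> I').
Variables (w : I -> 'rV[K]_3) (w' : I' -> 'rV[K]_3).
Local Notation im := (@imap K I I' X X' f).

Lemma imap_Em g q u : im (Em w g q u) = Em w' g q (im u).
Proof.
rewrite /Em; elim/Ex_ind: q => [q q0|//|q IH].
  by rewrite !Ex_neg // (islin0 (imap_is _ _)).
apply: (@scale_inj _ _ q); rewrite -(islinZ (imap_is _ _)).
rewrite (@ExE _ _ _ (gm_is w g) q.+1%:Z q.+1) // (@ExE _ _ _ (gm_is w' g) q.+1%:Z q.+1) //.
rewrite (islin_sum (imap_is _ _)); apply: eq_bigr => i _.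
by rewrite -IH; [apply: imap_hs; lia|lia].
Qed.

Lemma imap_Ep g q u : im (Ep w g q u) = Ep w' g q (im u).
Proof.
rewrite /Ep; elim/Ex_ind: q => [q q0|//|q IH].
  by rewrite !Ex_neg // (islin0 (imap_is _ _)).
apply: (@scale_inj _ _ q); rewrite -(islinZ (imap_is _ _)).
rewrite (@ExE _ _ _ (gp_is w g) q.+1%:Z q.+1) // (@ExE _ _ _ (gp_is w' g) q.+1%:Z q.+1) //.
rewrite (islin_sum (imap_is _ _)); apply: eq_bigr => i _.
rewrite -IH; last by lia.
by rewrite /gp (islinN (imap_is _ _)) (imap_hs _ _ w w').
Qed.

End ImapExp.

Section Generation.
Variables (K : numFieldType) (r : K) (X : fockmod K sector).
Local Notation hs := (@hs K sector (swt r) X).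
Local Notation Gam := (@Gam K r X).
Local Notation gop := (@gop K r X).
Local Notation Em := (@Em K sector (swt r) X).
Local Notation al := (wal K).
Local Notation cc := (wc K).
Local Notation dd := (wd K).
Local Notation mu := (wmu (lev K)).
Local Notation nu := (wnu (lev K)).
Local Notation xop := (@xop K r X).
Local Notation yop := (@yop K r X).
Local Notation Bo := (@Bop K r X).
Implicit Types (u v : X).

Definition ctr (l : int) : X -> X := imap X (gsh (0, l)).

Lemma ctr_is l : islin (ctr l). Proof. exact: imap_is. Qed.

Lemma ctr_e0 l s n m : ctr l (e0 X (s, (n, m))) = e0 X (s, (n, m + l)).
Proof. by rewrite /ctr imap_kt /gsh /= addr0. Qed.

Lemma ctr_ctr l l' u : ctr l (ctr l' u) = ctr (l' + l) u.
Proof.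
move: u; apply: fx_eq => [||A [o [n m]]].
- by apply: islin_comp; exact: imap_is.
- exact: imap_is.
- by rewrite /ctr !imap_kt /gsh /= !addr0 addrA.
Qed.

Lemma ctr0 u : ctr 0 u = u.
Proof.
move: u; apply: fx_eq => [||A [o [n m]]].
- exact: imap_is.
- exact: islin_id.
- by rewrite /ctr !imap_kt /gsh /= !addr0.
Qed.

Lemma ctr_hs l h n u : n != 0 -> ctr l (hs h n u) = hs h n (ctr l u).
Proof. exact: imap_hs. Qed.

Lemma ctr_hs0 l h u : hs h 0 (ctr l u) = ctr l (hs h 0 u) + (l%:~R * pairing h cc) *: ctr l u.
Proof.
move: u; apply: fx_eq => [||A [o [n m]]].
- by apply: islin_comp; [exact: hs_is|exact: imap_is].
- by apply: islin_add; [apply: islin_comp; [exact: imap_is|exact: hs_is]|apply: islin_scale; exact: imap_is].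
rewrite /ctr imap_kt !hs0U (islinZ (imap_is _ _)) imap_kt -scalerDl; congr (_ *: _).
rewrite /gsh /swt /= -(pairingZr l%:~R) -(pairingDr h) -addrA; congr (pairing h (_ + _)).
by rewrite /lat /= addr0 rmorphD /= -addrA -scalerDl addrA.
Qed.

Lemma ctr_Em l g q u : ctr l (Em g q u) = Em g q (ctr l u).
Proof. exact: imap_Em. Qed.

Lemma ctr_Gam l x n u : Gam x n (ctr l u) = ctr l (Gam x n u).
Proof.
move: u; apply: fx_eq => [||A i].
- by apply: islin_comp; [exact: Gam_is|exact: imap_is].
- by apply: islin_comp; [exact: imap_is|exact: Gam_is].
have ge : gexp x (gsh (0, l) i) = gexp x i by rewrite /gexp /gsh /= addr0.
have gg : gsh x (gsh (0, l) i) = gsh (0, l) (gsh x i).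
  by rewrite /gsh /= !addr0; congr (_, (_, _)); lia.
have lt : (mdeg A)%:Z < (mdeg A).+1%:Z by lia.
have E1 := @vopE _ _ (swt r) X (lat K x) (gexp x) (gsh x) (fun _ => 1) i _ n _ _ (Sd_kt X A i) lt.
have := @vopE _ _ (swt r) X (lat K x) (gexp x) (gsh x) (fun _ => 1) (gsh (0, l) i) _ n _ _ (Sd_kt X A _) lt.
rewrite /ctr imap_kt -/(Gam x) => ->; rewrite [Gam x n _]E1 !scale1r (islin_sum (imap_is _ _)).
apply: eq_bigr => q _; rewrite -/(ctr l _) ctr_Em ge -(imap_kt X X (gsh (0, l)) A i).
rewrite -(@imap_Ep _ _ _ X X (gsh (0, l)) (swt r) (swt r)); congr (Em _ _ _).
move: (Ep _ _ _ _); apply: fx_eq => [||B i'].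
- by apply: islin_comp; exact: imap_is.
- by apply: islin_comp; exact: imap_is.
rewrite /ctr !imap_kt; congr (kt _ _).
by rewrite /gsh /= !addr0; congr (_, (_, _)); lia.
Qed.

Variables (b : bool) (S : set X).
Let s : option bool := Some b.
Local Notation inS := (xsec (X := X) [set s]).
Hypotheses (Ss : subspace S).
Hypotheses (Se : forall k u, S u -> S (Gam (0, 1) k u)) (Sh : forall k u, S u -> S (hs (2 *: mu) k u)).
Hypotheses (Sx : forall k u, S u -> S (xop k u)) (Sy : forall k u, S u -> S (yop k u)).

(** The currents contain $e^c$ but not $e^{-c}$, so [S] need not be stable under translation by
    $-c$. Asking that all translates lie in [S] supplies the missing inverse; the top vectors
    satisfy it because they occur with every [m]. *)
Definition allS : set X := [set u | inS u /\ forall l, S (ctr l u)].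
Definition freeS : set X := [set u | allS u /\ cfree r u].

Lemma allS_sub : subspace allS.
Proof.
split=> [|c u v [iu hu] [iv hv]]; first by split=> [|l]; [exact: supp0|rewrite (islin0 (ctr_is l)); case: Ss].
by split=> [|l]; [exact: suppL|rewrite ctr_is; apply: Ss.2].
Qed.

Lemma freeS_sub : subspace freeS.
Proof.
split=> [|c u v [au fu] [av fv]]; split.
- by case: allS_sub.
- by move=> i; apply: islin0 (hs_is _ _ _).
- exact: allS_sub.2.
- by move=> i; rewrite hs_is fu fv scaler0 addr0.
Qed.

Lemma allS_ctr l u : allS u -> allS (ctr l u).
Proof.
move=> [iu hu]; split=> [|l']; last by rewrite ctr_ctr.
have := iu; apply: supp_lin; first exact: ctr_is.
by move=> A i /= <-; rewrite /ctr imap_kt; apply: suppU.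
Qed.

Lemma freeS_ctr l u : freeS u -> freeS (ctr l u).
Proof.
move=> [au fu]; split=> [|i]; first exact: allS_ctr.
by rewrite -ctr_hs // fu (islin0 (ctr_is _)).
Qed.

Lemma allS_h k u : allS u -> allS (hs (2 *: mu) k u).
Proof.
move=> [iu hu]; split=> [|l]; first exact: hs_inS.
have [->|k0] := eqVneq k 0; last by rewrite ctr_hs //; apply: Sh.
have -> : ctr l (hs (2 *: mu) 0 u) = hs (2 *: mu) 0 (ctr l u) - (l%:~R * pairing (2 *: mu) cc) *: ctr l u.
  by rewrite ctr_hs0 addrK.
by apply: subspaceB => //; [exact: Sh|exact: subspaceZ].
Qed.

Lemma freeS_h k u : 0 <= k -> freeS u -> freeS (hs (2 *: mu) k u).
Proof.
move=> k0 [au fu]; split=> [|i]; first exact: allS_h.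
by rewrite hs_comm ifN ?scale0r ?addr0 ?fu ?(islin0 (hs_is _ _ _)) //; lia.
Qed.

Lemma freeS_Em_c q u : freeS u -> freeS (Em cc q u).
Proof.
move=> [[iu hu] fu].
have E l : ctr l (Em cc q u) = Gam (0, 1) (- q) (ctr (l - 1) u).
  have [[iv _] fv] := freeS_ctr (l - 1) (conj (conj iu hu) fu).
  rewrite (@Gam_cfree K r X s 1) // lat01 ctr_Em -/(ctr 1 _) ctr_ctr.
  by rewrite (subrK 1 l); congr (Em _ _ _); rewrite /=; lia.
split=> [|i]; last first.
  by rewrite Em_hsP fu pairing_cc scale0r addr0 (islin0 (Em_is _ _ _)).
split=> [|l]; last by rewrite E; apply: Se; have [] := allS_ctr (l - 1) (conj iu hu) => _ h; have := h 0; rewrite ctr0.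
by rewrite -[Em _ _ _]ctr0 E; apply: Gam_inS; have [] := allS_ctr (0 - 1) (conj iu hu).
Qed.

(** Solving the recursion of the exponential for its last term expresses $c(-n-1)$ through
    coefficients of $e^c(z)$ and earlier modes $c(-i-1)$. *)
Lemma freeS_c n u : freeS u -> freeS (hs cc (Negz n) u).
Proof.
elim/ltn_ind: n u => n IH u hu.
have E : hs cc (Negz n) u = n.+1%:R *: Em cc n.+1%:Z u - \sum_(i < n) hs cc (Negz i) (Em cc (n.+1%:Z - i.+1%:Z) u).
  rewrite /Em -[n.+1%:R *: _]/(n.+1%:Z%:~R *: _) (@ExE _ _ _ (gm_is (swt r) cc) n.+1%:Z n.+1) //.
  rewrite big_ord_recr /= subrr Ex0 [X in _ = X - _]addrC; exact: esym (addrK _ _).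
rewrite E; apply: subspaceB; first exact: freeS_sub.
  by apply: subspaceZ; [exact: freeS_sub|exact: freeS_Em_c].
apply: subspace_sum; first exact: freeS_sub.
by move=> i _; apply: IH => //; exact: freeS_Em_c.
Qed.

Lemma freeS_Gam_c l k u : freeS u -> freeS (Gam (0, l) k u).
Proof.
move=> hu; have [[iu _] fu] := hu; rewrite (Gam_cfree l k iu fu).
have lE : lat K (0, l) = l%:~R *: cc by rewrite /lat /= mul0r add0r scale0r add0r.
have := freeS_ctr l hu; rewrite /ctr; move: (imap _ _ u) (- k - 1 + _) => v q hv.
rewrite /Em; elim/Ex_ind: q => [q q0|//|q IH].
  by rewrite Ex_neg //; case: freeS_sub.
have q0 : q.+1%:R != 0 :> K by rewrite pnatr_eq0.
rewrite -[Ex _ _ _]scale1r -(mulVf q0) -scalerA; apply: subspaceZ; first exact: freeS_sub.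
rewrite -[q.+1%:R *: _]/(q.+1%:Z%:~R *: _) (@ExE _ _ _ (gm_is (swt r) _) q.+1%:Z q.+1) //.
apply: subspace_sum; first exact: freeS_sub.
move=> i _; rewrite /gm lE hsZl; apply: subspaceZ; first exact: freeS_sub.
by apply: freeS_c; rewrite -lE; apply: IH; lia.
Qed.

Lemma freeS_x k u : freeS u -> freeS (xop k u).
Proof.
move=> [[iu hu] fu]; split=> [|i]; last first.
  by rewrite /xop (islinD (hs_is _ _ _)) !(cfree_GamS _ _ fu) addr0.
split=> [|l]; first by apply: suppD; apply: Gam_inS.
by rewrite /xop (islinD (ctr_is l)) -!ctr_Gam; apply: Sx.
Qed.

Lemma freeS_B k u : freeS u -> freeS (Bo k u).
Proof.
move=> hu; have [[iu _] fu] := hu; have [N ->] := Bop_xop k iu fu.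
apply: subspace_sum; first exact: freeS_sub.
by move=> i _; apply: freeS_Gam_c; apply: freeS_x.
Qed.

Lemma ctr_gop l g x k u : gop g x k (ctr l u) =
  ctr l (gop g x k u) + (l%:~R * pairing g cc) *: ctr l (Gam x (k - 1) u).
Proof.
have [N hN] := gop_bound r x k u; have [N' hN'] := gop_bound r x k (ctr l u).
pose M := (maxn N N').+1.
have l1 : (N <= M)%N by rewrite leqW // leq_maxl.
have l2 : (N' <= M)%N by rewrite leqW // leq_maxr.
rewrite (hN M) // (hN' M) // (islinD (ctr_is l)) !(islin_sum (ctr_is l)) -addrA; congr (_ + _).
  by apply: eq_bigr => i _; rewrite ctr_Gam ctr_hs //; lia.
rewrite /M !big_ord_recl ctr_hs0 (islinD (Gam_is _ _ _)) !ctr_Gam (islinZ (Gam_is _ _ _)) ctr_Gam subr0.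
rewrite -!addrA; congr (_ + _); rewrite addrC; congr (_ + _).
by apply: eq_bigr => i _; rewrite -ctr_hs // ctr_Gam.
Qed.

(** Both Heisenberg factors of $y$ pair with $c$ to 1, so moving $y$ past a translation costs a
    multiple of [Bop]. The conclusion is [allS] and not [freeS], since modes of $\nu$ do not commute
    with those of $c$. *)
Lemma allS_y k u : freeS u -> allS (yop k u).
Proof.
move=> hu; have [[iu au] fu] := hu.
have gin g x : inS (gop g x k u).
  apply: D_closed; [exact: supp_subspace|exact: lfield_hs|exact: Gam_fld| |].
  - by move=> p q _; apply/hs_inS/Gam_inS.
  - by move=> p q _; apply/Gam_inS/hs_inS.
split=> [|l]; first by rewrite /yop; apply: suppD; exact: gin.
have -> : ctr l (yop k u) = yop k (ctr l u) - l%:~R *: ctr l (Bo (k - 1) u).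
  rewrite /yop !ctr_gop /Bop !(islinD (ctr_is l)) /wnu !pairE /lev.
  by mod_coords K X; field.
apply: subspaceB => //; first exact: Sy.
by apply: subspaceZ => //; have [[_ h] _] := freeS_B (k - 1) hu.
Qed.

(** Here [yop_cfree] is solved for the mode of [Gam (-1, 0)], descending from large modes, where it
    vanishes. The coefficient $k'+1+\frac12$ is never zero, in contrast to the vacuum sector, where
    it would be $k'+1$. *)
Lemma freeS_minus k u : freeS u -> freeS (Gam (-1, 0) k u).
Proof.
move=> hu; have [[iu au] fu] := hu; have [M hM] := Gam_bound r (-1, 0) k u.
suff H (j : nat) k' : k <= k' -> k + M%:Z <= k' + j%:Z -> freeS (Gam (-1, 0) k' u) by apply: (H M); lia.
elim: j k' => [|j IH] k' l1 l2.
  rewrite (_ : k' = k + `|k' - k|%N%:Z); last by lia.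
  by rewrite hM; [case: freeS_sub|lia].
split=> [|i]; last by rewrite (cfree_GamS _ _ fu).
have [N] := yop_cfree (k' + 1) iu fu.
set h1 := \sum_(i < N) hs _ _ _; set h2 := \sum_(i < N) Bo _ _; set h3 := \sum_(i < N) hs _ _ _.
rewrite addrK; set G := Gam _ _ _ => E.
have Sub := allS_sub.
have a1 : allS h1 by apply: subspace_sum => // i _; apply: allS_h; case: (freeS_B (k' + 1 + i%:Z) hu).
have a2 : allS h2.
  by apply: subspace_sum => // i _; case: (@freeS_B (k' + 1 - 1 - i%:Z) (hs (2 *: mu) i%:Z u)) => //; exact: freeS_h.
have a3 : allS h3.
  apply: subspace_sum => // i _; case: (@freeS_c i (Gam (-1, 0) (k' + 1 + i%:Z) u)) => [|h _].
    by apply: IH; lia.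
  by rewrite (_ : -1 - i%:Z = Negz i) //; lia.
have a4 : allS (Bo k' u) by case: (freeS_B k' hu).
have c0 : (k' + 1)%:~R + 1 / 2 != 0 :> K.
  have -> : (k' + 1)%:~R + 1 / 2 = (2 * (k' + 1) + 1)%:~R / 2 :> K.
    by rewrite !(rmorphD, rmorphM) /=; field.
  by rewrite mulf_neq0 ?invr_eq0 ?pnatr_eq0 // intr_eq0; apply/eqP; lia.
have -> : G = ((k' + 1)%:~R + 1 / 2)^-1 *: (2^-1 *: (h1 + h2) + 2^-1 *: h3
    + (3 / 2 * (k' + 1)%:~R) *: Bo k' u - yop (k' + 1) u).
  rewrite E /=; apply: (scalerI c0); rewrite scalerA mulfV // scale1r.
  by mod_coords K X; ring.
apply: subspaceZ => //; apply: subspaceB => //; last exact: allS_y.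
have a12 : allS (2^-1 *: (h1 + h2)) by apply: subspaceZ => //; exact: subspaceD.
have a123 : allS (2^-1 *: (h1 + h2) + 2^-1 *: h3) by apply: subspaceD => //; exact: subspaceZ.
by apply: subspaceD => //; exact: subspaceZ.
Qed.

Lemma freeS_plus k u : freeS u -> freeS (Gam (1, -1) k u).
Proof.
move=> hu; have -> : Gam (1, -1) k u = Bo k u - Gam (-1, 0) k u by rewrite /Bop addrC addKr.
by apply: subspaceB; [exact: freeS_sub|exact: freeS_B|exact: freeS_minus].
Qed.

(** Multiplying [Gam (1, -1)] by $e^c$ gives [Gam (1, 0)]; bosonization with [Gam (-1, 0)] yields
    the modes of $\alpha+\frac c2$, from which those of $c$ are subtracted. *)
Lemma freeS_al n u : freeS u -> freeS (hs al n u).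
Proof.
move=> hu.
have g10 k v : freeS v -> freeS (Gam (1, 0) k v).
  move=> hv; have := @Gam_shift K r X (1, -1) 1; rewrite /= addNr => ->.
  apply: D_closed; [exact: freeS_sub|exact: Gam_fld|exact: Gam_fld| |].
  - by move=> p q _; apply/freeS_Gam_c/freeS_plus.
  - by move=> p q _; apply/freeS_plus/freeS_Gam_c.
have l10 : freeS (hs (lat K (1, 0)) n u).
  rewrite hs_bosonization.
  apply: D_closed; [exact: freeS_sub|exact: Gam_fld|exact: Gam_fld| |].
  - by move=> p q _; apply/g10/freeS_minus.
  - by move=> p q _; apply/freeS_minus/g10.
have -> : al = lat K (1, 0) - 2^-1 *: cc by rewrite lat10 addrK.
rewrite hsDl hsNl hsZl; apply: subspaceB; [exact: freeS_sub|exact: l10|apply: subspaceZ; first exact: freeS_sub].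
case: n {l10} => [[|n]|n]; last exact: freeS_c.
  have [[iu _] _] := hu; rewrite (@c_zero K r X s u iu); apply: subspaceZ => //; exact: freeS_sub.
by have [_ ->] := hu; case: freeS_sub.
Qed.

Hypothesis St : forall m, S (e0 X (s, (0, m))).

Lemma freeS_e0 n m : freeS (e0 X (s, (n, m))).
Proof.
have h0 m' : freeS (e0 X (s, (0, m'))).
  split=> [|i]; last exact: hsP_e0.
  by split=> [|l]; [exact: suppU|rewrite ctr_e0; apply: St].
case: n => [n|n].
  elim: n m => [|n IH] m; first exact: h0.
  have := freeS_plus (- gexp (1, -1) (s, (n%:Z, m + 1)) - 1) (IH (m + 1)).
  by rewrite Gam_top /gsh /= addrK (_ : n%:Z + 1 = n.+1%:Z) //; lia.
rewrite NegzE; elim: n m => [|n IH] m.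
  have := freeS_minus (- gexp (-1, 0) (s, (0, m)) - 1) (h0 m).
  by rewrite Gam_top /gsh /= addr0.
have := freeS_minus (- gexp (-1, 0) (s, (- n.+1%:Z, m)) - 1) (IH m).
by rewrite Gam_top /gsh /= addr0 (_ : - n.+1%:Z - 1 = - n.+2%:Z) //; lia.
Qed.

Theorem sector_generated u : inS u -> S u.
Proof.
(* $d(-n)$ destroys $c$-freeness, so it is obtained from $h(-n)$ and $c(-n)$ with the $h(-n)$
   applied last: [Q] is the closure of [freeS] under the $h(-n)$. Creation by $\alpha$ and $c$
   passes through because creation operators commute. *)
pose Q v := forall S' : set X, subspace S' -> (forall v, freeS v -> S' v) ->
  (forall n v, S' v -> S' (hs (2 *: mu) (Negz n) v)) -> S' v.
have Qf g n v : (forall v, freeS v -> freeS (hs g (Negz n) v)) -> Q v -> Q (hs g (Negz n) v).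
  move=> hg Qv S' Ss' fS' hS'; apply: (Qv (fun v => S' (hs g (Negz n) v))).
  - by split=> [|c w w' hw hw']; [rewrite (islin0 (hs_is _ _ _)); case: Ss'|rewrite hs_is; apply: Ss'.2].
  - by move=> w hw; apply: fS'; apply: hg.
  - move=> n' w hw; have -> : hs g (Negz n) (hs (2 *: mu) (Negz n') w) = hs (2 *: mu) (Negz n') (hs g (Negz n) w).
      by rewrite [LHS]hs_comm; case: eqP => [|_]; [lia|rewrite scale0r addr0].
    exact: hS'.
have Qh n v : Q v -> Q (hs (2 *: mu) (Negz n) v).
  by move=> Qv S' Ss' fS' hS'; exact: hS' (Qv S' Ss' fS' hS').
have Qsub : subspace Q.
  split=> [|c v v' Qv Qv'] S' Ss' fS' hS'; first by case: Ss'.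
  by apply: Ss'.2; [exact: (Qv S' Ss' fS' hS')|exact: (Qv' S' Ss' fS' hS')].
have Qal n v : Q v -> Q (hs al (Negz n) v) by apply: Qf => w; apply: freeS_al.
have Qcc n v : Q v -> Q (hs cc (Negz n) v) by apply: Qf => w; apply: freeS_c.
have Qdd n v : Q v -> Q (hs dd (Negz n) v).
  move=> Qv; have -> : dd = 2 *: mu + (3 / 4) *: cc by apply/rowP => j; rewrite /wmu /lev !mxE; field.
  by rewrite hsDl [X in _ + X]hsZl; exact: (@subspaceD _ _ Q _ _ Qsub (Qh n v Qv) (@subspaceZ _ _ Q _ _ Qsub (Qcc n v Qv))).
move=> hu; suff : Q u.
  by apply=> // [v [[_ h] _]|n v]; [have := h 0; rewrite ctr0|apply: Sh].
apply: (suppE (P := Q) hu); first by case: Qsub.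
- by move=> c v v'; apply: Qsub.2.
move=> A [o [n m]] /= ->; elim/modes_ind: A => [|A [i k] IH].
  by move=> S' _ h _; apply: h; exact: freeS_e0.
rewrite -crU (cr_hs (swt r)); case: i => -[|[|[|//]]] l3.
- by rewrite (_ : bas K (Ordinal l3) = al); [apply: Qal|congr bas; apply/val_inj; rewrite /= inordK].
- by rewrite (_ : bas K (Ordinal l3) = cc); [apply: Qcc|congr bas; apply/val_inj; rewrite /= inordK].
- by rewrite (_ : bas K (Ordinal l3) = dd); [apply: Qdd|congr bas; apply/val_inj; rewrite /= inordK].
Qed.

End Generation.

(** * The universal affine vertex superalgebra *)

Section FsumGeneral.
Variables (K : numFieldType) (M M' : lmodType K).

(** An injective linear map preserves the support, so both sums range over the same set, also in the
    default case of an infinite support. *)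
Lemma fsum_inj (f : M -> M') (F : nat -> M) : islin f -> injective f ->
  f (\sum_(j \in [set: nat]) F j) = \sum_(j \in [set: nat]) f (F j).
Proof.
move=> fl fi; rewrite [in RHS](_ : finite_support _ _ _ = finite_support 0 [set: nat] F).
  exact: islin_sum.
rewrite /finite_support !unlock; congr (enum_fset (fset_set (_ `&` _))).
apply/seteqP; split=> j /= h E; apply: h; first by rewrite E islin0.
by apply: fi; rewrite E islin0.
Qed.

Lemma subspace_fsum (S : set M) (F : nat -> M) : subspace S -> (forall j, S (F j)) ->
  S (\sum_(j \in [set: nat]) F j).
Proof. by move=> Ss h; apply: (@subspace_sum _ _ S). Qed.
End FsumGeneral.

Section SubLmodule.
Variables (K : numFieldType) (V : lmodType K) (S : set V) (Ss : subspace S).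

Definition subpred (_ : subspace S) : {pred V} := fun u => `[<S u>].

Lemma subpred_closed : submod_closed (subpred Ss).
Proof.
split=> [|c u v]; first by apply/asboolP; case: Ss.
by move=> /asboolP hu /asboolP hv; apply/asboolP; apply: Ss.2.
Qed.
HB.instance Definition _ := GRing.isSubmodClosed.Build K V (subpred Ss) subpred_closed.

Inductive sublm : predArgType := Sublm u & u \in subpred Ss.
Definition subval (w : sublm) : V := let: Sublm u _ := w in u.
HB.instance Definition _ := [isSub of sublm for subval].
HB.instance Definition _ := [Choice of sublm by <:].
HB.instance Definition _ := [SubChoice_isSubLmodule of sublm by <:].

Lemma subval_is : islin subval. Proof. by []. Qed.
Lemma subval_inj : injective subval. Proof. exact: val_inj. Qed.
Lemma subvalP w : S (subval w). Proof. by case: w => u /= /asboolP. Qed.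
Definition mksub u (h : S u) : sublm := Sublm (introT (asboolP _) h).
End SubLmodule.

Section SubVsa.
Variables (K : numFieldType) (V : vsa K) (S : set V).
Hypotheses (Ss : subspace S) (Sh : homogeneous (@vpar K V) S) (Sv : S (vac V)).
Hypothesis Sp : forall a n b, S a -> S b -> S (vprod a n b).

Definition subprod (a : sublm Ss) n (b : sublm Ss) : sublm Ss :=
  mksub Ss (Sp n (subvalP a) (subvalP b)).
Definition subpar p (a : sublm Ss) := vpar p (subval a).

Let H := vsa_action V.

Lemma subpar_grading : grading subpar.
Proof.
have [Gs Gh Gi] := vsa_grading V.
split=> [p|u _|s v us hv s0 i si].
- by split=> [|c u v]; [case: (Gs p)|apply: (Gs p).2].
- have [s [v [hv E]]] := Sh (subvalP u).
  exists s, (fun i => mksub Ss (hv i).2); split=> [i|]; first by split=> //; exact: (hv i).1.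
  by apply: val_inj; rewrite /= (islin_sum (@subval_is _ _ _ Ss)).
- apply: val_inj; apply: (Gi s (fun i => subval (v i))) => //.
  by rewrite -(islin_sum (@subval_is _ _ _ Ss)) s0.
Qed.

Lemma subprod_action : vertex_action subpar subpar (mksub Ss Sv) subprod subprod.
Proof.
split.
- by move=> c a b n u; apply: val_inj; apply: (va_linl H).
- by move=> c a n u w; apply: val_inj; apply: (va_linr H).
- by move=> p q a n u; apply: (va_par H).
- move=> a u; have [N h] := va_trunc H (subval a) (subval u).
  by exists N => n /h e; apply: val_inj.
- by move=> n u; apply: val_inj; rewrite /= (va_vac H); case: ifP.
- move=> p q a b c m n l pa pb; apply: (@subval_inj _ _ _ Ss).
  rewrite !(fsum_inj _ (@subval_is _ _ _ Ss) (@subval_inj _ _ _ Ss)).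
  exact: (va_borcherds H).
Qed.

Definition subvsa : vsa K.
Proof.
refine (@Vsa K (sublm Ss) subpar (mksub Ss Sv) subprod subpar_grading _ subprod_action _ _).
- exact: vpar_vac.
- by move=> a; apply: val_inj; apply: vprod_vacr.
- by move=> a n n0; apply: val_inj; apply: vprod_vac0.
Defined.
End SubVsa.

Section ScaledVsa.
Variables (K : numFieldType) (V : vsa K) (t : K).
Hypothesis t0 : t != 0.

(** The substitution $z\mapsto tz$ in $Y(a,z)$. On a graded algebra it is transport along
    $t^{\deg}$, but it makes sense before any grading is known. *)
Definition sprod (a : V) (n : int) (b : V) : V := t ^ (- n - 1) *: vprod a n b.

Lemma sprod_action : vertex_action (@vpar K V) (@vpar K V) (vac V) sprod sprod.
Proof.
have H := vsa_action V; have [Gs _ _] := vsa_grading V.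
split.
- by move=> c a b n u; rewrite /sprod (va_linl H) scalerDr !scalerA mulrC.
- by move=> c a n u w; rewrite /sprod (va_linr H) scalerDr !scalerA mulrC.
- by move=> p q a n u pa qu; apply: subspaceZ => //; apply: (va_par H).
- by move=> a u; have [N h] := va_trunc H a u; exists N => n /h; rewrite /sprod => ->; rewrite scaler0.
- move=> n u; rewrite /sprod (va_vac H); case: eqP => [->|_]; last exact: scaler0.
  by rewrite opprK subrr expr0z scale1r.
move=> p q a b c m n l pa qb.
have c0 : t ^ (- m - n - l - 2) != 0 by rewrite expfz_neq0.
have sl : islin (fun u : V => t ^ (- m - n - l - 2) *: u) by move=> k u v; rewrite scalerDr !scalerA mulrC.
have si : injective (fun u : V => t ^ (- m - n - l - 2) *: u) by exact: scalerI.
have := congr1 (fun u : V => t ^ (- m - n - l - 2) *: u) (va_borcherds H c m n l pa qb).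
have ss x y (u : V) : t ^ x *: (t ^ y *: u) = t ^ (x + y) *: u by rewrite scalerA -expfzDr.
rewrite /= !(fsum_inj _ sl si) => E; apply: (etrans _ (etrans E _)).
- apply: eq_fsbigr => j _; rewrite /sprod (islinZ (vprod_linl _ _)) ss !scalerA mulrC.
  by congr (_ * _ *: _); congr (t ^ _); lia.
- apply: eq_fsbigr => j _; rewrite /sprod !(islinZ (vprod_lin _ _)) !ss [LHS]scalerA [X in X *: _ = _]mulrC -[LHS]scalerA.
  congr (_ *: _); rewrite scalerBr; congr (_ - _); first by congr (t ^ _ *: _); lia.
  by rewrite scalerA [RHS]scalerA mulrC; congr (_ * _ *: _); congr (t ^ _); lia.
Qed.

Lemma sprod_vac a : sprod a (-1) (vac V) = a.
Proof. by rewrite /sprod vprod_vacr opprK subrr expr0z scale1r. Qed.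

Lemma sprod_vac0 a (n : int) : 0 <= n -> sprod a n (vac V) = 0.
Proof. by move=> n0; rewrite /sprod vprod_vac0 ?scaler0. Qed.

Definition svsa : vsa K :=
  Vsa (vsa_grading V) (vpar_vac V) sprod_action sprod_vac sprod_vac0.

Lemma svsa_affine (k : K) (j : osp -> V) : affine_map k j ->
  affine_map k ((fun a => t *: j a) : osp -> svsa).
Proof.
case=> h1 h2 h3 h4; have [Gs _ _] := vsa_grading V; split=> /=.
- by move=> a; apply: subspaceZ.
- move=> a b; rewrite /sprod (islinZ (vprod_linl _ _)) (islinZ (vprod_lin _ _)) h2 !scalerA.
  rewrite (_ : - 0 - 1 = -1 :> int) // exprN1 mulKf // scaler_sumr; apply: eq_bigr => x _.
  by rewrite !scalerA mulrC.
- move=> a b; rewrite /sprod (islinZ (vprod_linl _ _)) (islinZ (vprod_lin _ _)) h3 !scalerA.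
  by rewrite (_ : -1 - 1 = - 2%:Z) // -exprz_inv -exprnP exprVn expr2 mulVf ?mul1r // mulf_neq0.
- by move=> a b n le; rewrite /sprod (islinZ (vprod_linl _ _)) (islinZ (vprod_lin _ _)) h4 // !scaler0.
Qed.

End ScaledVsa.

Section Gradings.
Variables (K : numFieldType) (I : eqType) (V : lmodType K) (G : I -> set V).
Hypothesis Gs : forall i, subspace (G i).

Definition gsum : set V :=
  [set u | exists s v, [/\ uniq s, forall i, G i (v i) & u = \sum_(i <- s) v i]].

Lemma gsumI (s : seq I) (v : I -> V) : (forall i, G i (v i)) -> gsum (\sum_(i <- s) v i).
Proof.
move=> hv; exists (undup s), (fun i => \sum_(x <- s | x == i) v x); split; first exact: undup_uniq.
  by move=> i; apply: subspace_sum => // x /eqP ->.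
rewrite (exchange_big_dep xpredT) //= big_seq [RHS]big_seq; apply: eq_bigr => x xs.
rewrite big_mkcond (bigD1_seq x) ?undup_uniq ?mem_undup //= eqxx big1 ?addr0 //.
by move=> i ne; rewrite ifN // eq_sym.
Qed.

Lemma gsum_sub : subspace gsum.
Proof.
split=> [|c u u' [s [v [us hv ->]]] [s' [v' [us' hv' ->]]]].
  by exists [::], (fun _ => 0); split=> // [i|]; [case: (Gs i)|rewrite big_nil].
have gZ k (t : seq I) w : (forall i, G i (w i)) -> gsum (k *: \sum_(i <- t) w i).
  by move=> hw; rewrite scaler_sumr; apply: gsumI => i; apply: subspaceZ.
have -> : c *: (\sum_(i <- s) v i) + \sum_(i <- s') v' i =
    \sum_(i <- undup (s ++ s')) ((if i \in s then c *: v i else 0) + (if i \in s' then v' i else 0)).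
  have sub (t : seq I) w : uniq t -> {subset t <= undup (s ++ s')} ->
      \sum_(i <- t) w i = \sum_(i <- undup (s ++ s')) (if i \in t then w i else 0) :> V.
    move=> ut st; rewrite -big_mkcond -big_filter; apply: perm_big; apply: uniq_perm => //.
      by apply/filter_uniq/undup_uniq.
    by move=> x; rewrite mem_filter; case: (boolP (x \in t)) => // /st ->.
  rewrite scaler_sumr big_split; congr (_ + _); apply: sub => // x xs; rewrite mem_undup mem_cat xs ?orbT //.
apply: gsumI => i; apply: subspaceD => //; case: ifP => _; try by case: (Gs i).
exact: subspaceZ.
Qed.

Lemma gsum_incl i u : G i u -> gsum u.
Proof.
move=> hu; have [G0 _] := Gs i.
have -> : u = \sum_(x <- [:: i]) (if x == i then u else 0) by rewrite big_seq1 eqxx.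
by apply: gsumI => x; case: eqP => [->//|_]; case: (Gs x).
Qed.

Lemma grading_sum u : grading G -> gsum u.
Proof. by case=> _ h _; have [s [v [hv ->]]] := h u Logic.I; apply: gsumI => i; case: (hv i). Qed.

Lemma grading_comp (s : seq I) (v : I -> V) i : grading G -> uniq s -> (forall x, G x (v x)) ->
  G i (\sum_(x <- s) v x) -> forall x, x \in s -> x != i -> v x = 0.
Proof.
move=> [_ _ Gi] us hv hi x xs xi; pose w y := (if y \in s then v y else 0) -
  (if y == i then \sum_(x <- s) v x else 0).
have hw y : G y (w y).
  by apply: subspaceB => //; [case: ifP => _ //; case: (Gs y)|case: eqP => [->//|_]; case: (Gs y)].
have := Gi (undup (i :: s)) w (undup_uniq _) hw _ x.
rewrite /w xs (negPf xi) subr0; apply; last by rewrite mem_undup inE xs orbT.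
rewrite sumrB; apply/eqP; rewrite subr_eq0; apply/eqP.
rewrite -big_mkcond -[RHS]big_mkcond -big_filter -[RHS]big_filter.
have -> : [seq y <- undup (i :: s) | y == i] = [:: i].
  apply: perm_small_eq => //; apply: uniq_perm => //; first by apply/filter_uniq/undup_uniq.
  by move=> y; rewrite mem_filter mem_undup !inE; case: eqP.
rewrite big_seq1; apply: perm_big; apply: uniq_perm => //; first by apply/filter_uniq/undup_uniq.
by move=> y; rewrite mem_filter mem_undup inE; case: (y \in s); rewrite ?orbT ?andbF.
Qed.

End Gradings.

Lemma vsa_parts (K : numFieldType) (V : vsa K) (u : V) :
  exists u0 u1, [/\ vpar false u0, vpar true u1 & u = u0 + u1].
Proof.
have [Gs _ _] := vsa_grading V; have [s [v [us hv ->]]] := grading_sum Gs u (vsa_grading V).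
exists (if false \in s then v false else 0), (if true \in s then v true else 0).
split; try by [case: ifP => _; [exact: hv|case: (Gs false)]|case: ifP => _; [exact: hv|case: (Gs true)]].
rewrite (perm_big [seq b <- [:: false; true] | b \in s]); last first.
  by apply: uniq_perm => //; [apply: filter_uniq|move=> []; rewrite mem_filter !inE ?andbT].
by rewrite big_filter big_mkcond !big_cons big_nil /= addr0.
Qed.

Section Iterate.
Variables (K : numFieldType) (V : vsa K) (M : lmodType K) (mp : bool -> set M) (act : V -> int -> M -> M).
Hypothesis H : vertex_action (@vpar K V) mp (vac V) (@vprod K V) act.

Lemma act_iterate (T : set M) p q a b n l u : subspace T -> vpar p a -> vpar q b ->
    (forall x y : int, x + y = n + l -> T (act a x (act b y u))) ->
    (forall x y : int, x + y = n + l -> T (act b y (act a x u))) ->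
  T (act (vprod a n b) l u).
Proof.
move=> Ts pa qb hab hba; have := va_borcherds H u 0 n l pa qb.
rewrite (@fsumE _ _ 1) => [|[|j] // _]; last by rewrite binz_nat0 // scale0r.
rewrite big_ord1 binz0 scale1r addr0 add0r subr0 => ->.
apply: subspace_fsum => // j; apply: subspaceZ => //; apply: subspaceB => //.
  by apply: hab; lia.
by apply: subspaceZ => //; apply: hba; lia.
Qed.
End Iterate.

Section AffineStates.
Variables (K : numFieldType) (V : vsa K) (k : K) (j : osp -> V).
Hypothesis hj : affine_map k j.

Lemma affine_ope a b : ope (j a) (j b) (\sum_(t <- osp_br a b) t.1%:~R *: j t.2) (k * (osp_form a b)%:~R).
Proof.
move=> n n0; have [E|n1] := eqVneq n 0; first by rewrite E /= scale0r addr0 (am_ope0 hj).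
have [->|n2] := eqVneq n 1; first by rewrite add0r (am_ope1 hj).
by rewrite scale0r addr0 (am_ope2 hj) //; lia.
Qed.

Definition mono (w : seq (osp * nat)) : V := foldr (fun p u => vprod (j p.1) (Negz p.2) u) (vac V) w.
Definition mono_deg (w : seq (osp * nat)) : int := (\sum_(p <- w) p.2.+1)%N%:Z.

(* the span of the monomials of degree [d] *)
Definition monos (d : int) : set V :=
  [set u | forall S, subspace S -> (forall w, mono_deg w = d -> S (mono w)) -> S u].

Lemma monos_sub d : subspace (monos d).
Proof. by split=> [S []//|c u v hu hv S Ss h]; apply: Ss.2; [apply: hu|apply: hv]. Qed.

Lemma monos_mono w d : mono_deg w = d -> monos d (mono w).
Proof. by move=> E S _; apply. Qed.

Lemma mono_deg_cons a m w : mono_deg ((a, m) :: w) = mono_deg w + m.+1%:Z.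
Proof. by rewrite /mono_deg big_cons /=; lia. Qed.

Lemma mono_par w : exists p, vpar p (mono w).
Proof.
elim: w => [|[a m] w [p hp]]; first by exists false; exact: vpar_vac.
by eexists; apply: (va_par (vsa_action V)); [exact: (am_par hj)|exact: hp].
Qed.

Lemma monos_neg d u : d < 0 -> monos d u -> u = 0.
Proof.
move=> d0 hu; apply: (hu [set 0]) => [|w E]; last by rewrite /mono_deg in E; lia.
by split=> // c x y -> ->; rewrite scaler0 addr0.
Qed.

Lemma monos_cr a m d u : monos d u -> monos (d + m.+1%:Z) (vprod (j a) (Negz m) u).
Proof.
move=> hu; apply: (hu [set u | monos (d + m.+1%:Z) (vprod (j a) (Negz m) u)]).
  split=> [|c x y hx hy] /=; first by rewrite (islin0 (vprod_lin _ _)); case: (monos_sub (d + m.+1%:Z)).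
  by rewrite vprod_lin; apply: (monos_sub _).2.
by move=> w <-; apply: (@monos_mono ((a, m) :: w)); exact: mono_deg_cons.
Qed.

(** Induction on the monomial: the current is commuted to the right past each factor until it acts
    on the vacuum, and every bracket respects the degree. *)
Lemma monos_mode a n d u : monos d u -> monos (d - n) (vprod (j a) n u).
Proof.
move=> hu; apply: (hu [set u | monos (d - n) (vprod (j a) n u)]).
  split=> [|c x y hx hy] /=; first by rewrite (islin0 (vprod_lin _ _)); case: (monos_sub (d - n)).
  by rewrite vprod_lin; apply: (monos_sub _).2.
move=> w <- {d u hu}; elim: w a n => [|[b m] w IH] a n /=.
  case: n => n; last by have := monos_cr a (m := n) (@monos_mono [::] _ erefl); rewrite NegzE opprK.
  by rewrite vprod_vac0 //; case: (monos_sub (mono_deg [::] - n%:Z)).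
rewrite mono_deg_cons; have s := monos_sub (mono_deg w + m.+1%:Z - n).
rewrite (ope_comm (vsa_action V) n (Negz m) _ (am_par hj a) (am_par hj b) (affine_ope a b)).
apply: (@subspaceD _ _ (monos _) _ _ s); last first.
  case: ifP => [/eqP E|_]; last by rewrite scale0r; case: s.
  rewrite (_ : mono_deg w + m.+1%:Z - n = mono_deg w); last by lia.
  by apply: (@subspaceZ _ _ (monos _)); [exact: monos_sub|exact: (@monos_mono w)].
apply: (@subspaceD _ _ (monos _) _ _ s).
  apply: (@subspaceZ _ _ (monos _) _ _ s); have := monos_cr b (m := m) (IH a n).
  by rewrite (_ : mono_deg w - n + m.+1%:Z = mono_deg w + m.+1%:Z - n); last by lia.
rewrite (islin_sum (vprod_linl _ _)); apply: (@subspace_sum _ _ (monos _)) => // t _.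
rewrite (islinZ (vprod_linl _ _)); apply: (@subspaceZ _ _ (monos _) _ _ s).
by have := IH t.2 (n + Negz m); rewrite (_ : mono_deg w - (n + Negz m) = mono_deg w + m.+1%:Z - n) //; lia.
Qed.

Lemma monos_prod d d' n a b : monos d a -> monos d' b -> monos (d + d' - n - 1) (vprod a n b).
Proof.
move=> ha; apply: (ha [set a | forall n d' b, monos d' b -> monos (d + d' - n - 1) (vprod a n b)]).
  split=> [|c x y hx hy] n' d1 b' hb'; first by rewrite (islin0 (vprod_linl _ _)); case: (monos_sub (d + d1 - n' - 1)).
  by rewrite vprod_linl; apply: (monos_sub _).2; [apply: hx|apply: hy].
move=> w <- {d d' n a b ha}; elim: w => [|[x m] w IH] n d' b hb.
  rewrite /= (va_vac (vsa_action V)); case: eqP => [->|_]; last by case: (monos_sub (mono_deg [::] + d' - n - 1)).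
  by rewrite /mono_deg big_nil add0r opprK addrK.
have [p pw] := mono_par w; rewrite mono_deg_cons.
have s := monos_sub (mono_deg w + m.+1%:Z + d' - n - 1).
apply: (act_iterate (vsa_action V) s (am_par hj x) pw) => /= y z E.
  have := monos_mode x (n := y) (IH z d' b hb).
  by rewrite (_ : mono_deg w + d' - z - 1 - y = mono_deg w + m.+1%:Z + d' - n - 1); last by lia.
have := IH z _ _ (monos_mode x (n := y) hb).
by rewrite (_ : mono_deg w + (d' - y) - z - 1 = mono_deg w + m.+1%:Z + d' - n - 1); last by lia.
Qed.

Lemma monos_hom d : homogeneous (@vpar K V) (monos d).
Proof.
have [Gs _ _] := vsa_grading V.
move=> u hu; suff [u0 [u1 [p0 p1 m0 m1 ->]]] : exists u0 u1,
    [/\ vpar false u0, vpar true u1, monos d u0, monos d u1 & u = u0 + u1].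
  exists [:: false; true], (fun b : bool => if b then u1 else u0); split; first by case.
  by rewrite !big_cons big_nil addr0.
apply: (hu [set u | exists u0 u1, [/\ vpar false u0, vpar true u1, monos d u0, monos d u1 & u = u0 + u1]]).
  split=> [|c _ _ [u0 [u1 [p0 p1 m0 m1 ->]]] [v0 [v1 [q0 q1 n0 n1 ->]]]].
    by exists 0, 0; split; rewrite ?addr0 //; [case: (Gs false)|case: (Gs true)|case: (monos_sub d)|case: (monos_sub d)].
  exists (c *: u0 + v0), (c *: u1 + v1); split; try by [apply: (Gs _).2|apply: (monos_sub _).2].
  by rewrite scalerDr addrACA.
move=> w E; have mw := monos_mono E; have [[] pw] := mono_par w.
  by exists 0, (mono w); split; rewrite ?add0r //; [case: (Gs false)|case: (monos_sub d)].
by exists (mono w), 0; split; rewrite ?addr0 //; [case: (Gs true)|case: (monos_sub d)].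
Qed.

Lemma monos0 u : monos 0 u -> exists c, u = c *: vac V.
Proof.
move=> hu; apply: (hu [set u | exists c, u = c *: vac V]).
  split=> [|c _ _ [a ->] [b ->]]; first by exists 0; rewrite scale0r.
  by exists (c * a + b); rewrite scalerDl scalerA.
case=> [|[a m] w]; first by exists 1; rewrite scale1r.
by rewrite mono_deg_cons /mono_deg; lia.
Qed.

Lemma hom_monos (W : vsa K) (f : V -> W) (G : int -> set W) d u : vsa_hom f ->
    (forall d, subspace (G d)) -> G 0 (vac W) ->
    (forall d d' n a b, G d a -> G d' b -> G (d + d' - n - 1) (vprod a n b)) ->
    (forall a, G 1 (f (j a))) ->
  monos d u -> G d (f u).
Proof.
move=> [fl _ fv fp] Gs G0 Gp G1 hu.
apply: (hu [set u | G d (f u)]) => [|w <-] /=.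
  split=> [|c x y hx hy] /=; last by rewrite fl; apply: (Gs d).2.
  have -> : f 0 = 0 by exact: (islin0 fl).
  by case: (Gs d).
elim: w => [|[a m] w IH] /=; first by rewrite fv /mono_deg big_nil.
have := Gp _ _ (Negz m) _ _ (G1 a) IH.
by rewrite fp mono_deg_cons NegzE opprK (_ : 1 + mono_deg w + m.+1%:Z - 1 = mono_deg w + m.+1%:Z); last by lia.
Qed.

End AffineStates.

Lemma hom_comp (K : numFieldType) (U V W : vsa K) (f : U -> V) (g : V -> W) :
  vsa_hom f -> vsa_hom g -> vsa_hom (fun u => g (f u)).
Proof.
move=> [fl fp fv fm] [gl gp gv gm]; split=> [c a b|p a pa||a n b]; rewrite ?fl ?gl ?fv ?gv ?fm ?gm //.
exact/gp/fp.
Qed.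

Section Universal.
Variables (K : numFieldType) (V : vsa K) (k : K) (j : osp -> V).
Hypothesis hV : universal_affine k j.
Let hj : affine_map k j := hV.1.

(** The states whose modes preserve [T] give a subalgebra containing the currents. Initiality maps
    [V] into it, and by uniqueness the composite with the inclusion is the identity, so the modes of
    every state preserve [T]. Acting on the vacuum then puts every state in [T]. *)
Lemma universal_ind (T : set V) : subspace T -> T (vac V) ->
  (forall a n u, T u -> T (vprod (j a) n u)) -> forall u, T u.
Proof.
move=> Ts Tv Tj.
pose S' : set V := [set a | forall n u, T u -> T (vprod a n u)].
have S's : subspace S'.
  split=> [|c a b ha hb] n u Tu; first by rewrite (islin0 (vprod_linl _ _)); case: Ts.
  by rewrite vprod_linl; apply: Ts.2; [apply: ha|apply: hb].
have S'p p q a b n : vpar p a -> vpar q b -> S' a -> S' b -> S' (vprod a n b).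
  move=> pa qb ha hb l u Tu; apply: (act_iterate (vsa_action V) Ts pa qb) => y z _.
    by apply/ha/hb.
  by apply/hb/ha.
have [Gs _ _] := vsa_grading V.
(* Even and odd parts are kept separate because closure of [S'] under products is available for
   homogeneous states. *)
pose S : set V := [set a | exists a0 a1, [/\ vpar false a0 /\ vpar true a1, S' a0, S' a1 & a = a0 + a1]].
have S1 p a : vpar p a -> S' a -> S a.
  case: p => pa ha; [exists 0, a|exists a, 0]; split; rewrite ?addr0 ?add0r //; try by case: S's.
    by split=> //; case: (Gs false).
  by split=> //; case: (Gs true).
have Ss : subspace S.
  split=> [|c _ _ [a0 [a1 [[p0 p1] h0 h1 ->]]] [b0 [b1 [[q0 q1] g0 g1 ->]]]].
    by apply: (S1 false); [case: (Gs false)|case: S's].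
  exists (c *: a0 + b0), (c *: a1 + b1); split; try exact: S's.2.
    by split; [apply: (Gs false).2|apply: (Gs true).2].
  by rewrite scalerDr addrACA.
have Sh : homogeneous (@vpar K V) S.
  move=> _ [a0 [a1 [[p0 p1] h0 h1 ->]]]; exists [:: false; true], (fun b : bool => if b then a1 else a0).
  split; last by rewrite !big_cons big_nil addr0.
  by case; split=> //; [exact: S1 p1 h1|exact: S1 p0 h0].
have Sv : S (vac V).
  apply: (S1 false); first exact: vpar_vac.
  by move=> n u Tu; rewrite (va_vac (vsa_action V)); case: ifP => // _; case: Ts.
have Sp a n b : S a -> S b -> S (vprod a n b).
  move=> [a0 [a1 [[p0 p1] h0 h1 ->]]] [b0 [b1 [[q0 q1] g0 g1 ->]]].
  rewrite (islinD (vprod_linl _ _)) !(islinD (vprod_lin _ _)).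
  by do !apply: subspaceD => //; apply: S1 (va_par (vsa_action V) n _ _) (S'p _ _ _ _ n _ _ _ _); eauto.
have Sj a : S (j a) by apply: (S1 (osp_odd a)); [exact: (am_par hj)|exact: Tj].
pose W := subvsa Ss Sh Sv Sp.
have aW : affine_map k ((fun a => mksub Ss (Sj a)) : osp -> W).
  have [h1 h2 h3 h4] := hj; split=> [a|a b|a b|a b n le].
  - exact: h1.
  - apply: (@subval_inj _ _ _ Ss); rewrite (islin_sum (@subval_is _ _ _ Ss)); exact: h2.
  - by apply: (@subval_inj _ _ _ Ss); exact: h3.
  - by apply: (@subval_inj _ _ _ Ss); exact: h4.
have [f [[hf fj] _]] := hV.2 W _ aW.
have hval : vsa_hom (@subval K V S Ss : W -> V) by split.
have [i [_ iu]] := hV.2 V j hj.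
have i1 : i = id by apply: iu; split.
have i2 : i = (fun u => subval (f u)) by apply: iu; split=> [|a]; [exact: hom_comp hval|rewrite fj].
move=> u; have -> : u = subval (f u) by rewrite -[LHS]/(id u) -i1 i2.
have [a0 [a1 [_ h0 h1 ->]]] := subvalP (f u).
by rewrite -[a0]vprod_vacr -[a1]vprod_vacr; apply: subspaceD => //; [apply: h0|apply: h1].
Qed.

Lemma universal_spanned u : gsum (monos j) u.
Proof.
have Gs := monos_sub j; apply: universal_ind u; first exact: gsum_sub.
  by apply: (@gsum_incl _ _ _ _ Gs 0); apply: (@monos_mono _ _ j [::]); rewrite /mono_deg big_nil.
move=> a n _ [s [v [us hv ->]]]; rewrite (islin_sum (vprod_lin _ _)).
apply: subspace_sum; first exact: gsum_sub.
by move=> i _; apply: (@gsum_incl _ _ _ _ Gs (i - n)); apply: monos_mode hj _ _ _ _ (hv i).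
Qed.

Lemma monos_grading : grading (monos j).
Proof.
have Gs := monos_sub j; split=> [//|u _|s v us hv s0 i si].
  have [s [v [_ hv ->]]] := universal_spanned u; exists s, v; split=> // i; split=> //.
have two0 : 2 != 0 :> K by rewrite pnatr_eq0.
(* Rescaling the [n]-th products by [2 ^ (- n - 1)] gives another affine vertex algebra; the map to it
   sending [j a] to [2 *: j a] separates the degrees. *)
have [f [[[fl _ fv fp] fj] _]] := hV.2 _ _ (svsa_affine two0 hj).
have fm d u : monos j d u -> f u = (2 : K) ^ d *: u.
  move=> hu; apply: (hu [set u | f u = (2 : K) ^ d *: u]) => [|w <-] /=.
    split=> [|c x y hx hy] /=; first by rewrite scaler0; exact: (islin0 fl).
    by rewrite fl hx hy scalerDr !scalerA mulrC.
  elim: w => [|[a m] w IH] /=; first by rewrite fv /mono_deg big_nil expr0z scale1r.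
  rewrite fp fj IH mono_deg_cons /sprod (islinZ (vprod_linl _ _)) (islinZ (vprod_lin _ _)) !scalerA.
  rewrite -{2}[2]expr1z -!expfzDr //; congr (_ ^ _ *: _); lia.
apply: (@eigen_extract _ _ _ [set 0] f (fun d : int => (2 : K) ^ d) s v) => //.
- by split=> // c x y -> ->; rewrite scaler0 addr0.
- have p1 (n : nat) : (2 : K) ^ n%:Z = 1 -> n = 0%N.
    move/eqP; rewrite -exprnP -natrX pnatr_eq1; case: n => // n /eqP E.
    by have := ltn_expl n.+1 (ltnSn 1); rewrite E.
  have q1 a b : (2 : K) ^ a = 2 ^ b -> (2 : K) ^ (a - b) = 1.
    by move=> E; rewrite expfzDr // E -expfzDr // subrr.
  move=> a b E; have [ab|ba] := leP b a.
    by have := q1 _ _ E; rewrite (_ : a - b = `|a - b|%N%:Z) => [/p1|]; lia.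
  by have := q1 _ _ (esym E); rewrite (_ : b - a = `|b - a|%N%:Z) => [/p1|]; lia.
- by move=> u ->; exact: (islin0 fl).
- by move=> d; apply: fm.
Qed.

Lemma monos_affine_grading : affine_grading j (monos j).
Proof.
split=> [|a]; last first.
  rewrite -[j a]vprod_vacr; apply: (@monos_mono _ _ j [:: (a, 0%N)]).
  by rewrite mono_deg_cons /mono_deg big_nil.
split; first exact: monos_grading.
- exact: monos_hom hj.
- exact: monos_neg.
- by apply: (@monos_mono _ _ j [::]); rewrite /mono_deg big_nil.
- by move=> d d' n a b; apply: monos_prod hj _ _ _ _ _.
Qed.

End Universal.

(** * The simple quotient and its modules *)

Lemma suppB (K : numFieldType) (I : choiceType) (X : fockmod K I) (S : set (modes * I)) (u v : X) :
  supp S u -> supp S v -> supp S (u - v).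
Proof. by apply: subspaceB; exact: supp_subspace. Qed.

Section PullPush.
Variables (K : numFieldType) (V W : vsa K) (f : V -> W) (hf : vsa_hom f).
Variables (M : lmodType K) (mp : bool -> set M).

Lemma pull_action (act : W -> int -> M -> M) :
  vertex_action (@vpar K W) mp (vac W) (@vprod K W) act ->
  vertex_action (@vpar K V) mp (vac V) (@vprod K V) (fun a => act (f a)).
Proof.
have [fl fp fv fm] := hf; move=> H; split.
- by move=> c a b n u; rewrite fl (va_linl H).
- by move=> c a n u w; rewrite (va_linr H).
- by move=> p q a n u pa; apply: (va_par H); exact: fp.
- by move=> a u; exact: (va_trunc H).
- by move=> n u; rewrite fv (va_vac H).
- move=> p q a b c m n l pa pb; rewrite -(va_borcherds H c m n l (fp _ _ pa) (fp _ _ pb)).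
  by apply: eq_fsbigr => i _; rewrite fm.
Qed.

Hypothesis sf : forall l, exists v, l = f v.

Lemma lift_par p l : vpar p l -> exists2 a, vpar p a & l = f a.
Proof.
have [fl fp fv fm] := hf; have fl' : islin f := fl.
move=> pl; have [a E] := sf l; have [a0 [a1 [p0 p1 Ea]]] := vsa_parts a.
have [Gs _ _] := vsa_grading W; pose v (b : bool) := if b then f a1 else f a0.
have hv b : vpar b (v b) by case: b; exact: fp.
have El : l = \sum_(b <- [:: false; true]) v b by rewrite !big_cons big_nil addr0 E Ea (islinD fl').
rewrite {}El in pl *; have v0 := grading_comp Gs (vsa_grading W) (isT : uniq [:: false; true]) hv pl.
rewrite !big_cons big_nil addr0; case: p pl v0 => _ v0.
  by exists a1 => //; rewrite (v0 false) ?add0r.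
by exists a0 => //; rewrite (v0 true) ?addr0.
Qed.

Variable act : V -> int -> M -> M.
Hypothesis H : vertex_action (@vpar K V) mp (vac V) (@vprod K V) act.
Hypothesis ker0 : forall a, f a = 0 -> forall n u, act a n u = 0.

(** An arbitrary preimage is chosen; [ker0] makes the action independent of the choice. *)
Definition push_act (l : W) : int -> M -> M := act (projT1 (cid (sf l))).

Lemma push_actE a n u : push_act (f a) n u = act a n u.
Proof.
have [fl _ _ _] := hf; have fl' : islin f := fl.
rewrite /push_act; case: cid => b /= E; apply/eqP; rewrite -subr_eq0; apply/eqP.
by rewrite -(islinB (act_linl H n u)) ker0 // (islinB fl') E subrr.
Qed.

Lemma push_action : vertex_action (@vpar K W) mp (vac W) (@vprod K W) push_act.
Proof.
have [fl fp fv fm] := hf; split.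
- by move=> c a b n u; have [x ->] := sf a; have [y ->] := sf b; rewrite -fl !push_actE (va_linl H).
- by move=> c a n u w; rewrite /push_act (va_linr H).
- by move=> p q a n u /lift_par[x px ->]; rewrite push_actE; apply: (va_par H).
- by move=> a u; exact: (va_trunc H).
- by move=> n u; rewrite -fv push_actE (va_vac H).
- move=> p q a b c m n l /lift_par[x px ->] /lift_par[y py ->].
  have := va_borcherds H c m n l px py.
  under eq_fsbigr => i _ do rewrite -push_actE fm.
  under [X in _ = X -> _]eq_fsbigr => i _ do rewrite -!push_actE.
  by [].
Qed.

End PullPush.

(** * Conformal degrees on the sectors *)

Section Degrees.
Variables (K : numFieldType) (r : K) (X : fockmod K sector) (P : fockmod K (int * int)%type).
Local Notation hs := (@hs K sector (swt r) X).
Local Notation Gam := (@Gam K r X).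
Local Notation Y := (@Y K r X P).

(* twice the conformal weight, normalised to vanish on the top components *)
Definition xdeg (b : modes * sector) : int := 2 * (mdeg b.1)%:Z + b.2.2.1 * b.2.2.1 + b.2.2.1
  + (if b.2.1 is None then 2 * b.2.2.2 else 0).
Definition pdeg (b : modes * (int * int)) : int := xdeg (b.1, (None, b.2)).
Definition ldeg (x : int * int) : int := x.1 * x.1 + x.1 + 2 * x.2.

Lemma Gam_xdeg x k e (u : X) : lgr xdeg e u -> lgr xdeg (e + ldeg x - 2 * k - 2) (Gam x k u).
Proof.
apply: supp_lin; first exact: Gam_is.
move=> A [s [n m]] /= E.
have := @vop_supp _ _ (swt r) X (lat K x) (gexp x) (gsh x) (fun _ => 1) _ _ k _ (Sd_kt X A (s, (n, m))).
apply: supp_sub => -[B j] [/= -> D]; move: D E.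
rewrite /xdeg /ldeg /gexp /=; case: x => a b /= D <-.
have -> : (n + a) * (n + a) = n * n + 2 * (a * n) + a * a by ring.
by case: s D => [b'|]; lia.
Qed.

Lemma hs_xdeg h k e (u : X) : lgr xdeg e u -> lgr xdeg (e - 2 * k) (hs h k u).
Proof.
apply: supp_lin; first exact: hs_is.
move=> A i /= E; have := @hs_supp _ _ (swt r) X h k _ _ _ (Sd_kt X A i).
by apply: supp_sub => -[B j] [/= -> D]; move: D E; rewrite /xdeg /=; lia.
Qed.

Lemma word_xdeg A x k e (u : X) : lgr xdeg e u ->
  lgr xdeg (e + 2 * (\sum_(p <- A) p.2.+1)%N%:Z + ldeg x - 2 * k - 2) (@word K r X A x k u).
Proof.
elim: A k e u => [|[i m] A IH] k e u hu /=.
  by rewrite big_nil mulr0 addr0; exact: Gam_xdeg.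
rewrite big_cons; apply: D_closed; first exact: supp_subspace.
- exact: lfield_hs.
- exact/gd_fld/gd_word.
- move=> p q E; have := hs_xdeg (bas K i) p (IH q _ _ hu).
  by move: E; rewrite NegzE /= => E; congr (lgr _ _ _); lia.
- move=> p q E; have := IH q _ _ (hs_xdeg (bas K i) p hu).
  by move: E; rewrite NegzE /= => E; congr (lgr _ _ _); lia.
Qed.

Lemma Y_xdeg d k e (a : P) (u : X) : lgr pdeg d a -> lgr xdeg e u -> lgr xdeg (e + d - 2 * k - 2) (Y a k u).
Proof.
move=> ha hu; apply: (suppE (P := fun a => lgr xdeg (e + d - 2 * k - 2) (Y a k u)) ha).
- by rewrite Y0; exact: supp0.
- by move=> c v v' hv hv'; rewrite Y_lin; exact: suppL.
move=> A x /= E; rewrite Y_kt; have := word_xdeg (enum_mset A) x k hu.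
by congr (lgr _ _ _); move: E; rewrite /pdeg /xdeg /ldeg /mdeg /=; lia.
Qed.

Lemma pprod_pdeg d d' n (a b : P) : lgr pdeg d a -> lgr pdeg d' b ->
  lgr pdeg (d + d' - 2 * n - 2) (pprod r X a n b).
Proof.
move=> ha hb; have hi : lgr xdeg d' (iota X b).
  by apply: supp_lin hb; [exact: imap_is|move=> A x E; rewrite /iota imap_kt; exact: suppU].
have := Y_xdeg n ha hi; rewrite -pprod_iota (addrC d').
move: (pprod _ _ _ _ _) (_ - 2) => z D hz.
have {}hz : supp [set b | xdeg b = D /\ b.2.1 = None] (iota X z).
  have hN : supp [set b | b.2.1 = None] (iota X z).
    apply: (@supp_lin _ _ _ _ _ setT _ _ _ (imap_is _ _)); last exact: suppT.
    by move=> A x _; rewrite imap_kt; apply: suppU.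
  by have := proj_supp [set b | b.2.1 = None] hz; rewrite (proj_id hN); apply: supp_sub => b' [? ?].
have -> : z = imap P snd (iota X z).
  move: z {hz}; apply: fx_eq => [||A x]; first exact: islin_id.
    by apply: islin_comp; exact: imap_is.
  by rewrite /iota !imap_kt.
apply: supp_lin hz; first exact: imap_is.
by move=> A [s x] [/= E E']; rewrite imap_kt; apply: suppU; rewrite E' in E.
Qed.

Lemma e0_pdeg x : lgr pdeg (ldeg x) (e0 P x).
Proof. by apply: suppU; rewrite /pdeg /xdeg /= mdeg0 /ldeg; lia. Qed.

Lemma hP_pdeg h n d (u : P) : lgr pdeg d u -> lgr pdeg (d + 2 * n.+1%:Z) (hP h n u).
Proof.
apply: supp_lin; first exact: hs_is.
move=> A i /= E; have := @hs_supp _ _ (fun x => swt 0 (None, x)) P h (Negz n) i _ _ (Sd_kt P A i).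
by apply: supp_sub => -[B x] [/= -> D]; move: D E; rewrite /pdeg /xdeg /=; lia.
Qed.

Definition pcur : osp -> Pvsa r X P :=
  @osp_state K (Pvsa r X P) (st_x P) (st_y P) (st_e P) (st_f P) (st_h P).

Lemma pcur_pdeg a : lgr (X := P) pdeg 2 (pcur a).
Proof.
have h0 h x : ldeg x = 0 -> lgr pdeg 2 (hP h 0 (e0 P x)).
  by move=> E; have := hP_pdeg h 0 (e0_pdeg x); rewrite E.
case: a => /=.
- exact: (e0_pdeg (0, 1)).
- have h1 h : lgr pdeg 2 (hP h 1 (e0 P (0, -1))) by have := hP_pdeg h 1 (e0_pdeg (0, -1)).
  have h2 h : lgr pdeg 2 (hP h 0 (hP h 0 (e0 P (0, -1)))).
    by have := hP_pdeg h 0 (hP_pdeg h 0 (e0_pdeg (0, -1))).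
  have h3 : lgr pdeg 2 (e0 P (2, -2)) by have := e0_pdeg (2, -2).
  rewrite /st_f /st_om; apply: suppB; last by apply: suppZ; exact: h1.
  apply: suppB; last exact: h2.
  apply: suppZ; apply: suppD; last exact: h3.
  by apply: suppD; apply: suppZ; [exact: h2|exact: h1].
- by apply: h0.
- by apply: suppD; [have := e0_pdeg (1, 0)|have := e0_pdeg (-1, 1)].
- by apply: suppD; apply: h0.
Qed.

End Degrees.

Lemma e0_neq0 (K : numFieldType) (I : choiceType) (X : fockmod K I) i : e0 X i != 0.
Proof.
apply/eqP => E; have := congr1 (fext (fun _ _ => 1 : (K^o : lmodType K))) E.
by rewrite /e0 fext_kt (islin0 (fext_is _)) => /eqP; rewrite oner_eq0.
Qed.

Section Quotient.
Variables (K : numFieldType) (V : vsa K) (j : osp -> V) (L : vsa K) (pr : V -> L).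
Hypotheses (hV : universal_affine (lev K) j) (hL : simple_graded_quotient j pr).

Lemma quotient_monos (GL : int -> set L) d u : affine_grading (fun a => pr (j a)) GL ->
  monos j d u -> GL d (pr u).
Proof.
case=> [[[Gs _ _] _ _ G0 Gp] G1]; have [hp _ _ _] := hL.
by move=> hu; exact: (hom_monos (G := GL) hp Gs G0 Gp G1 hu).
Qed.

(** Take the degree [d] component of any lift: the other components map to components of [l] in
    other degrees, which vanish. So any admissible grading of [L] is the image of the one on [V]. *)
Lemma quotient_lift (GL : int -> set L) d l : affine_grading (fun a => pr (j a)) GL ->
  GL d l -> exists2 u, monos j d u & l = pr u.
Proof.
move=> hG hl; have [hp sp _ _] := hL; have [fl _ _ _] := hp; have fl' : islin pr := fl.
have [u E] := sp l; have [s [v [us hv Eu]]] := universal_spanned hV u.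
have [[[Gs Gh Gi] _ _ _ _] _] := hG.
have hw x : GL x (pr (v x)) by apply: quotient_monos hG (hv x).
have El : l = \sum_(x <- s) pr (v x) by rewrite E Eu (islin_sum fl').
rewrite {}El in hl *; have z := grading_comp Gs (And3 Gs Gh Gi) us hw hl.
have [ds|nd] := boolP (d \in s).
  exists (v d) => //; rewrite (bigD1_seq d) //= big_seq_cond big1 ?addr0 // => x /andP[xs xd].
  exact: z.
exists 0; first by case: (monos_sub j d).
rewrite (islin0 fl') big_seq big1 // => x xs; apply: z => //.
by apply: contraNneq nd => <-.
Qed.

Variables (r : K) (X : fockmod K sector) (P : fockmod K (int * int)%type).
Local Notation PV := (Pvsa r X P).
Variable F : V -> PV.
Hypotheses (hF : vsa_hom F) (Fj : forall a, F (j a) = pcur r X P a).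
Local Notation Y := (@Y K r X P).

Lemma Y_pcur n u : [/\ Y (pcur r X P ge) n u = Gam r (0, 1) n u,
  Y (pcur r X P gh) n u = hs (swt r) (2 *: wmu (lev K)) n u,
  Y (pcur r X P gx) n u = xop r n u & Y (pcur r X P gy) n u = yop r n u].
Proof. by split; [rewrite /= Y_e0|exact: Y_h|exact: Y_x|exact: Y_y]. Qed.

Lemma hom_pdeg d u : monos j d u -> lgr (X := P) pdeg (2 * d) (F u).
Proof.
move=> hu; pose G : int -> set PV := fun d => lgr (X := P) pdeg (2 * d).
apply: (@hom_monos K V j PV F G d u hF _ _ _ _ hu).
- by move=> d'; exact: supp_subspace.
- by have := @e0_pdeg K P (0, 0).
- move=> e e' n a b ha hb; have := pprod_pdeg r X n ha hb.
  by congr (lgr _ _ _); lia.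
- by move=> a; rewrite Fj; exact: pcur_pdeg.
Qed.

(** If the kernel of [pr] had nonzero image in [P], the image would contain the vacuum by
    [vacuum_vector]. Take a kernel element mapping to it: since [L] is graded, its degree zero
    component lies in the kernel too. That component is a multiple of the vacuum, hence zero as the
    vacuum of [L] is not; yet by degrees its image is the vacuum of [P]. *)
Lemma hom_ker u : pr u = 0 -> F u = 0.
Proof.
have [fl fp fv fm] := hF; have fl' : islin F := fl.
have [[gl _ gv gm] _ [L0 _] [GL hG]] := hL; have gl' : islin pr := gl.
move=> pu; apply: contrapT => Fu.
pose S : set X := [set z | exists2 u, pr u = 0 & z = iota X (F u)].
have iol : islin (@iota K X P) by exact: imap_is.
have Sm a n z : S z -> S (Y (pcur r X P a) n z).
  move=> [v pv ->]; exists (vprod (j a) n v).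
    by rewrite gm pv (islin0 (vprod_lin _ _)).
  by rewrite fm -pprod_iota Fj.
have [v pv E] : S (svac X).
  apply: (@vacuum_vector K r X S).
  - split=> [|c _ _ [v pv ->] [w pw ->]].
      by exists 0; rewrite ?(islin0 gl') // (islin0 fl') (islin0 iol).
    by exists (c *: v + w); rewrite ?gl ?pv ?pw ?scaler0 ?addr0 // fl iol.
  - move=> _ [v _ ->]; apply: (@supp_lin _ _ _ _ _ setT _ _ _ (imap_is _ _)); last exact: suppT.
    by move=> A x _; rewrite imap_kt; apply: suppU.
  - by move=> n z /(Sm ge n); have [-> _ _ _] := Y_pcur n z.
  - by move=> n z /(Sm gh n); have [_ -> _ _] := Y_pcur n z.
  - by move=> n z /(Sm gx n); have [_ _ -> _] := Y_pcur n z.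
  - by move=> n z /(Sm gy n); have [_ _ _ ->] := Y_pcur n z.
  - exists (iota X (F u)); first by exists u.
    by move=> E0; apply: Fu; apply: (@iota_inj K X P); rewrite E0 (islin0 iol).
have {}E : F v = pvac P by apply: (@iota_inj K X P); rewrite -E /pvac iota_e0.
have [s [w [us hw Ev]]] := universal_spanned hV v.
have [[[Gs Gh Gi] _ _ _ _] _] := hG.
have w0 x : x \in s -> pr (w x) = 0.
  apply: (Gi s (fun x => pr (w x)) us) => [y|]; first exact: quotient_monos hG (hw y).
  by rewrite -(islin_sum gl') -Ev.
have dw x : lgr (X := P) pdeg (2 * x) (F (w x)) by exact: hom_pdeg.
have zs : 0 \in s.
  apply: contrapT => /negP nz; have : lproj pdeg 0 (F v) = 0.
    rewrite Ev (islin_sum fl') (islin_sum (lproj_is _ _)) big_seq big1 // => x xs.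
    rewrite (lproj_ne _ (dw x)) //; apply: contraNneq nz => /eqP E0.
    by rewrite (_ : 0 = x) //; lia.
  rewrite E lproj_id; last by have := @e0_pdeg K P (0, 0).
  by move/eqP; rewrite (negbTE (e0_neq0 P _)).
have [c Ec] := monos0 (hw 0); have := w0 0 zs; rewrite Ec (islinZ gl') gv => /eqP.
rewrite scaler_eq0 => /orP[/eqP c0|/eqP //].
have : F v = lproj pdeg 0 (F (w 0)).
  rewrite -(lproj_id (j := 0) (lab := pdeg) (u := F v)); last by rewrite E; have := @e0_pdeg K P (0, 0).
  rewrite Ev (islin_sum fl') (islin_sum (lproj_is _ _)) (bigD1_seq 0) //= big1 ?addr0 // => x x0.
  by rewrite (lproj_ne _ (dw x)) //; apply: contraNneq x0 => /eqP E0; lia.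
rewrite E Ec c0 scale0r (islin0 fl') (islin0 (lproj_is _ _)).
by move/eqP; rewrite (negbTE (e0_neq0 P _)).
Qed.

End Quotient.

(** * The modules carried by a single twisted sector *)

Section TopModule.
Variables (K : numFieldType) (V : vsa K) (j : osp -> V).
Hypothesis hV : universal_affine (lev K) j.
Variables (r : K) (X : fockmod K sector) (P : fockmod K (int * int)%type).
Variable F : V -> Pvsa r X P.
Hypotheses (hF : vsa_hom F) (Fj : forall a, F (j a) = pcur r X P a).
Variables (b : bool) (N : fockmod K (int * int)%type).
Local Notation Y := (@Y K r X P).
Local Notation rb := (if b then r + 1 / 2 else r).

Definition nidx (x : int * int) : sector := (Some b, x).
Local Notation io := (@imap K _ _ N X nidx).
Local Notation nact := (fun a : V => @smod K r X P _ nidx snd N (F a)).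
Local Notation npar := (@smpar K _ nidx N).

Let fg (i : sector) : [set Some b] i.1 -> nidx i.2 = i.
Proof. by case: i => s x /= ->. Qed.

Lemma nact_action : vertex_action (@vpar K V) npar (vac V) (@vprod K V) nact.
Proof. exact: (pull_action hF (@smod_action K r X P _ nidx snd [set Some b] N _ fg _)). Qed.

Definition nmod : vmod V N := Vmod (@smpar_grading K _ nidx N) nact_action.

Lemma nactE a n z : io (nact a n z) = Y (F a) n (io z).
Proof. exact: (@smodE K r X P _ nidx snd [set Some b] N _ fg). Qed.

Lemma nidx_inj : injective io.
Proof. exact: (@imap_f_inj K X _ nidx snd N). Qed.

Lemma nidx_sec z : xsec [set Some b] (io z).
Proof. exact: (@imap_f_sec K X _ nidx [set Some b] N). Qed.

Lemma nidx_e0 x : io (e0 N x) = e0 X (Some b, x).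
Proof. exact: imap_kt. Qed.

Lemma nidx_is : islin io. Proof. exact: imap_is. Qed.

Lemma nact_lin a n : islin (nact a n). Proof. exact: (act_lin nact_action). Qed.

Lemma nact_e0 n m : nact (j ge) 0 (e0 N (n, m)) = e0 N (n, m + 1).
Proof.
apply: nidx_inj; rewrite nactE !nidx_e0 Fj; have [-> _ _ _] := Y_pcur r P 0 (e0 X (Some b, (n, m))).
exact: (@Gam_topE K r X b 1).
Qed.

Lemma nact_h0 n m : nact (j gh) 0 (e0 N (n, m)) = (- 2 * rb + (n + 2 * m)%:~R - 1 / 2 + 3 / 2) *: e0 N (n, m).
Proof.
apply: nidx_inj; rewrite nactE (islinZ nidx_is) nidx_e0 Fj.
have [_ -> _ _] := Y_pcur r P 0 (e0 X (Some b, (n, m))); exact: hs_top.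
Qed.

Lemma nact_x0 m : nact (j gx) 0 (e0 N (0, m)) = e0 N (-1, m + 1).
Proof.
apply: nidx_inj; rewrite nactE !nidx_e0 Fj; have [_ _ -> _] := Y_pcur r P 0 (e0 X (Some b, (0, m))).
exact: xop_top0.
Qed.

Lemma nact_x1 m : nact (j gx) 0 (e0 N (-1, m)) = e0 N (0, m).
Proof.
apply: nidx_inj; rewrite nactE !nidx_e0 Fj; have [_ _ -> _] := Y_pcur r P 0 (e0 X (Some b, (-1, m))).
exact: xop_top1.
Qed.

Lemma nact_y0 m : nact (j gy) 0 (e0 N (0, m)) = (m%:~R - rb) *: e0 N (-1, m).
Proof.
apply: nidx_inj; rewrite nactE (islinZ nidx_is) !nidx_e0 Fj.
have [_ _ _ ->] := Y_pcur r P 0 (e0 X (Some b, (0, m))); exact: yop_top0.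
Qed.

Lemma nact_y1 m : nact (j gy) 0 (e0 N (-1, m)) = (m%:~R - rb) *: e0 N (0, m - 1).
Proof.
apply: nidx_inj; rewrite nactE (islinZ nidx_is) !nidx_e0 Fj.
have [_ _ _ ->] := Y_pcur r P 0 (e0 X (Some b, (-1, m))); exact: yop_top1.
Qed.

(** From $\{y,y\}=-2f$; the action of $f$ on the top then follows from that of $y$. *)
Lemma nact_f z : nact (j gf) 0 z = - nact (j gy) 0 (nact (j gy) 0 z).
Proof.
have hj := hV.1.
have := ope_comm nact_action 0 0 z (am_par hj gy) (am_par hj gy) (affine_ope hj gy gy).
rewrite /= big_cons big_nil !addr0 mulr0z !mul0r ?if_same scale0r addr0.
rewrite (islinZ (act_linl nact_action _ _)) /sgn expr1 scaleN1r.
set v := nact (j gy) 0 _; set w := nact (j gf) 0 z => E.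
move/eqP: E; rewrite addrC -subr_eq opprK => /eqP E.
have {}E : (-2)%:~R *: w = 2 *: v by rewrite -[LHS]E scaler_nat mulr2n.
apply: (scalerI (_ : (-2)%:~R != 0 :> K)); first by rewrite intr_eq0.
by rewrite E; mod_ring K N.
Qed.

(** Read off from the exponents: $-(r+i+\frac54)=-(r+\frac14)-(i+1)$ for $E_i$, and
    $-(r+i+\frac34)=-(r+\frac14)-\frac12-i$ for $E_{i-1/2}$, where $-\frac12$ comes with charge
    $-1$. *)
Definition ntop (x : int * bool) : int * int := if x.2 then (-1, - x.1) else (0, - x.1 - 1).
Definition ntheta : U0 K -> N := linext (fun x => e0 N (ntop x)).

Lemma ntheta_is : islin ntheta. Proof. exact: linext_is. Qed.
Lemma ntheta_U x : ntheta << x >> = e0 N (ntop x). Proof. exact: linextU. Qed.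

Definition ndeg (x : modes * (int * int)) : int := xdeg (x.1, nidx x.2).

Lemma ntheta_act a w : ntheta (U0act rb a w) = nact (j a) 0 (ntheta w).
Proof.
move: w; apply: lin_eq => [||[i o]].
- by apply: islin_comp; [exact: ntheta_is|exact: linext_is].
- by apply: islin_comp; [exact: nact_lin|exact: ntheta_is].
rewrite ntheta_U /U0act linextU /U0basis_act /U0E /U0Eh /ntop.
have E1 : - (i + 1) - 1 = - i - 1 - 1 by lia.
have E2 : - (i - 1) - 1 = - i - 1 + 1 by lia.
have E3 : - (i - 1) = - i + 1 by lia.
have E4 : - (i + 1) = - i - 1 by lia.
have E5 : - i - 1 + 1 = - i by lia.
case: a; case: o; rewrite /= ?(islinZ ntheta_is) ?ntheta_U /ntop /= ?E1 ?E2 ?E3 ?E4 ?E5.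
- by rewrite nact_e0.
- by rewrite nact_e0 E5.
- rewrite nact_f nact_y1 (islinZ (nact_lin _ _)) nact_y0 scalerA -scaleNr.
  by congr (_ *: _); rewrite rmorphB rmorphN /=; ring.
- rewrite nact_f nact_y0 (islinZ (nact_lin _ _)) nact_y1 scalerA -scaleNr.
  by congr (_ *: _); rewrite rmorphB rmorphN /=; ring.
- by rewrite nact_h0; congr (_ *: _); rewrite !(rmorphD, rmorphM, rmorphN) /=; field.
- by rewrite nact_h0; congr (_ *: _); rewrite !(rmorphD, rmorphM, rmorphN) /=; field.
- by rewrite nact_x1.
- by rewrite nact_x0 E5.
- by rewrite nact_y1; congr (_ *: _); rewrite rmorphN /=; ring.
- by rewrite nact_y0; congr (_ *: _); rewrite rmorphB rmorphN /=; ring.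
Qed.

Lemma ntheta_inj : injective ntheta.
Proof.
pose g (A : modes) (x : int * int) : U0 K := if x.1 == 0 then << (- x.2 - 1, false) >> else << (- x.2, true) >>.
apply: (can_inj (g := fext g)) => w; move: w; apply: lin_eq => [||[i o]].
- by apply: islin_comp; [exact: fext_is|exact: ntheta_is].
- exact: islin_id.
rewrite ntheta_U /e0 fext_kt /g /ntop; case: o => /=; first by rewrite opprK.
by rewrite opprB opprK addrAC subrr add0r.
Qed.

(** The degree of a basis vector is $n(n+1)$ plus twice the degree of the monomial, both
    nonnegative, so it vanishes exactly for the empty monomial and $n\in\{-1,0\}$. *)
Lemma ntheta_top u : lgr ndeg 0 u <-> exists w, u = ntheta w.
Proof.
split=> [hu|[w ->]].
  apply: (suppE (P := fun u => exists w, u = ntheta w) hu).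
  - by exists 0; rewrite (islin0 ntheta_is).
  - by move=> c v v' [w ->] [w' ->]; exists (c *: w + w'); rewrite ntheta_is.
  move=> A [n m]; rewrite /ndeg /xdeg /= addr0 => E.
  have A0 : A = mset0.
    move: E; elim/modes_ind: A => // A x _; rewrite mdeg_ins => E.
    have : 0 <= n * (n + 1) by case: (ltP n 0) => ?; [apply: mulr_le0|apply: mulr_ge0]; lia.
    by move: E; rewrite mulrDr mulr1; lia.
  rewrite A0 mdeg0 mulr0 add0r in E *; have : n * (n + 1) = 0 by rewrite mulrDr mulr1.
  move/eqP; rewrite mulf_eq0 => /orP[] /eqP n0.
    exists << (- m - 1, false) >>; rewrite ntheta_U /ntop /= n0; congr (kt _ (_, _)); lia.
  exists << (- m, true) >>; rewrite ntheta_U /ntop /= opprK; congr (kt _ (_, _)); lia.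
move: w; apply: malg_lind.
- by rewrite (islin0 ntheta_is); exact: supp0.
- by move=> c v v' hv hv'; rewrite ntheta_is; exact: suppL.
by move=> [i []]; rewrite ntheta_U; apply: suppU; rewrite /ndeg /xdeg /ntop /= mdeg0.
Qed.

Lemma nmod_top_iso : top_iso j nmod (lgr ndeg) rb ntheta.
Proof.
split.
- exact: ntheta_is.
- exact: ntheta_inj.
- exact: ntheta_top.
- by move=> i; rewrite /U0E /U0Eh !ntheta_U; split; apply: suppU.
- exact: ntheta_act.
Qed.

Lemma nact_deg d t n a u : monos j d a -> lgr ndeg t u -> lgr ndeg (t + 2 * (d - n - 1)) (nact a n u).
Proof.
move=> ha hu; have hi : lgr xdeg t (io u).
  by apply: supp_lin hu; [exact: nidx_is|move=> A x E; rewrite imap_kt; exact: suppU].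
have := @Y_xdeg K r X P _ n _ _ _ (hom_pdeg hF Fj ha) hi; rewrite -nactE.
rewrite (_ : t + 2 * d - 2 * n - 2 = t + 2 * (d - n - 1)); last by lia.
move: (nact a n u) (t + _) => z D hz.
have -> : z = imap N snd (io z) by rewrite (@imap_gf K X _ nidx snd N).
have hs' := proj_supp [set x | x.2.1 = Some b] hz; rewrite (proj_id (nidx_sec z)) in hs'.
apply: supp_lin hs'; first exact: imap_is.
by move=> A [s x] [/= Es E]; rewrite imap_kt; apply: suppU; rewrite Es in E.
Qed.

Lemma nact_mgrading : mgrading nmod (monos j) (lgr ndeg).
Proof.
split.
- exact: lgr_grading.
- move=> t; apply: lgr_hom => p u hu.
  by apply: supp_sub (proj_supp _ hu) => x [].
- move=> t u t0 hu; apply: (supp_disj _ hu hu) => -[A [n m]] /= E _.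
  have : 0 <= n * (n + 1) by case: (ltP n 0) => ?; [apply: mulr_le0|apply: mulr_ge0]; lia.
  by move: E; rewrite /ndeg /xdeg /= mulrDr mulr1; lia.
- by move=> d t n a u; exact: nact_deg.
Qed.

Section Submodules.
Variable S : set N.
Hypotheses (Ss : subspace S) (Sj : forall a n u, S u -> S (nact (j a) n u)).
Let SX : set X := [set z | exists2 u, S u & z = io u].

Let SXs : subspace SX.
Proof.
split=> [|c _ _ [v sv ->] [w sw ->]]; first by exists 0; [case: Ss|rewrite (islin0 nidx_is)].
by exists (c *: v + w); [exact: Ss.2|rewrite nidx_is].
Qed.

Let SXY a n z : SX z -> SX (Y (pcur r X P a) n z).
Proof. by move=> [u su ->]; exists (nact (j a) n u); [exact: Sj|rewrite nactE Fj]. Qed.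
Let SXe n z : SX z -> SX (Gam r (0, 1) n z).
Proof. by move=> /(SXY ge n); have [-> _ _ _] := Y_pcur r P n z. Qed.
Let SXh n z : SX z -> SX (hs (swt r) (2 *: wmu (lev K)) n z).
Proof. by move=> /(SXY gh n); have [_ -> _ _] := Y_pcur r P n z. Qed.
Let SXx n z : SX z -> SX (xop r n z).
Proof. by move=> /(SXY gx n); have [_ _ -> _] := Y_pcur r P n z. Qed.
Let SXy n z : SX z -> SX (yop r n z).
Proof. by move=> /(SXY gy n); have [_ _ _ ->] := Y_pcur r P n z. Qed.

Lemma nmod_singular : (exists2 u, S u & u <> 0) ->
  exists n m, [/\ -1 <= n, n <= 0 & S (e0 N (n, m))].
Proof.
move=> [u su u0]; have SI z : SX z -> xsec [set Some b] z by move=> [v _ ->]; exact: nidx_sec.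
have [|n [m [n1 n2 [v sv E]]]] := singular_vector SXs SI SXe SXh SXx SXy.
  by exists (io u); [exists u|move=> E; apply: u0; apply: nidx_inj; rewrite E (islin0 nidx_is)].
exists n, m; split=> //; suff -> : e0 N (n, m) = v by [].
by apply: nidx_inj; rewrite nidx_e0.
Qed.

Lemma nmod_generated : (forall m, S (e0 N (0, m))) -> forall u, S u.
Proof.
move=> S0 u; suff [v sv /nidx_inj ->//] : SX (io u).
apply: (sector_generated SXs SXe SXh SXx SXy _ (nidx_sec u)) => m.
by exists (e0 N (0, m)); rewrite ?nidx_e0.
Qed.

(** $e_{(0)}$ raises [m], and $y_{(0)}^2$ lowers it with coefficient $(m-r_b)^2$, where $r_b$ is the
    parameter of the sector: here its non-integrality enters. *)
Lemma nmod_spread n m : (forall k : int, rb <> k%:~R) -> -1 <= n -> n <= 0 -> S (e0 N (n, m)) ->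
  forall m', S (e0 N (0, m')).
Proof.
move=> nb n1 n2 h; have {n n1 n2 h} h : S (e0 N (0, m)).
  have [E|E] : n = -1 \/ n = 0 by lia.
    by rewrite E in h; have := Sj gx 0 h; rewrite nact_x1.
  by rewrite -E.
have up (k : nat) m' : S (e0 N (0, m')) -> S (e0 N (0, m' + k%:Z)).
  elim: k => [|k IH] hk; first by rewrite addr0.
  by have := Sj ge 0 (IH hk); rewrite nact_e0 -addrA (_ : k%:Z + 1 = k.+1%:Z) //; lia.
have down (k : nat) m' : S (e0 N (0, m')) -> S (e0 N (0, m' - k%:Z)).
  elim: k => [|k IH] hk; first by rewrite subr0.
  have := Sj gy 0 (Sj gy 0 (IH hk)); rewrite nact_y0 (islinZ (nact_lin _ _)) nact_y1 scalerA.
  set c := _ * _ => hc; have c0 : c != 0.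
    by rewrite mulf_neq0 // subr_eq0; apply/eqP => E; apply: (nb (m' - k%:Z)).
  rewrite (_ : m' - k.+1%:Z = m' - k%:Z - 1); last by lia.
  by rewrite -[e0 _ _]scale1r -(mulVf c0) -scalerA; apply: subspaceZ.
move=> m'; have [le|lt] := leP m m'.
  by have := up `|m' - m|%N m h; rewrite (_ : m + `|m' - m|%N%:Z = m') //; lia.
by have := down `|m - m'|%N m h; rewrite (_ : m - `|m - m'|%N%:Z = m') //; lia.
Qed.
End Submodules.

Lemma nmod_irreducible : (forall k : int, rb <> k%:~R) -> irreducible nmod.
Proof.
move=> nb; split; first by exists (e0 N (0, 0)); apply/eqP; exact: e0_neq0.
move=> S [Ss _ Sa]; have Sj a n u : S u -> S (nact (j a) n u) by apply: Sa.
have [h|no] := pselect (exists2 u, S u & u <> 0); last first.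
  by left=> u su; apply: contrapT => u0; apply: no; exists u.
right; have [n [m [n1 n2 h0]]] := nmod_singular Ss Sj h.
exact: nmod_generated Ss Sj (nmod_spread Ss Sj nb n1 n2 h0).
Qed.

Lemma nmod_irreducible_with_top : (forall k : int, rb <> k%:~R) ->
  irreducible_with_top j nmod rb ntheta.
Proof.
move=> nb; split; first exact: nmod_irreducible.
exists (monos j), (lgr ndeg); split.
- exact: monos_affine_grading hV.
- exact: nact_mgrading.
- exact: nmod_top_iso.
Qed.

Section OverQuotient.
Variables (L : vsa K) (pr : V -> L).
Hypothesis hL : simple_graded_quotient j pr.
Let hp : vsa_hom pr := let: And4 h _ _ _ := hL in h.
Let sp : forall l, exists v, l = pr v := let: And4 _ h _ _ := hL in h.

Let ker0 a : pr a = 0 -> forall n u, nact a n u = 0.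
Proof.
by move=> /(hom_ker hV hL hF Fj) E n u; rewrite E /smod Y0 (islin0 (imap_is _ _)).
Qed.

Definition qmod : vmod L N :=
  Vmod (@smpar_grading K _ nidx N) (push_action hp sp nact_action ker0).

Lemma qmodE a n u : mact qmod (pr a) n u = mact nmod a n u.
Proof. exact: (push_actE hp sp nact_action ker0). Qed.

(** The parameter $r+\frac12$ of the second sector may be an integer, and then the top need not be
    irreducible. The properties of $L(U)$ rest instead on generation by the whole top and on every
    nonzero submodule containing a top vector. *)
Lemma qmod_zhu : zhu_module (fun a => pr (j a)) qmod rb ntheta.
Proof.
have [_ _ _ [GL hG]] := hL; exists GL, (lgr ndeg); split=> //.
- have [h1 h2 h3 _] := nact_mgrading; split=> // d t n a u /(quotient_lift hV hL hG)[v hv ->] hu.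
  by rewrite qmodE; apply: nact_deg.
- have [h1 h2 h3 h4 h5] := nmod_top_iso; split=> // a w.
  by rewrite qmodE; apply: h5.
- move=> u S [Ss _ Sa] ST; apply: (nmod_generated Ss) => [a n v sv|m].
    by have := Sa (pr (j a)) n v sv; rewrite qmodE.
  by apply: ST; apply: suppU; rewrite /ndeg /xdeg /= mdeg0.
move=> S [Ss _ Sa] _ ST u su; apply: contrapT => u0.
have Sj a n v : S v -> S (nact (j a) n v) by move=> /(Sa (pr (j a)) n); rewrite qmodE.
have [|n [m [n1 n2 h]]] := nmod_singular Ss Sj; first by exists u.
case/negP: (e0_neq0 N (n, m)); apply/eqP; apply: ST h _.
apply: suppU; rewrite /ndeg /xdeg /= mdeg0 addr0 mulr0 add0r.
by have [->|->] : n = -1 \/ n = 0 by lia.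
Qed.

End OverQuotient.
End TopModule.

(** Comparing $\lambda+\frac m2$ with the exponents of the sectors gives $m=n+2q$ in the first and
    $m=n+2q-1$ in the second, so the parity of $m-n$ selects the sector. *)
Definition midx (x : int * int) : sector :=
  let b := iodd (x.2 - x.1) in (Some b, (x.1, ((x.2 - x.1 + b%:Z) %/ 2)%Z)).
Definition minv (i : sector) : int * int :=
  (i.2.1, i.2.1 + 2 * i.2.2 - (if i.1 is Some true then 1 else 0)).

Lemma minvK b x : midx (minv (Some b, x)) = (Some b, x).
Proof.
case: x => n m; rewrite /midx /minv /=.
have -> : iodd (n + 2 * m - (if b then 1 else 0) - n) = b by rewrite /iodd; case: b; lia.
by congr (_, (_, _)); case: b; lia.
Qed.

Lemma midxK x : minv (midx x) = x.
Proof.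
case: x => n m; rewrite /midx /minv /=; congr (_, _).
by rewrite /iodd; case: ifP; lia.
Qed.

(** * The twisted space and its two summands *)

Section TwistedModule.
Variables (K : numFieldType) (V : vsa K) (j : osp -> V) (L : vsa K) (pr : V -> L).
Hypotheses (hV : universal_affine (lev K) j) (hL : simple_graded_quotient j pr).
Variables (r : K) (X : fockmod K sector) (P : fockmod K (int * int)%type).
Variable F : V -> Pvsa r X P.
Hypotheses (hF : vsa_hom F) (Fj : forall a, F (j a) = pcur r X P a).
Variable M : fockmod K (int * int)%type.
Local Notation Y := (@Y K r X P).
Local Notation io := (@imap K _ _ M X midx).
Local Notation tact := (fun a : V => @smod K r X P _ midx minv M (F a)).
Local Notation tpar := (@smpar K _ midx M).
Local Notation C := [set s : option bool | exists b, s = Some b].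

Let fC x : C (midx x).1. Proof. by eexists. Qed.
Let fg (i : sector) : C i.1 -> midx (minv i) = i.
Proof. by case: i => s x /= [b ->]; exact: minvK. Qed.

Lemma tact_action : vertex_action (@vpar K V) tpar (vac V) (@vprod K V) tact.
Proof. exact: (pull_action hF (@smod_action K r X P _ midx minv C M fC fg midxK)). Qed.

Let hp : vsa_hom pr := let: And4 h _ _ _ := hL in h.
Let sp : forall l, exists v, l = pr v := let: And4 _ h _ _ := hL in h.
Let ker0 a : pr a = 0 -> forall n u, tact a n u = 0.
Proof. by move=> /(hom_ker hV hL hF Fj) E n u; rewrite E /smod Y0 (islin0 (imap_is _ _)). Qed.

Definition tmod : vmod L M :=
  Vmod (@smpar_grading K _ midx M) (push_action hp sp tact_action ker0).

Lemma tmodE a n u : mact tmod (pr a) n u = tact a n u.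
Proof. exact: (push_actE hp sp tact_action ker0). Qed.

Lemma tactE a n z : io (tact a n z) = Y (F a) n (io z).
Proof. exact: (@smodE K r X P _ midx minv C M fC fg). Qed.

Lemma midx_inj : injective io.
Proof. exact: (@imap_f_inj K X _ midx minv M midxK). Qed.

Variable N : fockmod K (int * int)%type.
Local Notation nio b := (@imap K _ _ N X (nidx b)).
Local Notation qm b := (qmod hV hF Fj b N hL).

Definition temb (b : bool) : N -> M := imap M (fun x => minv (Some b, x)).

Lemma temb_is b : islin (temb b). Proof. exact: imap_is. Qed.

Lemma temb_e0 b x : temb b (e0 N x) = e0 M (minv (Some b, x)).
Proof. exact: imap_kt. Qed.

Lemma tembE b u : io (temb b u) = nio b u.
Proof.
move: u; apply: fx_eq => [||A x].
- by apply: islin_comp; exact: imap_is.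
- exact: imap_is.
- by rewrite /temb !imap_kt minvK.
Qed.

Lemma temb_inj b : injective (temb b).
Proof. by move=> u v /(congr1 io); rewrite !tembE => /(@nidx_inj K X b N). Qed.

Lemma temb_act b a n u : temb b (mact (qm b) a n u) = mact tmod a n (temb b u).
Proof.
have [v ->] := sp a; rewrite qmodE tmodE; apply: midx_inj.
by rewrite tactE !tembE nactE.
Qed.

Lemma temb_hom b : vmod_hom (qm b) tmod (temb b).
Proof.
split; [exact: temb_is| |exact: temb_act].
move=> p u; apply: supp_lin; first exact: temb_is.
by move=> A x E; rewrite /temb imap_kt; apply: suppU.
Qed.

Definition tproj (b : bool) (w : M) : N :=
  imap N snd (lproj (fun x : modes * sector => x.2.1) (Some b) (io w)).

Lemma tproj_is b : islin (tproj b).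
Proof. by apply: (islin_comp (imap_is _ _)); apply: (islin_comp (lproj_is _ _)); exact: imap_is. Qed.

Lemma tproj_temb b b' u : tproj b (temb b' u) = if b == b' then u else 0.
Proof.
rewrite /tproj tembE; have h : lgr (fun x : modes * sector => x.2.1) (Some b') (nio b' u).
  exact: (@nidx_sec K X b' N u).
case: eqP => [->|ne].
  by rewrite (lproj_id h); exact: (@imap_gf K X _ (nidx b') snd N).
rewrite (lproj_ne _ h); first exact: islin0 (imap_is _ _).
by apply/eqP => -[].
Qed.

Lemma temb_sum w : w = temb false (tproj false w) + temb true (tproj true w).
Proof.
move: w; apply: fx_eq => [||A x].
- exact: islin_id.
- by apply: islin_add; apply: islin_comp; by [exact: temb_is|exact: tproj_is].
set b := iodd (x.2 - x.1).
have -> : kt A x = temb b (kt A (midx x).2) :> M by rewrite /temb imap_kt -{1}(midxK x).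
rewrite !tproj_temb; case: b; rewrite /= (islin0 (temb_is _)) ?addr0 ?add0r //.
Qed.

Lemma temb_decomposition w : exists! p : N * N, w = temb false p.1 + temb true p.2.
Proof.
exists (tproj false w, tproj true w); split=> [|[u v] /= E]; first exact: temb_sum.
by rewrite E !(islinD (tproj_is _)) !tproj_temb /= addr0 add0r.
Qed.

(** Zero modes spread the generator over all charge zero top vectors because [r] is not an integer,
    and these generate the sector; conversely the image is a submodule containing the generator. *)
Lemma temb_range : (forall k : int, r <> k%:~R) ->
  range (temb false) = generated_submodule tmod [set e0 M (0, 0)].
Proof.
move=> nr; apply/seteqP; split=> [_ [u _ <-]|w hw].
  move=> S [Ss _ Sa] Sv; pose S' : set N := [set u | S (temb false u)].
  have Ss' : subspace S'.
    split=> [|c v v' hv hv'] /=; first by rewrite /S' /= (islin0 (temb_is _)); case: Ss.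
    by rewrite /S' /= temb_is; exact: Ss.2.
  have Sj' a n v : S' v -> S' (@smod K r X P _ (nidx false) snd N (F (j a)) n v).
    move=> sv; rewrite /S' /=; have := Sa (pr (j a)) n _ sv.
    by rewrite -temb_act qmodE.
  have h0 : S' (e0 N (0, 0)) by rewrite /S' /= temb_e0; exact: Sv.
  have h1 : forall m, S' (e0 N (0, m)) by apply: (nmod_spread hF Fj Ss' Sj' nr _ _ h0).
by have := nmod_generated Fj Ss' Sj' h1; apply.
apply: hw; last by move=> _ ->; exists (e0 N (0, 0)) => //; rewrite temb_e0.
split.
- split=> [|c _ _ [u _ <-] [v _ <-]]; first by exists 0 => //; rewrite (islin0 (temb_is _)).
  by exists (c *: u + v) => //; rewrite temb_is.
- move=> _ [u _ <-].
  have [Gs Gh _] := @smpar_grading K _ (nidx false) N.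
  have [s [v [hv ->]]] := Gh u Logic.I; exists s, (fun i => temb false (v i)); split.
    move=> i; split; last by exists (v i).
    by have [_ h _] := temb_hom false; apply: h; exact: (hv i).1.
  by rewrite (islin_sum (temb_is _)).
- by move=> a n _ [u _ <-]; exists (mact (qm false) a n u) => //; rewrite temb_act.
Qed.

End TwistedModule.

(** * Comparison with the lattice vertex operators of the statement *)

Section ExpTuples.
Variables (K : numFieldType) (M : lmodType K) (t g : nat -> M -> M).
Hypotheses (tl : forall i, islin (t i)) (gl : forall i, islin (g i)).
Hypothesis tC : forall i k u, t i (t k u) = t k (t i u).
Hypothesis tg : forall i u, i.+1%:R *: t i.+1 u = g i.+1 u.

(** The coefficient of $z^n$ in $(\sum_{i\ge1}t_iz^i)^l$. *)
Fixpoint comps (l : nat) (n : int) (u : M) : M :=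
  if l is l'.+1 then \sum_(i < `|n|%N) t i.+1 (comps l' (n - i.+1%:Z) u)
  else if n == 0 then u else 0.

Lemma comps_lt l (n : int) u : n < l%:Z -> comps l n u = 0.
Proof.
elim: l n => [|l IH] n lt /=; first by rewrite ifF //; apply/negP => /eqP; lia.
by rewrite big1 // => i _; rewrite IH ?(islin0 (tl _)) //; lia.
Qed.

Lemma compsS l (n : int) N u : n <= N%:Z ->
  comps l.+1 n u = \sum_(i < N) t i.+1 (comps l (n - i.+1%:Z) u).
Proof.
move=> le /=; have z J (i : nat) : (`|n| <= i)%N || (n < 0) -> t i.+1 (comps J (n - i.+1%:Z) u) = 0.
  by move=> h; rewrite comps_lt ?(islin0 (tl _)) //; lia.
have [n0|n0] := ltP n 0; first by rewrite !big1 // => i _; rewrite z ?n0 ?orbT.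
symmetry; apply: (@sum_ord_trunc _ (fun i => t i.+1 (comps l (n - i.+1%:Z) u))); last by lia.
by move=> i le'; rewrite z ?le'.
Qed.

(** With $T(z)=\sum_{i\ge1}t_iz^i$ this is the coefficient form of
    $z\frac{d}{dz}T^{l+1}=(l+1)(zT')T^l$. *)
Lemma comps_weight l (n : int) N u : n <= N%:Z -> n%:~R *: comps l.+1 n u =
  l.+1%:R *: \sum_(i < N) i.+1%:R *: t i.+1 (comps l (n - i.+1%:Z) u).
Proof.
elim: l n => [|l IH] n le.
  rewrite (compsS _ _ le) scale1r scaler_sumr; apply: eq_bigr => i _ /=.
  case: eqP => [E|_]; last by rewrite !(islin0 (tl _)) !scaler0.
  by rewrite (_ : n = i.+1%:Z) //; lia.
rewrite (compsS _ _ le) scaler_sumr.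
have E (i : 'I_N) : n%:~R *: t i.+1 (comps l.+1 (n - i.+1%:Z) u) =
    i.+1%:R *: t i.+1 (comps l.+1 (n - i.+1%:Z) u) +
    l.+1%:R *: \sum_(k < N) k.+1%:R *: t k.+1 (t i.+1 (comps l (n - k.+1%:Z - i.+1%:Z) u)).
  have -> : n%:~R = i.+1%:R + (n - i.+1%:Z)%:~R :> K by rewrite rmorphB /= addrC subrK.
  rewrite scalerDl; congr (_ + _); rewrite -(islinZ (tl _)) IH; last by lia.
  rewrite (islinZ (tl _)) (islin_sum (tl _)); congr (_ *: _); apply: eq_bigr => k _.
  by rewrite (islinZ (tl _)) tC addrAC.
rewrite (eq_bigr _ (fun i _ => E i)) big_split /= -scaler_sumr exchange_big /=.
have -> : \sum_(k < N) \sum_(i < N) k.+1%:R *: t k.+1 (t i.+1 (comps l (n - k.+1%:Z - i.+1%:Z) u)) =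
    \sum_(k < N) k.+1%:R *: t k.+1 (comps l.+1 (n - k.+1%:Z) u).
  apply: eq_bigr => k _; rewrite -scaler_sumr -(islin_sum (tl _)); congr (_ *: t _ _).
  by rewrite (@compsS l _ N) //; lia.
by rewrite -[l.+2%:R]natr1 scalerDl scale1r addrC.
Qed.

Lemma comps_exp (n : int) N u : n <= N%:Z ->
  \sum_(l < N.+1) (l`!)%:R^-1 *: comps l n u = Ex g n u.
Proof.
elim/Ex_ind: n N => [n n0 N _|N _|n IH N le].
- by rewrite Ex_neg // big1 // => l _; rewrite comps_lt ?scaler0 //; lia.
- rewrite Ex0 big_ord_recl /= fact0 invr1 scale1r big1 ?addr0 // => l _.
  by rewrite big_ord0 scaler0.
apply: (@scale_inj _ _ n); rewrite (ExE gl (N := N)) //.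
case: N le => // N le; rewrite big_ord_recl /= scaler0 add0r scaler_sumr.
have E (l : 'I_N.+1) : n.+1%:~R *: ((bump 0 l)`!%:R^-1 *: comps (bump 0 l) n.+1%:Z u) =
    \sum_(i < N.+1) g i.+1 ((l`!)%:R^-1 *: comps l (n.+1%:Z - i.+1%:Z) u).
  rewrite scalerA mulrC -scalerA (@comps_weight l n.+1%:Z N.+1) // scalerA /bump add1n.
  have -> : (l.+1)`!%:R^-1 * l.+1%:R = (l`!)%:R^-1 :> K.
    by rewrite factS natrM invfM mulrAC mulVf ?mul1r // pnatr_eq0.
  rewrite scaler_sumr; apply: eq_bigr => i _.
  by rewrite tg (islinZ (gl _)).
rewrite (eq_bigr _ (fun l _ => E l)) exchange_big; apply: eq_bigr => i _ /=.
by rewrite -(islin_sum (gl _)) IH //; lia.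
Qed.

Lemma comps_tuples N l (n : nat) u : (n <= N)%N ->
  \sum_(s : l.-tuple 'I_N.+1 | all (fun i : 'I_N.+1 => 0 < i)%N s && (\sum_(i <- s) (i : nat) == n)%N)
    foldr (fun (i : 'I_N.+1) w => t i w) u s = comps l n%:Z u.
Proof.
elim: l n => [|l IH] n le.
  have [->|n0] := eqVneq n 0%N.
    rewrite (big_pred1 [tuple]) //= => s; rewrite !tuple0 /= big_nil; apply/esym/eqP; exact: tuple0.
  rewrite big_pred0 /= => [|s]; first by rewrite ifF //; apply/negP => /eqP; lia.
  by rewrite tuple0 /= big_nil eq_sym (negbTE n0).
rewrite (reindex (fun p : 'I_N.+1 * l.-tuple 'I_N.+1 => [tuple of p.1 :: p.2])); last first.
  exists (fun s => (thead s, [tuple of behead s])) => [[i s] _|s _] /=.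
    by congr (_, _); apply: val_inj.
  exact: esym (tuple_eta s).
have -> : comps l.+1 n%:Z u = \sum_(i : 'I_N.+1 | (0 < i)%N && (i <= n)%N) t i (comps l (n - i)%N%:Z u).
  have leN : n%:Z <= N%:Z by lia.
  rewrite (compsS _ _ leN) [RHS]big_mkcond big_ord_recl /= add0r; apply: eq_bigr => i _.
  rewrite /bump add1n; case: ifP => [h|/negbT h]; first by rewrite -subzn.
  by rewrite comps_lt ?(islin0 (tl _)) //; lia.
have -> : \sum_(i : 'I_N.+1 | (0 < i)%N && (i <= n)%N) t i (comps l (n - i)%N%:Z u) =
    \sum_(i : 'I_N.+1 | (0 < i)%N && (i <= n)%N)
      \sum_(s : l.-tuple 'I_N.+1 | all (fun i : 'I_N.+1 => 0 < i)%N s && (\sum_(i <- s) (i : nat) == n - i)%N)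
        foldr (fun (i : 'I_N.+1) w => t i w) u (i :: s).
  apply: eq_bigr => i _; rewrite -IH; last by lia.
  by rewrite (islin_sum (tl _)).
rewrite pair_big_dep /=; apply: eq_bigl => -[i s] /=; rewrite big_cons.
move: (all _ s) (\sum_(_ <- s) _)%N => a m; case: a; rewrite ?andbF ?andbT //=; lia.
Qed.

End ExpTuples.

Lemma exp_coefE (K : numFieldType) (t g : nat -> fock K -> fock K) n u :
    (forall i, islin (t i)) -> (forall i, islin (g i)) ->
    (forall i k u, t i (t k u) = t k (t i u)) ->
    (forall i u, i.+1%:R *: t i.+1 u = g i.+1 u) ->
  exp_coef t n u = Ex g n%:Z u.
Proof.
move=> tl gl tC tg; rewrite -(comps_exp tl gl tC tg u (lexx n%:Z)).
by apply: eq_bigr => l _; rewrite (comps_tuples tl).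
Qed.

Section MonomialRecursion.
Variables (K : numFieldType) (M : lmodType K) (hh : 'rV[K]_3 -> int -> M -> M) (em : 'rV[K]_3 -> K -> M -> M).

(** [monomial_mode] abstracted over its two operators: equality of the operators gives equality of
    the recursions by congruence, without unfolding the Fock space. *)
Fixpoint mono_gen (A : seq ('I_3 * nat)) (gam : 'rV[K]_3) (s : K) (u : M) : M :=
  match A with
  | [::] => em gam s u
  | (i, k) :: A' =>
      \sum_(m \in [set: nat])
        'C(m, k)%:R *: hh (bas K i) (Negz m) (mono_gen A' gam (s + m%:R - k%:R) u)
      + \sum_(m \in [set: nat])
        ((-1) ^+ k * 'C((m + k)%N, k)%:R) *:
          mono_gen A' gam (s - m%:R - k%:R - 1) (hh (bas K i) m%:Z u)
  end.
End MonomialRecursion.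

Section LatticeFields.
Variables (K : numFieldType) (r : K) (X : fockmod K sector) (W : fockmod K (wt K)).
Local Notation hw := (@hs K (wt K) (fun x => x) W).
Local Notation Emw := (@Em K (wt K) (fun x => x) W).
Local Notation Epw := (@Ep K (wt K) (fun x => x) W).
Local Notation hx := (@hs K sector (swt r) X).
Local Notation Gam := (@Gam K r X).
Implicit Types (u : X) (h g : 'rV[K]_3).

Definition wio : X -> W := imap W (swt r).
Definition wshift g : W -> W := imap W (fun be => be + g).

Lemma wio_is : islin wio. Proof. exact: imap_is. Qed.
Lemma wio_kt A i : wio (kt A i) = kt A (swt r i). Proof. exact: imap_kt. Qed.

Definition wheis h n : W -> W := fext (fun A be => match n with
  | Negz k => \sum_(i < 3) h 0 i *: kt (A `+` [mset (i, k)])%mset be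
  | Posz 0 => pairing h be *: kt A be
  | Posz k.+1 => \sum_(i < 3) (k.+1%:R * (A (i, k))%:R * pairing h (bas K i)) *: kt (A `\ (i, k))%mset be
  end).

Lemma wheisE h n (z : W) : wheis h n z = hw h n z.
Proof.
move: z; apply: fx_eq => [||A x]; [exact: fext_is|exact: hs_is|].
rewrite /wheis fext_kt; case: n => [[|k]|k].
- by rewrite hs0U.
- rewrite hsP; apply: eq_bigr => i _; rewrite anU scalerA del_def.
  by congr (_ *: _); rewrite mulrAC.
- by rewrite hsN; apply: eq_bigr => i _; rewrite crU ins_def.
Qed.

Lemma wio_hs h n u : wio (hx h n u) = hw h n (wio u).
Proof.
have [->|n0] := eqVneq n 0; last exact: imap_hs.
move: u; apply: fx_eq => [||A i].
- by apply: islin_comp; [exact: imap_is|exact: hs_is].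
- by apply: islin_comp; [exact: hs_is|exact: imap_is].
by rewrite wio_kt !hs0U (islinZ wio_is) wio_kt.
Qed.

Definition wexp_mode g (s : K) : W -> W := fext (fun A be =>
  \sum_(pq \in [set pq : nat * nat | pairing g be + pq.1%:R - pq.2%:R = - s - 1])
    Emw g pq.1%:Z (wshift g (Epw g pq.2%:Z (kt A be)))).

Lemma wio_gsh x u : wio (imap X (gsh x) u) = wshift (lat K x) (wio u).
Proof.
move: u; apply: fx_eq => [||A i].
- by apply: islin_comp; exact: imap_is.
- by apply: islin_comp; exact: imap_is.
by rewrite /wshift /wio !imap_kt (Gam_hw r x i (oner_neq0 K)).
Qed.

Lemma wio_Gam x (n : int) u : wio (Gam x n u) = wexp_mode (lat K x) n%:~R (wio u).
Proof.
move: u; apply: fx_eq => [||A i].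
- by apply: islin_comp; [exact: imap_is|exact: Gam_is].
- by apply: islin_comp; [exact: fext_is|exact: imap_is].
rewrite wio_kt /wexp_mode fext_kt.
pose e (q : nat) : int := q%:Z - n - 1 - gexp x i.
have lt : (mdeg A)%:Z < (mdeg A).+1%:Z by lia.
have -> : wio (Gam x n (kt A i)) = \sum_(q <- seq.iota 0 (mdeg A).+1)
    Emw (lat K x) (e q) (wshift (lat K x) (Epw (lat K x) q%:Z (kt A (swt r i)))).
  rewrite /Gam (@vopE _ _ (swt r) X (lat K x) (gexp x) (gsh x) (fun _ => 1) i _ n _ _ (Sd_kt X A i) lt).
  rewrite scale1r (islin_sum wio_is) -[seq.iota _ _]/(index_iota 0 (mdeg A).+1) big_mkord.
  apply: eq_bigr => q _; rewrite /wio (@imap_Em K sector (wt K) X W (swt r) (swt r) (fun x => x)) -/(e q); congr (Emw _ _ _).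
  by rewrite -/wio wio_gsh /wio (@imap_Ep K sector (wt K) X W (swt r) (swt r) (fun x => x)) imap_kt.
(* The index condition of the statement is an equation in [K]. The exponent is an integer and the
   characteristic is zero, so the condition says that [q] determines [p]. *)
have ip (p q : nat) : (pairing (lat K x) (swt r i) + p%:R - q%:R = - n%:~R - 1) <-> p%:Z = e q.
  rewrite (Gam_ha r x i (oner_neq0 K)) /e; move: (gexp x i) => G; split=> [E|E].
    apply: (@intr_inj K); rewrite !rmorphB /= -[p%:Z%:~R]/(p%:R) -[q%:Z%:~R]/(q%:R).
    have -> : p%:R = (G%:~R + p%:R - q%:R) - G%:~R + q%:R :> K by ring.
    by rewrite E; ring.
  by rewrite -[p%:R]/(p%:Z%:~R) E !rmorphB /= -[q%:Z%:~R]/(q%:R); ring.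
(* The support lies among the pairs whose second index is at most the degree of the monomial; values
   of [q] giving a negative first index contribute zero to the sum over [q]. *)
rewrite (@fsbigE _ _ _ _ _ [seq (absz (e q), q) | q <- seq.iota 0 (mdeg A).+1 & 0 <= e q]).
- rewrite big_map big_filter_cond [RHS]big_mkcond /=; apply: eq_bigr => q _.
  have [h|h] := boolP (0 <= e q); last by rewrite /Em Ex_neg //; lia.
  by rewrite ifT ?gez0_abs //; apply/asboolP/ip => /=; rewrite gez0_abs.
- rewrite map_inj_uniq; last by move=> q q' [_ ->].
  exact/filter_uniq/iota_uniq.
- by move=> pq /mapP[q]; rewrite mem_filter => /andP[h _] ->; apply/ip => /=; rewrite gez0_abs.
- move=> [p q] /ip E nr; rewrite /= in E; rewrite (@Ep_big _ _ _ _ _ _ (swt r i) (mdeg A)).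
  + by rewrite /wshift (islin0 (imap_is _ _)) (islin0 (Em_is _ _ _)).
  + rewrite ltNge; apply: contra nr => le; have {}le : q%:Z <= (mdeg A)%:Z := le.
    apply/mapP; exists q; last by rewrite -E.
    by rewrite mem_filter mem_iota -E /=; lia.
  + exact: Sd_kt.
Qed.

Definition wmono_mode := mono_gen hw wexp_mode.

Lemma wmono_cons i k A g s z : wmono_mode ((i, k) :: A) g s z =
  \sum_(m \in [set: nat]) 'C(m, k)%:R *: hw (bas K i) (Negz m) (wmono_mode A g (s + m%:R - k%:R) z)
  + \sum_(m \in [set: nat]) ((-1) ^+ k * 'C((m + k)%N, k)%:R) *:
      wmono_mode A g (s - m%:R - k%:R - 1) (hw (bas K i) m%:Z z).
Proof. by []. Qed.

Lemma wmono_mode0 A g s : wmono_mode A g s 0 = 0.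
Proof.
elim: A s => [|[i k] A IH] s; first exact: islin0 (fext_is _).
rewrite wmono_cons !(@fsumE _ _ 0) ?big_ord0 ?addr0 // => m _; rewrite ?(islin0 (hs_is _ _ _)) IH ?(islin0 (hs_is _ _ _)) scaler0 //.
Qed.

Lemma cf_Negz k j : cf K (Negz k) j = 'C((j + k)%N, k)%:R.
Proof.
elim: j => [|j IH]; first by rewrite cf0 binn.
apply: (mulfI (_ : j.+1%:R != 0)); first by rewrite pnatr_eq0.
have E : - (Negz k - j%:Z)%:~R = (j + k).+1%:R :> K.
  by rewrite -rmorphN opprB (_ : j%:Z - Negz k = (j + k).+1%:Z); last by lia.
rewrite cfSr IH E -!natrM; congr (_%:R).
by have := mul_bin_left (j.+1 + k) k; rewrite addnK => <-; rewrite addSn mulnC -mul_bin_diag mulnC.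
Qed.

Lemma wio_word A x (n : int) u : wio (word r A x n u) = wmono_mode A (lat K x) n%:~R (wio u).
Proof.
elim: A n u => [|[i k] A IH] n u; first exact: wio_Gam.
have fh := lfield_hs (swt r) X (bas K i); have fw := gd_fld (gd_word r X A x).
rewrite [word r _ _]/(nprod 1 (hx (bas K i)) (word r A x) (Negz k)) /nprod /D (islinB wio_is) (islinZ wio_is).
have [J hJ] := hs_bound r u; have [J' hJ'] := fw.2 u.
have l1 j : (absz (J' - n) <= j)%N -> word r A x (n + j%:Z) u = 0 by move=> le; apply: hJ'; lia.
rewrite wmono_cons (@exE _ _ _ _ _ _ (absz (J' - n))) => [|j le]; last first.
  by rewrite /prodf l1 // (islin0 (hs_is _ _ _)).
rewrite (@exE _ _ _ _ _ _ J) => [|j le]; last by rewrite /prodf add0r hJ // (islin0 (fw.1 _)).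
congr (_ + _).
  (* The binomial vanishes below [m = k], and $m=k+j$ matches the expansion index [j]: by [cf_Negz],
     $\binom{k+j}k$ is the coefficient of $x^j$ in $(1-x)^{-k-1}$. *)
  rewrite (@fsumE _ _ (k + absz (J' - n))%N) => [|m le]; last first.
    rewrite -(_ : (n + (m - k)%N%:Z)%:~R = n%:~R + m%:R - k%:R); last first.
      by rewrite -subzn ?(leq_trans (leq_addr _ _) le) // addrA rmorphB rmorphD.
    by rewrite -IH l1 ?(islin0 wio_is) ?(islin0 (hs_is _ _ _)) ?scaler0 //; lia.
  rewrite [RHS]big_split_ord /= [X in _ = X + _]big1 ?add0r => [|m _]; last by rewrite bin_small ?scale0r.
  rewrite (islin_sum wio_is); apply: eq_bigr => j _; rewrite (islinZ wio_is) cf_Negz addnC /prodf wio_hs IH.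
  rewrite (_ : Negz k - j%:Z = Negz (k + j)); last by lia.
  by congr (_ *: hw _ _ (wmono_mode _ _ _ _)); rewrite rmorphD natrD /=; ring.
rewrite (@fsumE _ _ J) => [|m le]; last first.
  by rewrite -wio_hs hJ // (islin0 wio_is) wmono_mode0 scaler0.
rewrite (islin_sum wio_is) -scaleNr scaler_sumr; apply: eq_bigr => j _.
rewrite (islinZ wio_is) scalerA cf_Negz /prodf add0r -wio_hs IH; congr (_ *: wmono_mode _ _ _ _).
  by rewrite mulr1 NegzE -exprz_inv invrN1 -exprnP exprS mulN1r opprK.
rewrite (_ : n + Negz k - j%:Z = n - j%:Z - k%:Z - 1); last by lia.
by rewrite !rmorphB.
Qed.

Variable P : fockmod K (int * int)%type.

Definition kap : P -> W := imap W (lat K).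
Definition wYmode (v : W) (s : K) (z : W) : W := fext (fun A be => wmono_mode (enum_mset A) be s z) v.

Lemma wio_Y (p : P) (n : int) u : wio (@Y K r X P p n u) = wYmode (kap p) n%:~R (wio u).
Proof.
move: p; apply: fx_eq => [||A x].
- by apply: islin_comp; [exact: wio_is|exact: fext_is].
- by apply: islin_comp; [exact: fext_is|exact: imap_is].
by rewrite Y_kt wio_word /kap imap_kt /wYmode fext_kt.
Qed.

Lemma kap_is : islin kap. Proof. exact: imap_is. Qed.
Lemma kap_e0 x : kap (e0 P x) = kt mset0 (lat K x). Proof. exact: imap_kt. Qed.
Lemma kap_hP h n p : kap (hP h n p) = hw h (Negz n) (kap p). Proof. exact: imap_hs. Qed.

Definition womega (g : 'rV[K]_3) : W :=
  2^-1 *: hw (wal K) (-1) (hw (wal K) (-1) (kt mset0 g)) + 2^-1 *: hw (wal K) (-2) (kt mset0 g)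
  + kt mset0 (2 *: wal K + g).

Definition wcur (k : K) (a : osp) : W := match a with
  | ge => kt mset0 (wc K)
  | gh => 2 *: hw (wmu k) (-1) (kt mset0 0)
  | gf => (k + 2) *: womega (- wc K) - hw (wnu k) (-1) (hw (wnu k) (-1) (kt mset0 (- wc K)))
          - (k + 1) *: hw (wnu k) (-2) (kt mset0 (- wc K))
  | gx => kt mset0 (wal K + 2^-1 *: wc K) + kt mset0 (- wal K + 2^-1 *: wc K)
  | gy => hw (wnu k + 2^-1 *: wal K) (-1) (kt mset0 (- wal K - 2^-1 *: wc K))
          + hw (wnu k - (3 / 2) *: wal K) (-1) (kt mset0 (wal K - 2^-1 *: wc K))
  end.

Lemma kap_pcur a : kap (pcur r X P a) = wcur (lev K) a.
Proof.
have E0 : lat K (0, 0) = 0 by apply/rowP => i; rewrite /lat !mxE /=; ring.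
case: a; rewrite /= /wcur.
- by rewrite kap_e0 lat01.
- rewrite /st_f /st_om !(islinB kap_is) !(islinZ kap_is) !(islinD kap_is) !(islinZ kap_is) !kap_hP !kap_e0 /womega.
  by rewrite lat0N lat2N.
- by rewrite /st_h kap_hP kap_e0 E0 (islinZ (hs_linl _ _ _)).
- by rewrite /st_x (islinD kap_is) !kap_e0 lat10 latN1.
- by rewrite /st_y (islinD kap_is) !kap_hP !kap_e0 latN0 lat1N.
Qed.

End LatticeFields.

Section Concrete.
Variable K : numFieldType.
Local Notation W := (malg_fock K (wt K)).
Local Notation hw := (@hs K (wt K) (fun x => x) W).

Lemma heis_hs h n (z : W) : heis h n z = hw h n z.
Proof.
rewrite -wheisE; congr (linext _ z); apply: functional_extensionality_dep => -[A be].
by [].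
Qed.

Lemma heis_is h n : islin (heis h n : fock K -> fock K).
Proof. exact: linext_is. Qed.

Lemma exp_coef_m g (p : nat) (z : W) :
  exp_coef (fun i w => i%:R^-1 *: heis g (- i%:Z) w) p z = Em (fun x => x) g p%:Z z.
Proof.
have hC i k (w : W) : hw g (- i%:Z) (hw g (- k%:Z) w) = hw g (- k%:Z) (hw g (- i%:Z) w).
  rewrite hs_comm; case: eqP => [E|_]; last by rewrite scale0r addr0.
  by rewrite (_ : - i%:Z = 0) ?mul0r ?scale0r ?addr0 //; lia.
apply: (@exp_coefE K _ (@gm K (wt K) (fun x => x) W g)).
- by move=> i; apply: (islin_scale _ (heis_is g (- i%:Z))).
- exact: (@gm_is K (wt K) (fun x => x) W g).
- by move=> i k w; rewrite !(islinZ (heis_is _ _)) !heis_hs hC !scalerA mulrC.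
- by move=> i w; rewrite heis_hs scalerA mulfV ?scale1r // pnatr_eq0.
Qed.

Lemma exp_coef_p g (q : nat) (z : W) :
  exp_coef (fun i w => - i%:R^-1 *: heis g i%:Z w) q z = Ep (fun x => x) g q%:Z z.
Proof.
have hC i k (w : W) : hw g i%:Z (hw g k%:Z w) = hw g k%:Z (hw g i%:Z w).
  rewrite hs_comm; case: eqP => [E|_]; last by rewrite scale0r addr0.
  by rewrite (_ : i%:Z = 0) ?mul0r ?scale0r ?addr0 //; lia.
apply: (@exp_coefE K _ (@gp K (wt K) (fun x => x) W g)).
- by move=> i; apply: (islin_scale _ (heis_is g i%:Z)).
- exact: (@gp_is K (wt K) (fun x => x) W g).
- by move=> i k w; rewrite !(islinZ (heis_is _ _)) !heis_hs hC !scalerA mulrC.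
- by move=> i w; rewrite heis_hs scalerA mulrN mulfV ?scaleN1r // pnatr_eq0.
Qed.

Lemma exp_mode_wexp : exp_mode (K := K) = (@wexp_mode K W : 'rV[K]_3 -> K -> fock K -> fock K).
Proof.
apply: functional_extensionality_dep => g; apply: functional_extensionality_dep => s.
have Em_fun : (fun p => exp_coef (fun i w => i%:R^-1 *: heis g (- i%:Z) w) p) =
    (fun p : nat => @Em K (wt K) (fun x => x) W g p%:Z : fock K -> fock K).
  by apply: functional_extensionality_dep => p; apply: functional_extensionality_dep => z; exact: exp_coef_m.
have Ep_fun : (fun q => exp_coef (fun i w => - i%:R^-1 *: heis g i%:Z w) q) =
    (fun q : nat => @Ep K (wt K) (fun x => x) W g q%:Z : fock K -> fock K).
  by apply: functional_extensionality_dep => q; apply: functional_extensionality_dep => z; exact: exp_coef_p.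
exact: (f_equal2 (fun ec ep : nat -> fock K -> fock K => linext (fun b : modes * wt K =>
  \sum_(pq \in [set pq : nat * nat | pairing g b.2 + pq.1%:R - pq.2%:R = - s - 1])
    ec pq.1 (shift g (ep pq.2 (ket b.1 b.2))))) Em_fun Ep_fun).
Qed.

Lemma heis_fun : heis (K := K) = (hw : 'rV[K]_3 -> int -> fock K -> fock K).
Proof.
apply: functional_extensionality_dep => g; apply: functional_extensionality_dep => n.
by apply: functional_extensionality_dep => z; exact: heis_hs.
Qed.

Lemma monomial_mode_w : monomial_mode (K := K) =
  (@wmono_mode K W : seq ('I_3 * nat) -> 'rV[K]_3 -> K -> fock K -> fock K).
Proof.
exact: (f_equal2 (fun (hh : 'rV[K]_3 -> int -> fock K -> fock K) (em : 'rV[K]_3 -> K -> fock K -> fock K) =>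
  @mono_gen K (fock K) hh em) heis_fun exp_mode_wexp).
Qed.

Lemma Ymode_w (v : W) s (z : W) : Ymode v s z = wYmode v s z.
Proof.
exact: (f_equal (fun mm : seq ('I_3 * nat) -> 'rV[K]_3 -> K -> fock K -> fock K =>
  linext (fun b : modes * wt K => mm (enum_mset b.1) b.2 s z) v) monomial_mode_w).
Qed.

Lemma realization_w k a : realization k a = wcur W k a.
Proof. by case: a; rewrite /realization /wcur /omega_exp /womega ?heis_hs. Qed.

End Concrete.

Lemma swt_minv (K : numFieldType) (r : K) b n q : swt r (Some b, (n, q)) =
  (n%:~R + 2^-1) *: wal K - wmu (lev K) + (- (r + 1 / 4) + (minv (Some b, (n, q))).2%:~R / 2) *: wc K.
Proof.
apply/rowP => i; rewrite /swt /sbase /lat /minv /wmu /lev /= !mxE.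
by case: b; rewrite !(rmorphD, rmorphB, rmorphM) /=; field.
Qed.

Lemma wio_tmod (K : numFieldType) (X : fockmod K sector) (W : fockmod K (wt K)) (V : vsa K) (j : osp -> V)
    (L : vsa K) (pr : V -> L) (r : K) (P M : fockmod K (int * int)%type) (F : V -> Pvsa r X P)
    (hV : universal_affine (lev K) j) (hL : simple_graded_quotient j pr)
    (hF : vsa_hom F) (Fj : forall a, F (j a) = pcur r X P a) a (n : int) u :
  wio r W (imap X midx (mact (tmod hV hL hF Fj M) (pr (j a)) n u)) =
  wYmode (wcur W (lev K) a) n%:~R (wio r W (imap X midx u)).
Proof. by rewrite tmodE tactE Fj wio_Y kap_pcur. Qed.

Lemma temb_theta (K : numFieldType) (M N : fockmod K (int * int)%type) b x :
  temb M b (ntheta N << x >>) = e0 M (minv (Some b, ntop x)).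
Proof. by rewrite ntheta_U temb_e0. Qed.

Section Inclusion.
Variables (K : numFieldType) (r : K).
Local Notation X := (malg_fock K sector).
Local Notation W := (malg_fock K (wt K)).
Local Notation M := (malg_fock K (int * int)%type).
Local Notation incl := (FtwPi_incl (lev K) (- (r + 1 / 4))).

Lemma FtwPi_inclE (u : M) : incl u = wio r W (imap X midx u).
Proof.
move: u; apply: (@fx_eq K _ M W incl (fun u => wio r W (imap X midx u))).
- exact: linext_is.
- by apply: islin_comp; exact: imap_is.
move=> A x; rewrite imap_kt wio_kt; apply: etrans (linextU _ (A, x)) _.
have [b [n [q E]]] : exists b n q, midx x = (Some b, (n, q)).
  by exists (iodd (x.2 - x.1)), x.1, ((x.2 - x.1 + (iodd (x.2 - x.1))%:Z) %/ 2)%Z.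
rewrite E swt_minv; have -> : x = (n, (minv (Some b, (n, q))).2) by rewrite -(midxK x) E.
by [].
Qed.

Lemma expv_minv b n q be : swt r (Some b, (n, q)) = be -> incl (e0 M (minv (Some b, (n, q)))) = expv be.
Proof. by move=> <-; rewrite FtwPi_inclE /e0 imap_kt wio_kt minvK. Qed.

End Inclusion.

Section Main.
Variables (K : numFieldType) (Vk : vsa K) (j : osp -> Vk) (L : vsa K) (pr : Vk -> L) (r : K).
Local Notation mu := (wmu (lev K)).
Local Notation al := (wal K).
Local Notation c := (wc K).
Local Notation M := (FtwPi K).
Local Notation incl := (FtwPi_incl (lev K) (- (r + 1 / 4)) : M -> fock K).
Hypotheses (hVk : universal_affine (lev K) j) (hL : simple_graded_quotient j pr).
Hypothesis hr : forall m : int, r <> m%:~R.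

Local Notation X := (malg_fock K sector).
Local Notation P := (malg_fock K (int * int)%type).
Local Notation W := (malg_fock K (wt K)).

Lemma tmod_Ymode (F : Vk -> Pvsa r X P) (hF : vsa_hom F) (Fj : forall a, F (j a) = pcur r X P a) a (n : int) u :
  incl (mact (tmod hVk hL hF Fj P) (pr (j a)) n u) = Ymode (realization (lev K) a) n%:~R (incl u).
Proof.
have E1 := FtwPi_inclE r (mact (tmod hVk hL hF Fj P) (pr (j a)) n u).
have E2 := wio_tmod W hVk hL hF Fj a n u.
have E3 := Ymode_w (realization (lev K) a) n%:~R (incl u).
have E4 := f_equal2 (fun v z : W => wYmode v n%:~R z) (realization_w (lev K) a) (FtwPi_inclE r u).
exact (eq_trans E1 (eq_trans E2 (esym (eq_trans E3 E4)))).
Qed.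

Theorem realization_over_field : exists YM : vmod L M,
  (forall a (n : int) u,
     incl (mact YM (pr (j a)) n u) = Ymode (realization (lev K) a) n%:~R (incl u)) /\
  exists (N : lmodType K) (YN : vmod Vk N) (theta : U0 K -> N)
         (ZN : vmod L N) (phi : N -> M)
         (N' : lmodType K) (ZN' : vmod L N') (theta' : U0 K -> N')
         (phi' : N' -> M),
    [/\ irreducible_with_top j YN r theta /\
        ((forall p u, mpar ZN p u <-> mpar YN p u) /\
         (forall v n u, mact ZN (pr v) n u = mact YN v n u)),
        [/\ vmod_hom ZN YM phi, injective phi
          & exists v : M,
              incl v = expv (2^-1 *: al - mu - (r + 1 / 4) *: c) /\
              range phi = generated_submodule YM [set v]],
        forall i : int,
          incl (phi (theta (U0E K i)))
            = expv (2^-1 *: al - mu - (r + i%:~R + 5 / 4) *: c) /\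
          incl (phi (theta (U0Eh K i)))
            = expv (- 2^-1 *: al - mu - (r + i%:~R + 3 / 4) *: c),
        zhu_module (fun a => pr (j a)) ZN' (r + 1 / 2) theta'
      & vmod_hom ZN' YM phi' /\
        forall w : M, exists! p : N * N', w = phi p.1 + phi' p.2].
Proof.
have [F [[hF Fj] _]] := hVk.2 (Pvsa r X P) (pcur r X P) (st_affine r X P).
exists (tmod hVk hL hF Fj P); split; first exact: tmod_Ymode.
(* Sector [false] carries the parameter [r] and is a module both over $V^k$ and over [L]; sector
   [true] carries $r+\frac12$. One space of labels serves for both, and for the twisted space
   itself. *)
exists P, (nmod hF false P), (ntheta P), (qmod hVk hF Fj false P hL), (@temb K P P false).
exists P, (qmod hVk hF Fj true P hL), (ntheta P), (@temb K P P true); split.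
- split; first exact: (nmod_irreducible_with_top hVk hF Fj P (b := false) hr).
  split; [exact: (fun p u => iff_refl _)|exact: (qmodE hVk hF Fj false hL)].
- split; [exact: (temb_hom hVk hL hF Fj P P false)|exact: (@temb_inj K X P P false)|exists (e0 P (0, 0)); split].
    rewrite -[(0, 0)]/(minv (Some false, (0, 0))); apply: expv_minv.
    by apply/rowP => i; rewrite /swt /sbase /lat !mxE /=; field.
  exact: (temb_range hVk hL hF Fj P P hr).
- move=> i; split.
    apply: (etrans (f_equal incl (temb_theta P P false (i, false)))).
    apply: (@expv_minv K r false 0 (- i - 1)).
    by apply/rowP => i'; rewrite /swt /sbase /lat !mxE /= !(rmorphB, rmorphN) /=; field.
  apply: (etrans (f_equal incl (temb_theta P P false (i, true)))).
  apply: (@expv_minv K r false (-1) (- i)).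
  by apply/rowP => i'; rewrite /swt /sbase /lat !mxE /= !(rmorphB, rmorphN) /=; field.
- exact: (qmod_zhu hVk hF Fj true P hL).
split; first exact: (temb_hom hVk hL hF Fj P P true).
exact: (@temb_decomposition K X P P).
Qed.
End Main.

Theorem theorem6p5 (R : realType) (Vk : vsa R[i]) (j : osp -> Vk)
    (L : vsa R[i]) (pr : Vk -> L) (r : R[i])
    (k := - (3 / 2) : R[i])
    (mu := wmu k) (al := wal R[i]) (c := wc R[i])
    (M := FtwPi R[i]) (incl := FtwPi_incl k (- (r + 1 / 4)) : M -> fock R[i])
    (hVk : universal_affine k j)
    (hL : simple_graded_quotient j pr)
    (hr : forall m : int, r <> m%:~R) :
  exists YM : vmod L M,
    (forall a (n : int) u,
       incl (mact YM (pr (j a)) n u) = Ymode (realization k a) n%:~R (incl u)) /\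
  exists (N : lmodType R[i]) (YN : vmod Vk N) (theta : U0 R[i] -> N)
         (ZN : vmod L N) (phi : N -> M)
         (N' : lmodType R[i]) (ZN' : vmod L N') (theta' : U0 R[i] -> N')
         (phi' : N' -> M),
    [/\ irreducible_with_top j YN r theta /\
        ((forall p u, mpar ZN p u <-> mpar YN p u) /\
         (forall v n u, mact ZN (pr v) n u = mact YN v n u)),
        [/\ vmod_hom ZN YM phi, injective phi
          & exists v : M,
              incl v = expv (2^-1 *: al - mu - (r + 1 / 4) *: c) /\
              range phi = generated_submodule YM [set v]],
        forall i : int,
          incl (phi (theta (U0E R[i] i)))
            = expv (2^-1 *: al - mu - (r + i%:~R + 5 / 4) *: c) /\
          incl (phi (theta (U0Eh R[i] i)))
            = expv (- 2^-1 *: al - mu - (r + i%:~R + 3 / 4) *: c),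
        zhu_module (fun a => pr (j a)) ZN' (r + 1 / 2) theta'
      & vmod_hom ZN' YM phi' /\
        forall w : M, exists! p : N * N', w = phi p.1 + phi' p.2].
Proof. exact: (@realization_over_field R[i] Vk j L pr r hVk hL hr). Qed.
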